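(* If $\varphi_1, \varphi_2 \in \mathrm{QS}(\mathbb{S}^1)$, then $$\mathbf{\Lambda}_{\varphi_1 \circ \varphi_2} = \mathbf{C}_{\varphi_2}\mathbf{\Lambda}_{\varphi_1}\mathbf{C}_{\varphi_2}^* + \mathbf{\Lambda}_{\varphi_2}.$$ In particular, if $\varphi\in\mathrm{QS}(\mathbb S^1)$ and $\mu \in \mathrm{M\ddot{o}b}(\mathbb{S}^1)$, then $\mathbf{\Lambda}_{\varphi\circ \mu}= \mathbf{C}_\mu \mathbf{\Lambda}_\varphi \mathbf{C}_\mu^*$ is a conjugation of $\mathbf{\Lambda}_\varphi$ by the unitary operator $\mathbf{C}_\mu$.
   Context: All circle homeomorphisms are orientation-preserving. $\mathrm{QS}(\mathbb{S}^1)$ is the group of quasisymmetric homeomorphisms of the unit circle $\mathbb{S}^1$ (those extending to a quasiconformal homeomorphism of the unit disc). $\mathrm{M\ddot{o}b}(\mathbb{S}^1)$ is the group of M\''obius transformations preserving $\mathbb S^1$. Welding Grunsky matrix: for $\varphi\in\mathrm{QS}(\mathbb S^1)$, $k,\ell\in\mathbb Z$, put $\widehat\lambda_{k,\ell}=\frac1{(2\pi)^2}\iint_{[0,2\pi]^2}\log\left|\frac{\varphi(e^{is})-\varphi(e^{it})}{e^{is}-e^{it}}\right|e^{-i(ks+\ell t)}\,ds\,dt$ (the integrand is integrable), and for $k,\ell\in\mathbb Z^*=\mathbb Z\setminus\{0\}$ put $\lambda_{k,\ell}=\sqrt{|k\ell|}\,\widehat\lambda_{k,\ell}$. Then $\mathbf\Lambda_\varphi=\begin{pmatrix}M&N\\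 \overline N&\overline M\end{pmatrix}$ with $M=(\lambda_{k,-\ell})_{k,\ell\ge1}$, $N=(\lambda_{k,\ell})_{k,\ell\ge1}$, a bounded self-adjoint operator on $\ell^2_{\mathbb Z^*}$ with coordinates ordered $((h_k)_{k\ge1},(h_{-k})_{k\ge1})$. Composition operator: $\dot H^{1/2}$ is the space of complex functions $u$ on $\mathbb S^1$ with $\widehat u_0=0$ and $\|u\|^2_{\dot H^{1/2}}=\sum_{k\ne0}|k||\widehat u_k|^2<\infty$. $\mathbf C_\varphi:\dot H^{1/2}\to\dot H^{1/2}$, $u\mapsto u\circ\varphi-\frac1{2\pi}\int_0^{2\pi}u\circ\varphi(e^{it})\,dt$, is bounded, and is identified with its matrix in the orthonormal basis $(e^{ikt}/\sqrt k)_{k\ge1}$, $(e^{-ikt}/\sqrt k)_{k\ge1}$ (in this order), hence with an operator on $\ell^2_{\mathbb Z^*}$. *)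

(* Defs.v *)
From HB Require Import structures.
From mathcomp Require Import all_boot all_order all_algebra.
From mathcomp Require Import all_classical all_reals all_analysis.
From mathcomp Require Import complex.

Set Implicit Arguments.
Unset Strict Implicit.
Unset Printing Implicit Defensive.
Import Order.TTheory GRing.Theory Num.Theory.
Import numFieldNormedType.Exports.

Local Open Scope classical_set_scope.
Local Open Scope ring_scope.
Local Open Scope complex_scope.

(* R[i] carries no topology by itself; R[i]^o is the same field with the
   topology of the modulus. *)
Definition continuous_on (R : realType) (A : set R[i]) (f : R[i] -> R[i]) :
  Prop := {within (A : set R[i]^o), continuous (f : R[i]^o -> R[i]^o)}.

Definition modulus (R : realType) (z : R[i]) : R := ComplexField.Normc.normc z.

Definition expi (R : realType) (t : R) : R[i] := cos t +i* sin t.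

Definition circle (R : realType) : set R[i] := [set z | modulus z = 1].
Definition disc (R : realType) : set R[i] := [set z | modulus z < 1].
Definition closed_disc (R : realType) : set R[i] := [set z | modulus z <= 1].
Arguments circle {R}.
Arguments disc {R}.
Arguments closed_disc {R}.

Definition homeo (R : realType) (A B : set R[i]) (f : R[i] -> R[i]) : Prop :=
  continuous_on A f /\
  exists g : R[i] -> R[i],
    [/\ continuous_on B g,
        forall z, A z -> B (f z) /\ g (f z) = z
      & forall w, B w -> A (g w) /\ f (g w) = w].

(* Self-maps of the circle are represented by functions on the whole plane, of
   which only the restriction to the circle matters. The map preserves the
   orientation when it lifts to an increasing map of the real line. *)
Definition circle_homeo (R : realType) (phi : R[i] -> R[i]) : Prop :=
  homeo circle circle phi /\
  exists theta : R -> R,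
    [/\ continuous theta,
        {homo theta : s t / s < t},
        forall t, theta (t + 2 * pi) = theta t + 2 * pi
      & forall t, phi (expi t) = expi (theta t)].

Definition abs_continuous (R : realType) (a b : R) (g : R -> R[i]) : Prop :=
  forall e : R, 0 < e -> exists2 d : R, 0 < d &
    forall (n : nat) (p q : 'I_n -> R),
      (forall i, a <= p i /\ p i <= q i /\ q i <= b) ->
      (forall i j : 'I_n, (i < j)%N -> q i <= p j) ->
      \sum_i (q i - p i) < d ->
      \sum_i modulus (g (q i) - g (p i)) < e.

Definition ACL (R : realType) (U : set R[i]) (f : R[i] -> R[i]) : Prop :=
  forall a b c d : R,
    (forall x y, a <= x <= b -> c <= y <= d -> U (x +i* y)) ->
    {ae (@lebesgue_measure R), forall y, c <= y <= d ->
       abs_continuous a b (fun x => f (x +i* y))} /\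
    {ae (@lebesgue_measure R), forall x, a <= x <= b ->
       abs_continuous c d (fun y => f (x +i* y))}.

Definition cderive (R : realType) (g : R -> R[i]) (t : R) : R[i] :=
  derive1 (fun s => complex.Re (g s)) t +i* derive1 (fun s => complex.Im (g s)) t.

Definition partial_x (R : realType) (f : R[i] -> R[i]) (z : R[i]) : R[i] :=
  cderive (fun x => f (x +i* complex.Im z)) (complex.Re z).
Definition partial_y (R : realType) (f : R[i] -> R[i]) (z : R[i]) : R[i] :=
  cderive (fun y => f (complex.Re z +i* y)) (complex.Im z).

Definition d_z (R : realType) (f : R[i] -> R[i]) (z : R[i]) : R[i] :=
  (partial_x f z - (0 +i* 1) * partial_y f z) / 2.
Definition d_zbar (R : realType) (f : R[i] -> R[i]) (z : R[i]) : R[i] :=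
  (partial_x f z + (0 +i* 1) * partial_y f z) / 2.

Definition plane_measure (R : realType) :
    {measure set (measurableTypeR R * measurableTypeR R) -> \bar R} :=
  (@lebesgue_measure R \x @lebesgue_measure R)%E.

(* Analytic definition of (orientation-preserving) quasiconformal maps. For a
   continuous map, the first two analytic conditions say that it belongs to
   the local Sobolev space W^{1,2}. *)
Definition quasiconformal (R : realType) (U V : set R[i]) (f : R[i] -> R[i]) :
    Prop :=
  [/\ homeo U V f,
      ACL U f,
      forall a b c d : R,
        (forall x y, a <= x <= b -> c <= y <= d -> U (x +i* y)) ->
        (\int[plane_measure R]_(p in `[a, b] `*` `[c, d])
           (modulus (partial_x f (p.1 +i* p.2)) ^+ 2 +
            modulus (partial_y f (p.1 +i* p.2)) ^+ 2)%:E < +oo)%E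
    & exists k : R, 0 <= k < 1 /\
        {ae plane_measure R, forall p : R * R, U (p.1 +i* p.2) ->
           modulus (d_zbar f (p.1 +i* p.2)) <=
           k * modulus (d_z f (p.1 +i* p.2))}].

Definition QS (R : realType) (phi : R[i] -> R[i]) : Prop :=
  circle_homeo phi /\
  exists Phi : R[i] -> R[i],
    [/\ quasiconformal disc disc Phi,
        continuous_on closed_disc Phi
      & forall z, circle z -> Phi z = phi z].

(* A pole of the fraction on the circle is excluded, because division by zero
   yields zero, which is not on the circle. *)
Definition Mob (R : realType) (mu : R[i] -> R[i]) : Prop :=
  circle_homeo mu /\
  exists a b c d : R[i], a * d - b * c != 0 /\
    forall z, circle z -> mu z = (a * z + b) / (c * z + d).

Definition cintegral (d : measure_display) (T : measurableType d)
    (R : realType)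
    (m : {measure set T -> \bar R}) (D : set T) (f : T -> R[i]) : R[i] :=
  (\int[m]_(x in D) complex.Re (f x)) +i* (\int[m]_(x in D) complex.Im (f x)).

(* inl n stands for n+1 and inr n for -(n+1): the nonzero integers, split into
   the two blocks. *)
Definition idx : Type := (nat + nat)%type.
Definition idx_int (i : idx) : int :=
  match i with inl n => n.+1%:Z | inr n => - n.+1%:Z end.

Definition idx_sum (R : realType) (f : idx -> R[i]) : R[i] :=
  limn (fun n => \sum_(0 <= k < n) complex.Re (f (inl k) + f (inr k))) +i*
  limn (fun n => \sum_(0 <= k < n) complex.Im (f (inl k) + f (inr k))).

Definition sqnorm (R : realType) (h : idx -> R[i]) : \bar R :=
  (\sum_(0 <= k <oo)
     (modulus (h (inl k)) ^+ 2 + modulus (h (inr k)) ^+ 2)%:E)%E.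
Definition ell2 (R : realType) (h : idx -> R[i]) : Prop :=
  (sqnorm h < +oo)%E.

Definition imx (R : realType) : Type := idx -> idx -> R[i].

Definition imx_block (R : realType) (A B C D : nat -> nat -> R[i]) : imx R :=
  fun i j => match i, j with
  | inl k, inl l => A k l
  | inl k, inr l => B k l
  | inr k, inl l => C k l
  | inr k, inr l => D k l
  end.

Definition imx_adj (R : realType) (A : imx R) : imx R := fun i j => (A j i)^*.

Definition imx_op (R : realType) (A : imx R) (h : idx -> R[i]) : idx -> R[i] :=
  fun i => idx_sum (fun j => A i j * h j).

Definition imx_bounded (R : realType) (A : imx R) : Prop :=
  exists M : R, forall h, ell2 h -> (sqnorm (imx_op A h) <= M%:E * sqnorm h)%E.

Definition imx_unitary (R : realType) (A : imx R) : Prop :=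
  [/\ imx_bounded A,
      forall h, ell2 h -> imx_op (imx_adj A) (imx_op A h) = h
    & forall h, ell2 h -> imx_op A (imx_op (imx_adj A) h) = h].

Definition log_kernel (R : realType) (phi : R[i] -> R[i]) (s t : R) : R :=
  ln (modulus ((phi (expi s) - phi (expi t)) / (expi s - expi t))).

Definition lambda_hat (R : realType) (phi : R[i] -> R[i]) (k l : int) : R[i] :=
  ((2 * pi) ^- 2)%:C *
  cintegral (plane_measure R) (`[0, 2 * pi] `*` `[0, 2 * pi])
    (fun p => (log_kernel phi p.1 p.2)%:C *
              expi (- (k%:~R * p.1 + l%:~R * p.2))).

Definition lambda (R : realType) (phi : R[i] -> R[i]) (k l : int) : R[i] :=
  (Num.sqrt `|k * l|%:~R)%:C * lambda_hat phi k l.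

Definition Lambda (R : realType) (phi : R[i] -> R[i]) : imx R :=
  let M k l := lambda phi k.+1%:Z (- l.+1%:Z) in
  let N k l := lambda phi k.+1%:Z l.+1%:Z in
  imx_block M N (fun k l => (N k l)^*) (fun k l => (M k l)^*).

Definition circle_mean (R : realType) (u : R[i] -> R[i]) : R[i] :=
  ((2 * pi)^-1)%:C *
  cintegral (@lebesgue_measure R) `[0, 2 * pi] (fun t => u (expi t)).

Definition fourier (R : realType) (u : R[i] -> R[i]) (k : int) : R[i] :=
  circle_mean (fun z => u z * z ^ (- k)).

(* Inner product of the homogeneous Sobolev space of order 1/2. *)
Definition Hdot_inner (R : realType) (u v : R[i] -> R[i]) : R[i] :=
  idx_sum (fun i => `|idx_int i|%:~R * fourier u (idx_int i) *
                    (fourier v (idx_int i))^*).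

Definition Hdot_basis (R : realType) (i : idx) : R[i] -> R[i] :=
  fun z => z ^ idx_int i / (Num.sqrt `|idx_int i|%:~R)%:C.

Definition comp_op (R : realType) (phi u : R[i] -> R[i]) : R[i] -> R[i] :=
  fun z => u (phi z) - circle_mean (u \o phi).

Definition Cmx (R : realType) (phi : R[i] -> R[i]) : imx R :=
  fun i j => Hdot_inner (comp_op phi (@Hdot_basis R j)) (@Hdot_basis R i).

(* Main.v *)
(** Let C(phi) be the matrix of the composition operator. Expanding
    [- ln |1 - r w|], with [w = phi(z) / phi(z')] on the circle, in powers of [w]
    and letting [r] tend to 1 yields [Lambda(phi) = (I - C(phi) C(phi)^adj) / 2].
    Since [C(phi1 o phi2) = C(phi2) C(phi1)], the cocycle identity becomes algebra
    of bounded operators. For a Moebius map [mu] the kernel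
    [ln |(mu z - mu w) / (z - w)|] is the sum of a function of [z] and a function
    of [w], so Lambda(mu) vanishes and C(mu) is a coisometry; so is the matrix of
    the inverse map, which makes C(mu) unitary.

    Boundedness of C(phi) uses the quasiconformal extension [Phi]. By Green's
    formula on the disc, the matrix of C(phi) pairs the Dirichlet gradients of
    [p(Phi)] and of [q(z)], for [p] and [q] sums of powers of the variable and of
    its conjugate. The Dirichlet energy of [p(Phi)] is at most a constant times
    the integral of [|p'(Phi)|^2 jac Phi]. Instead of a change of variables, this
    integral is computed from the null Lagrangian identity
    [int (A_x B_y - A_y B_x) = 0], applied to monomials in [Phi] and its conjugate
    multiplied by radial cut-offs in [|Phi|^2]. *)

(* A quasiconformal map is given here as an ACL homeomorphism whose energy is known to be finite on
   compact parts of the disc only. The area formula for such maps rests on Lusin's condition (N);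
   the null Lagrangian avoids it, since it involves only compactly supported functions of [Phi] of
   finite energy. The price is a cut-off, and estimates that are uniform in it: comparing the
   monomials of degree 0 and 1 bounds all area integrals by a single one over a fixed compact part
   of the disc. A second obstacle is that the logarithmic kernel is not known to be integrable at
   the outset, whereas C(phi) involves only Fourier coefficients of nonzero index. Integrability
   amounts to a bound on the means of the powers of [phi], which are recovered from C(phi) by
   multiplying with [phi] itself. Infinite matrix products are limits of symmetric partial sums, so
   associativity is not formal: it is proved for bounded matrices by truncation. Likewise the
   product rule for C cannot rest on pointwise convergence of Fourier series; it uses their Cesaro
   means. *)
Require Import Defs.
From HB Require Import structures.
From mathcomp Require Import all_boot all_order all_algebra.
From mathcomp Require Import all_classical all_reals all_analysis.
From mathcomp Require Import measurable_realfun complex ring lra.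

Set Implicit Arguments.
Unset Strict Implicit.
Unset Printing Implicit Defensive.
Import Order.TTheory GRing.Theory Num.Theory.
Import numFieldNormedType.Exports.

Local Open Scope classical_set_scope.
Local Open Scope ring_scope.
Local Open Scope complex_scope.

Local Notation Re := complex.Re.
Local Notation Im := complex.Im.

(** * Measure-theoretic preliminaries *)

Section real_integrable.
Context d (T : measurableType d) (R : realType).
Context (mu : {measure set T -> \bar R}) (D : set T) (mD : measurable D).
Implicit Types f g : T -> R.
Local Notation intble f := (mu.-integrable D (EFin \o f)).

Lemma RintegrableD f g : intble f -> intble g -> intble (fun x => f x + g x).
Proof. by move=> fi gi; exact: (integrableD mD fi gi). Qed.

Lemma RintegrableB f g : intble f -> intble g -> intble (fun x => f x - g x).
Proof. by move=> fi gi; exact: (integrableB mD fi gi). Qed.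

Lemma RintegrableZ k f : intble f -> intble (fun x => k * f x).
Proof. by move=> fi; exact: (integrableZl mD k fi). Qed.

Lemma Rintegrable_sum (I : Type) (s : seq I) (F : I -> T -> R) :
  (forall i, intble (F i)) -> intble (fun x => \sum_(i <- s) F i x).
Proof.
move=> Fi; elim: s => [|i s IH].
  rewrite (_ : _ \o _ = cst 0%E); first exact: integrable0.
  by apply/funext => x /=; rewrite big_nil.
rewrite (_ : _ \o _ = EFin \o (fun x => F i x + \sum_(j <- s) F j x)).
  exact: RintegrableD.
by apply/funext => x /=; rewrite big_cons.
Qed.

Lemma Rintegrable_le f g : measurable_fun D f -> intble g ->
  (forall x, D x -> `|f x| <= g x) -> intble f.
Proof.
move=> mf gi fg; apply: (le_integrable mD _ _ gi); first exact/measurable_EFinP.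
by move=> x Dx /=; rewrite lee_fin (le_trans (fg _ Dx))// ler_norm.
Qed.

Lemma Rintegrable_ge0 f : measurable_fun D f -> (forall x, D x -> 0 <= f x) ->
  (\int[mu]_(x in D) (f x)%:E < +oo)%E -> intble f.
Proof.
move=> mf f0 fi; apply/integrableP; split; first exact/measurable_EFinP.
rewrite (@eq_integral _ _ _ _ _ (EFin \o f))// => x; rewrite inE => Dx /=.
by rewrite ger0_norm// f0.
Qed.

Lemma Rintegrable_cst (c : R) : (mu D < +oo)%E -> intble (fun=> c).
Proof.
move=> Dfin; apply/integrableP; split; first exact: measurable_cst.
rewrite (@eq_integral _ _ _ _ _ (cst `|c|%:E))// integral_cst//.
by rewrite lte_mul_pinfty.
Qed.

Lemma Rintegrable_restrict f : intble f ->
  mu.-integrable setT (EFin \o (f \_ D)).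
Proof. by move=> fi; rewrite -restrict_EFin -integrable_mkcond. Qed.

Lemma Rintegrable_restrictP f : mu.-integrable setT (EFin \o (f \_ D)) -> intble f.
Proof. by move=> fi; rewrite integrable_mkcond// restrict_EFin. Qed.

Lemma Rintegral_sum (I : Type) (s : seq I) (F : I -> T -> R) :
  (forall i, intble (F i)) ->
  \int[mu]_(x in D) (\sum_(i <- s) F i x) = \sum_(i <- s) \int[mu]_(x in D) F i x.
Proof.
move=> Fi; elim: s => [|i s IH].
  rewrite big_nil (@eq_Rintegral _ _ _ _ _ (cst 0)) => [|x _].
    by rewrite Rintegral_cst// mul0r.
  by rewrite big_nil.
rewrite big_cons -IH -RintegralD//; last exact: Rintegrable_sum.
by apply: eq_Rintegral => x _; rewrite big_cons.
Qed.

End real_integrable.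

Lemma Rintegral_cst_itv (R : realType) (c x y : R) (p q : bool) : x <= y ->
  \int[@lebesgue_measure R]_(t in [set` Interval (BSide p x) (BSide q y)]) c = c * (y - x).
Proof.
move=> xy.
have := @Rintegral_cst _ (measurableTypeR R) R (@lebesgue_measure R) [set` Interval (BSide p x) (BSide q y)] (measurable_itv _) c.
move=> ->; rewrite [X in fine X]lebesgue_measure_itv/= lte_fin.
by move: xy; case: ltgtP => //= -> _; rewrite subrr.
Qed.

Lemma leb_integrableS (R : realType) (A B : set R) (f : R -> \bar R) :
  measurable A -> measurable B -> A `<=` B ->
  (@lebesgue_measure R).-integrable B f -> (@lebesgue_measure R).-integrable A f.
Proof. by move=> mA mB AB; apply: integrableS; [exact: mB|exact: mA|]. Qed.

Section almost_everywhere.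
Context d (T : measurableType d) (R : realType) (mu : {measure set T -> \bar R}).

Lemma ae_imply (P Q : T -> Prop) : (forall x, P x -> Q x) ->
  {ae mu, forall x, P x} -> {ae mu, forall x, Q x}.
Proof.
exact: (@filterS _ _ (ae_filter_ringOfSetsType mu) P Q).
Qed.

Lemma ae_imply2 (P Q S : T -> Prop) : (forall x, P x -> Q x -> S x) ->
  {ae mu, forall x, P x} -> {ae mu, forall x, Q x} -> {ae mu, forall x, S x}.
Proof.
exact: (@filterS2 _ _ (ae_filter_ringOfSetsType mu) P Q S).
Qed.

Lemma ae_all (P : T -> Prop) : (forall x, P x) -> {ae mu, forall x, P x}.
Proof. by move=> H; exists set0; split => // x /= /(_ (H x)). Qed.

Lemma ae_Rintegrable (D : set T) (f g : T -> R) : measurable D ->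
  measurable_fun D f -> {ae mu, forall x, D x -> f x = g x} ->
  mu.-integrable D (EFin \o g) -> mu.-integrable D (EFin \o f).
Proof.
move=> mD mf fg ig; have /integrableP[mg lg] := ig.
apply/integrableP; split; first exact/measurable_EFinP.
apply: le_lt_trans lg.
rewrite (@ae_eq_integral _ _ _ mu D (fun x => `|(EFin \o g) x|)%E
    (fun x => `|(EFin \o f) x|)%E)//.
- by apply: measurableT_comp => //; exact/measurable_EFinP.
- by apply: measurableT_comp => //.
- by apply: ae_imply fg => x H Dx /=; rewrite (H Dx).
Qed.

Lemma ae_Rintegral (D : set T) (f g : T -> R) : measurable D ->
  measurable_fun D f -> measurable_fun D g -> {ae mu, forall x, D x -> f x = g x} ->
  \int[mu]_(x in D) f x = \int[mu]_(x in D) g x.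
Proof.
move=> mD mf mg fg; rewrite /Rintegral; congr fine.
apply: ae_eq_integral => //; [exact/measurable_EFinP..|].
by apply: ae_imply fg => x H Dx; rewrite (H Dx).
Qed.

End almost_everywhere.

Lemma cvg_harmonic_dnbhs (R : realType) :
  n.+1%:R^-1 @[n --> \oo] `=>` (0 : R)^'.
Proof.
move=> A [e /= e0 eA]; have := @cvg_harmonic R => /cvgr0Pnorm_lt/(_ _ e0).
apply: filterS => n nE; apply: eA => /=; first by rewrite sub0r normrN.
by rewrite invr_eq0.
Qed.

(** * Measurability of derivatives and of the set of differentiability *)

Section measurable_derivative.
Context (R : realType) (d : measure_display) (X : measurableType d).
Variable F : R -> X -> R.
Hypothesis mF : forall h, measurable_fun setT (F h).
Hypothesis cF : forall x, continuous (F ^~ x).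

Let Q (h : R) (x : X) : R := h^-1 * (F h x - F 0 x).
Let u (n : nat) := Q n.+1%:R^-1.

Let mQ h : measurable_fun setT (Q h).
Proof. by apply: measurable_funM => //; exact: measurable_funB. Qed.

Let G : set X := [set x | cvg (Q h x @[h --> 0^'])].

Let GE : G = \bigcap_(k : nat) \bigcup_(n : nat) \bigcap_(q : rat)
   \bigcap_(m : nat) [set x | (q != 0 -> `|ratr q : R| < n.+1%:R^-1 ->
      (n <= m)%N -> `|Q (ratr q) x - u m x| <= k.+1%:R^-1)].
Proof.
apply/seteqP; split=> x.
- move=> /cvg_ex[l /cvgrPdist_le Ql] k _.
  have e0 : 0 < k.+1%:R^-1 / 2 :> R by rewrite divr_gt0.
  have := Ql _ e0 => -[e /= e1 He].
  exists (Num.bound (e^-1)) => // q _ m _ /= q0 qn nm.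
  have ne : (Num.bound e^-1).+1%:R^-1 < e.
    rewrite invf_plt ?posrE//.
    rewrite (lt_le_trans (archi_boundP _)) ?invr_ge0 ?(ltW e1)//.
    by rewrite ler_nat.
  have H1 : `|l - Q (ratr q) x| <= k.+1%:R^-1 / 2.
    apply: He; last by rewrite fmorph_eq0.
    by rewrite /= sub0r normrN (lt_trans qn).
  have H2 : `|l - u m x| <= k.+1%:R^-1 / 2.
    apply: He => //=; rewrite sub0r normrN ger0_norm ?invr_ge0//.
    rewrite (le_lt_trans _ ne)// lef_pV2 ?posrE//.
    by rewrite ler_nat.
  rewrite [leRHS]splitr (_ : _ - _ = (l - u m x) - (l - Q (ratr q) x)); last ring.
  by rewrite (le_trans (ler_normB _ _))// lerD.
- move=> Hx.
  (* The terms of [u] are themselves quotients at the rational increments [1 / (i + 1)], so the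
     condition makes [u] a Cauchy sequence; its limit is the candidate for the derivative. *)
  have cu : cvgn (u ^~ x).
    apply/cauchy_cvgP/cauchy_ballP => e e0.
    have [n _ Hn] := Hx (Num.bound (e / 2)^-1) I.
    have He : (Num.bound (e / 2)^-1).+1%:R^-1 < e / 2.
      rewrite invf_plt ?posrE ?divr_gt0//.
      rewrite (lt_le_trans (archi_boundP _)) ?invr_ge0 ?divr_ge0 ?(ltW e0)//.
      by rewrite ler_nat.
    have uE i : (n < i)%N -> `|u i x - u n.+1 x| < e / 2.
      move=> ni; apply: le_lt_trans He.
      have qE : ratr (i.+1%:Q^-1) = i.+1%:R^-1 :> R.
        by rewrite fmorphV /= ratr_int.
      have := Hn (i.+1%:Q^-1) I n.+1 I; rewrite /= qE; apply => //.
        by rewrite invr_eq0 intr_eq0.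
      by rewrite ger0_norm ?invr_ge0// ltf_pV2 ?posrE// ltr_nat ltnS.
    rewrite near_map2; exists ([set i | n < i]%N, [set i | n < i]%N).
      by split; exists n.+1.
    case=> i j [/= ni nj].
    rewrite -ball_normE /= [ltRHS]splitr.
    rewrite (_ : _ - _ = (u i x - u n.+1 x) - (u j x - u n.+1 x)); last ring.
    by rewrite (le_lt_trans (ler_normB _ _))// ltrD// uE.
  have /cvg_ex[l /cvgrPdist_le ul] := cu.
  apply/cvg_ex; exists l; apply/cvgrPdist_le => e e0.
  have [n _ Hn] := Hx (Num.bound (e / 2)^-1) I.
  have He : (Num.bound (e / 2)^-1).+1%:R^-1 <= e / 2.
    rewrite invf_ple ?posrE ?divr_gt0// (le_trans (ltW (archi_boundP _)))//.
      by rewrite invr_ge0 divr_ge0// ltW.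
    by rewrite ler_nat.
  have Qq q : q != 0 -> `|ratr q : R| < n.+1%:R^-1 -> `|l - Q (ratr q) x| <= e / 2.
    move=> q0 qn.
    have ul' : `|u m x - Q (ratr q) x| @[m --> \oo] --> `|l - Q (ratr q) x|.
      by apply: cvg_norm; apply: cvgB; [apply/cvgrPdist_le|exact: cvg_cst].
    rewrite -(cvg_lim _ ul')//; apply: limr_le; first by apply/cvg_ex; eexists; exact: ul'.
    near=> m; rewrite distrC; apply: le_trans He.
    by apply: (Hn q I m I) => //; near: m; exact: nbhs_infty_ge.
  exists n.+1%:R^-1 => //= h /=; rewrite sub0r normrN => hn h0.
  (* At [h != 0] the quotient is continuous in [h], and a nearby rational increment transfers the
     estimate [Qq] to [h]. *)
  have cQ : {for h, continuous (Q ^~ x)}.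
    by apply: cvgM; [exact: cvgV|apply: cvgB; [exact: cF|exact: cvg_cst]].
  have e2 : 0 < e / 2 by rewrite divr_gt0.
  have /cvgrPdist_le/(_ _ e2) Qe := cQ.
  have [] := @dense_rat R ([set y | `|y| < n.+1%:R^-1] `&` [set y | y != 0] `&`
      [set y | `|Q h x - Q y x| <= e / 2]^°).
  - exists h; split; first by split.
    exact: Qe.
  - apply: openI; last exact: open_interior.
    apply: openI; last exact: open_neq.
    rewrite (_ : [set y | _] = ball (0 : R) n.+1%:R^-1); first exact: ball_open.
    by rewrite -ball_normE; apply/seteqP; split=> y /=; rewrite sub0r normrN.
  - move=> y [[[/= q1 q2] /interior_subset/= q3] [q _ qE]].
    rewrite -qE in q1 q2 q3.
    rewrite [leRHS]splitr (_ : l - _ = (l - Q (ratr q) x) - (Q h x - Q (ratr q) x)); last ring.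
    by rewrite (le_trans (ler_normB _ _))// lerD// Qq// -(fmorph_eq0 (@ratr R)).
Unshelve. all: by end_near. Qed.

(* By continuity in [h], the increments may be restricted to the rationals, and
   the existence of the limit becomes a countable Cauchy condition. *)
Lemma measurable_cvg_quotient : measurable [set x | cvg (h^-1 * (F h x - F 0 x) @[h --> 0^'])].
Proof.
rewrite -/G GE.
apply: bigcapT_measurable => k; apply: bigcup_measurable => n _.
rewrite -[X in measurable X]setCK setC_bigcap; apply: measurableC.
apply: bigcupT_measurable_rat => q; apply: measurableC.
apply: bigcapT_measurable => m.
have [->|q0] := eqVneq q 0.
  by rewrite [X in measurable X](_ : _ = setT)//; apply/seteqP; split.
have [qn|qn] := boolP ((`|ratr q : R| < n.+1%:R^-1) && (n <= m)%N); last first.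
  rewrite [X in measurable X](_ : _ = setT)//; apply/seteqP; split => // x _ /= _ a b.
  by rewrite a b in qn.
rewrite [X in measurable X](_ : _ =
    (fun x => `|Q (ratr q) x - u m x|) @^-1` `]-oo, k.+1%:R^-1]); last first.
  case/andP: qn => qn nm.
  by apply/seteqP; split => x /=; rewrite in_itv/= => H; [exact: H|].
rewrite -[X in measurable X]setTI.
have mf : measurable_fun setT (fun x => `|Q (ratr q) x - u m x|).
  by apply: measurableT_comp => //; apply: measurable_funB => //; exact: mQ.
exact: mf.
Qed.

Lemma measurable_lim_quotient :
  measurable_fun setT (fun x => lim (h^-1 * (F h x - F 0 x) @[h --> 0^'])).
Proof.
apply: (measurable_fun_cvg (h := fun n => u n \* \1_G)) => [n|x _].
  apply: measurable_funM => //; first exact: mQ.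
  by apply: measurable_indic; exact: measurable_cvg_quotient.
rewrite [X in X @ _ --> _](_ : _ = (fun n => u n x * (x \in G)%:R)); last first.
  by apply/funext => n /=; rewrite indicE.
have [xG|xG] := pselect (cvg (Q h x @[h --> 0^'])); last first.
  (* Where the limit does not exist, [lim] takes the default value 0, which is also what the factor
     [\1_G] produces. *)
  rewrite (_ : lim _ = 0); last exact: (dvgP xG).
  rewrite memNset//; under eq_fun do rewrite mulr0.
  exact: cvg_cst.
rewrite mem_set//; under eq_fun do rewrite mulr1.
apply: (@cvg_comp _ _ _ (fun n : nat => n.+1%:R^-1 : R) (fun h => Q h x) _ (0^')) => //.
exact: cvg_harmonic_dnbhs.
Qed.
End measurable_derivative.

Lemma measurable_derive1 (R : realType) (g : R -> R) : continuous g ->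
  measurable_fun setT (derive1 g).
Proof.
move=> cg; rewrite (_ : (derive1 g) = fun x => lim ((h^-1 * (g (h + x) - g (0 + x))) @[h --> 0^'])).
  apply: (@measurable_lim_quotient _ _ _ (fun h x => g (h + x))) => [h|x].
    apply: (measurableT_comp (continuous_measurable_fun cg)).
    exact: measurable_funD.
  by move=> h; apply: continuous_comp; [apply: cvgD; [exact: cvg_id|exact: cvg_cst]|exact: cg].
by apply/funext => x; rewrite add0r.
Qed.

(** * Absolutely continuous functions *)

(* Finite families of non-overlapping intervals are lists of pairs. *)
Definition ordered_itvs (R : realType) (s : seq (R * R)) : bool :=
  all (fun u => u.1 <= u.2) s && pairwise (fun u v => u.2 <= v.1) s.

Definition itvs_length (R : realType) (s : seq (R * R)) : R :=
  \sum_(u <- s) (u.2 - u.1).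

Definition itvs_variation (R : realType) (f : R -> R) (s : seq (R * R)) : R :=
  \sum_(u <- s) `|f u.2 - f u.1|.

(** Only the outer ends are tested; together with [ordered_itvs] this places both ends of every
    interval in [[a, b]]. *)
Definition within_itv (R : realType) (a b : R) (s : seq (R * R)) : bool :=
  all (fun u => (a <= u.1) && (u.2 <= b)) s.

Definition real_ac (R : realType) (a b : R) (f : R -> R) : Prop :=
  forall e : R, 0 < e -> exists2 d : R, 0 < d & forall s, ordered_itvs s ->
    within_itv a b s -> itvs_length s < d -> itvs_variation f s < e.

Section real_ac_variation.
Context (R : realType).
Implicit Types (a b c : R) (f : R -> R) (s t : seq (R * R)).

Fixpoint pieces a (l : seq R) : seq (R * R) :=
  if l is x :: k then (a, x) :: pieces x k else [::].

Lemma pieces_variation a b f l : itv_partition a b l ->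
  itvs_variation f (pieces a l) = variation a b f l.
Proof.
move=> abl; rewrite variation_zip// /itvs_variation.
elim: l a {abl} => [|x l IH] a /=; first by rewrite !big_nil.
by rewrite !big_cons IH.
Qed.

Lemma pieces_length a b l : itv_partition a b l ->
  itvs_length (pieces a l) = b - a.
Proof.
move=> [_ /eqP <-]; rewrite /itvs_length.
elim: l a => [|x l IH] a /=; first by rewrite big_nil subrr.
by rewrite big_cons IH /= addrC subrKA.
Qed.

Lemma pieces_ordered a b l : itv_partition a b l ->
  ordered_itvs (pieces a l) && within_itv a b (pieces a l).
Proof.
elim: l a => [//|x l IH] a abl; have /IH/andP[/andP[p1 p2] w] := itv_partition_cons abl.
have xb := itv_partition_le (itv_partition_cons abl).
case: abl => /= /andP[ax _] _.
rewrite /ordered_itvs /within_itv /= lexx xb (ltW ax) p1 p2 /=.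
rewrite (sub_all _ w) ?andbT; last by move=> u /andP[].
by apply: sub_all w => u /andP[/(le_trans (ltW ax)) -> ->].
Qed.

Lemma ordered_itvs_cat s t : ordered_itvs (s ++ t) =
  [&& ordered_itvs s, ordered_itvs t & allrel (fun u v => u.2 <= v.1) s t].
Proof.
rewrite /ordered_itvs all_cat pairwise_cat.
by case: (all _ s); case: (all _ t); case: (pairwise _ s); case: (pairwise _ t);
  case: (allrel _ _ _).
Qed.

(** Subdividing the intervals of a family keeps it ordered and preserves its total length, so a
    modulus of absolute continuity for [f] also serves for its total variation. *)
Lemma TV_sum_le a b f e d :
  (forall s, ordered_itvs s -> within_itv a b s -> itvs_length s < d ->
     itvs_variation f s <= e) ->
  forall s, ordered_itvs s -> within_itv a b s -> itvs_length s < d ->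
    (\sum_(u <- s) total_variation u.1 u.2 f <= e%:E)%E.
Proof.
move=> H s os ws ls.
(* The list [t] collects intervals already subdivided; those of [s] still count with their total
   variation. *)
suff : forall t, ordered_itvs (t ++ s) -> within_itv a b (t ++ s) ->
    itvs_length (t ++ s) < d ->
    ((itvs_variation f t)%:E + \sum_(u <- s) total_variation u.1 u.2 f <= e%:E)%E.
  by move=> /(_ [::] os ws ls); rewrite /itvs_variation big_nil add0e.
elim: s {os ws ls} => [|u s IH] t ot wt lt.
  by rewrite big_nil adde0 lee_fin H// -(cats0 t).
rewrite big_cons.
have H2 l : itv_partition u.1 u.2 l -> ((itvs_variation f t)%:E +
    ((variation u.1 u.2 f l)%:E + \sum_(v <- s) total_variation v.1 v.2 f) <= e%:E)%E.
  move=> ul; rewrite addeA -EFinD -(pieces_variation f ul).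
  rewrite [X in (X%:E + _)%E](_ : _ = itvs_variation f (t ++ pieces u.1 l)); last first.
    by rewrite /itvs_variation big_cat.
  have /andP[po pw] := pieces_ordered ul.
  have pl := pieces_length ul.
  apply: IH; rewrite -catA.
  - move: ot; rewrite -(cat1s u) !ordered_itvs_cat po.
    case/and3P => -> /and3P[_ -> /allrelP us] /allrelP tus /=.
    apply/andP; split; apply/allrelP => v w.
      by move=> /(allP pw)/andP[_ vu] /(us _ _ (mem_head _ _)); apply: le_trans.
    rewrite mem_cat => tv /orP[/(allP pw)/andP[uw _]|sw].
      by apply: le_trans uw; apply: tus => //; rewrite mem_cat mem_head.
    by apply: tus => //; rewrite mem_cat sw orbT.
  - move: wt; rewrite /within_itv !all_cat /= => /and3P[-> /andP[au ub] ->].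
    rewrite andbT /=; apply: sub_all pw => w /andP[uw wu].
    by rewrite (le_trans au uw) (le_trans wu ub).
  - move: lt; rewrite /itvs_length !big_cat /= big_cons -pl.
    by rewrite /itvs_length.
have X0 : (0 <= \sum_(v <- s) total_variation v.1 v.2 f)%E.
  rewrite big_seq; apply: sume_ge0 => v sv; apply: total_variation_ge0.
  move: ot => /andP[/allP H1 _]; apply: H1.
  by rewrite mem_cat in_cons sv !orbT.
move: X0 H2; set X := (\sum_(v <- s) _)%E => X0 H2.
have u12 : u.1 <= u.2.
  move: ot => /andP[/allP H1 _]; apply: H1.
  by rewrite mem_cat in_cons eqxx !orbT.
(* Moving [X] across the inequality requires it to be finite: [H2] at a trivial partition would fail
   if [X] were infinite. *)
have Xfin : X \is a fin_num.
  rewrite ge0_fin_numE//.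
  have [l ul] : exists l, itv_partition u.1 u.2 l.
    move: u12; rewrite le_eqVlt => /predU1P[->|u12]; first by exists [::].
    by exists [:: u.2]; exact: itv_partition1.
  by have := H2 _ ul; rewrite ltey; apply: contraTN => /eqP ->; rewrite addey// addey.
rewrite addeA -leeBrDr// addeC -leeBrDr//.
rewrite /total_variation; apply: ge_ereal_sup => _ [_ [l ul <-] <-].
rewrite leeBrDr// leeBrDr//; apply: le_trans (H2 _ ul).
by rewrite addeA [X in (X + _)%E]addeC.
Qed.

(** The interval is cut into finitely many pieces shorter than the [d] that belongs to [e = 1]; the
    variation is at most 1 on each. *)
Lemma real_ac_BV a b f : a <= b -> real_ac a b f -> bounded_variation a b f.
Proof.
move=> ab /(_ _ ltr01)[d d0 H].
have {}H s os ws ls : itvs_variation f s <= 1 := ltW (H s os ws ls).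
have TV1 p q : a <= p -> p <= q -> q <= b -> q - p < d -> (total_variation p q f <= 1)%E.
  move=> ap pq qb qpd; have := @TV_sum_le a b f 1 d H [:: (p, q)].
  rewrite big_seq1/=; apply.
  - by rewrite /ordered_itvs/= pq.
  - by rewrite /within_itv/= ap qb.
  - by rewrite /itvs_length big_seq1.
pose n := (Num.bound ((b - a) / d)).+1.
pose h := (b - a) / n%:R.
have n0 : 0 < n%:R :> R by rewrite ltr0n.
have h0 : 0 <= h by rewrite divr_ge0// ?subr_ge0// ltW.
have hd : h < d.
  rewrite ltr_pdivrMr// mulrC -ltr_pdivrMr//.
  rewrite (lt_le_trans (archi_boundP _))// ?divr_ge0 ?subr_ge0 ?(ltW d0)//.
  by rewrite ler_nat.
apply/bounded_variationP => //.
rewrite ge0_fin_numE ?total_variation_ge0//.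
have nh : n%:R * h = b - a by rewrite mulrC divfK// gt_eqF.
suff H3 k : (k <= n)%N -> (total_variation a (a + k%:R * h) f <= k%:R%:E)%E.
  have := H3 _ (leqnn n); rewrite nh addrC subrK => /le_lt_trans; apply.
  exact: ltry.
elim: k => [_|k IH kn]; first by rewrite mul0r addr0 total_variationxx.
have k1 : a + k%:R * h <= a + k.+1%:R * h.
  by rewrite lerD2l ler_wpM2r// ler_nat.
have k2 : a + k.+1%:R * h <= b.
  by rewrite -lerBrDl -nh ler_wpM2r// ler_nat.
rewrite (@total_variationD _ _ _ (a + k%:R * h))//; last first.
  by rewrite lerDl mulr_ge0.
rewrite -[in leRHS]natr1 EFinD leeD// ?IH ?(ltnW kn)//.
apply: TV1 => //; first by rewrite lerDl mulr_ge0.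
by rewrite [ltLHS](_ : _ = h)// -natr1; ring.
Qed.

(** Composing with this monotone retraction turns a function on [[a, b]] into one on the line that
    is constant on either side, to which Stieltjes measures apply. *)
Definition clip a b x := Num.max a (Num.min x b).

Lemma clip_itv a b x : a <= b -> a <= clip a b x <= b.
Proof. by move=> ab; rewrite le_max lexx/= ge_max ab ge_min lexx orbT. Qed.

Lemma clip_id a b x : a <= x <= b -> clip a b x = x.
Proof. by move=> /andP[ax xb]; rewrite /clip (min_idPl xb) (max_idPr ax). Qed.

Lemma clip_homo a b : {homo clip a b : x y / x <= y}.
Proof.
move=> x y xy; rewrite /clip ge_max le_max lexx/= le_max; apply/orP; right.
by rewrite le_min !ge_min xy lexx orbT.
Qed.

Lemma clip_length a b x y : a <= b -> x <= y -> clip a b y - clip a b x <= y - x.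
Proof.
move=> ab xy; rewrite /clip /Num.max /Num.min.
by case: (ltP y b) => ?; case: (ltP x b) => ?; do 2?[case: (ltP a _) => ?]; lra.
Qed.

Definition global_ac f := forall e : R, 0 < e -> exists2 d : R, 0 < d &
  forall s, ordered_itvs s -> itvs_length s < d -> itvs_variation f s < e.

Lemma ordered_itvs_clip a b s : ordered_itvs s ->
  ordered_itvs [seq (clip a b u.1, clip a b u.2) | u <- s].
Proof.
move=> /andP[s1 s2]; rewrite /ordered_itvs all_map pairwise_map; apply/andP; split.
  by apply: sub_all s1 => u /=; exact: clip_homo.
by apply: sub_pairwise s2 => u v /=; exact: clip_homo.
Qed.

Lemma within_itv_clip a b s : a <= b ->
  within_itv a b [seq (clip a b u.1, clip a b u.2) | u <- s].
Proof.
move=> ab; rewrite /within_itv all_map; apply/allP => u _ /=.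
by have /andP[-> _] := clip_itv u.1 ab; have /andP[_ ->] := clip_itv u.2 ab.
Qed.

Lemma itvs_length_clip a b s : a <= b -> ordered_itvs s ->
  itvs_length [seq (clip a b u.1, clip a b u.2) | u <- s] <= itvs_length s.
Proof.
move=> ab /andP[/allP s1 _]; rewrite /itvs_length big_map.
rewrite big_seq [leRHS]big_seq; apply: ler_sum => u us.
by apply: clip_length => //; exact: s1.
Qed.

Lemma global_ac_clip a b f : a <= b -> real_ac a b f -> global_ac (f \o clip a b).
Proof.
move=> ab H e /H[d d0 Hd]; exists d => // s os ls.
have := Hd [seq (clip a b u.1, clip a b u.2) | u <- s].
rewrite /itvs_variation big_map; apply.
- exact: ordered_itvs_clip.
- exact: within_itv_clip.
- by apply: le_lt_trans ls; exact: itvs_length_clip.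
Qed.

(** Increments of the variation function are total variations over the clipped intervals, which
    [TV_sum_le] controls; it is used at [e / 2] because its conclusion is a weak inequality. *)
Lemma global_ac_TV_clip a b f : a <= b -> real_ac a b f ->
  global_ac (fun x => fine (total_variation a (clip a b x) f)).
Proof.
move=> ab acf; have bvf := real_ac_BV ab acf.
move=> e e0; have e20 : 0 < e / 2 by rewrite divr_gt0.
have [d d0 Hd] := acf _ e20; exists d => // s os ls.
have := @TV_sum_le a b f (e / 2) d _ [seq (clip a b u.1, clip a b u.2) | u <- s].
move=> /(_ _ (ordered_itvs_clip _ _ os) (within_itv_clip _ ab)) H.
apply: (@le_lt_trans _ _ (e / 2)); last by rewrite ltr_pdivrMr// ltr_pMr// ltr1n.
rewrite -lee_fin; apply: le_trans (H _ _); last 2 first.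
- by move=> t ot wt lt; exact/ltW/Hd.
- by apply: le_lt_trans ls; exact: itvs_length_clip.
rewrite /itvs_variation big_map -sumEFin.
rewrite big_seq [leRHS]big_seq; apply: lee_sum => u us /=.
have u12 : u.1 <= u.2 by move: os => /andP[/allP H1 _]; exact: H1.
have /andP[c1 c2] := clip_itv u.1 ab; have /andP[c3 c4] := clip_itv u.2 ab.
have c12 := clip_homo a b u12.
have fT p q : a <= p -> p <= q -> q <= b -> total_variation p q f \is a fin_num.
  move=> ap pq qb; apply/bounded_variationP => //.
  by apply: (bounded_variationr ap) => //; apply: bounded_variationl bvf => //; exact: le_trans pq.
rewrite -fineB ?fT// (total_variationD f c1 c12) addeAC subee ?fT// add0e.
by rewrite ger0_norm ?fine_ge0 ?total_variation_ge0// fineK// fT.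
Qed.

End real_ac_variation.

Lemma le_measureR (R : realType)
    (m : {measure set (measurableTypeR R) -> \bar R}) (A B : set R) :
  measurable A -> measurable B -> A `<=` B -> (m A <= m B)%E.
Proof. by move=> mA mB AB; apply: le_measure; rewrite ?inE; [exact: mA|exact: mB|]. Qed.

Lemma measureU2R (R : realType)
    (m : {measure set (measurableTypeR R) -> \bar R}) (A B : set R) :
  measurable A -> measurable B -> (m (A `|` B) <= m A + m B)%E.
Proof. by move=> mA mB; apply: measureU2; [exact: mA|exact: mB]. Qed.

Lemma measure_semi_bigcupR (R : realType)
    (m : {measure set (measurableTypeR R) -> \bar R}) (F : nat -> set R) :
  (forall n, measurable (F n)) -> trivIset setT F ->
  m (\bigcup_n F n) = (\sum_(0 <= k <oo) m (F k))%E.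
Proof.
move=> mF tF.
have mU : measurable (\bigcup_n F n) := bigcupT_measurable F mF.
exact: (@measure_semi_bigcup _ _ _ m F mF tF mU).
Qed.

(** * Stieltjes measures of absolutely continuous functions *)

Section stieltjes_dominated.
Context (R : realType).
Local Notation leb := (@lebesgue_measure R).
Implicit Types (s t : seq (R * R)).

Definition apart (u v : R * R) : bool :=
  [&& u.1 < u.2, v.1 < v.2 & (u.2 <= v.1) || (v.2 <= u.1)].

(** Absolute continuity is stated for intervals in increasing order, whereas the components of an
    open set come in no particular order. *)
Lemma apart_sort s : all (fun u => u.1 < u.2) s -> pairwise apart s ->
  exists2 t, perm_eq s t & ordered_itvs t.
Proof.
move=> s1 s2; pose le1 := relpre (fst : R * R -> R) <=%R.
have tr : transitive le1 by move=> x y z; exact: le_trans.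
have tot : total le1 by move=> x y; exact: le_total.
exists (sort le1 s); first by rewrite perm_sym perm_sort.
have us : uniq s.
  by apply: pairwise_uniq s2 => u; rewrite /apart; case: ltP => //= ab; rewrite leNgt ab.
have sA u v : u \in s -> v \in s -> u != v -> apart u v.
  move=> us' vs; move/(pairwiseP u): s2 => s2 uv.
  have iu : (index u s < size s)%N by rewrite index_mem.
  have iv : (index v s < size s)%N by rewrite index_mem.
  have [lt|lt|eqi] := ltngtP (index u s) (index v s).
  - by have := s2 _ _ iu iv lt; rewrite !nth_index.
  - have := s2 _ _ iv iu lt; rewrite !nth_index// /apart => /and3P[-> -> /=].
    by rewrite orbC.
  - by move: uv; rewrite -(nth_index u us') -(nth_index u vs) eqi eqxx.
apply/andP; split.
  by rewrite all_sort; apply: sub_all s1 => u /ltW.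
have := sort_sorted tot s; rewrite sorted_pairwise// => srt.
have us' : uniq (sort le1 s) by rewrite sort_uniq.
apply/(pairwiseP (0, 0)) => i j isz jsz ij.
move/(pairwiseP (0, 0)): srt => /(_ _ _ isz jsz ij); rewrite /le1 /=.
set u := nth _ _ i; set v := nth _ _ j => uv.
have us1 : u \in s by rewrite -(mem_sort le1) mem_nth.
have vs1 : v \in s by rewrite -(mem_sort le1) mem_nth.
have neq : u != v by rewrite nth_uniq// ltn_eqF.
have /and3P[u12 v12 /orP[//|vu]] := sA _ _ us1 vs1 neq.
by move: (lt_le_trans v12 vu); rewrite ltNge uv.
Qed.

Lemma finite_length_itv (i : interval R) : (leb [set` i] < +oo)%E ->
  exists u : R * R, u.1 <= u.2 /\
    ([set` i] `<=` `[u.1, u.2]%classic) /\ (`]u.1, u.2[%classic `<=` [set` i]).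
Proof.
have [i0|i0] := boolP (neitv i); last first.
  (* The empty interval is represented by a degenerate pair. *)
  move=> _; exists (0, 0); rewrite set_itvoo0; split => //; split => //.
  by move: i0; rewrite negbK => /eqP ->; exact: sub0set.
have := i0; rewrite lebesgue_measure_itv.
move: i0; case: i => [[c p|[]] [c' q|[]]]; rewrite ?neitvE //= => i0 _.
- move=> _; exists (p, q) => /=; split.
    by case: c c' i0 => [] []; rewrite bnd_simp// => /ltW.
  by case: c c' {i0} => [] []; split; apply: subset_itv; rewrite bnd_simp.
- by rewrite ltry addye.
- by rewrite ltNyr addey.
Qed.

Variable g : cumulative R R.
Hypothesis acg : global_ac g.
Local Notation nu := (lebesgue_stieltjes_measure g).

Lemma stieltjes_oc (p q : R) : p <= q -> nu `]p, q] = (g q - g p)%:E.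
Proof.
move=> pq; rewrite /lebesgue_stieltjes_measure /measure_extension.
by rewrite measurable_mu_extE/= ?wlength_itv_bnd//; exact: is_ocitv.
Qed.

(** There are no atoms, since the mass of []p - d / 2, p]] is an increment of [g] over a short
    interval. *)
Lemma stieltjes_pt (p : R) : nu [set p] = 0%E.
Proof.
apply/eqP; rewrite eq_le measure_ge0 andbT; apply/lee_addgt0Pr => e e0.
have [d d0 H] := acg e0; rewrite add0e.
have pd : p - d / 2 < p by rewrite ltrBlDr ltrDl divr_gt0.
apply: (@le_trans _ _ (nu `]p - d / 2, p])).
  apply: le_measure; rewrite ?inE.
  - exact: measurable_set1.
  - exact: measurable_itv.
  - by move=> _ ->; rewrite /= in_itv/= pd lexx.
rewrite stieltjes_oc ?(ltW pd)// lee_fin.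
have := H [:: (p - d / 2, p)]; rewrite /itvs_length /itvs_variation !big_seq1/=.
move=> /(_ _ _)/ltW/(le_trans (ler_norm _)); apply.
- by rewrite /ordered_itvs/= (ltW pd).
- by rewrite opprB addrC subrK ltr_pdivrMr// ltr_pMr// ltr1n.
Qed.

(** A null set lies in an open set of measure below [d]. Finitely many components of this set have
    total length below [d], hence increments of [g] with sum below [e]; the bound passes to the
    countable union. *)
Lemma stieltjes_dominates : nu `<< leb.
Proof.
apply/null_content_dominatesP => N mN N0.
apply/eqP; rewrite eq_le measure_ge0 andbT; apply/lee_addgt0Pr => e e0.
rewrite add0e.
have [d d0 Hd] := acg e0.
have [U [oU NU UN]] := lebesgue_regularity_outer mN (eq_ind_r (fun x => (x < +oo)%E) (ltry _) N0) d0.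
have mU : measurable U by exact: open_measurable.
have Ud : (leb U < d%:E)%E.
  apply: le_lt_trans UN; rewrite -[leRHS]adde0 -[X in (_ + X)%E]N0.
  apply: le_trans (measureU2 _ _ _) => //; last exact: measurableD.
  by rewrite setUC setDUK.
pose I := open_disjoint_itv oU.
have mI n : measurable (I n) by apply: open_measurable; exact: open_disjoint_itv_open.
have tI := @open_disjoint_itv_trivIset _ _ oU.
have UI : U = \bigcup_n I n := open_disjoint_itv_bigcup oU.
have IU n : I n `<=` U by rewrite UI; exact: bigcup_sup.
have /choice[J HJ] : forall n, exists u : R * R, u.1 <= u.2 /\
    (I n `<=` `[u.1, u.2]%classic) /\ (`]u.1, u.2[%classic `<=` I n).
  move=> n; have In : I n = [set` Rhull (I n)].
    exact/is_intervalP/open_disjoint_itv_is_interval.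
  rewrite In; apply: finite_length_itv; rewrite -In.
  apply: (@le_lt_trans _ _ (leb U)); last by rewrite (lt_trans Ud)// ltry.
  exact: le_measureR.
have mJ n : (nu (I n) <= (g (J n).2 - g (J n).1)%:E)%E.
  have [J12 [IJ _]] := HJ n.
  apply: (@le_trans _ _ (nu ([set (J n).1] `|` `](J n).1, (J n).2]))).
    apply: le_measureR => //.
      by apply: measurableU; [exact: measurable_set1|exact: measurable_itv].
    move=> x /IJ /=; rewrite !in_itv/= le_eqVlt => /andP[/predU1P[->|->] ->].
      by left.
    by right.
  apply: le_trans (measureU2R _ _ _) _; [exact: measurable_set1|exact: measurable_itv|].
  by rewrite [X in (X + _)%E]stieltjes_pt add0e [leLHS]stieltjes_oc.
have lJ n : (((J n).2 - (J n).1)%:E <= leb (I n))%E.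
  have [J12 [_ JI]] := HJ n.
  apply: (@le_trans _ _ (leb `](J n).1, (J n).2[)).
    by rewrite lebesgue_measure_itv/= lte_fin; case: ltgtP J12 => // -> _; rewrite subrr.
  by apply: le_measureR => //; exact: measurable_itv.
have sumI n : (\sum_(0 <= k < n) nu (I k) <= e%:E)%E.
  (* Degenerate components are discarded: they carry no mass, and [apart] asks for nonempty
     interiors. *)
  pose s := [seq u <- [seq J k | k <- index_iota 0 n] | u.1 < u.2].
  have [t st ot] : exists2 t, perm_eq s t & ordered_itvs t.
    apply: apart_sort; first by rewrite /s filter_all.
    have Japart x y : x != y -> (J x).1 < (J x).2 -> (J y).1 < (J y).2 ->
        apart (J x) (J y).
      move=> xy Jx Jy; rewrite /apart Jx Jy /= -implyNb -ltNge; apply/implyP => yx.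
      rewrite leNgt; apply/negP => xy'.
      have [[_ [_ Hx]] [_ [_ Hy]]] := (HJ x, HJ y).
      (* If the two open intervals overlapped, the midpoint [m] of their intersection would lie in
         two disjoint components. *)
      pose m := (Num.max (J x).1 (J y).1 + Num.min (J x).2 (J y).2) / 2.
      have mlt : Num.max (J x).1 (J y).1 < Num.min (J x).2 (J y).2.
        by rewrite gt_max !lt_min Jx Jy yx xy'.
      have := midf_lt mlt; rewrite -/m => -[].
      rewrite gt_max lt_min => /andP[m1 m2] /andP[m3 m4].
      move/eqP: xy; apply; apply: (tI x y Logic.I Logic.I).
      by exists m; split; [apply: Hx|apply: Hy]; rewrite /= in_itv/= ?m1 ?m2 ?m3 ?m4.
    rewrite /s; have := iota_uniq 0 (n - 0).
    rewrite -/(index_iota 0 n); elim: (index_iota 0 n) => [//|x l IH] /= /andP[xl ul].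
    case: ifP => [Jx|_]; last exact: IH.
    rewrite /= IH// andbT; apply/allP => u; rewrite mem_filter => /andP[u12 /mapP[y yl uE]].
    rewrite uE in u12 *; apply: Japart => //.
    by apply: contraNneq xl => ->.
  have := Hd t ot; rewrite /itvs_length -(perm_big _ st)/= => /(_ _)/ltW.
  rewrite /s big_filter big_map big_mkcond/= => H.
  have {}H : itvs_variation g t <= e.
    apply: H; rewrite -lte_fin; apply: le_lt_trans Ud.
    rewrite [X in (_ <= leb X)%E]UI (measure_semi_bigcupR _ mI tI).
    apply: (@le_trans _ _ (\sum_(0 <= k < n) leb (I k))%E); last first.
      by apply: nneseries_lim_ge => k _ _; exact: measure_ge0.
    rewrite -sumEFin; apply: lee_sum => k _.
    by case: ifP => _; [exact: lJ|exact: measure_ge0].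
  apply: (@le_trans _ _ (itvs_variation g t)%:E); last by rewrite lee_fin.
  rewrite /itvs_variation -(perm_big _ st)/= /s big_filter big_map.
  rewrite -sumEFin [leRHS]big_mkcond/=; apply: lee_sum => k _; apply: le_trans (mJ k) _.
  case: ifP => [_|/negbT]; rewrite lee_fin; first exact: ler_norm.
  rewrite -leNgt => J21; have [J12 _] := HJ k.
  by rewrite (@le_anti _ _ (J k).1 (J k).2) ?subrr// J12 J21.
apply: (@le_trans _ _ (nu U)).
  exact: le_measureR.
rewrite UI (measure_semi_bigcupR _ mI tI).
by apply: lime_le => //; [exact: is_cvg_nneseries|exact: nearW].
Qed.
End stieltjes_dominated.

(** * The fundamental theorem of calculus for absolutely continuous functions *)

Section absolutely_continuous_ftc.
Context (R : realType).
Local Notation leb := (@lebesgue_measure R).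
Implicit Types (f g : R -> R) (a b x y : R).

Lemma global_ac_continuous g : global_ac g -> continuous g.
Proof.
move=> acg x; apply/cvgrPdist_lt => e /acg[d d0 H].
exists d => //= y; rewrite /= => xyd.
have := H [:: (Num.min x y, Num.max x y)].
rewrite /ordered_itvs /itvs_length /itvs_variation !big_seq1/= andbT andbT.
rewrite ge_min le_max lexx /= => /(_ isT).
by move: xyd; case: (ltP x y) => xy; [rewrite ltr0_norm ?subr_lt0// opprB|
  rewrite ger0_norm ?subr_ge0//] => xyd /(_ xyd) => //; rewrite distrC.
Qed.

(** The values 0 and 1 at the ends make the Stieltjes measure finite; being dominated by Lebesgue
    measure, it has an integrable Radon-Nikodym density. *)
Lemma unit_density a b (G : R -> R) : a < b -> nondecreasing G -> global_ac G ->
  (forall x, x <= a -> G x = 0) -> (forall x, b <= x -> G x = 1) ->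
  exists h : R -> R, leb.-integrable setT (EFin \o h) /\
    forall x y, x <= y -> G y - G x = \int[leb]_(t in `]x, y]) h t.
Proof.
move=> ab ndG acG Ga Gb.
have rcG := right_continuousW (global_ac_continuous acG).
have GNy : G @ -oo --> (0 : R).
  by apply: cvg_near_cst; exists a; split; [exact: num_real|move=> x /= /ltW; exact: Ga].
have Gy : G @ +oo --> (1 : R).
  by apply: cvg_near_cst; exists b; split; [exact: num_real|move=> x /= /ltW; exact: Gb].
pose H : cumulativeBounded (0 : R) (1 : R) := HB.pack G
  (isCumulative.Build R _ R G ndG rcG) (isCumulativeBounded.Build R 0 1 G GNy Gy).
have dom := @stieltjes_dominates _ (H : cumulative R R) acG.
have [h [h0 hfin ih hE]] := @radon_nikodym_sigma_finite _ _ _ leb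
   (lebesgue_stieltjes_measure H) dom.
exists (fine \o h); split.
  by apply: eq_integrable ih => // x _ /=; rewrite fineK.
move=> x y xy.
apply: EFin_inj; rewrite /Rintegral fineK; last first.
  apply: integrable_fin_num => //; apply: (@integrableS _ _ _ _ setT) => //.
  by apply: eq_integrable ih => // t _ /=; rewrite fineK.
transitivity (lebesgue_stieltjes_measure H `]x, y]); first by rewrite stieltjes_oc.
rewrite hE; last exact: measurable_itv.
by apply: eq_integral => t _ /=; rewrite fineK.
Qed.

Lemma global_acD f g : global_ac f -> global_ac g -> global_ac (f \+ g).
Proof.
move=> acf acg e e0; have e2 : 0 < e / 2 by rewrite divr_gt0.
have [d d0 Hd] := acf _ e2; have [c c0 Hc] := acg _ e2.
exists (Num.min d c); first by rewrite lt_min d0 c0.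
move=> s os; rewrite lt_min => /andP[sd sc].
rewrite [ltRHS]splitr; apply: le_lt_trans (ltrD (Hd _ os sd) (Hc _ os sc)).
rewrite /itvs_variation -big_split/=; apply: ler_sum => u _.
by rewrite [X in `|X|](_ : _ = (f u.2 - f u.1) + (g u.2 - g u.1)) ?ler_normD//; ring.
Qed.

Lemma global_acZ k f : global_ac f -> global_ac (fun x => k * f x).
Proof.
move=> acf e e0; have ek : 0 < e / (`|k| + 1) by rewrite divr_gt0// ltr_pwDr.
have [d d0 Hd] := acf _ ek; exists d => // s os sd.
have k1 : 0 < `|k| + 1 by rewrite ltr_pwDr.
have := Hd _ os sd; rewrite ltr_pdivlMr// => /(le_lt_trans _); apply.
rewrite mulrC /itvs_variation mulr_sumr; apply: ler_sum => u _.
by rewrite -mulrBr normrM ler_wpM2r// lerDl.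
Qed.

Lemma global_ac_cst (k : R) : global_ac (cst k).
Proof.
move=> e e0; exists 1 => // s _ _; rewrite /itvs_variation big1// => u _.
by rewrite subrr normr0.
Qed.

Lemma global_ac_id : global_ac (@idfun R).
Proof.
move=> e e0; exists e => // s /andP[/allP s1 _]; apply: le_lt_trans.
rewrite /itvs_variation /itvs_length big_seq [leRHS]big_seq.
by apply: ler_sum => u /s1 u12; rewrite ger0_norm// subr_ge0.
Qed.

(* The density is a Radon-Nikodym derivative of the Stieltjes measure of [g];
   adding [x - a] and rescaling turns [g] into a distribution function. *)
Lemma monotone_density a b g : a < b -> nondecreasing g -> global_ac g ->
  (forall x, x <= a -> g x = g a) -> (forall x, b <= x -> g x = g b) ->
  exists h : R -> R, leb.-integrable setT (EFin \o h) /\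
    forall x y, a <= x -> x <= y -> y <= b -> g y - g x = \int[leb]_(t in `]x, y]) h t.
Proof.
move=> ab ndg acg ga gb.
(* The total increment of [g] plus that of [clip]; the second one keeps [k] positive when [g] is
   constant. *)
pose k := g b - g a + (b - a).
have k0 : 0 < k by rewrite ltr_wpDl// ?subr_gt0// subr_ge0 ndg// ltW.
pose G x := k^-1 * ((g x - g a) + (clip a b x - a)).
have [||||h [ih hE]] := @unit_density a b G ab.
- move=> x y xy; rewrite /G ler_wpM2l ?invr_ge0 ?(ltW k0)//.
  by rewrite lerD// lerD2r; [exact: ndg|exact: clip_homo].
- apply: global_acZ; apply: global_acD.
    by apply: (global_acD acg); exact: global_ac_cst.
  apply: global_acD; last exact: global_ac_cst.
  apply: (@global_ac_clip _ _ _ idfun); first exact: ltW.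
  by move=> e /global_ac_id[d d0 H]; exists d => // s os _; exact: H.
- move=> x xa; rewrite /G ga// /clip (min_idPl _) ?(le_trans xa (ltW ab))//.
  by rewrite (max_idPl xa) !subrr addr0 mulr0.
- move=> x bx; rewrite /G gb// /clip (min_idPr _)// (max_idPr (ltW ab)).
  by rewrite mulVf// gt_eqF.
(* The rescaling is undone and the density of [clip a b] is removed. *)
exists (fun t => k * h t - \1_(`[a, b]%classic) t); split.
  apply: RintegrableB => //; first exact: RintegrableZ.
  exact: integrable_indic_itv.
move=> x y ax xy yb.
have mxy : measurable `]x, y] by exact: measurable_itv.
rewrite RintegralB//.
- rewrite RintegralZl//; last exact: (@leb_integrableS _ _ setT).
  rewrite -(hE _ _ xy) /G !clip_id ?ax ?yb ?(le_trans ax xy) ?(le_trans xy yb)//.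
  rewrite [X in _ = _ - X](_ : _ = y - x); last first.
    rewrite (@eq_Rintegral _ _ _ _ _ (cst 1)).
      by rewrite Rintegral_cst_itv// mul1r.
    move=> t; rewrite inE/= in_itv/= => /andP[xt ty].
    by rewrite indicE mem_set//= in_itv/= (le_trans ax (ltW xt)) (le_trans ty yb).
  rewrite -mulrBr mulrA divff ?gt_eqF// mul1r; ring.
- by apply: (@leb_integrableS _ _ setT) => //; exact: RintegrableZ.
- apply: (@leb_integrableS _ _ setT) => //; exact: integrable_indic_itv.
Qed.

(** Jordan decomposition: the variation function [T] and the difference [T - f] are both
    nondecreasing and absolutely continuous. *)
Lemma real_ac_density a b f : a < b -> real_ac a b f ->
  exists h : R -> R, leb.-integrable setT (EFin \o h) /\
    forall x y, a <= x -> x <= y -> y <= b -> f y - f x = \int[leb]_(t in `]x, y]) h t.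
Proof.
move=> ab acf; have abw := ltW ab; have bvf := real_ac_BV abw acf.
pose T x := fine (total_variation a (clip a b x) f).
have fT p q : a <= p -> p <= q -> q <= b -> total_variation p q f \is a fin_num.
  move=> ap pq qb; apply/bounded_variationP => //.
  by apply: (bounded_variationr ap) => //; apply: bounded_variationl bvf => //; exact: le_trans pq.
have clip_out : (forall x, x <= a -> clip a b x = clip a b a) /\
    (forall x, b <= x -> clip a b x = clip a b b).
  split=> x xab; rewrite /clip.
    by rewrite (min_idPl (le_trans xab abw)) (min_idPl abw) (max_idPl xab) maxxx.
  by rewrite (min_idPr xab) minxx.
have TB x y : x <= y -> T y - T x = fine (total_variation (clip a b x) (clip a b y) f).
  move=> xy; have /andP[x1 x2] := clip_itv x abw; have /andP[y1 y2] := clip_itv y abw.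
  have cxy := clip_homo a b xy.
  by rewrite /T (total_variationD f x1 cxy) fineD ?fT// addrC addKr.
have acT : global_ac T := global_ac_TV_clip abw acf.
have acfc := global_ac_clip abw acf.
have [||||h1 [ih1 h1E]] := @monotone_density a b T ab.
- by move=> x y xy; rewrite -subr_ge0 TB// fine_ge0// total_variation_ge0// clip_homo.
- exact: acT.
- by move=> x xa; rewrite /T clip_out.1.
- by move=> x bx; rewrite /T clip_out.2.
have [||||h2 [ih2 h2E]] := @monotone_density a b (fun x => T x + (-1) * f (clip a b x)) ab.
- move=> x y xy; rewrite -subr_ge0.
  have := TB _ _ xy; have cxy := clip_homo a b xy.
  have /andP[x1 x2] := clip_itv x abw; have /andP[y1 y2] := clip_itv y abw.
  have := total_variation_ge f cxy; rewrite -[X in (_ <= X)%E]fineK ?fT// lee_fin.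
  by move=> + TE; rewrite -TE; have := ler_norm (f (clip a b y) - f (clip a b x)); lra.
- by apply: global_acD => //; exact: (global_acZ (-1) acfc).
- by move=> x xa; rewrite /T clip_out.1.
- by move=> x bx; rewrite /T clip_out.2.
exists (fun t => h1 t - h2 t); split; first exact: RintegrableB.
move=> x y ax xy yb.
rewrite RintegralB//; [|by apply: (@leb_integrableS _ _ setT)..].
rewrite -h1E// -h2E// !clip_id ?ax ?yb ?(le_trans ax xy) ?(le_trans xy yb)//; ring.
Qed.

(** By Lebesgue's differentiation theorem the density of [real_ac_density] equals the derivative of
    [f] almost everywhere, and may be replaced by it. *)
Lemma real_ac_ftc a b f : a < b -> real_ac a b f ->
  [/\ {ae leb, forall x, a < x < b -> derivable f x 1},
      leb.-integrable `]a, b[ (EFin \o (derive1 f)) &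
      forall x y, a <= x -> x <= y -> y <= b -> f y - f x = \int[leb]_(t in `]x, y[) (derive1 f) t].
Proof.
move=> ab acf; have [h [ih hE]] := real_ac_density ab acf.
pose F x := \int[leb]_(t in `]a, x]) h t.
have FE x : a <= x -> x <= b -> f x = f a + F x.
  by move=> ax xb; rewrite /F -hE// addrC subrK.
have lih : locally_integrable setT h 
  by apply: open_integrable_locally => //; exact: openT.
have dfF x : a < x < b -> derivable F x 1 /\ derive1 F x = h x ->
    derivable f x 1 /\ derive1 f x = h x.
  move=> xab [dFx F'x].
  have fF : {near x, (fun y => f a + F y) =1 f}.
    have := @near_in_itvoo _ a b x; rewrite in_itv/= => /(_ xab).
    by apply: filterS => y; rewrite in_itv/= => /andP[ay yb]; rewrite -FE ?ltW.
  have iF : is_derive x 1 F (h x) by apply: DeriveDef; [exact: dFx|rewrite -derive1E].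
  have iF' : is_derive x 1 (fun y => f a + F y) (0 + h x).
    by apply: is_deriveD; exact: is_derive_cst.
  split; first by apply: near_eq_derivable fF _; case: iF'.
  by rewrite derive1E -(near_eq_derive _ fF); case: iF' => _ ->; rewrite add0r.
have dF : {ae leb, forall x, a < x < b -> derivable f x 1 /\ derive1 f x = h x}.
  have := @FTC1 R h (BRight a) _ lih.
  move=> /(_ (fun y => @leb_integrableS _ _ _ _ (measurable_itv _) measurableT (@subsetT _ _) ih)).
  by apply: ae_imply => x H xab; apply: dfF => //; apply: H; case/andP: xab.
(* [measurable_derive1] asks for continuity on the line; near each interior point [f] coincides with
   the continuous function [f \o clip a b]. *)
have mdf : measurable_fun `]a, b[ (derive1 f).
  have cf := global_ac_continuous (global_ac_clip (ltW ab) acf).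
  apply: (eq_measurable_fun (derive1 (f \o clip a b))); last first.
    by apply: measurable_funTS; exact: measurable_derive1.
  move=> x; rewrite inE/= => xab; rewrite !derive1E; apply: near_eq_derive.
  have := near_in_itvoo xab; apply: filterS => y; rewrite in_itv/= => /andP[ay yb].
  by rewrite /= clip_id// !ltW.
have hdf : {ae leb, forall x, `]a, b[%classic x -> derive1 f x = h x}.
  by apply: ae_imply dF => x dfx /=; rewrite in_itv/= => /dfx[_ ->].
have ihab : leb.-integrable `]a, b[ (EFin \o h) by apply: (@leb_integrableS _ _ setT).
split.
- by apply: ae_imply dF => x dfx /dfx[].
- by apply: ae_Rintegrable hdf ihab; [exact: measurable_itv|exact: mdf].
- move=> x y ax xy yb.
  have sab : `]x, y[%classic `<=` `]a, b[%classic.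
    by apply: subset_itv; rewrite bnd_simp.
  rewrite hE// -Rintegral_itv_bndo_bndc; last exact: (@leb_integrableS _ _ setT).
  apply: ae_Rintegral.
  + exact: measurable_itv.
  + have /integrableP[mh _] := ih; apply/measurable_EFinP.
    exact: (measurable_funTS mh).
  + exact: (measurable_funS _ sab mdf).
  + by apply: ae_imply hdf => t dft /sab /dft ->.
Qed.

End absolutely_continuous_ftc.

(** * Complex numbers and integrals *)

Section complex_lemmas.
Context (R : realType).
Implicit Types (x y z : R[i]) (a b t : R).

Lemma complex_eq x y : Re x = Re y -> Im x = Im y -> x = y.
Proof. by case: x y => [a b] [c d] /= -> ->. Qed.

Lemma ReD x y : Re (x + y) = Re x + Re y. Proof. by case: x y => ? ? [? ?]. Qed.
Lemma ImD x y : Im (x + y) = Im x + Im y. Proof. by case: x y => ? ? [? ?]. Qed.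
Lemma ReN x : Re (- x) = - Re x. Proof. by case: x. Qed.
Lemma ImN x : Im (- x) = - Im x. Proof. by case: x. Qed.
Lemma ReB x y : Re (x - y) = Re x - Re y. Proof. by rewrite ReD ReN. Qed.
Lemma ImB x y : Im (x - y) = Im x - Im y. Proof. by rewrite ImD ImN. Qed.
Lemma ReM x y : Re (x * y) = Re x * Re y - Im x * Im y.
Proof. by case: x y => ? ? [? ?]. Qed.
Lemma ImM x y : Im (x * y) = Re x * Im y + Im x * Re y.
Proof. by case: x y => ? ? [? ?]. Qed.
Lemma ReJ x : Re (conjc x) = Re x. Proof. by case: x. Qed.
Lemma ImJ x : Im (conjc x) = - Im x. Proof. by case: x. Qed.
Lemma Re_real a : Re a%:C = a. Proof. by []. Qed.
Lemma Im_real a : Im a%:C = 0. Proof. by []. Qed.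
Lemma Re0 : Re (0 : R[i]) = 0. Proof. by []. Qed.
Lemma Im0 : Im (0 : R[i]) = 0. Proof. by []. Qed.
Lemma Re1 : Re (1 : R[i]) = 1. Proof. by []. Qed.
Lemma Im1 : Im (1 : R[i]) = 0. Proof. by []. Qed.

Lemma real_complexD a b : (a + b)%:C = a%:C + b%:C.
Proof. exact: (rmorphD (real_complex R)). Qed.
Lemma real_complexB a b : (a - b)%:C = a%:C - b%:C.
Proof. exact: (rmorphB (real_complex R)). Qed.
Lemma real_complexN a : (- a)%:C = - a%:C.
Proof. exact: (rmorphN (real_complex R)). Qed.
Lemma real_complexM a b : (a * b)%:C = a%:C * b%:C.
Proof. exact: (rmorphM (real_complex R)). Qed.
Lemma real_complexV a : (a^-1)%:C = a%:C^-1.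
Proof. exact: (fmorphV (real_complex R)). Qed.
Lemma real_complexX a n : (a ^+ n)%:C = a%:C ^+ n.
Proof. exact: (rmorphXn (real_complex R)). Qed.
Lemma real_complex_nat n : (n%:R)%:C = n%:R :> R[i].
Proof. exact: (rmorph_nat (real_complex R)). Qed.
Lemma real_complex_sum I (s : seq I) (F : I -> R) :
  (\sum_(i <- s) F i)%:C = \sum_(i <- s) (F i)%:C :> R[i].
Proof. exact: (rmorph_sum (real_complex R)). Qed.

Lemma Re_sum I (s : seq I) (F : I -> R[i]) : Re (\sum_(i <- s) F i) = \sum_(i <- s) Re (F i).
Proof. by apply: (big_morph (@complex.Re R) ReD). Qed.
Lemma Im_sum I (s : seq I) (F : I -> R[i]) : Im (\sum_(i <- s) F i) = \sum_(i <- s) Im (F i).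
Proof. by apply: (big_morph (@complex.Im R) ImD). Qed.

Lemma conjcD x y : (conjc (x + y)) = (conjc x) + (conjc y). Proof. exact: (rmorphD (@conjc R)). Qed.
Lemma conjcB x y : (conjc (x - y)) = (conjc x) - (conjc y). Proof. exact: (rmorphB (@conjc R)). Qed.
Lemma conjcM x y : (conjc (x * y)) = (conjc x) * (conjc y). Proof. exact: (rmorphM (@conjc R)). Qed.
Lemma conjcX x n : (conjc (x ^+ n)) = (conjc x) ^+ n. Proof. exact: (rmorphXn (@conjc R)). Qed.
Lemma conjc_sum I (s : seq I) (F : I -> R[i]) :
  (conjc (\sum_(i <- s) F i)) = \sum_(i <- s) (conjc (F i)).
Proof. exact: (rmorph_sum (@conjc R)). Qed.

Lemma modulusE z : modulus z = Num.sqrt (Re z ^+ 2 + Im z ^+ 2).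
Proof. by case: z. Qed.
Lemma modulus_ge0 z : 0 <= modulus z. Proof. by rewrite modulusE sqrtr_ge0. Qed.
Lemma modulus2 z : modulus z ^+ 2 = Re z ^+ 2 + Im z ^+ 2.
Proof. by rewrite modulusE sqr_sqrtr// addr_ge0// sqr_ge0. Qed.
Lemma modulus0 : modulus (0 : R[i]) = 0. Proof. exact: ComplexField.Normc.normc0. Qed.
Lemma modulus1 : modulus (1 : R[i]) = 1. Proof. exact: ComplexField.Normc.normc1. Qed.
Lemma modulusM x y : modulus (x * y) = modulus x * modulus y.
Proof. exact: ComplexField.Normc.normcM. Qed.
Lemma modulusV x : modulus x^-1 = (modulus x)^-1.
Proof. exact: ComplexField.Normc.normcV. Qed.
Lemma modulusX x n : modulus (x ^+ n) = modulus x ^+ n.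
Proof. by elim: n => [|n IH]; rewrite ?expr0 ?modulus1// !exprS modulusM IH. Qed.
Lemma modulusD x y : modulus (x + y) <= modulus x + modulus y.
Proof. exact: le_normcD. Qed.
Lemma modulusN x : modulus (- x) = modulus x.
Proof. exact: normcN. Qed.
Lemma modulusB x y : modulus (x - y) <= modulus x + modulus y.
Proof. by rewrite (le_trans (modulusD _ _))// modulusN. Qed.
Lemma modulusBC x y : modulus (x - y) = modulus (y - x).
Proof. by rewrite -modulusN opprB. Qed.
Lemma modulusJ x : modulus (conjc x) = modulus x.
Proof. by rewrite !modulusE ReJ ImJ sqrrN. Qed.
Lemma modulus_real a : modulus a%:C = `|a|.
Proof. by rewrite modulusE/= expr0n addr0 sqrtr_sqr. Qed.
Lemma modulus_eq0 z : (modulus z == 0) = (z == 0).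
Proof.
apply/eqP/eqP => [/ComplexField.Normc.eq0_normc//|->]; exact: modulus0.
Qed.
Lemma modulus_gt0 z : (0 < modulus z) = (z != 0).
Proof. by rewrite lt_neqAle modulus_ge0 andbT eq_sym modulus_eq0. Qed.
Lemma modulus_sum I (s : seq I) (F : I -> R[i]) :
  modulus (\sum_(i <- s) F i) <= \sum_(i <- s) modulus (F i).
Proof.
elim: s => [|i s IH]; first by rewrite !big_nil modulus0.
by rewrite !big_cons (le_trans (modulusD _ _))// lerD2l.
Qed.
Lemma Re_le_modulus z : `|Re z| <= modulus z.
Proof. by rewrite modulusE -sqrtr_sqr ler_wsqrtr// lerDl sqr_ge0. Qed.
Lemma Im_le_modulus z : `|Im z| <= modulus z.
Proof. by rewrite modulusE -sqrtr_sqr ler_wsqrtr// lerDr sqr_ge0. Qed.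
Lemma modulus_le_ReIm z : modulus z <= `|Re z| + `|Im z|.
Proof.
rewrite -[leRHS]ger0_norm ?addr_ge0// -sqrtr_sqr modulusE ler_wsqrtr//.
rewrite sqrrD !real_normK ?num_real// addrAC lerDl.
by rewrite mulrn_wge0// mulr_ge0.
Qed.
Lemma mulcJ z : z * (conjc z) = (modulus z ^+ 2)%:C.
Proof. by apply: complex_eq; rewrite ?ReM ?ImM ReJ ImJ /= ?modulus2; ring. Qed.

Lemma expiD (s t : R) : expi (s + t) = expi s * expi t.
Proof. by apply: complex_eq; rewrite ?ReM ?ImM /= ?cosD ?sinD//; ring. Qed.
Lemma expi0 : expi (0 : R) = 1. Proof. by rewrite /expi cos0 sin0. Qed.
Lemma expiN t : expi (- t) = (conjc (expi t)).
Proof. by rewrite /expi cosN sinN. Qed.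
Lemma modulus_expi t : modulus (expi t) = 1.
Proof. by rewrite modulusE/= cos2Dsin2 sqrtr1. Qed.
Lemma expi_neq0 t : expi t != 0.
Proof. by rewrite -modulus_eq0 modulus_expi oner_eq0. Qed.
Lemma expiV t : (expi t)^-1 = expi (- t).
Proof.
apply: (mulfI (expi_neq0 t)); rewrite mulfV ?expi_neq0// expiN mulcJ.
by rewrite modulus_expi expr1n.
Qed.
Lemma expiX t n : expi t ^+ n = expi (n%:R * t).
Proof.
elim: n => [|n IH]; first by rewrite expr0 mul0r expi0.
by rewrite exprS IH -expiD -natr1 mulrDl mul1r addrC.
Qed.
Lemma expiz t (k : int) : expi t ^ k = expi (k%:~R * t).
Proof.
case: k => n; first by rewrite -exprnP expiX.
by rewrite NegzE -exprnN expiX expiV mulrNz mulNr.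
Qed.
Lemma expi_2pi : expi (2 * pi) = 1 :> R[i].
Proof.
rewrite mulr_natl mulr2n expiD /expi cospi sinpi.
by apply: complex_eq; rewrite ?ReM ?ImM /=; ring.
Qed.
Lemma expi_periodic t : expi (t + 2 * pi) = expi t.
Proof. by rewrite expiD expi_2pi mulr1. Qed.
End complex_lemmas.

Definition reimE := (ReD, ImD, ReN, ImN, ReM, ImM, ReJ, ImJ, Re_real, Im_real,
  Re0, Im0, Re1, Im1).

(** * Integrals of complex-valued functions *)

Section complex_integral.
Context d (T : measurableType d) (R : realType).
Context (mu : {measure set T -> \bar R}) (D : set T) (mD : measurable D).
Implicit Types (f g : T -> R[i]) (c : R[i]).
Local Notation intble f := (mu.-integrable D (EFin \o f)).

Definition cintegrable f :=
  intble (fun x => Re (f x)) /\ intble (fun x => Im (f x)).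

Lemma cintegrableD f g : cintegrable f -> cintegrable g ->
  cintegrable (fun x => f x + g x).
Proof.
move=> [f1 f2] [g1 g2]; split.
  by under eq_fun do rewrite ReD; exact: RintegrableD.
by under eq_fun do rewrite ImD; exact: RintegrableD.
Qed.

Lemma cintegrableZ c f : cintegrable f -> cintegrable (fun x => c * f x).
Proof.
move=> [f1 f2]; split.
  under eq_fun do rewrite ReM.
  by apply: RintegrableB => //; exact: RintegrableZ.
under eq_fun do rewrite ImM.
by apply: RintegrableD => //; exact: RintegrableZ.
Qed.

Lemma cintegrableN f : cintegrable f -> cintegrable (fun x => - f x).
Proof.
move=> fi; have := cintegrableZ (-1) fi.
by under eq_fun do rewrite mulN1r.
Qed.

Lemma cintegrable_sum (I : Type) (s : seq I) (F : I -> T -> R[i]) :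
  (forall i, cintegrable (F i)) -> cintegrable (fun x => \sum_(i <- s) F i x).
Proof.
move=> Fi; split.
  by under eq_fun do rewrite Re_sum; apply: Rintegrable_sum => // i; case: (Fi i).
by under eq_fun do rewrite Im_sum; apply: Rintegrable_sum => // i; case: (Fi i).
Qed.

Lemma cintegralD f g : cintegrable f -> cintegrable g ->
  cintegral mu D (fun x => f x + g x) = cintegral mu D f + cintegral mu D g.
Proof.
move=> [f1 f2] [g1 g2]; apply: complex_eq => /=.
  by under eq_Rintegral do rewrite ReD; rewrite RintegralD.
by under eq_Rintegral do rewrite ImD; rewrite RintegralD.
Qed.

Lemma cintegralZ c f : cintegrable f ->
  cintegral mu D (fun x => c * f x) = c * cintegral mu D f.
Proof.
move=> [f1 f2]; apply: complex_eq => /=.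
  under eq_Rintegral do rewrite ReM.
  by rewrite RintegralB ?RintegralZl// ?ReM//; exact: RintegrableZ.
under eq_Rintegral do rewrite ImM.
by rewrite RintegralD ?RintegralZl// ?ImM//; exact: RintegrableZ.
Qed.

Lemma cintegralJ f : cintegrable f ->
  cintegral mu D (fun x => (conjc (f x))) = (conjc (cintegral mu D f)).
Proof.
move=> [f1 f2]; apply: complex_eq; rewrite ?ReJ ?ImJ /=.
  by under eq_Rintegral do rewrite ReJ.
under eq_Rintegral do rewrite ImJ -mulN1r.
by rewrite RintegralZl// mulN1r.
Qed.

Lemma cintegral_sum (I : Type) (s : seq I) (F : I -> T -> R[i]) :
  (forall i, cintegrable (F i)) ->
  cintegral mu D (fun x => \sum_(i <- s) F i x) = \sum_(i <- s) cintegral mu D (F i).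
Proof.
move=> Fi; apply: complex_eq; rewrite ?Re_sum ?Im_sum /=.
  by under eq_Rintegral do rewrite Re_sum; rewrite Rintegral_sum// => i; case: (Fi i).
by under eq_Rintegral do rewrite Im_sum; rewrite Rintegral_sum// => i; case: (Fi i).
Qed.

Lemma cintegral_real (f : T -> R) :
  cintegral mu D (fun x => (f x)%:C) = (\int[mu]_(x in D) f x)%:C.
Proof.
apply: complex_eq => //=.
by rewrite /Rintegral (@eq_integral _ _ _ _ _ (cst 0%E))// integral_cst// mul0e.
Qed.

Lemma eq_cintegral f g : {in D, f =1 g} -> cintegral mu D f = cintegral mu D g.
Proof.
by move=> fg; apply: complex_eq => /=; apply: eq_Rintegral => x xD; rewrite fg.
Qed.

Definition cmeasurable f := measurable_fun D (fun x => Re (f x)) /\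
  measurable_fun D (fun x => Im (f x)).

Lemma cintegrable_measurable f : cintegrable f -> cmeasurable f.
Proof.
by move=> [/integrableP[/measurable_EFinP f1 _] /integrableP[/measurable_EFinP f2 _]].
Qed.

Lemma measurable_modulus f : cmeasurable f ->
  measurable_fun D (fun x => modulus (f x)).
Proof.
move=> [f1 f2]; under eq_fun do rewrite modulusE.
apply: (measurableT_comp (continuous_measurable_fun (@sqrt_continuous R))).
by apply: measurable_funD; exact: measurable_funX.
Qed.

Lemma cintegrable_le f (g : T -> R) : cmeasurable f -> intble g ->
  (forall x, D x -> modulus (f x) <= g x) -> cintegrable f.
Proof.
move=> [f1 f2] gi fg; split; apply: Rintegrable_le gi _ => // x Dx.
  by rewrite (le_trans (Re_le_modulus _))// fg.
by rewrite (le_trans (Im_le_modulus _))// fg.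
Qed.

Lemma integrable_modulus f : cintegrable f -> intble (fun x => modulus (f x)).
Proof.
move=> fi; have [f1 f2] := fi.
apply: (@Rintegrable_le _ _ _ _ _ mD _ (fun x => `|Re (f x)| + `|Im (f x)|)).
- exact/measurable_modulus/cintegrable_measurable.
- by apply: RintegrableD => //; exact: integrable_norm.
- by move=> x Dx; rewrite ger0_norm ?modulus_ge0// modulus_le_ReIm.
Qed.

(** Multiplying [f] by the unimodular constant [c] that rotates its integral onto the positive axis
    reduces the claim to real parts. *)
Lemma modulus_cintegral_le f : cintegrable f ->
  modulus (cintegral mu D f) <= \int[mu]_(x in D) modulus (f x).
Proof.
move=> fi; have mi := integrable_modulus fi.
set J := cintegral mu D f.
have [J0|J0] := eqVneq J 0.
  by rewrite J0 modulus0; apply: Rintegral_ge0 => x _; exact: modulus_ge0.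
have mJ : 0 < modulus J by rewrite modulus_gt0.
have E : (modulus J)%:C = cintegral mu D (fun x => ((modulus J)^-1%:C * (conjc J)) * f x).
  rewrite cintegralZ// -/J -mulrA [(conjc _) * _]mulrC mulcJ -real_complexM.
  by congr (_%:C); rewrite expr2 mulrA mulVf ?mul1r// gt_eqF.
have [c Ec] : exists c, c = (modulus J)^-1%:C * conjc J by eexists.
have c1 : modulus c = 1.
  rewrite Ec modulusM modulusJ modulus_real ger0_norm ?invr_ge0 ?modulus_ge0//.
  by rewrite mulVf// gt_eqF.
have -> : modulus J = Re (modulus J)%:C by [].
rewrite E -Ec; apply: le_Rintegral => //; first by have [] := cintegrableZ c fi.
move=> x Dx; apply: le_trans (ler_norm _) _; apply: le_trans (Re_le_modulus _) _.
by rewrite modulusM c1 mul1r.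
Qed.

End complex_integral.

(** The norm of [R[i]^o] takes its values in [R[i]], where a positive element is a positive real;
    this permits the passage to real radii. *)
Lemma continuous_onP (R : realType) (A : set R[i]) (f : R[i] -> R[i]) :
  continuous_on A f <-> forall z, A z -> forall e : R, 0 < e ->
    exists2 d : R, 0 < d & forall w, A w -> modulus (w - z) < d ->
      modulus (f w - f z) < e.
Proof.
have normE (z : R[i]) : `|z| = (modulus z)%:C by rewrite modulusE normc_def.
split.
  move=> cf z Az e e0.
  have /subspace_continuousP/(_ z Az) := cf.
  move=> /(@cvgrPdist_lt _ R[i]^o)/(_ e%:C).
  rewrite ltcR => /(_ e0).
  rewrite /= near_withinE => -[d /= d0 H].
  have [dr dE] : exists2 dr, d = dr%:C & 0 < dr.
    case: d d0 {H} => a b; rewrite ltcE /= => /andP[/eqP -> a0]; by exists a.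
  exists dr => // w Aw wz.
  have := H w; rewrite /= => /(_ _ Aw).
  rewrite !normE dE !ltcR => Hw.
  by rewrite modulusBC Hw// modulusBC.
move=> H; apply/subspace_continuousP => z Az.
apply/(@cvgrPdist_lt _ R[i]^o) => e e0.
have [er eE er0] : exists2 er, e = er%:C & 0 < er.
  by case: e e0 => a b; rewrite ltcE /= => /andP[/eqP -> a0]; exists a.
have [d d0 Hd] := H z Az er er0.
rewrite /= near_withinE; exists d%:C; first by rewrite /= ltcR.
move=> w /=; rewrite !normE ltcR eE ltcR => zw Aw.
by rewrite modulusBC Hd// modulusBC.
Qed.

(** * Continuity and measurability on the plane *)

Section plane.
Context (R : realType).
Implicit Types (F : R * R -> R) (p q : R * R).

Lemma plane_continuousP F : continuous F <->
  forall p (e : R), 0 < e -> exists2 d : R, 0 < d & forall q,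
    `|q.1 - p.1| < d -> `|q.2 - p.2| < d -> `|F q - F p| < e.
Proof.
split=> [cF p e e0|H p].
  have /cvgrPdist_lt/(_ _ e0) := cF p.
  move=> /nbhs_ballP[d /= d0 Hd]; exists d => // q q1 q2.
  rewrite distrC; apply: Hd; split => /=; rewrite -ball_normE /= distrC//.
apply/cvgrPdist_lt => e e0; have [d d0 Hd] := H p _ e0.
exists (ball p.1 d, ball p.2 d); first by split; exact: nbhsx_ballx.
move=> q [/= q1 q2]; rewrite distrC; apply: Hd.
  by move: q1; rewrite -ball_normE /= distrC.
by move: q2; rewrite -ball_normE /= distrC.
Qed.

(** An open set is the union of the countably many boxes with rational centre and radius
    [1 / (n + 1)] that it contains. *)
Lemma open_plane_measurable (U : set (R * R)) : open U -> measurable U.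
Proof.
move=> oU.
pose box (a b : R) (n : nat) : set (R * R) := ball a n.+1%:R^-1 `*` ball b n.+1%:R^-1.
have mbox a b n : measurable (box a b n).
  by apply: measurableX; exact: measurable_ball.
have -> : U = \bigcup_(a : rat) \bigcup_(b : rat) \bigcup_(n : nat)
    (if `[< box (ratr a) (ratr b) n `<=` U >] then box (ratr a) (ratr b) n else set0).
  apply/seteqP; split=> p; last first.
    by move=> [a _ [b _ [n _]]]; case: asboolP => // H /H.
  move=> Up; have /nbhs_ballP[e /= e0 He] : nbhs p U by exact: open_nbhs_nbhs.
  pose n := Num.bound (2 / e).
  have n1 : n.+1%:R^-1 < e / 2.
    rewrite -[X in _ < X]invrK invf_div ltf_pV2 ?posrE ?divr_gt0//.
    rewrite (lt_le_trans (archi_boundP _))// ?divr_ge0 ?(ltW e0)//.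
    by rewrite ler_nat.
  have rt (x : R) : exists a : rat, ball x n.+1%:R^-1 (ratr a : R).
    have [||y [xa [a _ aE]]] := @dense_rat R (ball x n.+1%:R^-1).
    - by exists x; exact: ballxx.
    - exact: ball_open.
    - by exists a; rewrite aE.
  have [a pa] := rt p.1; have [b pb] := rt p.2.
  exists a => //; exists b => //; exists n => //.
  case: asboolP => [_|[]]; first by split; exact: ball_sym.
  have tri x y z : ball x n.+1%:R^-1 y -> ball y n.+1%:R^-1 z -> ball x e z.
    move=> xy yz; apply: (le_ball _ (ball_triangle xy yz)).
    by rewrite [leRHS]splitr lerD// ltW.
  by move=> q [/= q1 q2]; apply: He; split => /=; [apply: tri pa q1|apply: tri pb q2].
apply: bigcupT_measurable_rat => a; apply: bigcupT_measurable_rat => b.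
by apply: bigcupT_measurable => n; case: ifP => // _; exact: mbox.
Qed.

Lemma continuous_plane_measurable F : continuous F -> measurable_fun setT F.
Proof.
move=> cF; apply: (measurability _ (RGenOpens.measurableE R)).
move=> /= _ [_ [a [b ->] <-]]; rewrite setTI.
apply: open_plane_measurable; move/continuousP: cF; apply; exact: interval_open.
Qed.
End plane.

Section plane_measure_lemmas.
Context (R : realType).
Local Notation leb := (@lebesgue_measure R).
Local Notation mu2 := (@plane_measure R).

(** The translated measure agrees with Lebesgue measure on half-open intervals, hence everywhere by
    uniqueness. *)
Lemma leb_shift (h : R) (A : set R) : measurable A ->
  leb ((fun x => x + h) @^-1` A) = leb A.
Proof.
move=> mA; apply/esym.
have ms : measurable_fun [set: measurableTypeR R] ((fun x => x + h) : measurableTypeR R -> measurableTypeR R).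
  by apply: measurable_funD => //; exact: measurable_id.
pose pf : {measure set (measurableTypeR R) -> \bar R} := pushforward leb ((fun x => x + h) : measurableTypeR R -> measurableTypeR R).
have := @lebesgue_measure_unique R (pf ms); apply => // _ [[a b]] _ <-.
rewrite /pf /pushforward/=.
transitivity (leb `]a - h, b - h]%classic); last first.
  congr (leb _); apply/seteqP; split=> x /=; by rewrite !in_itv/= ltrBlDr lerBrDr.
rewrite !lebesgue_measure_itv/= !lte_fin ltrD2r.
by case: ifP => // _; congr (_%:E); ring.
Qed.

(** Tonelli's theorem for the indicator of the complement, almost all of whose slices are null. *)
Lemma ae_plane_y (P : set (R * R)) : measurable P ->
  {ae leb, forall y, {ae leb, forall x, P (x, y)}} -> {ae mu2, forall p, P p}.
Proof.
move=> mP H.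
have mN : measurable (~` P) by exact: measurableC.
exists (~` P); split => //.
transitivity (\int[mu2]_p (\1_(~` P) p)%:E)%E; first by rewrite integral_indic// setIT.
rewrite fubini_tonelli2//; last first.
  by apply/measurable_EFinP; exact: measurable_indic.
have m1N : measurable_fun setT (EFin \o (\1_(~` P) : R * R -> R)).
  by apply/measurable_EFinP; exact: measurable_indic.
rewrite (@ae_eq_integral _ _ _ leb setT (cst 0%E)).
- by rewrite integral_cst// mul0e.
- exact: measurableT.
- by apply: measurable_fun_fubini_tonelli_G => //; exact: m1N.
- exact: measurable_cst.
apply: ae_imply H => y Hy _ /=; rewrite /fubini_G.
rewrite (@ae_eq_integral _ _ _ leb setT (cst 0%E)).
- by rewrite integral_cst// mul0e.
- exact: measurableT.
- exact: (measurableT_comp m1N (pair2_measurable y)).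
- exact: measurable_cst.
by apply: ae_imply Hy => x Pxy _ /=; rewrite indicE memNset//= => /(_ Pxy).
Qed.

Lemma ae_plane_x (P : set (R * R)) : measurable P ->
  {ae leb, forall x, {ae leb, forall y, P (x, y)}} -> {ae mu2, forall p, P p}.
Proof.
move=> mP H.
have mN : measurable (~` P) by exact: measurableC.
exists (~` P); split => //.
transitivity (\int[mu2]_p (\1_(~` P) p)%:E)%E; first by rewrite integral_indic// setIT.
have m1N : measurable_fun setT (EFin \o (\1_(~` P) : R * R -> R)).
  by apply/measurable_EFinP; exact: measurable_indic.
rewrite fubini_tonelli1//.
rewrite (@ae_eq_integral _ _ _ leb setT (cst 0%E)).
- by rewrite integral_cst// mul0e.
- exact: measurableT.
- by apply: measurable_fun_fubini_tonelli_F => //; exact: m1N.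
- exact: measurable_cst.
apply: ae_imply H => x Hx _ /=; rewrite /fubini_F.
rewrite (@ae_eq_integral _ _ _ leb setT (cst 0%E)).
- by rewrite integral_cst// mul0e.
- exact: measurableT.
- exact: (measurableT_comp m1N (pair1_measurable x)).
- exact: measurable_cst.
by apply: ae_imply Hx => y Pxy _ /=; rewrite indicE memNset//= => /(_ Pxy).
Qed.
End plane_measure_lemmas.

(** * Sobolev functions on the plane *)

Section partial_derivatives.
Context (R : realType).
Local Notation leb := (@lebesgue_measure R).
Local Notation mu2 := (@plane_measure R).
Implicit Types (F : R * R -> R) (p : R * R).

Definition udisc : set (R * R) := [set p | p.1 ^+ 2 + p.2 ^+ 2 < 1].

Definition px F p := derive1 (fun x => F (x, p.2)) p.1.
Definition py F p := derive1 (fun y => F (p.1, y)) p.2.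

Lemma derivable1E (f : R -> R) (a : R) : derivable f a 1 =
  cvg (h^-1 * (f (h + a) - f (0 + a)) @[h --> 0^']).
Proof.
rewrite /derivable add0r; suff -> : (fun h : R => h^-1 *: (f (h *: 1 + a) - f a)) =
    (fun h => h^-1 * (f (h + a) - f a)) by [].
by apply/funext => h; rewrite [h *: 1]mulr1.
Qed.

Lemma continuous_slice_x F (y : R) : continuous F -> continuous (fun x => F (x, y)).
Proof.
move=> cF x; apply: continuous_comp; last exact: cF.
move=> A [[B C] [/= nB nC] BC]; rewrite /= nbhs_filterE; apply: filterS nB => z Bz.
by apply: BC; split => //=; exact: nbhs_singleton.
Qed.

Lemma continuous_slice_y F (x : R) : continuous F -> continuous (fun y => F (x, y)).
Proof.
move=> cF y; apply: continuous_comp; last exact: cF.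
move=> A [[B C] [/= nB nC] BC]; rewrite /= nbhs_filterE; apply: filterS nC => z Cz.
by apply: BC; split => //=; exact: nbhs_singleton.
Qed.

Let shx (h : R) (p : R * R) : R * R := (h + p.1, p.2).
Let shy (h : R) (p : R * R) : R * R := (p.1, h + p.2).

Let mshx h : measurable_fun setT (shx h).
Proof. by apply: measurable_fun_pair => //; apply: measurable_funD. Qed.

Let mshy h : measurable_fun setT (shy h).
Proof. by apply: measurable_fun_pair => //; apply: measurable_funD. Qed.

Lemma continuous_shift_x F p : continuous F -> continuous (fun h : R => F (shx h p)).
Proof.
move=> cF h; apply: (continuous_comp (f := fun h => h + p.1) (g := fun x => F (x, p.2))).
  by apply: cvgD; [exact: cvg_id|exact: cvg_cst].
exact: continuous_slice_x.
Qed.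

Lemma continuous_shift_y F p : continuous F -> continuous (fun h : R => F (shy h p)).
Proof.
move=> cF h; apply: (continuous_comp (f := fun h => h + p.2) (g := fun x => F (p.1, x))).
  by apply: cvgD; [exact: cvg_id|exact: cvg_cst].
exact: continuous_slice_y.
Qed.

Lemma measurable_px F : continuous F -> measurable_fun setT (px F).
Proof.
move=> cF; have mF := continuous_plane_measurable cF.
rewrite (_ : px F = fun p => lim (h^-1 * (F (shx h p) - F (shx 0 p)) @[h --> 0^'])).
  apply: (@measurable_lim_quotient _ _ _ (fun h p => F (shx h p))) => [h|p].
    exact: measurableT_comp.
  exact: continuous_shift_x.
by apply/funext => p; rewrite /px /shx add0r.
Qed.

Lemma measurable_py F : continuous F -> measurable_fun setT (py F).
Proof.
move=> cF; have mF := continuous_plane_measurable cF.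
rewrite (_ : py F = fun p => lim (h^-1 * (F (shy h p) - F (shy 0 p)) @[h --> 0^'])).
  apply: (@measurable_lim_quotient _ _ _ (fun h p => F (shy h p))) => [h|p].
    exact: measurableT_comp.
  exact: continuous_shift_y.
by apply/funext => p; rewrite /py /shy add0r.
Qed.

Definition derivable_x F p := derivable (fun x => F (x, p.2)) p.1 1.
Definition derivable_y F p := derivable (fun y => F (p.1, y)) p.2 1.

Lemma measurable_derivable_x F : continuous F -> measurable (derivable_x F).
Proof.
move=> cF; have mF := continuous_plane_measurable cF.
rewrite (_ : derivable_x F = [set p | cvg (h^-1 * (F (shx h p) - F (shx 0 p)) @[h --> 0^'])]).
  apply: (@measurable_cvg_quotient _ _ _ (fun h p => F (shx h p))) => [h|p].
    exact: measurableT_comp.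
  exact: continuous_shift_x.
by apply/funext => p; rewrite /derivable_x derivable1E.
Qed.

Lemma measurable_derivable_y F : continuous F -> measurable (derivable_y F).
Proof.
move=> cF; have mF := continuous_plane_measurable cF.
rewrite (_ : derivable_y F = [set p | cvg (h^-1 * (F (shy h p) - F (shy 0 p)) @[h --> 0^'])]).
  apply: (@measurable_cvg_quotient _ _ _ (fun h p => F (shy h p))) => [h|p].
    exact: measurableT_comp.
  exact: continuous_shift_y.
by apply/funext => p; rewrite /derivable_y derivable1E.
Qed.

Lemma measurable_udisc : measurable udisc.
Proof.
rewrite -[udisc]setTI (_ : udisc = (fun p => p.1 ^+ 2 + p.2 ^+ 2) @^-1` `]-oo, 1[%classic).
  have m : measurable_fun setT (fun p : R * R => p.1 ^+ 2 + p.2 ^+ 2).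
    by apply: measurable_funD; apply: measurable_funX; [exact: measurable_fst|exact: measurable_snd].
  by apply: m => //; exact: measurable_itv.
by apply/seteqP; split=> p; rewrite /udisc /= in_itv.
Qed.

(** A single null set of lines serves all segments of the disc, whereas in [ACL] it may depend on
    the rectangle. *)
Definition acl_x F := {ae leb, forall y, forall a b, a < b ->
  (forall x, a <= x <= b -> x ^+ 2 + y ^+ 2 < 1) -> real_ac a b (fun x => F (x, y))}.
Definition acl_y F := {ae leb, forall x, forall a b, a < b ->
  (forall y, a <= y <= b -> x ^+ 2 + y ^+ 2 < 1) -> real_ac a b (fun y => F (x, y))}.

(** The open chord [|x| < s] is exhausted by the countably many closed segments
    [|x| <= s - s / (n + 2)], each with its own null set. *)
Lemma ae_interval_slice (P : R -> Prop) (c : R) :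
  (forall a b, a < b -> (forall x, a <= x <= b -> x ^+ 2 + c ^+ 2 < 1) ->
     {ae leb, forall x, a < x < b -> P x}) ->
  {ae leb, forall x, x ^+ 2 + c ^+ 2 < 1 -> P x}.
Proof.
move=> H.
pose s := Num.sqrt (1 - c ^+ 2).
have [c1|c1] := leP 1 (c ^+ 2).
  by apply: ae_all => x; rewrite ltNge; have := sqr_ge0 x; move: c1; lra.
have s0 : 0 < s by rewrite sqrtr_gt0 subr_gt0.
have s2 : s ^+ 2 = 1 - c ^+ 2 by rewrite sqr_sqrtr// subr_ge0 ltW.
have lts x : x ^+ 2 + c ^+ 2 < 1 -> `|x| < s.
  by move=> xc; rewrite -(ltr_pXn2r (n := 2))// ?nnegrE ?(ltW s0)// real_normK ?num_real// s2; lra.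
have Hn : {ae leb, forall x, forall n : nat, `|x| < s - s / n.+2%:R -> P x}.
  apply/ae_foralln => n.
  have n2 : s / n.+2%:R < s by rewrite ltr_pdivrMr ?ltr_pMr// ltr1n.
  have [||] := H (- (s - s / n.+2%:R)) (s - s / n.+2%:R).
  - by rewrite -subr_gt0 opprK addr_gt0// subr_gt0.
  - move=> x; rewrite -ler_norml => xs.
    have : `|x| < s by rewrite (le_lt_trans xs)// ltrBlDr ltrDl divr_gt0.
    by rewrite -(ltr_pXn2r (n := 2))// ?nnegrE ?(ltW s0)// real_normK ?num_real// s2; lra.
  by move=> N HN; exists N; case: HN => h1 h2 h3; split => // x /= Hx; apply: h3 => /= Hx'; apply: Hx;
    rewrite ltr_norml.
apply: ae_imply Hn => x Hx /lts xs.
have xs0 : 0 < s - `|x| by rewrite subr_gt0.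
apply: (Hx (Num.bound (s / (s - `|x|)))).
rewrite ltrBrDr -ltrBrDl ltr_pdivrMr//.
have := archi_boundP (divr_ge0 (ltW s0) (ltW xs0)).
rewrite ltr_pdivrMr// => B; apply: (lt_le_trans B).
by rewrite mulrC ler_wpM2l ?(ltW xs0)// ler_nat; do 2 apply: leqW.
Qed.

Lemma ae_derivable_x F : continuous F -> acl_x F ->
  {ae mu2, forall p, udisc p -> derivable_x F p}.
Proof.
move=> cF aF.
(* Tonelli's argument needs a measurable property, so the implication is turned into a union of
   measurable sets. *)
suff : {ae mu2, forall p, (~` udisc `|` derivable_x F) p}.
  by apply: ae_imply => p [|//]; rewrite /setC /= => np /np.
apply: ae_plane_y.
  by apply: measurableU; [apply: measurableC; exact: measurable_udisc|exact: measurable_derivable_x].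
apply: ae_imply aF => y Hy.
suff : {ae leb, forall x, x ^+ 2 + y ^+ 2 < 1 -> derivable (fun x => F (x, y)) x 1}.
  apply: ae_imply => x Hx; have [xy|xy] := ltP (x ^+ 2 + y ^+ 2) 1.
    by right; exact: Hx.
  by left; rewrite /udisc /=; apply/negP; rewrite -leNgt.
by apply: ae_interval_slice => a b ab abD; have [] := real_ac_ftc ab (Hy _ _ ab abD).
Qed.

Lemma ae_derivable_y F : continuous F -> acl_y F ->
  {ae mu2, forall p, udisc p -> derivable_y F p}.
Proof.
move=> cF aF.
suff : {ae mu2, forall p, (~` udisc `|` derivable_y F) p}.
  by apply: ae_imply => p [|//]; rewrite /setC /= => np /np.
apply: ae_plane_x.
  by apply: measurableU; [apply: measurableC; exact: measurable_udisc|exact: measurable_derivable_y].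
apply: ae_imply aF => x Hx.
suff : {ae leb, forall y, y ^+ 2 + x ^+ 2 < 1 -> derivable (fun y => F (x, y)) y 1}.
  apply: ae_imply => y Hy; have [xy|xy] := ltP (x ^+ 2 + y ^+ 2) 1.
    by right; apply: Hy; rewrite addrC.
  by left; rewrite /udisc /=; apply/negP; rewrite -leNgt.
apply: ae_interval_slice => a b ab abD; have [] // := real_ac_ftc ab (Hx _ _ ab _).
by move=> y yab; rewrite addrC; exact: abD.
Qed.

End partial_derivatives.

(** * Closure properties of absolute continuity *)

Section real_ac_algebra.
Context (R : realType).
Implicit Types (a b : R) (f g : R -> R) (s : seq (R * R)).

Lemma within_itvP a b s u : ordered_itvs s -> within_itv a b s -> u \in s ->
  (a <= u.1 <= b) && (a <= u.2 <= b).
Proof.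
move=> /andP[/allP os _] /allP ws us.
have /andP[au ub] := ws _ us; have u12 := os _ us.
by rewrite au ub (le_trans u12 ub) (le_trans au u12).
Qed.

(** Common source of the closure properties: sums, products and Lipschitz images all have increments
    of this kind. Dividing by [K + 1] covers the case [K = 0]. *)
Lemma real_ac_dominated a b f g1 g2 (K : R) : 0 <= K ->
  (forall x y, a <= x <= b -> a <= y <= b ->
     `|f y - f x| <= K * (`|g1 y - g1 x| + `|g2 y - g2 x|)) ->
  real_ac a b g1 -> real_ac a b g2 -> real_ac a b f.
Proof.
move=> K0 H ac1 ac2 e e0.
have k0 : 0 < K + 1 by rewrite ltr_wpDl.
have e2 : 0 < e / (K + 1) / 2 by rewrite !divr_gt0.
have [d1 d10 H1] := ac1 _ e2; have [d2 d20 H2] := ac2 _ e2.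
exists (Num.min d1 d2); first by rewrite lt_min d10.
move=> s os ws; rewrite lt_min => /andP[s1 s2].
have := ltrD (H1 _ os ws s1) (H2 _ os ws s2).
rewrite -splitr ltr_pdivlMr// => /(le_lt_trans _); apply.
rewrite mulrC /itvs_variation -big_split/= mulr_sumr big_seq [leRHS]big_seq.
apply: ler_sum => u us.
have /andP[u1 u2] := within_itvP os ws us.
apply: le_trans (H _ _ u1 u2) _.
by rewrite ler_wpM2r ?addr_ge0// lerDl.
Qed.

Lemma real_ac_cst a b (k : R) : real_ac a b (cst k).
Proof.
move=> e e0; exists 1 => // s _ _ _; rewrite /itvs_variation big1// => u _.
by rewrite subrr normr0.
Qed.

Lemma real_ac_id a b : real_ac a b idfun.
Proof.
move=> e e0; exists e => // s /andP[/allP s1 _] _; apply: le_lt_trans.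
rewrite /itvs_variation /itvs_length big_seq [leRHS]big_seq.
by apply: ler_sum => u /s1 u12; rewrite ger0_norm// subr_ge0.
Qed.

Lemma real_acD a b f g : real_ac a b f -> real_ac a b g ->
  real_ac a b (fun x => f x + g x).
Proof.
apply: (@real_ac_dominated _ _ _ _ _ 1) => // x y _ _; rewrite mul1r.
by rewrite opprD addrACA ler_normD.
Qed.

Lemma real_ac_eq a b f g : (forall x, a <= x <= b -> f x = g x) ->
  real_ac a b f -> real_ac a b g.
Proof.
move=> fg acf; apply: (real_ac_dominated ler01 _ acf (real_ac_cst _ _ 0)).
by move=> x y xab yab; rewrite !fg// /cst subrr normr0 addr0 mul1r.
Qed.

Lemma continuous_itv_bounded a b f : {within `[a, b], continuous f} ->
  exists2 K : R, 0 <= K & forall x, a <= x <= b -> `|f x| <= K.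
Proof.
have [ab|ba] := leP a b; last first.
  by move=> _; exists 0 => // x /andP[ax xb]; move: (le_trans ax xb); rewrite leNgt ba.
move=> cf; have cn : {within `[a, b], continuous (fun x => `|f x|)}.
  by move=> x; apply: continuous_comp; [exact: cf|exact: norm_continuous].
have [c cab Hc] := EVT_max ab cn.
by exists `|f c| => // x xab; apply: Hc; rewrite in_itv.
Qed.

Lemma real_acM a b f g :
  {within `[a, b], continuous f} -> {within `[a, b], continuous g} ->
  real_ac a b f -> real_ac a b g -> real_ac a b (fun x => f x * g x).
Proof.
move=> /continuous_itv_bounded[K K0 fK] /continuous_itv_bounded[L L0 gL].
apply: (@real_ac_dominated _ _ _ _ _ (K + L)); first exact: addr_ge0.
move=> x y xab yab.
rewrite (_ : _ - _ = (f y - f x) * g y + f x * (g y - g x)); last ring.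
rewrite (le_trans (ler_normD _ _))// !normrM mulrDr addrC.
have H1 := ler_wpM2r (normr_ge0 (g y - g x)) (fK _ xab).
have H2 := ler_wpM2l (normr_ge0 (f y - f x)) (gL _ yab).
have H3 := mulr_ge0 K0 (normr_ge0 (f y - f x)).
have H4 := mulr_ge0 L0 (normr_ge0 (g y - g x)).
move: H1 H2 H3 H4; lra.
Qed.

Lemma real_ac_sub a b c d f : a <= c -> d <= b -> real_ac a b f -> real_ac c d f.
Proof.
move=> ac db acf e /acf[t t0 H]; exists t => // s os ws; apply: H => //.
by apply: sub_all ws => u /andP[u1 u2]; rewrite (le_trans ac u1) (le_trans u2 db).
Qed.

Lemma real_ac_zero_ext a b c d f : a <= b -> (forall x, x <= a -> f x = 0) ->
  (forall x, b <= x -> f x = 0) -> real_ac a b f -> real_ac c d f.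
Proof.
move=> ab fa fb acf.
have fE x : f x = f (clip a b x).
  have [xa|ax] := leP x a.
    by rewrite /clip (min_idPl (le_trans xa ab)) (max_idPl xa) !fa.
  have [bx|xb] := leP b x; last by rewrite clip_id// (ltW ax) (ltW xb).
  by rewrite /clip (min_idPr bx) (max_idPr ab) !fb.
move=> e e0; have [t t0 H] := global_ac_clip ab acf e0.
exists t => // s os _ ls; apply: le_lt_trans (H s os ls).
by rewrite /itvs_variation; apply: ler_sum => u _; rewrite /= -!fE.
Qed.

Lemma abs_continuous_real_ac a b (g : R -> R[i]) : abs_continuous a b g ->
  real_ac a b (fun x => Re (g x)) /\ real_ac a b (fun x => Im (g x)).
Proof.
move=> acg.
suff H e : 0 < e -> exists2 d : R, 0 < d & forall s, ordered_itvs s ->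
    within_itv a b s -> itvs_length s < d ->
    \sum_(u <- s) modulus (g u.2 - g u.1) < e.
  split=> e /H[d d0 Hd]; exists d => // s os ws ls; apply: le_lt_trans (Hd s os ws ls);
    apply: ler_sum => u _; rewrite -?ReB -?ImB ?Re_le_modulus ?Im_le_modulus//.
move=> /acg[d d0 Hd]; exists d => // s os ws ls.
rewrite (big_nth (0, 0)) big_mkord.
apply: (Hd _ (fun i : 'I_(size s) => (nth (0, 0) s i).1) (fun i : 'I_(size s) => (nth (0, 0) s i).2)).
- move=> i; have iu : nth (0, 0) s i \in s by rewrite mem_nth.
  have /andP[/allP os1 _] := os; have u12 := os1 _ iu.
  by have /andP[/andP[-> _] /andP[_ ->]] := within_itvP os ws iu.
- move=> i j ij; have /andP[_ /(pairwiseP (0, 0)) os2] := os.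
  exact: (os2 i j (ltn_ord i) (ltn_ord j) ij).
- by move: ls; rewrite /itvs_length (big_nth (0, 0)) big_mkord.
Qed.

End real_ac_algebra.

(** * Limits of complex sequences *)

Section complex_sequences.
Context (R : realType).
Implicit Types (u v : nat -> R[i]) (l m : R[i]).

(** Convergence is taken by components, in accordance with the limits in [idx_sum]. *)
Definition ccvg u l : Prop :=
  (Re (u n) @[n --> \oo] --> Re l) /\ (Im (u n) @[n --> \oo] --> Im l).

Lemma ccvg_unique u l m : ccvg u l -> ccvg u m -> l = m.
Proof.
move=> [u1 u2] [v1 v2]; apply: complex_eq.
  by rewrite -(cvg_lim _ u1)// -(cvg_lim _ v1).
by rewrite -(cvg_lim _ u2)// -(cvg_lim _ v2).
Qed.

Lemma ccvg_cst l : ccvg (fun=> l) l.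
Proof. by split; exact: cvg_cst. Qed.

Lemma ccvg_near u v l : (\forall n \near \oo, u n = v n) -> ccvg u l -> ccvg v l.
Proof.
move=> uv [u1 u2]; split; [apply: cvg_trans u1|apply: cvg_trans u2];
  apply: near_eq_cvg; by apply: filterS uv => n ->.
Qed.

Lemma ccvgD u v l m : ccvg u l -> ccvg v m -> ccvg (fun n => u n + v n) (l + m).
Proof.
move=> [u1 u2] [v1 v2]; split; rewrite reimE; under eq_fun do rewrite reimE.
  exact: cvgD.
exact: cvgD.
Qed.

Lemma ccvgM u v l m : ccvg u l -> ccvg v m -> ccvg (fun n => u n * v n) (l * m).
Proof.
move=> [u1 u2] [v1 v2]; split; rewrite reimE; under eq_fun do rewrite reimE.
  by apply: cvgB; exact: cvgM.
by apply: cvgD; exact: cvgM.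
Qed.

Lemma ccvgZ a u l : ccvg u l -> ccvg (fun n => a * u n) (a * l).
Proof. by move=> ul; apply: ccvgM ul; exact: ccvg_cst. Qed.

Lemma ccvgN u l : ccvg u l -> ccvg (fun n => - u n) (- l).
Proof. by move=> ul; have := ccvgZ (-1) ul; under eq_fun do rewrite mulN1r; rewrite mulN1r. Qed.

Lemma ccvgB u v l m : ccvg u l -> ccvg v m -> ccvg (fun n => u n - v n) (l - m).
Proof. by move=> ul vm; apply: ccvgD => //; exact: ccvgN. Qed.

Lemma ccvgJ u l : ccvg u l -> ccvg (fun n => (conjc (u n))) ((conjc l)).
Proof.
move=> [u1 u2]; split; rewrite reimE; under eq_fun do rewrite reimE; first exact: u1.
exact: cvgN.
Qed.

Lemma ccvg_sum (I : Type) (s : seq I) (F : I -> nat -> R[i]) (G : I -> R[i]) :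
  (forall i, ccvg (F i) (G i)) -> ccvg (fun n => \sum_(i <- s) F i n) (\sum_(i <- s) G i).
Proof.
move=> FG; elim: s => [|i s IH].
  by under eq_fun do rewrite big_nil; rewrite big_nil; exact: ccvg_cst.
by under eq_fun do rewrite big_cons; rewrite big_cons; exact: ccvgD.
Qed.

Lemma ccvg_modulus2 u l : ccvg u l -> modulus (u n) ^+ 2 @[n --> \oo] --> modulus l ^+ 2.
Proof.
move=> [u1 u2]; under eq_fun do rewrite modulus2; rewrite modulus2.
by apply: cvgD; rewrite expr2; under eq_fun do rewrite expr2; exact: cvgM.
Qed.

Lemma ccvg_modulus u l : ccvg u l -> modulus (u n) @[n --> \oo] --> modulus l.
Proof.
move=> /ccvg_modulus2 ul.
have E (z : R[i]) : modulus z = Num.sqrt (modulus z ^+ 2) by rewrite sqrtr_sqr ger0_norm ?modulus_ge0.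
rewrite (E l); under eq_fun do rewrite E.
by apply: (cvg_comp _ _ ul); exact: sqrt_continuous.
Qed.

Lemma ccvgP u l : ccvg u l <-> forall e : R, 0 < e -> \forall n \near \oo, modulus (u n - l) < e.
Proof.
split=> [ul e e0|H].
  have := ccvg_modulus (ccvgB ul (ccvg_cst l)); rewrite subrr modulus0.
  by move=> /cvgr0Pnorm_lt/(_ _ e0); apply: filterS => n; rewrite ger0_norm ?modulus_ge0.
split; apply/cvgrPdist_lt => e /H; apply: filterS => n; apply: le_lt_trans; rewrite distrC.
  by have := Re_le_modulus (u n - l); rewrite !reimE.
by have := Im_le_modulus (u n - l); rewrite !reimE.
Qed.

Lemma ccvg_modulus_le u l (K : R) : ccvg u l -> (\forall n \near \oo, modulus (u n) <= K) ->
  modulus l <= K.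
Proof.
move=> /ccvg_modulus ul uK; rewrite -(cvg_lim _ ul)//; apply: limr_le => //.
exact: (cvgP _ ul).
Qed.

Lemma ccvg_cesaro u l : ccvg u l ->
  ccvg (fun n => n.+1%:R^-1 * \sum_(0 <= k < n.+1) u k) l.
Proof.
move=> [u1 u2].
have E n : n.+1%:R^-1 = (n.+1%:R^-1)%:C :> R[i].
  by rewrite real_complexV real_complex_nat.
split; under eq_fun do rewrite E reimE ?Re_sum ?Im_sum ?mul0r ?subr0 ?addr0.
- exact: (cesaro u1).
- exact: (cesaro u2).
Qed.

End complex_sequences.

(** * Passage to the limit under the integral sign *)

Section limits_of_integrals.
Context d (T : measurableType d) (R : realType) (mu : {measure set T -> \bar R}).
Context (D : set T) (mD : measurable D).

(** Fatou's lemma as lower semicontinuity; this form serves directly for the squares in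
    [l2_limit]. *)
Lemma fatou_lt (u : nat -> T -> R) (g : T -> R) (c : \bar R) :
  (forall n, measurable_fun D (u n)) -> measurable_fun D g ->
  (forall n x, D x -> 0 <= u n x) ->
  {ae mu, forall x, D x -> u n x @[n --> \oo] --> g x} ->
  (c < \int[mu]_(x in D) (g x)%:E)%E ->
  \forall n \near \oo, (c < \int[mu]_(x in D) (u n x)%:E)%E.
Proof.
move=> mu_ mg u0 ug cg.
have mE n : measurable_fun D (fun x => (u n x)%:E) by apply/measurable_EFinP; exact: mu_.
have := @fatou _ _ _ mu D mD (fun n x => (u n x)%:E) mE (fun n x Dx => u0 n x Dx).
have <- : (\int[mu]_(x in D) (g x)%:E = \int[mu]_(x in D) limn_einf (fun n => (u n x)%:E))%E.
  apply: ae_eq_integral => //.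
  - exact/measurable_EFinP.
  - rewrite /limn_einf; apply: measurableT_comp => //; apply: measurable_fun_limn_esup => n.
    by apply: measurableT_comp => //; exact: mE.
  - apply: ae_imply ug => x H Dx; rewrite limn_einf_lim; apply/esym/cvg_lim => //.
    by apply: cvg_einfs; apply: cvg_EFin; [exact: nearW|exact: H].
move=> /(lt_le_trans cg); rewrite limn_einf_lim (cvg_lim _ (@cvg_einfs_sup _ _))//.
move=> /ereal_sup_gt[_ [n _ <-]] /lt_le_trans cn.
by exists n => // m /= nm; apply: cn; apply: ereal_inf_lbound; exists m.
Qed.

Lemma fatou_le (u : nat -> T -> R) (g : T -> R) (K : \bar R) :
  (forall n, measurable_fun D (u n)) -> measurable_fun D g ->
  (forall n x, D x -> 0 <= u n x) ->
  {ae mu, forall x, D x -> u n x @[n --> \oo] --> g x} ->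
  (\forall n \near \oo, (\int[mu]_(x in D) (u n x)%:E <= K)%E) ->
  (\int[mu]_(x in D) (g x)%:E <= K)%E.
Proof.
move=> mu_ mg u0 ug uK; rewrite leNgt; apply/negP => /(fatou_lt mu_ mg u0 ug) H.
have [n _ /(_ n (leqnn n))[]] : \forall n \near \oo, (\int[mu]_(x in D) (u n x)%:E <= K)%E /\
   (K < \int[mu]_(x in D) (u n x)%:E)%E.
  by apply: filterS2 uK H => n *; split.
by move=> /le_lt_trans/[apply]; rewrite ltxx.
Qed.

Lemma integral_EFin (f : T -> R) : mu.-integrable D (EFin \o f) ->
  (\int[mu]_(x in D) (f x)%:E)%E = (\int[mu]_(x in D) f x)%:E.
Proof. by move=> fi; rewrite /Rintegral fineK//; exact: integrable_fin_num. Qed.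

Lemma mul_integrable (f g : T -> R) : measurable_fun D f -> measurable_fun D g ->
  mu.-integrable D (EFin \o (fun x => f x ^+ 2)) ->
  mu.-integrable D (EFin \o (fun x => g x ^+ 2)) ->
  mu.-integrable D (EFin \o (fun x => f x * g x)).
Proof.
move=> mf mg f2 g2; apply: (@Rintegrable_le _ _ _ _ D mD _ (fun x => f x ^+ 2 + g x ^+ 2)).
- exact: measurable_funM.
- exact: RintegrableD.
- move=> x _; rewrite ler_norml; apply/andP; split.
    by have := sqr_ge0 (f x + g x); have := sqr_ge0 (f x); have := sqr_ge0 (g x); nra.
  by have := sqr_ge0 (f x - g x); have := sqr_ge0 (f x); have := sqr_ge0 (g x); nra.
Qed.

(** Weak convergence without compactness: Fatou's lemma for [(fn + s G)^2] and the bound on the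
    norms of [fn] give a lower bound for [s] times the limit of the pairings, and [s = 1], [s = -1]
    give both inequalities. *)
Lemma l2_limit (fn : nat -> T -> R) (f G : T -> R) :
  (forall n, measurable_fun D (fn n)) -> measurable_fun D f -> measurable_fun D G ->
  (forall n, mu.-integrable D (EFin \o (fun x => fn n x ^+ 2))) ->
  mu.-integrable D (EFin \o (fun x => f x ^+ 2)) ->
  mu.-integrable D (EFin \o (fun x => G x ^+ 2)) ->
  (forall n, \int[mu]_(x in D) fn n x ^+ 2 <= \int[mu]_(x in D) f x ^+ 2) ->
  {ae mu, forall x, D x -> fn n x @[n --> \oo] --> f x} ->
  \int[mu]_(x in D) (G x * fn n x) @[n --> \oo] --> \int[mu]_(x in D) (G x * f x).
Proof.
move=> mfn mf mG ifn if2 iG fnf cv.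
have exp_sq s (h : T -> R) : measurable_fun D h -> mu.-integrable D (EFin \o (fun x => h x ^+ 2)) ->
    mu.-integrable D (EFin \o (fun x => (h x + s * G x) ^+ 2)) /\
    \int[mu]_(x in D) (h x + s * G x) ^+ 2 = \int[mu]_(x in D) h x ^+ 2 +
      (2 * s) * \int[mu]_(x in D) (G x * h x) + s ^+ 2 * \int[mu]_(x in D) G x ^+ 2.
  move=> mh ih; have iGh := mul_integrable mG mh iG ih.
  rewrite (_ : (fun x => _) = (fun x => h x ^+ 2 + (2 * s) * (G x * h x) + s ^+ 2 * G x ^+ 2)); last first.
    by apply/funext => x; ring.
  have i1 : mu.-integrable D (EFin \o (fun x => (2 * s) * (G x * h x))) by exact: RintegrableZ.
  have i2 : mu.-integrable D (EFin \o (fun x => s ^+ 2 * G x ^+ 2)) by exact: RintegrableZ.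
  have i3 := RintegrableD mD ih i1.
  split; first exact: RintegrableD.
  by rewrite RintegralD// RintegralD// !RintegralZl.
have key (s e : R) : s ^+ 2 = 1 -> 0 < e -> \forall n \near \oo,
    s * \int[mu]_(x in D) (G x * f x) - e < s * \int[mu]_(x in D) (G x * fn n x).
  move=> s1 e0; have [ig Eg] := exp_sq s f mf if2.
  (* The cross term carries the coefficient [2 * s], so an error [2 * e] in the squares becomes [e]
     in the pairing. *)
  have lt0 : ((\int[mu]_(x in D) (f x + s * G x) ^+ 2 - 2 * e)%:E <
      \int[mu]_(x in D) ((f x + s * G x) ^+ 2)%:E)%E.
    by rewrite integral_EFin// lte_fin; lra.
  have msq (h : T -> R) : measurable_fun D h -> measurable_fun D (fun x => (h x + s * G x) ^+ 2).
    by move=> mh; apply: measurable_funX; apply: measurable_funD => //; exact: measurable_funM.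
  have := @fatou_lt (fun n x => (fn n x + s * G x) ^+ 2) _ _ (fun n => msq _ (mfn n)) (msq _ mf)
    (fun n x _ => sqr_ge0 _) _ lt0.
  have cv2 : {ae mu, forall x, D x -> (fn n x + s * G x) ^+ 2 @[n --> \oo] --> (f x + s * G x) ^+ 2}.
    apply: ae_imply cv => x H Dx; under eq_fun do rewrite expr2; rewrite expr2.
    by apply: cvgM; apply: cvgD; by [exact: H|exact: cvg_cst].
  move=> /(_ cv2); apply: filterS => n.
  have [ign Egn] := exp_sq s (fn n) (mfn n) (ifn n).
  rewrite integral_EFin// lte_fin Eg Egn s1 !mul1r; have := fnf n; lra.
apply/cvgrPdist_lt => e e0.
have k1 := key 1 e (expr1n _ _) e0; have k2 := key (-1) e (etrans (sqrrN 1) (expr1n _ _)) e0.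
apply: filterS2 k1 k2 => n; rewrite !mul1r !mulN1r ltr_norml => h1 h2; apply/andP; split; lra.
Qed.

Lemma cintegral_dct (fn : nat -> T -> R[i]) (f : T -> R[i]) (g : T -> R) :
  (forall n, cmeasurable D (fn n)) -> cmeasurable D f ->
  {ae mu, forall x, D x -> ccvg (fn ^~ x) (f x)} ->
  mu.-integrable D (EFin \o g) ->
  {ae mu, forall x, D x -> forall n, modulus (fn n x) <= g x} ->
  cintegrable mu D f /\ ccvg (fun n => cintegral mu D (fn n)) (cintegral mu D f).
Proof.
move=> mfn mf fnf gi fg.
have part (p : R[i] -> R) : (forall z, `|p z| <= modulus z) ->
    (forall n, measurable_fun D (fun x => p (fn n x))) -> measurable_fun D (fun x => p (f x)) ->
    {ae mu, forall x, D x -> p (fn n x) @[n --> \oo] --> p (f x)} ->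
    mu.-integrable D (EFin \o (fun x => p (f x))) /\
    \int[mu]_(x in D) p (fn n x) @[n --> \oo] --> \int[mu]_(x in D) p (f x).
  move=> pm mpn mp cv.
  have [|||||i1 _ i2] := @dominated_convergence _ _ _ mu D mD (fun n x => (p (fn n x))%:E)
    (fun x => (p (f x))%:E) (EFin \o g).
  - by move=> n; apply/measurable_EFinP; exact: mpn.
  - exact/measurable_EFinP.
  - by apply: ae_imply cv => x H Dx; apply: cvg_EFin; [exact: nearW|exact: H].
  - exact: gi.
  - by apply: ae_imply fg => x H n Dx /=; rewrite lee_fin (le_trans (pm _))// H.
  split => //; apply: fine_cvg.
  by rewrite -integral_EFin.
have [i1 c1] := part (@complex.Re R) (@Re_le_modulus R) (fun n => (mfn n).1) mf.1
  (ae_imply (fun x (H : D x -> ccvg (fn ^~ x) (f x)) Dx => (H Dx).1) fnf).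
have [i2 c2] := part (@complex.Im R) (@Im_le_modulus R) (fun n => (mfn n).2) mf.2
  (ae_imply (fun x (H : D x -> ccvg (fn ^~ x) (f x)) Dx => (H Dx).2) fnf).
by split; split.
Qed.

End limits_of_integrals.

(** * Integration by parts on the line *)

Section one_dimensional.
Context (R : realType).
Local Notation leb := (@lebesgue_measure R).
Implicit Types (f g : R -> R).

Lemma is_derive_derive1 f (x : R) : derivable f x 1 -> is_derive x 1 f (derive1 f x).
Proof. by move=> df; apply: DeriveDef => //; rewrite derive1E. Qed.

Lemma derive1_is_derive f (x l : R) : is_derive x 1 f l -> derive1 f x = l.
Proof. by move=> [_ fl]; rewrite derive1E. Qed.

Lemma derivable_is_derive f (x l : R) : is_derive x 1 f l -> derivable f x 1.
Proof. by case. Qed.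

Lemma derive1M f g (x : R) : derivable f x 1 -> derivable g x 1 ->
  derivable (fun t => f t * g t) x 1 /\
  derive1 (fun t => f t * g t) x = derive1 f x * g x + f x * derive1 g x.
Proof.
move=> /is_derive_derive1 df /is_derive_derive1 dg.
have H := is_deriveM df dg.
split; first exact: (derivable_is_derive H).
rewrite (derive1_is_derive H).
rewrite -[LHS]/(f x * derive1 g x + g x * derive1 f x); ring.
Qed.

Lemma measurable_leb (f : R -> R) : continuous f -> measurable_fun setT f.
Proof. exact: continuous_measurable_fun. Qed.

Lemma Rintegrable_bounded d (T : measurableType d) (mu : {measure set T -> \bar R})
    (D : set T) (f g : T -> R) (K : R) : measurable D ->
  mu.-integrable D (EFin \o f) -> measurable_fun D g -> (forall x, D x -> `|g x| <= K) ->
  mu.-integrable D (EFin \o (fun x => f x * g x)).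
Proof.
move=> mD fi mg gK.
have /integrableP[/measurable_EFinP mf _] := fi.
apply: (@Rintegrable_le _ _ _ mu D mD _ (fun x => K * `|f x|)).
- exact: measurable_funM.
- by apply: RintegrableZ => //; exact: integrable_norm.
- by move=> x Dx; rewrite normrM mulrC ler_wpM2r// gK.
Qed.

(** The product is absolutely continuous and vanishes at -2 and 2, so its derivative has integral 0
    between these points. *)
Lemma integration_by_parts_ac f g : continuous f -> continuous g ->
  (forall x, 1 <= `|x| -> f x = 0) -> (forall x, 1 <= `|x| -> g x = 0) ->
  (forall a b, real_ac a b f) -> (forall a b, real_ac a b g) ->
  [/\ leb.-integrable setT (EFin \o (fun x => derive1 f x * g x)),
      leb.-integrable setT (EFin \o (fun x => f x * derive1 g x)) &
      \int[leb]_x (derive1 f x * g x) = - \int[leb]_x (f x * derive1 g x)].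
Proof.
move=> cf cg f0 g0 acf acg.
have n22 : (-2 : R) < 2 by lra.
have wf : {within `[-2, 2], continuous f} by exact: continuous_subspaceT.
have wg : {within `[-2, 2], continuous g} by exact: continuous_subspaceT.
have [df ilf ftcf] := real_ac_ftc n22 (acf _ _).
have [dg ilg ftcg] := real_ac_ftc n22 (acg _ _).
have [dfg ifg ftcfg] := real_ac_ftc n22 (real_acM wf wg (acf _ _) (acg _ _)).
have [Kf _ bf] := continuous_itv_bounded wf.
have [Kg _ bg] := continuous_itv_bounded wg.
have m22 : measurable (`]-2, 2[%classic : set R) by exact: measurable_itv.
have i1 : leb.-integrable `]-2, 2[ (EFin \o (fun x => derive1 f x * g x)).
  apply: (@Rintegrable_bounded _ _ _ _ _ _ Kg) => //.
    exact: (measurable_funTS (measurable_leb cg)).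
  by move=> x /=; rewrite in_itv/= => /andP[/ltW x1 /ltW x2]; apply: bg; rewrite x1.
have i2 : leb.-integrable `]-2, 2[ (EFin \o (fun x => derive1 g x * f x)).
  apply: (@Rintegrable_bounded _ _ _ _ _ _ Kf) => //.
    exact: (measurable_funTS (measurable_leb cf)).
  by move=> x /=; rewrite in_itv/= => /andP[/ltW x1 /ltW x2]; apply: bf; rewrite x1.
(* Outside []-2, 2[] the undifferentiated factor vanishes, which reduces the integrals over the line
   to this interval. *)
have out (h k : R -> R) : (forall x, 1 <= `|x| -> k x = 0) ->
    (fun x => h x * k x) = (fun x => h x * k x) \_ `]-2, 2[%classic.
  move=> k0; apply/funext => x; rewrite patchE; case: ifPn => // /negP.
  rewrite inE/= in_itv/= => /negP; rewrite -ltr_norml -leNgt => x2.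
  by rewrite k0 ?mulr0// (le_trans _ x2)// ler1n.
split.
  rewrite (out _ _ g0).
  by apply: Rintegrable_restrict; [exact: m22|exact: i1].
  under eq_fun do rewrite mulrC.
  rewrite (out _ _ f0); by apply: Rintegrable_restrict; [exact: m22|exact: i2].
under [X in _ = - X]eq_Rintegral do rewrite mulrC.
rewrite (out _ _ g0) [in RHS](out _ _ f0) -!Rintegral_mkcond.
apply/eqP; rewrite -addr_eq0 -RintegralD//.
have := ftcfg (-2) 2 (lexx _) (ltW n22) (lexx _).
rewrite !f0 ?mul0r ?subr0 ?normrN ?ger0_norm ?ler1n// => /esym/eqP.
move=> /eqP <-; apply/eqP; apply/esym; apply: ae_Rintegral => //.
- by have /integrableP[/measurable_EFinP] := ifg.
- have /integrableP[/measurable_EFinP q1 _] := i1.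
  have /integrableP[/measurable_EFinP q2 _] := i2.
  exact: (measurable_funD q1 q2).
- apply: ae_imply2 df dg => x dfx dgx; rewrite /= in_itv/= => x22.
  by have [_ ->] := derive1M (dfx x22) (dgx x22); rewrite [f x * _]mulrC.
Qed.

End one_dimensional.

Lemma Rintegrable_indic d (T : measurableType d) (R : realType)
    (mu : {measure set T -> \bar R}) (A : set T) : measurable A -> (mu A < +oo)%E ->
  mu.-integrable setT (EFin \o \1_A).
Proof.
move=> mA Afin; apply/integrableP; split.
  by apply/measurable_EFinP; exact: measurable_indic.
rewrite (@eq_integral _ _ _ _ _ (fun x => (\1_A x)%:E)).
  by rewrite integral_indic// setIT.
by move=> x _ /=; rewrite ger0_norm.
Qed.

(** * Vertical translations of the plane *)

Section plane_translation.
Context (R : realType).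
Local Notation leb := (@lebesgue_measure R).
Local Notation mu2 := (@plane_measure R).
Implicit Types (h : R) (f g : R * R -> R).

Local Notation P2 := (measurableTypeR R * measurableTypeR R)%type.

Definition up h (p : R * R) : R * R := (p.1, p.2 + h).

Lemma measurable_up h : measurable_fun setT (up h).
Proof.
apply: measurable_fun_pair; first exact: measurable_fst.
by apply: measurable_funD; [exact: measurable_snd|exact: measurable_cst].
Qed.

Lemma plane_measure_up h (C : set (R * R)) : measurable C ->
  mu2 (up h @^-1` C) = mu2 C.
Proof.
move=> mC.
rewrite /plane_measure /= /product_measure1; apply: eq_integral => x _ /=.
have := @leb_shift R h (xsection C x) (measurable_xsection x mC).
move=> <-; congr (leb _); apply/seteqP; split => y /=; rewrite /xsection /= !inE//.
Qed.

Lemma up_integral_ge0 h (f : R * R -> \bar R) : measurable_fun setT f ->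
  (forall p, 0 <= f p)%E -> (\int[mu2]_p f (up h p) = \int[mu2]_p f p)%E.
Proof.
move=> mf f0.
have mup : @measurable_fun _ _ P2 P2 setT (up h) := measurable_up h.
have := @ge0_integral_pushforward _ _ P2 P2 R (up h) mup mu2 setT f measurableT mf.
rewrite preimage_setT => <-; last by move=> p _; exact: f0.
apply: eq_measure_integral => // A mA _; exact: plane_measure_up.
Qed.

Lemma up_integrable h f : mu2.-integrable setT (EFin \o f) ->
  mu2.-integrable setT (EFin \o (f \o up h)).
Proof.
move=> /integrableP[mf fi]; apply/integrableP; split.
  exact: (measurableT_comp mf (measurable_up h)).
rewrite (@up_integral_ge0 h (fun p => `|(EFin \o f) p|)%E)//.
exact: measurableT_comp.
Qed.

Lemma up_Rintegral h f : mu2.-integrable setT (EFin \o f) ->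
  \int[mu2]_p f (up h p) = \int[mu2]_p f p.
Proof.
move=> fi; have /integrableP[mf _] := fi.
rewrite /Rintegral; congr fine.
have mup : @measurable_fun _ _ P2 P2 setT (up h) := measurable_up h.
have := @integral_pushforward _ _ P2 P2 R (up h) mup mu2 setT (EFin \o f) mf.
rewrite preimage_setT => /(_ (up_integrable h fi) measurableT) <-.
apply: eq_measure_integral => // A mA _; exact: plane_measure_up.
Qed.

Lemma ae_shift h (P : R -> Prop) : {ae leb, forall y, P y} -> {ae leb, forall y, P (y + h)}.
Proof.
move=> [N [mN N0 PN]]; exists ((fun y => y + h) @^-1` N); split.
- have m : measurable_fun [set: R] (fun y => y + h) by exact: measurable_funD.
  by rewrite -[X in measurable X]setTI; exact: m.
- by rewrite leb_shift.
- by move=> y /= Py; apply: PN.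
Qed.

Lemma plane_Rintegral_y (f : R * R -> R) : mu2.-integrable setT (EFin \o f) ->
  (\int[mu2]_p f p)%:E = (\int[leb]_y \int[leb]_x (f (x, y))%:E)%E.
Proof.
move=> fi; rewrite /Rintegral fineK; last exact: integrable_fin_num.
by rewrite -(integral21_prod_meas1 fi).
Qed.

Lemma plane_ae_integrable_y (f : R * R -> R) : mu2.-integrable setT (EFin \o f) ->
  {ae leb, forall y, leb.-integrable setT (EFin \o (fun x => f (x, y)))}.
Proof. by move=> fi; exact: (ae_integrable2 fi). Qed.

Lemma eq_plane_Rintegral_y f g : mu2.-integrable setT (EFin \o f) ->
  mu2.-integrable setT (EFin \o g) ->
  {ae leb, forall y, \int[leb]_x f (x, y) = \int[leb]_x g (x, y)} ->
  \int[mu2]_p f p = \int[mu2]_p g p.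
Proof.
move=> fi gi fg; apply: EFin_inj; rewrite (plane_Rintegral_y fi) (plane_Rintegral_y gi).
apply: ae_eq_integral => //.
- exact: (measurable_fubini_G fi).
- exact: (measurable_fubini_G gi).
- apply: ae_imply2 fg; last first.
    apply: ae_imply2 (plane_ae_integrable_y fi) (plane_ae_integrable_y gi).
    by move=> y fy gy; exact: (conj fy gy).
  move=> y [fy gy] fgy _.
  have H k : leb.-integrable setT (EFin \o k) -> (\int[leb]_x (k x)%:E)%E = (\int[leb]_x k x)%:E.
    by move=> ki; rewrite /Rintegral fineK//; exact: integrable_fin_num.
  by rewrite !H// fgy.
Qed.

End plane_translation.

(** * Compactly supported Sobolev functions *)

Section test_functions.
Context (R : realType).
Local Notation leb := (@lebesgue_measure R).
Local Notation mu2 := (@plane_measure R).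
Local Notation P2 := (measurableTypeR R * measurableTypeR R)%type.
Implicit Types (A B : R * R -> R) (p : R * R).

(** Continuous functions of the Sobolev space W^{1,2} with support in the unit square, described by
    their restrictions to lines. *)
Record test_fun A : Prop := TestFun {
  tf_cont : continuous A;
  tf_supp : forall p, (1 <= `|p.1|) || (1 <= `|p.2|) -> A p = 0;
  tf_bnd : exists K, forall p, `|A p| <= K;
  tf_acx : {ae leb, forall y, forall a b, real_ac a b (fun x => A (x, y))};
  tf_acy : {ae leb, forall x, forall a b, real_ac a b (fun y => A (x, y))};
  tf_px2 : mu2.-integrable setT (EFin \o (fun p => px A p ^+ 2));
  tf_py2 : mu2.-integrable setT (EFin \o (fun p => py A p ^+ 2)) }.

Definition box : set (R * R) := `[-1, 1]%classic `*` `[-1, 1]%classic.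

Lemma measurable_box : measurable box.
Proof. by apply: measurableX; exact: measurable_itv. Qed.

Lemma box_finite : (mu2 box < +oo)%E.
Proof.
have := @product_measure1E _ _ (measurableTypeR R) (measurableTypeR R) R leb leb `[-1, 1]%classic `[-1, 1]%classic (measurable_itv _) (measurable_itv _).
move=> E; apply: (@eq_ind_r _ _ (fun x => (x < +oo)%E) _ _ E).
have L : leb (`[-1, 1]%classic : set R) = (1 - -1)%:E.
  by rewrite lebesgue_measure_itv/= lte_fin ifT// -subr_gt0 opprK addr_gt0.
by rewrite [X in (X * _)%E]L [X in (_ * X)%E]L -EFinM ltry.
Qed.

Lemma px_out A p : test_fun A -> ~ box p -> px A p = 0 /\ py A p = 0.
Proof.
move=> tA nbox.
have : (1 < `|p.1|) || (1 < `|p.2|).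
  apply: contra_notT nbox; rewrite negb_or -!leNgt => /andP[p1 p2].
  by split => /=; rewrite in_itv/= -ler_norml.
have c0 (f : R -> R) x : f = cst 0 -> derive1 f x = 0.
  by move=> ->; rewrite derive1_cst.
have nz (f : R -> R) x : 1 < `|x| -> (forall t, 1 <= `|t| -> f t = 0) -> derive1 f x = 0.
  move=> x1 f0; rewrite derive1E (@near_eq_derive _ _ _ _ (cst 0)) ?derive_cst//.
  have : \forall y \near x, 1 < `|y|.
    by apply: (@cvgr_gt R _ _ (nbhs_filter x) (fun y => `|y|) `|x|) => //; exact: norm_continuous.
  by apply: filterS => y /ltW; exact: f0.
move=> /orP[p1|p2]; split.
- by apply: nz => // t t1; apply: (tf_supp tA); rewrite /= t1.
- apply: c0; apply/funext => y; apply: (tf_supp tA); by rewrite /= (ltW p1).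
- apply: c0; apply/funext => y; apply: (tf_supp tA); by rewrite /= (ltW p2) orbT.
- by apply: nz => // t t1; apply: (tf_supp tA); rewrite /= t1 orbT.
Qed.

(** On the box [|G| <= G^2 + 1], and the box has finite measure. *)
Lemma sq_integrable (G : R * R -> R) : measurable_fun setT G ->
  (forall p, ~ box p -> G p = 0) ->
  mu2.-integrable setT (EFin \o (fun p => G p ^+ 2)) -> mu2.-integrable setT (EFin \o G).
Proof.
move=> mG G0 G2.
apply: (@Rintegrable_le _ P2 _ mu2 setT measurableT G (fun p => G p ^+ 2 + \1_box p)) => //.
- apply: RintegrableD => //.
  exact: (Rintegrable_indic (measurable_box : @measurable _ P2 _) box_finite).
- move=> p _; rewrite indicE.
  have [pb|pb] := pselect (box p); last by rewrite G0// normr0 addr_ge0// sqr_ge0.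
  rewrite mem_set//= -(real_normK (num_real (G p))).
  have := sqr_ge0 (`|G p| - 1); have := normr_ge0 (G p); nra.
Qed.

Lemma tf_px1 A : test_fun A -> mu2.-integrable setT (EFin \o px A).
Proof.
move=> tA; apply: sq_integrable; last exact: (tf_px2 tA).
  by apply: measurable_px; exact: (tf_cont tA).
by move=> p /(px_out tA)[].
Qed.

Lemma tf_px_mul A B h : test_fun A -> test_fun B ->
  mu2.-integrable setT (EFin \o (fun p => px A p * B (up h p))).
Proof.
move=> tA tB; have [K bK] := tf_bnd tB.
apply: (@Rintegrable_bounded _ _ P2 mu2 setT _ _ K) => //; first exact: tf_px1.
  exact: (measurableT_comp (continuous_plane_measurable (tf_cont tB)) (measurable_up h)).
Qed.

Lemma tf_mul_px A B h : test_fun A -> test_fun B ->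
  mu2.-integrable setT (EFin \o (fun p => A p * px B (up h p))).
Proof.
move=> tA tB; have [K bK] := tf_bnd tA.
under eq_fun do rewrite mulrC.
apply: (@Rintegrable_bounded _ _ P2 mu2 setT _ _ K) => //.
  by apply: (@up_integrable _ h (px B)); exact: tf_px1.
exact: (continuous_plane_measurable (tf_cont tA)).
Qed.

(** Integration by parts on almost every horizontal line. The vertical shift of [B] merely moves its
    exceptional lines, which [ae_shift] takes into account. *)
Lemma parts_x A B h : test_fun A -> test_fun B ->
  \int[mu2]_p (px A p * B (up h p)) = - \int[mu2]_p (A p * px B (up h p)).
Proof.
move=> tA tB; rewrite -mulN1r -RintegralZl//; last exact: tf_mul_px.
apply: eq_plane_Rintegral_y; first exact: tf_px_mul.
  by apply: RintegrableZ => //; exact: tf_mul_px.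
apply: ae_imply2 (tf_acx tA) (ae_shift h (tf_acx tB)) => y acA acB.
have [||||||_ iAB ->] := @integration_by_parts_ac R (fun x => A (x, y)) (fun x => B (x, y + h)).
- by apply: continuous_slice_x; exact: tf_cont.
- by apply: continuous_slice_x; exact: tf_cont.
- by move=> x x1; apply: (tf_supp tA); rewrite /= x1.
- by move=> x x1; apply: (tf_supp tB); rewrite /= x1.
- exact: acA.
- exact: acB.
by rewrite RintegralZl// mulN1r.
Qed.

Definition dq h B p : R := h^-1 * (B (up h p) - B p).

Lemma up0 p : up 0 p = p. Proof. by case: p => x y; rewrite /up /= addr0. Qed.

Lemma upNK h p : up (- h) (up h p) = p.
Proof. by case: p => x y; rewrite /up /= addrK. Qed.

Lemma measurable_dq h B : test_fun B -> measurable_fun setT (dq h B).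
Proof.
move=> tB; have mB := continuous_plane_measurable (tf_cont tB).
apply: measurable_funM => //; apply: measurable_funB => //.
exact: (measurableT_comp mB (measurable_up h)).
Qed.

(** The horizontal derivative is moved by [parts_x] and the vertical increment by translation; the
    sign from integration by parts is absorbed into [(- h)^-1]. *)
Lemma parts_dq h A B : test_fun A -> test_fun B ->
  \int[mu2]_p (px A p * dq h B p) = \int[mu2]_p (px B p * dq (- h) A p).
Proof.
move=> tA tB.
have split1 k C E : test_fun C -> test_fun E -> \int[mu2]_p (px C p * dq k E p) =
    k^-1 * (\int[mu2]_p (px C p * E (up k p)) - \int[mu2]_p (px C p * E (up 0 p))).
  move=> tC tE; rewrite -RintegralB//; [|exact: tf_px_mul..].
  rewrite -RintegralZl//; last by apply: RintegrableB => //; exact: tf_px_mul.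
  by apply: eq_Rintegral => p _; rewrite /dq up0 -mulrBr; ring.
rewrite !split1// [in LHS]parts_x// [X in _ * (_ - X)]parts_x//.
have swp k : \int[mu2]_p (A p * px B (up k p)) = \int[mu2]_p (px B p * A (up (- k) p)).
  rewrite -[RHS](@up_Rintegral _ k); last exact: tf_px_mul.
  by apply: eq_Rintegral => p _; rewrite upNK mulrC.
rewrite !swp oppr0 invrN; ring.
Qed.

End test_functions.

(** * Difference quotients and the null Lagrangian *)

Section difference_quotient_bound.
Context (R : realType).
Local Notation leb := (@lebesgue_measure R).
Local Notation mu2 := (@plane_measure R).
Local Notation P2 := (measurableTypeR R * measurableTypeR R)%type.

(** The mean square deviation of [g] from its mean [m] is nonnegative. As [g] is only assumed
    integrable, the right-hand side may be infinite and is an extended real. *)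
Lemma jensen_itv (g : R -> R) (y h : R) : 0 < h -> measurable_fun setT g ->
  leb.-integrable `]y, y + h[ (EFin \o g) ->
  (((h^-1 * \int[leb]_(t in `]y, (y + h)%R[) g t) ^+ 2)%:E <=
    h^-1%:E * \int[leb]_(t in `]y, (y + h)%R[) (g t ^+ 2)%:E)%E.
Proof.
move=> h0 mg ig; set I : set R := `]y, y + h[%classic.
have mI : measurable I by exact: measurable_itv.
have mI' : @measurable _ (measurableTypeR R) I := mI.
have yh : y <= y + h by rewrite lerDl ltW.
have [inf|fin] := eqVneq (\int[leb]_(t in I) (g t ^+ 2)%:E)%E +oo%E.
  by rewrite inf gt0_muley ?leey// lte_fin invr_gt0.
have g20 : (0 <= \int[leb]_(t in I) (g t ^+ 2)%:E)%E.
  by apply: integral_ge0 => t _; rewrite lee_fin sqr_ge0.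
have ig2 : leb.-integrable I (EFin \o (fun t => g t ^+ 2)).
  apply: Rintegrable_ge0 => //; last by rewrite ltey.
  - by apply: measurable_funX; exact: measurable_funTS.
  - by move=> t _; exact: sqr_ge0.
set m := h^-1 * _.
have mE : \int[leb]_(t in I) g t = m * h by rewrite /m mulrC mulrA divff ?mul1r// gt_eqF.
have icst c : leb.-integrable I (EFin \o (fun=> c)).
  apply: Rintegrable_cst => //; rewrite [ltLHS]lebesgue_measure_itv/=.
  by case: ifP => _; rewrite ?ltry// -EFinD ltry.
have : 0 <= \int[leb]_(t in I) (g t ^+ 2 + (- (2 * m) * g t + m ^+ 2)).
  by apply: Rintegral_ge0 => t _; have := sqr_ge0 (g t - m); nra.
have i1 : leb.-integrable I (EFin \o (fun t => - (2 * m) * g t)) by exact: RintegrableZ.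
rewrite RintegralD//; last exact: RintegrableD.
rewrite RintegralD// RintegralZl// mE.
rewrite (_ : \int[leb]_(t in I) m ^+ 2 = m ^+ 2 * h); last first.
  rewrite /I (@Rintegral_cst_itv R (m ^+ 2) y (y + h) false true yh).
  by congr (_ * _); ring.
have <- : (\int[leb]_(t in I) g t ^+ 2)%:E = (\int[leb]_(t in I) (g t ^+ 2)%:E)%E.
  by rewrite /Rintegral fineK//; exact: integrable_fin_num.
rewrite -EFinM lee_fin => H.
rewrite -ler_pdivrMl ?invr_gt0// invrK; move: H; lra.
Qed.

(** By Jensen's inequality the squared quotient is at most the mean of [g ^+ 2] over []y, y + h[];
    by Tonelli's theorem on the strip [S], integrating these means over [y] gives back the integral
    of [g ^+ 2]. *)
Lemma dq_slice (f : R -> R) (h : R) : 0 < h -> continuous f ->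
  (forall a b, real_ac a b f) ->
  (\int[leb]_y ((h^-1 * (f (y + h) - f y)) ^+ 2)%:E <= \int[leb]_y (derive1 f y ^+ 2)%:E)%E.
Proof.
move=> h0 cf acf; set g := derive1 f.
have mg : measurable_fun setT g by exact: measurable_derive1.
have mg2 : measurable_fun setT (EFin \o (fun t => g t ^+ 2)).
  by apply/measurable_EFinP; exact: measurable_funX.
pose S : set P2 := [set p | p.1 < p.2 < p.1 + h].
have mS : measurable S.
  rewrite -[S]setTI (_ : S = (fun p : R * R => p.2 - p.1) @^-1` `]0, h[%classic).
    have m : measurable_fun setT (fun p : R * R => p.2 - p.1).
      by apply: measurable_funB; [exact: measurable_snd|exact: measurable_fst].
    by apply: m => //; exact: measurable_itv.
  by apply/seteqP; split=> p; rewrite /S /= in_itv/= subr_gt0 ltrBlDl.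
pose k (p : P2) : \bar R := (\1_S p * g p.2 ^+ 2)%:E.
have mk : measurable_fun setT k.
  apply/measurable_EFinP; apply: measurable_funM; first exact: measurable_indic.
  by apply: measurable_funX; exact: (measurableT_comp mg measurable_snd).
have k0 p : (0 <= k p)%E by rewrite lee_fin mulr_ge0 ?sqr_ge0.
have inner (y : R) : (\int[leb]_t k (y, t) = \int[leb]_(t in `]y, (y + h)%R[) (g t ^+ 2)%:E)%E.
  rewrite [RHS]integral_mkcond; apply: eq_integral => t _.
  rewrite /k patchE indicE /=; have -> : ((y, t) \in S) = (t \in `]y, (y + h)%R[%classic).
    by apply/idP/idP => /set_mem H; apply/mem_set; move: H; rewrite /S /= in_itv.
  by case: ifP => _; rewrite ?mul1r ?mul0r.
have mF : measurable_fun [set: measurableTypeR R] (fun y => \int[leb]_t k (y, t))%E.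
  have := @measurable_fun_fubini_tonelli_F _ _ (measurableTypeR R) (measurableTypeR R) R leb k mk k0.
  exact.
apply: (@le_trans _ _ (\int[leb]_y (h^-1%:E * \int[leb]_t k (y, t)))%E).
  apply: ge0_le_integral => //.
  - by move=> y _; rewrite lee_fin sqr_ge0.
  - apply/measurable_EFinP; apply: measurable_funX; apply: measurable_funM => //.
    apply: measurable_funB; last exact: measurable_leb.
    by apply: measurable_leb => y; apply: continuous_comp; [apply: cvgD; [exact: cvg_id|exact: cvg_cst]|exact: cf].
  - by apply: measurable_funeM; exact: mF.
  - move=> y _; rewrite inner.
    have yh : y < y + h by rewrite ltrDl.
    have [_ ig ftc] := real_ac_ftc yh (acf _ _).
    by rewrite (ftc y (y + h)) ?(ltW yh)//; exact: jensen_itv.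
rewrite ge0_integralZl//; last 2 first.
- by move=> y _; apply: integral_ge0.
- by rewrite lee_fin invr_ge0 ltW.
rewrite (@fubini_tonelli _ _ (measurableTypeR R) (measurableTypeR R) R leb leb k mk k0).
rewrite (@eq_integral _ _ _ leb setT (fun t => h%:E * (g t ^+ 2)%:E)%E); last first.
  move=> t _; rewrite /fubini_G /k.
  transitivity (\int[leb]_(y in `](t - h)%R, t[) (g t ^+ 2)%:E)%E.
    rewrite [RHS]integral_mkcond; apply: eq_integral => y _.
    rewrite patchE indicE /=; have -> : ((y, t) \in S) = (y \in `](t - h)%R, t[%classic).
      by apply/idP/idP => /set_mem H; apply/mem_set; move: H; rewrite /S /= in_itv/= ltrBlDr andbC.
    by case: ifP => _; rewrite ?mul1r ?mul0r.
  rewrite integral_cst// [X in (_ * X)%E]lebesgue_measure_itv/= lte_fin ltrBlDr ltrDl h0.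
  by rewrite -EFinD -!EFinM; congr (_%:E); ring.
rewrite ge0_integralZl//.
- by rewrite muleA -EFinM mulVf ?mul1e// gt_eqF.
- by move=> t _; rewrite lee_fin sqr_ge0.
- by rewrite lee_fin ltW.
Qed.

Lemma dq_plane_le (B : R * R -> R) (h : R) : 0 < h -> test_fun B ->
  (\int[mu2]_p (dq h B p ^+ 2)%:E <= \int[mu2]_p (py B p ^+ 2)%:E)%E.
Proof.
move=> h0 tB.
have mpy := measurable_py (tf_cont tB); have mdq := measurable_dq h tB.
have m1 : measurable_fun [set: P2] (fun p => (dq h B p ^+ 2)%:E).
  by apply/measurable_EFinP; exact: measurable_funX.
have m2 : measurable_fun [set: P2] (fun p => (py B p ^+ 2)%:E).
  by apply/measurable_EFinP; exact: measurable_funX.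
have p1 (p : P2) : (0 <= (dq h B p ^+ 2)%:E)%E by rewrite lee_fin sqr_ge0.
have p2 (p : P2) : (0 <= (py B p ^+ 2)%:E)%E by rewrite lee_fin sqr_ge0.
rewrite /plane_measure.
rewrite (@fubini_tonelli1 _ _ (measurableTypeR R) (measurableTypeR R) R leb leb _ m1 p1).
rewrite (@fubini_tonelli1 _ _ (measurableTypeR R) (measurableTypeR R) R leb leb _ m2 p2).
apply: ae_ge0_le_integral => //.
- by move=> x _; apply: integral_ge0 => y _; exact: p1.
- exact: (@measurable_fun_fubini_tonelli_F _ _ (measurableTypeR R) (measurableTypeR R) R leb _ m1 p1).
- by move=> x _; apply: integral_ge0 => y _; exact: p2.
- exact: (@measurable_fun_fubini_tonelli_F _ _ (measurableTypeR R) (measurableTypeR R) R leb _ m2 p2).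
apply: ae_imply (tf_acy tB) => x acB _; rewrite /fubini_F.
by apply: (dq_slice h0 _ acB); apply: continuous_slice_y; exact: tf_cont.
Qed.

(** Reduces the negative increments that [parts_dq] produces to positive ones, up to a
    translation. *)
Lemma dq_opp (B : R * R -> R) (h : R) p : dq h B p = dq (- h) B (up h p).
Proof. by rewrite /dq upNK invrN; ring. Qed.

Lemma dq_integrable_le (B : R * R -> R) (h : R) : h != 0 -> test_fun B ->
  mu2.-integrable setT (EFin \o (fun p => dq h B p ^+ 2)) /\
  \int[mu2]_p (dq h B p ^+ 2) <= \int[mu2]_p (py B p ^+ 2).
Proof.
move=> hn0 tB; have mpy := measurable_py (tf_cont tB).
have le1 : (\int[mu2]_p (dq h B p ^+ 2)%:E <= \int[mu2]_p (py B p ^+ 2)%:E)%E.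
  have [h0|h0] := ltP 0 h; first exact: dq_plane_le.
  have hN0 : 0 < - h by rewrite oppr_gt0 lt_neqAle hn0.
  under eq_integral do rewrite dq_opp.
  rewrite (@up_integral_ge0 R h (fun p => (dq (- h) B p ^+ 2)%:E)).
  - exact: dq_plane_le.
  - by apply/measurable_EFinP; apply: measurable_funX; exact: measurable_dq.
  - by move=> p; rewrite lee_fin sqr_ge0.
have i2 := tf_py2 tB.
have i1 : mu2.-integrable setT (EFin \o (fun p => dq h B p ^+ 2)).
  apply: (@Rintegrable_ge0 _ P2) => //.
  - by apply: measurable_funX; exact: measurable_dq.
  - by move=> p _; rewrite sqr_ge0.
  - apply: le_lt_trans le1 _; by rewrite (@integral_EFin _ P2)// ltry.
split; first exact: i1.
by rewrite -lee_fin -!(@integral_EFin _ P2).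
Qed.

Lemma tf_derivable_y (B : R * R -> R) : test_fun B ->
  {ae mu2, forall p, derivable_y B p}.
Proof.
move=> tB; apply: ae_plane_x; first exact: (measurable_derivable_y (tf_cont tB)).
apply: ae_imply (tf_acy tB) => x acB.
have H n : {ae leb, forall y, - n.+1%:R < y < n.+1%:R -> derivable (fun y => B (x, y)) y 1}.
  by have [] := @real_ac_ftc R (- n.+1%:R) n.+1%:R _ _ (acB _ _) => //; rewrite -subr_gt0 opprK addr_gt0// ltr0n.
have := ae_foralln H; apply: ae_imply => y Hy; rewrite /derivable_y /=.
apply: (Hy (Num.truncn `|y|)); rewrite -ltr_norml.
exact: truncnS_gt.
Qed.

Lemma dq_cvg (B : R * R -> R) (h : nat -> R) p : derivable_y B p ->
  h n @[n --> \oo] `=>` (0 : R)^' -> dq (h n) B p @[n --> \oo] --> py B p.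
Proof.
rewrite /derivable_y => dB h0.
have := is_derive_derive1 dB => -[_ E].
have := dB; rewrite /derivable => /cvg_ex[l Hl].
have El : l = py B p.
  by rewrite /py -E; apply/esym/cvg_lim => //; exact: Hl.
rewrite -El; apply: (cvg_trans _ (cvg_comp _ _ h0 Hl)).
apply: near_eq_cvg; apply: nearW => n; rewrite /dq /up /=.
by rewrite -[LHS]/((h n)^-1 * (B (p.1, h n * 1 + p.2) - B (p.1, p.2))) mulr1 [h n + _]addrC; case: (p).
Qed.

(* Replacing one derivative by a difference quotient, the identity follows from
   integration by parts in the other variable and from translation invariance. *)
Lemma null_lagrangian (A B : R * R -> R) : test_fun A -> test_fun B ->
  \int[mu2]_p (px A p * py B p) = \int[mu2]_p (px B p * py A p).
Proof.
move=> tA tB.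
have lim E F (h : nat -> R) : test_fun E -> test_fun F -> (forall n, h n != 0) ->
    h n @[n --> \oo] `=>` (0 : R)^' ->
    \int[mu2]_p (px E p * dq (h n) F p) @[n --> \oo] --> \int[mu2]_p (px E p * py F p).
  move=> tE tF hn h0; apply: (@l2_limit _ P2) => //.
  - by move=> n; exact: measurable_dq.
  - exact: (measurable_py (tf_cont tF)).
  - exact: (measurable_px (tf_cont tE)).
  - by move=> n; exact: (dq_integrable_le (hn n) tF).1.
  - exact: tf_py2.
  - exact: tf_px2.
  - by move=> n; exact: (dq_integrable_le (hn n) tF).2.
  - by apply: ae_imply (tf_derivable_y tF) => p dF _; exact: dq_cvg.
have n0 n : n.+1%:R^-1 != 0 :> R by rewrite invr_eq0.
have nN0 n : - n.+1%:R^-1 != 0 :> R by rewrite oppr_eq0.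
have c0 : - n.+1%:R^-1 @[n --> \oo] `=>` (0 : R)^'.
  move=> U [e e0 eU]; have := @cvg_harmonic_dnbhs R [set x | U (- x)].
  apply; exists e => // x /= xe xn; apply: eU => /=; last by rewrite oppr_eq0.
  by move: xe; rewrite !sub0r opprK normrN.
have L1 := lim A B _ tA tB n0 (@cvg_harmonic_dnbhs R).
(* The opposite increments are used on this side, since [parts_dq] turns [h] into [- h]. *)
have L2 := lim B A _ tB tA nN0 c0.
rewrite -(cvg_lim _ L1)// -(cvg_lim _ L2)//; congr (limn _); apply/funext => n.
exact: parts_dq.
Qed.

End difference_quotient_bound.

(** * Operators on the two-sided sequence space *)

Section idx_sums.
Context (R : realType).
Implicit Types (F G h : idx -> R[i]) (A : imx R).

(** These index sets are those of the partial sums in [idx_sum], so that [psum] has its value as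
    limit. *)
Fixpoint ixs (n : nat) : seq idx := if n is m.+1 then ixs m ++ [:: inl m; inr m] else [::].

Definition irank (i : idx) : nat := match i with inl k => k | inr k => k end.

Lemma mem_ixs n i : (i \in ixs n) = (irank i < n)%N.
Proof.
elim: n => [|n IH] /=; first by rewrite in_nil.
rewrite mem_cat IH ltnS [in RHS]leq_eqVlt orbC; case: (irank i < n)%N; rewrite ?orbT ?orbF//=.
by case: i {IH} => k; rewrite !inE !eqE /= ?orbF.
Qed.

Lemma uniq_ixs n : uniq (ixs n).
Proof. by elim: n => [//|n IH] /=; rewrite cat_uniq IH /= !mem_ixs /= ltnn. Qed.

Definition psum F n : R[i] := \sum_(i <- ixs n) F i.

Definition isummable F l := ccvg (psum F) l.

Lemma psumE F n : psum F n = \sum_(0 <= k < n) (F (inl k) + F (inr k)).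
Proof.
rewrite /psum; elim: n => [|n IH]; first by rewrite big_nil big_geq.
by rewrite big_cat big_nat_recr//= IH !big_cons big_nil addr0.
Qed.

Lemma idx_sumE F l : isummable F l -> idx_sum F = l.
Proof.
move=> [F1 F2]; apply: complex_eq => /=.
  by rewrite -(cvg_lim _ F1)//; congr (limn _); apply/funext => n; rewrite psumE Re_sum.
by rewrite -(cvg_lim _ F2)//; congr (limn _); apply/funext => n; rewrite psumE Im_sum.
Qed.

Lemma big_ixs_widen (V : nmodType) (n m : nat) (f : idx -> V) : (n <= m)%N ->
  (forall i, (n <= irank i)%N -> f i = 0) -> \sum_(i <- ixs m) f i = \sum_(i <- ixs n) f i.
Proof.
move=> nm f0; rewrite -(subnK nm); elim: (m - n)%N => [//|k IH].
rewrite addSn /= big_cat /= IH !big_cons big_nil !f0 ?addr0//=; exact: leq_addl.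
Qed.

Lemma isummable_finite F n : (forall i, (n <= irank i)%N -> F i = 0) -> isummable F (psum F n).
Proof.
move=> F0; apply: (ccvg_near _ (ccvg_cst _)).
by exists n => // m /= nm; rewrite /psum (big_ixs_widen nm).
Qed.

Lemma isummable_single F i : (forall j, j != i -> F j = 0) -> isummable F (F i).
Proof.
move=> F0.
have H : isummable F (psum F (irank i).+1).
  by apply: isummable_finite => j ij; apply: F0; apply: contraTneq ij => ->; rewrite ltnn.
have -> : F i = psum F (irank i).+1 => //.
rewrite /psum (bigD1_seq i) ?uniq_ixs ?mem_ixs//= big1_seq ?addr0// => j /andP[ji _].
exact: F0.
Qed.

Lemma isummableD F G l m : isummable F l -> isummable G m ->
  isummable (fun i => F i + G i) (l + m).
Proof.
move=> Fl Gm; rewrite /isummable (_ : psum _ = fun n => psum F n + psum G n); first exact: ccvgD.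
by apply/funext => n; rewrite /psum big_split.
Qed.

Lemma isummableZ F l a : isummable F l -> isummable (fun i => a * F i) (a * l).
Proof.
move=> Fl; rewrite /isummable (_ : psum _ = fun n => a * psum F n); first exact: ccvgZ.
by apply/funext => n; rewrite /psum mulr_sumr.
Qed.

Lemma isummableB F G l m : isummable F l -> isummable G m ->
  isummable (fun i => F i - G i) (l - m).
Proof.
move=> Fl Gm; have := isummableD Fl (isummableZ (-1) Gm).
by rewrite mulN1r; under eq_fun do rewrite mulN1r.
Qed.

Lemma isummableJ F l : isummable F l -> isummable (fun i => (conjc (F i))) ((conjc l)).
Proof.
move=> Fl; rewrite /isummable (_ : psum _ = fun n => (conjc (psum F n))); first exact: ccvgJ.
by apply/funext => n; rewrite /psum conjc_sum.
Qed.

Lemma abs_isummable F (K : R) : (forall n, \sum_(i <- ixs n) modulus (F i) <= K) ->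
  exists l, isummable F l.
Proof.
move=> FK.
have part (p : R[i] -> R) : (forall z, `|p z| <= modulus z) ->
    (forall s : seq idx, p (\sum_(i <- s) F i) = \sum_(i <- s) p (F i)) ->
    exists l : R, p (psum F n) @[n --> \oo] --> l.
  move=> pm ps.
  have E : (fun n => p (psum F n)) = series (fun k => p (F (inl k)) + p (F (inr k))).
    apply/funext => n; rewrite /psum ps /series /=.
    elim: n => [|n IH] /=; first by rewrite big_nil big_geq.
    by rewrite big_cat big_nat_recr//= IH !big_cons big_nil addr0.
  have : cvgn [normed series (fun k => p (F (inl k)) + p (F (inr k)))].
    apply: nondecreasing_is_cvgn.
      by apply: nondecreasing_series => n _ _; exact: normr_ge0.
    exists K => _ [n _ <-]; apply: le_trans (FK n); rewrite /series /=.
    elim: n => [|n IH]; first by rewrite /series /= big_geq// big_nil.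
    rewrite /series /= big_cat big_nat_recr//= !big_cons big_nil addr0.
    by apply: lerD; [exact: IH|apply: (le_trans (ler_normD _ _)); apply: lerD; exact: pm].
  by move=> /normed_cvg; rewrite -E => /cvg_ex.
have [a Ha] := part (@complex.Re R) (@Re_le_modulus R) (@Re_sum R idx ^~ F).
have [b Hb] := part (@complex.Im R) (@Im_le_modulus R) (@Im_sum R idx ^~ F).
by exists (a +i* b); split.
Qed.

Lemma isummable_modulus_le F l (K : R) : isummable F l ->
  (forall n, \sum_(i <- ixs n) modulus (F i) <= K) -> modulus l <= K.
Proof.
move=> Fl FK; apply: (ccvg_modulus_le Fl); apply: nearW => n.
exact: le_trans (modulus_sum _ _) (FK n).
Qed.

Definition nsq h n : R := \sum_(i <- ixs n) modulus (h i) ^+ 2.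

Lemma nsq_ge0 h n : 0 <= nsq h n.
Proof. by apply: sumr_ge0 => i _; exact: sqr_ge0. Qed.

Lemma ler_sum_ixs (f : idx -> R) n m : (forall i, 0 <= f i) -> (n <= m)%N ->
  \sum_(i <- ixs n) f i <= \sum_(i <- ixs m) f i.
Proof.
move=> f0 nm; rewrite -(subnK nm); elim: (m - n)%N => [//|k IH].
by rewrite addSn /= big_cat /= (le_trans IH)// lerDl sumr_ge0.
Qed.

Lemma nsqE h n : ((nsq h n)%:E = \sum_(0 <= k < n)
  (modulus (h (inl k)) ^+ 2 + modulus (h (inr k)) ^+ 2)%:E)%E.
Proof.
rewrite /nsq; elim: n => [|n IH]; first by rewrite big_nil big_geq.
by rewrite big_cat big_nat_recr//= EFinD IH !big_cons big_nil addr0.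
Qed.

Lemma sqnorm_le h (K : \bar R) : (forall n, ((nsq h n)%:E <= K)%E) -> (sqnorm h <= K)%E.
Proof.
move=> hK; apply: lime_le.
  by apply: is_cvg_nneseries => k _ _; rewrite lee_fin addr_ge0 ?sqr_ge0.
by apply: nearW => n; rewrite -nsqE.
Qed.

Lemma nsq_le_sqnorm h n : ((nsq h n)%:E <= sqnorm h)%E.
Proof.
by rewrite nsqE; apply: nneseries_lim_ge => k _ _; rewrite lee_fin addr_ge0 ?sqr_ge0.
Qed.

Lemma ell2P h : ell2 h <-> exists K, forall n, nsq h n <= K.
Proof.
split=> [hfin|[K hK]].
  have s0 : (0 <= sqnorm h)%E.
    by apply: nneseries_ge0 => k _ _; rewrite lee_fin addr_ge0 ?sqr_ge0.
  exists (fine (sqnorm h)) => n; rewrite -lee_fin fineK ?nsq_le_sqnorm//.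
  by rewrite ge0_fin_numE.
by apply: le_lt_trans (ltry K); apply: sqnorm_le => n; rewrite lee_fin.
Qed.

Lemma nsq_fine_le h n : ell2 h -> nsq h n <= fine (sqnorm h).
Proof.
move=> hfin; rewrite -lee_fin fineK ?nsq_le_sqnorm// ge0_fin_numE//.
by apply: nneseries_ge0 => k _ _; rewrite lee_fin addr_ge0 ?sqr_ge0.
Qed.

(** This takes the place of the Cauchy-Schwarz inequality: [s] is tuned to the sizes of the two
    factors. *)
Lemma amgm (s a b : R) : 0 < s -> a * b <= s * a ^+ 2 + s^-1 * b ^+ 2.
Proof.
move=> s0; have := sqr_ge0 (s * a - b / 2).
have -> : s * a ^+ 2 + s^-1 * b ^+ 2 = s^-1 * ((s * a) ^+ 2 + b ^+ 2).
  by field; rewrite gt_eqF.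
move=> H; rewrite -ler_pdivrMl ?invr_gt0// invrK.
have := sqr_ge0 b; nra.
Qed.

(** Bilinear, without conjugation: a row against a column, as in an entry of a matrix product. *)
Definition ip (r v : idx -> R[i]) : R[i] := idx_sum (fun i => r i * v i).

Lemma ip_bound (r v : idx -> R[i]) (s a b : R) n : 0 < s -> (forall n, nsq r n <= a) ->
  (forall n, nsq v n <= b) -> \sum_(i <- ixs n) modulus (r i * v i) <= s * a + s^-1 * b.
Proof.
move=> s0 ra vb; apply: (@le_trans _ _ (s * nsq r n + s^-1 * nsq v n)).
  rewrite /nsq !mulr_sumr -big_split /=; apply: ler_sum => i _.
  by rewrite modulusM; exact: amgm.
by apply: lerD; rewrite ler_wpM2l ?invr_ge0 ?(ltW s0).
Qed.

Lemma ip_summable (r v : idx -> R[i]) : ell2 r -> ell2 v ->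
  isummable (fun i => r i * v i) (ip r v).
Proof.
move=> /ell2P[a ra] /ell2P[b vb].
have [l Hl] := abs_isummable (fun n => ip_bound n ltr01 ra vb).
by rewrite /ip (idx_sumE Hl).
Qed.

Lemma ip_le (r v : idx -> R[i]) (s a b : R) : 0 < s -> (forall n, nsq r n <= a) ->
  (forall n, nsq v n <= b) -> modulus (ip r v) <= s * a + s^-1 * b.
Proof.
move=> s0 ra vb; have er : ell2 r by apply/ell2P; exists a.
have ev : ell2 v by apply/ell2P; exists b.
exact: (isummable_modulus_le (ip_summable er ev) (fun n => ip_bound n s0 ra vb)).
Qed.

Lemma modulus2_add (x y : R[i]) : modulus (x + y) ^+ 2 <= 2 * (modulus x ^+ 2 + modulus y ^+ 2).
Proof.
have := modulusD x y; have := modulus_ge0 (x + y); have := modulus_ge0 x; have := modulus_ge0 y.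
by have := sqr_ge0 (modulus x - modulus y); nra.
Qed.

Lemma nsqD h g n : nsq (fun i => h i + g i) n <= 2 * (nsq h n + nsq g n).
Proof.
rewrite /nsq -big_split mulr_sumr /=; apply: ler_sum => i _; exact: modulus2_add.
Qed.

Lemma nsqZ a h n : nsq (fun i => a * h i) n = modulus a ^+ 2 * nsq h n.
Proof. by rewrite /nsq mulr_sumr; apply: eq_bigr => i _; rewrite modulusM exprMn. Qed.

Lemma ell2D h g : ell2 h -> ell2 g -> ell2 (fun i => h i + g i).
Proof.
move=> /ell2P[a ha] /ell2P[b gb]; apply/ell2P; exists (2 * (a + b)) => n.
by rewrite (le_trans (nsqD _ _ _))// ler_wpM2l// lerD.
Qed.

Lemma ell2Z a h : ell2 h -> ell2 (fun i => a * h i).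
Proof.
move=> /ell2P[b hb]; apply/ell2P; exists (modulus a ^+ 2 * b) => n.
by rewrite nsqZ ler_wpM2l// sqr_ge0.
Qed.

Lemma ell2B h g : ell2 h -> ell2 g -> ell2 (fun i => h i - g i).
Proof.
move=> hh hg; have := ell2D hh (ell2Z (-1) hg).
by under eq_fun do rewrite mulN1r.
Qed.

(* Boundedness is tested on finite sums only. The symmetric right-hand side makes
   the condition stable under adjunction and is enough by homogeneity. *)
Definition bform A (M : R) : Prop := forall n (x y : idx -> R[i]),
  modulus (\sum_(i <- ixs n) \sum_(j <- ixs n) x i * A i j * y j) <= M * (nsq x n + nsq y n).

Definition cut n h : idx -> R[i] := fun i => if (irank i < n)%N then h i else 0.

Lemma big_cut (V : nmodType) n m (f : idx -> V) : (n <= m)%N ->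
  \sum_(i <- ixs m) (if (irank i < n)%N then f i else 0) = \sum_(i <- ixs n) f i.
Proof.
move=> nm; rewrite (big_ixs_widen nm) => [|i]; last by rewrite ltnNge => ->.
by rewrite big_seq [RHS]big_seq; apply: eq_bigr => i; rewrite mem_ixs => ->.
Qed.

Lemma nsq_cut n m h : (n <= m)%N -> nsq (cut n h) m = nsq h n.
Proof.
move=> nm; rewrite /nsq -(big_cut _ nm); apply: eq_bigr => i _.
by rewrite /cut; case: ifP => // _; rewrite modulus0 expr0n.
Qed.

(** Padding the vectors with zeros makes a rectangular sum square. *)
Lemma bform_rect A M n m (x y : idx -> R[i]) : bform A M ->
  modulus (\sum_(i <- ixs n) \sum_(j <- ixs m) x i * A i j * y j) <= M * (nsq x n + nsq y m).
Proof.
move=> bA; have := bA (maxn n m) (cut n x) (cut m y).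
rewrite !nsq_cut ?leq_maxl ?leq_maxr//; congr (modulus _ <= _).
rewrite -(big_cut _ (leq_maxl n m)); apply: eq_bigr => i _; rewrite /cut.
case: ifP => _; last by rewrite big1// => j _; rewrite !mul0r.
rewrite -(big_cut _ (leq_maxr n m)); apply: eq_bigr => j _.
by case: ifP => _ //; rewrite mulr0.
Qed.

Lemma bform_weaken A M M' : M <= M' -> bform A M -> bform A M'.
Proof.
move=> MM bA n x y; apply: (le_trans (bA n x y)).
by rewrite ler_wpM2r// addr_ge0// nsq_ge0.
Qed.

Lemma bform_adj A M : bform A M -> bform (imx_adj A) M.
Proof.
move=> bA n x y; have := bA n (fun i => (conjc (y i))) (fun i => (conjc (x i))).
rewrite exchange_big /= -modulusJ conjc_sum.
rewrite (_ : nsq (fun i => (conjc (y i))) n = nsq y n); last first.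
  by rewrite /nsq; apply: eq_bigr => i _; rewrite modulusJ.
rewrite (_ : nsq (fun i => (conjc (x i))) n = nsq x n); last first.
  by rewrite /nsq; apply: eq_bigr => i _; rewrite modulusJ.
rewrite addrC; congr (modulus _ <= _); apply: eq_bigr => i _.
rewrite conjc_sum; apply: eq_bigr => j _.
by rewrite !conjcM !conjcK /imx_adj; ring.
Qed.

Lemma bform_pos A M : bform A M -> exists2 M', 0 < M' & bform A M'.
Proof.
move=> bA; exists (`|M| + 1); first by rewrite ltr_wpDl.
by apply: bform_weaken bA; rewrite (le_trans (ler_norm M))// lerDl.
Qed.

Lemma bform_row A M i n : 0 < M -> bform A M -> nsq (A i) n <= 4 * M ^+ 2.
Proof.
(* Testing the form on [2 M] at the index [i] against the conjugate row gives
   [2 M S <= M (4 M^2 + S)] for the row sum [S]. *)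
move=> M0 bA; pose x j : R[i] := if j == i then (2 * M)%:C else 0.
have := @bform_rect A M (irank i).+1 n x (fun j => (conjc (A i j))) bA.
rewrite (bigD1_seq i) ?uniq_ixs ?mem_ixs//= [X in _ + X]big1_seq ?addr0; last first.
  by move=> j /andP[/negbTE ji _]; rewrite big1// => k _; rewrite /x ji !mul0r.
rewrite (_ : nsq x _ = (2 * M) ^+ 2); last first.
  rewrite /nsq (bigD1_seq i) ?uniq_ixs ?mem_ixs//= big1_seq => [|j /andP[/negbTE ji _]].
    by rewrite /x eqxx modulus_real addr0 ger0_norm// mulr_ge0// ltW.
  by rewrite /x ji modulus0 expr0n.
rewrite (_ : nsq (fun j => (conjc (A i j))) n = nsq (A i) n); last first.
  by rewrite /nsq; apply: eq_bigr => j _; rewrite modulusJ.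
rewrite (_ : \sum_(j <- ixs n) _ = (2 * M * nsq (A i) n)%:C); last first.
  rewrite /nsq mulr_sumr real_complex_sum; apply: eq_bigr => j _.
  by rewrite -mulrA mulcJ /x eqxx -real_complexM.
rewrite modulus_real ger0_norm; last by rewrite !mulr_ge0 ?nsq_ge0// ltW.
move=> H; rewrite -(ler_pM2l M0); move: H; lra.
Qed.

Lemma bform_row_ell2 A M i : bform A M -> ell2 (A i).
Proof.
by move=> /bform_pos[M' M0 bA]; apply/ell2P; eexists => n; exact: (bform_row i n M0 bA).
Qed.

Lemma imx_op_summable A M h i : bform A M -> ell2 h ->
  isummable (fun j => A i j * h j) (imx_op A h i).
Proof. by move=> bA hh; exact: (ip_summable (bform_row_ell2 i bA) hh). Qed.

Lemma imx_op_nsq A M h K N : 0 < M -> bform A M -> ell2 h -> (forall n, nsq h n <= K) ->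
  nsq (imx_op A h) N <= 4 * M ^+ 2 * K.
Proof.
move=> M0 bA hh hK.
pose s n i := \sum_(j <- ixs n) A i j * h j.
have cs : nsq (s n) N @[n --> \oo] --> nsq (imx_op A h) N.
  rewrite /nsq; elim: (ixs N) => [|i r IH].
    by under eq_fun do rewrite big_nil; rewrite big_nil; exact: cvg_cst.
  under eq_fun do rewrite big_cons; rewrite big_cons; apply: cvgD => //.
  by apply: ccvg_modulus2; exact: (imx_op_summable i bA hh).
rewrite -(cvg_lim _ cs)//; apply: limr_le; first by apply: cvgP cs.
apply: nearW => n.
(* The form is tested against the conjugate of the truncated image divided by [2 M]; with [S] its
   squared norm and [H] that of [h], this gives [S / (2 M) <= S / (4 M) + M H]. *)
have := @bform_rect A M N n (fun i => (conjc (((2 * M)^-1)%:C * s n i))) h bA.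
rewrite (_ : nsq (fun i => (conjc (_ * s n i))) N = (2 * M) ^- 2 * nsq (s n) N); last first.
  rewrite -exprVn -[(2 * M)^-1 in RHS]ger0_norm ?invr_ge0 ?mulr_ge0 ?(ltW M0)// -modulus_real -nsqZ.
  by rewrite /nsq; apply: eq_bigr => i _; rewrite modulusJ.
rewrite (_ : \sum_(i <- ixs N) _ = ((2 * M)^-1 * nsq (s n) N)%:C); last first.
  rewrite /nsq mulr_sumr real_complex_sum; apply: eq_bigr => i _.
  under eq_bigr do rewrite -mulrA.
  rewrite -mulr_sumr -/(s n i) conjcM -mulrA [(conjc _) * s n i]mulrC mulcJ.
  by rewrite conjc_real -real_complexM.
rewrite modulus_real ger0_norm; last by rewrite mulr_ge0 ?nsq_ge0// invr_ge0 mulr_ge0// ltW.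
have /= := hK n; set S := nsq (s n) N; set H := nsq h n => HK.
have -> : M * ((2 * M) ^- 2 * S + H) = (2 * M)^-1 * (S / 2) + M * H by field; rewrite gt_eqF.
have -> : (2 * M)^-1 * S = (2 * M)^-1 * (S / 2) + (4 * M)^-1 * S by field; rewrite gt_eqF.
rewrite lerD2l ler_pdivrMl ?mulr_gt0// => HS.
by apply: (le_trans HS); rewrite mulrA -[4 * M * M]mulrA -expr2 ler_wpM2l// mulr_ge0// sqr_ge0.
Qed.

Lemma imx_op_ell2 A M h : bform A M -> ell2 h -> ell2 (imx_op A h).
Proof.
move=> /bform_pos[M' M0 bA] hh; have /ell2P[K hK] := hh.
by apply/ell2P; exists (4 * M' ^+ 2 * K) => n; exact: imx_op_nsq.
Qed.

Lemma bform_bounded A M : bform A M -> imx_bounded A.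
Proof.
move=> /bform_pos[M' M0 bA]; exists (4 * M' ^+ 2) => h hh; apply: sqnorm_le => n.
have E : sqnorm h = (fine (sqnorm h))%:E.
  rewrite fineK// ge0_fin_numE//.
  by apply: nneseries_ge0 => k _ _; rewrite lee_fin addr_ge0 ?sqr_ge0.
rewrite E -EFinM lee_fin; apply: imx_op_nsq => // m; exact: nsq_fine_le.
Qed.

Lemma imx_opB A M h g a : bform A M -> ell2 h -> ell2 g ->
  imx_op A (fun i => a * (h i - g i)) = fun i => a * (imx_op A h i - imx_op A g i).
Proof.
move=> bA hh hg; apply/funext => i; apply: idx_sumE.
have := isummableZ a (isummableB (imx_op_summable i bA hh) (imx_op_summable i bA hg)).
by congr isummable; apply/funext => j; ring.
Qed.

(** Associativity of row, matrix and column. It is a finite exchange of sums when [h] is truncated,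
    and both sides depend continuously on [h] because [A] is bounded. *)
Lemma ip_swap A M r h : bform A M -> ell2 r -> ell2 h ->
  idx_sum (fun j => ip r (A ^~ j) * h j) = ip r (imx_op A h).
Proof.
move=> bA0 hr hh; have [N N0 bA] := bform_pos bA0.
pose B : imx R := fun i j => A j i.
have bB : bform B N.
  move=> n x y; have := bA n y x; rewrite exchange_big /= addrC; congr (modulus _ <= _).
  by apply: eq_bigr => i _; apply: eq_bigr => j _; rewrite /B; ring.
have EB : (fun j => ip r (A ^~ j)) = imx_op B r.
  apply/funext => j; rewrite /ip /imx_op; congr idx_sum; apply/funext => i; exact: mulrC.
have eB : ell2 (imx_op B r) by exact: imx_op_ell2 bB hr.
pose f h := ip r (imx_op A h); pose g h := ip (imx_op B r) h.
have -> : idx_sum (fun j => ip r (A ^~ j) * h j) = g h.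
  by rewrite /g /ip -EB.
rewrite -/(f h).
have /ell2P[a ra] := hr; have /ell2P[b hb] := hh.
have /ell2P[c Bc] := eB.
have cut2 n : ell2 (cut n h).
  apply/ell2P; exists (nsq h n) => m.
  rewrite -(nsq_cut h (leq_maxl n m)); apply: ler_sum_ixs (leq_maxr n m) => i; exact: sqr_ge0.
pose T n i := h i - cut n h i.
have eT n : ell2 (T n) by apply: ell2B.
have fin n : g (cut n h) = f (cut n h).
  rewrite /g /f /ip; apply: idx_sumE.
  have -> : idx_sum (fun i => r i * imx_op A (cut n h) i) = \sum_(j <- ixs n) imx_op B r j * h j.
    apply: idx_sumE.
    have -> : (fun i => r i * imx_op A (cut n h) i) = fun i => \sum_(j <- ixs n) B j i * r i * h j.
      apply/funext => i; rewrite (_ : imx_op A (cut n h) i = \sum_(j <- ixs n) A i j * h j).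
        by rewrite mulr_sumr; apply: eq_bigr => j _; rewrite /B; ring.
      apply: idx_sumE; rewrite -(big_cut _ (leqnn n)).
      rewrite (_ : (fun j => A i j * cut n h j) = fun j => if (irank j < n)%N then A i j * h j else 0).
        by apply: isummable_finite => j; rewrite ltnNge => ->.
      by apply/funext => j; rewrite /cut; case: ifP => //; rewrite mulr0.
    rewrite /isummable (_ : psum _ = fun m => \sum_(j <- ixs n) psum (fun i => B j i * r i) m * h j); last first.
      apply/funext => m; rewrite /psum exchange_big /=; apply: eq_bigr => j _.
      by rewrite mulr_suml.
    apply: ccvg_sum => j; apply: ccvgM (ccvg_cst _); exact: (imx_op_summable j bB hr).
  rewrite -(big_cut _ (leqnn n)).
  rewrite (_ : (fun j => imx_op B r j * cut n h j) = fun j => if (irank j < n)%N then imx_op B r j * h j else 0).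
    by apply: isummable_finite => j; rewrite ltnNge => ->.
  by apply/funext => j; rewrite /cut; case: ifP => //; rewrite mulr0.
have lin n : g h - f h = g (T n) - f (T n).
  have Eg : g h = g (cut n h) + g (T n).
    rewrite /g /ip; apply: idx_sumE.
    have := isummableD (ip_summable eB (cut2 n)) (ip_summable eB (eT n)).
    by congr isummable; apply/funext => i; rewrite /T; ring.
  have Ef : f h = f (cut n h) + f (T n).
    have eA k : ell2 k -> ell2 (imx_op A k) by exact: imx_op_ell2 bA.
    rewrite /f /ip; apply: idx_sumE.
    have := isummableD (ip_summable hr (eA _ (cut2 n))) (ip_summable hr (eA _ (eT n))).
    congr isummable; apply/funext => i; rewrite -mulrDr; congr (_ * _).
    apply/esym/idx_sumE.
    have := isummableD (imx_op_summable i bA (cut2 n)) (imx_op_summable i bA (eT n)).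
    by congr isummable; apply/funext => j; rewrite /T; ring.
  by rewrite Eg Ef fin; ring.
have tail (e : R) : 0 < e -> exists n, forall m, nsq (T n) m <= e.
  move=> e0.
  have cn : cvgn (nsq h).
    apply: nondecreasing_is_cvgn; last by exists b => _ [n _ <-].
    by move=> n m nm; apply: ler_sum_ixs => // i; exact: sqr_ge0.
  have /cvgrPdist_lt /(_ _ e0) [n _ Hn] := cn; exists n => m.
  have nh k : nsq h k <= limn (nsq h).
    apply: nondecreasing_cvgn_le => // p q pq; apply: ler_sum_ixs => // i; exact: sqr_ge0.
  have := Hn n (leqnn n) => /=; rewrite ger0_norm ?subr_ge0// => He.
  have E : nsq (T n) (maxn n m) = nsq h (maxn n m) - nsq h n.
    rewrite -(nsq_cut h (leq_maxl n m)) /nsq -sumrB; apply: eq_bigr => i _.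
    by rewrite /T /cut; case: ifP => _; rewrite ?subrr ?modulus0 ?subr0 ?expr0n//= subr0.
  apply: (@le_trans _ _ (nsq (T n) (maxn n m))).
    by apply: ler_sum_ixs (leq_maxr n m) => i; exact: sqr_ge0.
  by rewrite E (le_trans _ (ltW He))// lerB.
apply/eqP; rewrite -subr_eq0 -modulus_eq0; apply/eqP/le_anti; rewrite modulus_ge0 andbT.
apply/ler_addgt0Pr => e e0; rewrite add0r.
have a0 : 0 <= a := le_trans (nsq_ge0 r 0) (ra 0%N).
have c0 : 0 <= c := le_trans (nsq_ge0 (imx_op B r) 0) (Bc 0%N).
(* With this [s] the terms containing the fixed bounds [a] and [c] are at most [e / 4]; then [t]
   makes those containing the tail equal to [e / 4]. *)
pose s : R := e / (4 * (a + c + 1)).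
have s0 : 0 < s by rewrite divr_gt0// mulr_gt0// ltr_wpDl// addr_ge0.
have d0 : 0 < 1 + 4 * N ^+ 2 by rewrite ltr_wpDr// mulr_ge0// sqr_ge0.
pose t : R := s * e / (4 * (1 + 4 * N ^+ 2)).
have t0 : 0 < t by apply: divr_gt0; apply: mulr_gt0.
have [n Hn] := tail t t0.
rewrite (lin n).
apply: (le_trans (modulusB _ _)).
have g1 := @ip_le (imx_op B r) (T n) s c t s0 Bc Hn.
have f1 := @ip_le r (imx_op A (T n)) s a (4 * N ^+ 2 * t) s0 ra
  (fun m => imx_op_nsq m N0 bA (eT n) Hn).
apply: (le_trans (lerD g1 f1)).
have -> : s * c + s^-1 * t + (s * a + s^-1 * (4 * N ^+ 2 * t)) =
    s * (a + c) + s^-1 * t * (1 + 4 * N ^+ 2) by ring.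
have -> : s^-1 * t * (1 + 4 * N ^+ 2) = e / 4.
  by rewrite /t; field; rewrite (gt_eqF s0) (gt_eqF d0).
have -> : s * (a + c) = e / 4 * ((a + c) / (a + c + 1)).
  by rewrite /s; field; rewrite gt_eqF// ltr_wpDl// addr_ge0.
have : (a + c) / (a + c + 1) <= 1.
  by rewrite ler_pdivrMr ?mul1r ?lerDl// ltr_wpDl// addr_ge0.
by move: e0; nra.
Qed.

End idx_sums.

(** * Fourier series on the circle *)

Record cc (R : realType) (u : R[i] -> R[i]) : Prop :=
  CC { cc_continuous : continuous_on circle u }.

Lemma ccP (R : realType) (u : R[i] -> R[i]) : cc u <-> forall z, circle z -> forall e : R, 0 < e ->
    exists2 d : R, 0 < d & forall w, circle w -> modulus (w - z) < d -> modulus (u w - u z) < e.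
Proof.
by split=> [[/continuous_onP]//|H]; apply: CC; apply/continuous_onP.
Qed.

Section circle_functions.
Context (R : realType).
Local Notation leb := (@lebesgue_measure R).
Implicit Types (u v phi : R[i] -> R[i]) (z w : R[i]).

Lemma ccD u v : cc u -> cc v -> cc (fun z => u z + v z).
Proof. by move=> [cu] [cv]; apply: CC => x; apply: cvgD; [exact: cu|exact: cv]. Qed.

Lemma ccM u v : cc u -> cc v -> cc (fun z => u z * v z).
Proof. by move=> [cu] [cv]; apply: CC => x; apply: cvgM; [exact: cu|exact: cv]. Qed.

Lemma cc_cst (a : R[i]) : cc (fun=> a).
Proof. by apply: CC => x; exact: cvg_cst. Qed.

Lemma cc_id : cc (id : R[i] -> R[i]).
Proof. by apply/ccP => z _ e e0; exists e. Qed.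

Lemma ccJ u : cc u -> cc (fun z => conjc (u z)).
Proof.
move=> /ccP cu; apply/ccP => z cz e e0.
have [d d0 H] := cu z cz e e0; exists d => // w cw wz.
by rewrite -conjcB modulusJ; exact: H.
Qed.

Lemma cc_comp u phi : cc u -> cc phi -> (forall z, circle z -> circle (phi z)) ->
  cc (u \o phi).
Proof.
move=> /ccP cu /ccP cp pc; apply/ccP => z cz e e0.
have [d d0 H] := cu _ (pc _ cz) e e0; have [r r0 Hr] := cp z cz d d0.
by exists r => // w cw wz; apply: H; [exact: pc|exact: Hr].
Qed.

Lemma cc_eq u v : (forall z, circle z -> u z = v z) -> cc u -> cc v.
Proof.
move=> uv /ccP cu; apply/ccP => z cz e e0.
have [d d0 H] := cu z cz e e0; exists d => // w cw wz.
by rewrite -!uv//; exact: H.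
Qed.

Lemma ccX u n : cc u -> cc (fun z => u z ^+ n).
Proof.
move=> cu; elim: n => [|n IH]; first exact: cc_cst.
by under eq_fun do rewrite exprS; exact: ccM.
Qed.

Lemma circle_conjV z : circle z -> z^-1 = conjc z.
Proof.
move=> cz; have z0 : z != 0.
  by rewrite -modulus_gt0 (cz : modulus z = 1).
by apply: (mulfI z0); rewrite mulfV// mulcJ (cz : modulus z = 1) expr1n.
Qed.

Lemma circle_neq0 z : circle z -> z != 0.
Proof. by move=> cz; rewrite -modulus_gt0 (cz : modulus z = 1). Qed.

Lemma circle_Nexp z n : circle z -> z ^ (- n%:Z) = conjc (z ^+ n).
Proof.
by move=> cz; rewrite -exprnN -exprVn circle_conjV// conjcX.
Qed.

Lemma circle_expz z (k : int) : circle z -> circle (z ^ k).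
Proof.
move=> cz; case: k => n; first by rewrite /circle /= -exprnP modulusX (cz : modulus z = 1) expr1n.
by rewrite NegzE circle_Nexp// /circle /= modulusJ modulusX (cz : modulus z = 1) expr1n.
Qed.

Lemma circle_conj_expz z (k : int) : circle z -> conjc (z ^ k) = z ^ (- k).
Proof.
by move=> cz; rewrite -circle_conjV ?invr_expz//; exact: circle_expz.
Qed.

Lemma circle_expi t : circle (expi t : R[i]).
Proof. exact: modulus_expi. Qed.

Lemma ccXz u (k : int) : cc u -> (forall z, circle z -> circle (u z)) ->
  cc (fun z => u z ^ k).
Proof.
move=> cu uc; case: k => n; first exact: ccX.
apply: (cc_eq (u := fun z => conjc (u z ^+ n.+1))) => [z cz|].
  by rewrite NegzE circle_Nexp//; exact: uc.
by apply: ccJ; exact: ccX.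
Qed.

Lemma cc_expz (k : int) : cc (fun z : R[i] => z ^ k).
Proof. by apply: ccXz => //; exact: cc_id. Qed.

Lemma cc_sum (I : Type) (s : seq I) (F : I -> R[i] -> R[i]) :
  (forall i, cc (F i)) -> cc (fun z => \sum_(i <- s) F i z).
Proof.
move=> cF; elim: s => [|i s IH].
  by under eq_fun do rewrite big_nil; exact: cc_cst.
by under eq_fun do rewrite big_cons; exact: ccD.
Qed.

Lemma expi_lip (s t e : R) : 0 < e ->
  exists2 d : R, 0 < d & forall s, `|s - t| < d -> modulus (expi s - expi t) < e.
Proof.
move=> e0; have e2 : 0 < e / 2 by lra.
have /cvgrPdist_lt /(_ _ e2) /= [d1 d10 H1] := @continuous_cos R t.
have /cvgrPdist_lt /(_ _ e2) /= [d2 d20 H2] := @continuous_sin R t.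
exists (Num.min d1 d2); first by rewrite lt_min d10.
move=> r; rewrite lt_min distrC => /andP[/H1 h1 /H2 h2].
have H : modulus (expi r - expi t) <= `|cos r - cos t| + `|sin r - sin t|.
  exact: modulus_le_ReIm.
apply: (le_lt_trans H).
by rewrite [X in X + _]distrC [X in _ + X]distrC (splitr e) ltrD.
Qed.

Lemma cc_slice u : cc u -> continuous (fun t => Re (u (expi t))) /\
  continuous (fun t => Im (u (expi t))).
Proof.
move=> /ccP cu.
have H t e : 0 < e -> \forall s \near t, modulus (u (expi s) - u (expi t)) < e.
  move=> e0; have [d d0 Hd] := cu _ (circle_expi t) e e0.
  have [r r0 Hr] := expi_lip t t d0; exists r => //= s ts.
  by apply: Hd; [exact: circle_expi|apply: Hr; rewrite distrC].
split=> t; apply/cvgrPdist_lt => e /(H t); apply: filterS => s; apply: le_lt_trans; rewrite distrC.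
  by have := Re_le_modulus (u (expi s) - u (expi t)); rewrite !reimE.
by have := Im_le_modulus (u (expi s) - u (expi t)); rewrite !reimE.
Qed.

Definition turn : set R := `[0, 2 * pi]%classic.

Lemma measurable_turn : @measurable _ (measurableTypeR R) turn.
Proof. exact: measurable_itv. Qed.

Lemma twopi_gt0 : 0 < 2 * pi :> R.
Proof. by rewrite mulr_gt0// pi_gt0. Qed.

Lemma turn_finite : (leb turn < +oo)%E.
Proof.
by rewrite [ltLHS]lebesgue_measure_itv/=; case: ifP => _; rewrite ?ltry// -EFinD ltry.
Qed.

Lemma cc_integrable u : cc u -> cintegrable leb turn (fun t => u (expi t)).
Proof.
move=> cu; have [c1 c2] := cc_slice cu.
split; apply: continuous_compact_integrable; try exact: segment_compact;
  exact: continuous_subspaceT.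
Qed.

Lemma cc_bounded u : cc u -> exists2 B : R, 0 <= B & forall t, turn t -> modulus (u (expi t)) <= B.
Proof.
move=> cu; have [c1 c2] := cc_slice cu.
have [B1 B10 H1] := continuous_itv_bounded (@continuous_subspaceT _ _ `[0, 2 * pi] _ c1).
have [B2 B20 H2] := continuous_itv_bounded (@continuous_subspaceT _ _ `[0, 2 * pi] _ c2).
exists (B1 + B2); first exact: addr_ge0.
move=> t; rewrite /turn /= in_itv /= => tt.
by rewrite (le_trans (modulus_le_ReIm _))// lerD// ?H1 ?H2.
Qed.

Lemma circle_arg z : circle z -> exists2 t, turn t & z = expi t.
Proof.
move=> cz; have n1 : Re z ^+ 2 + Im z ^+ 2 = 1 by rewrite -modulus2 (cz : modulus z = 1) expr1n.
have re1 : -1 <= Re z <= 1 by apply/andP; split; have := sqr_ge0 (Im z); nra.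
have sE : sin (acos (Re z)) = `|Im z|.
  rewrite sin_acos// -sqrtr_sqr; congr (Num.sqrt _); lra.
have a0 := acos_ge0 re1; have api := acos_lepi re1.
have [i0|i0] := leP 0 (Im z).
  exists (acos (Re z)).
    by rewrite /turn /= in_itv/= a0 (le_trans api)// ler_pMl ?ler1n// pi_gt0.
  by apply: complex_eq => /=; rewrite ?acosK// sE ger0_norm.
exists (2 * pi - acos (Re z)).
  by rewrite /turn /= in_itv/= gerBl a0 andbT; lra.
have -> : expi (2 * pi - acos (Re z)) = conjc (expi (acos (Re z))) :> R[i].
  by rewrite addrC expi_periodic expiN.
by apply: complex_eq; rewrite ?ReJ ?ImJ /= ?acosK// sE ltr0_norm// opprK.
Qed.

Lemma circle_meanD u v : cc u -> cc v ->
  circle_mean (fun z => u z + v z) = circle_mean u + circle_mean v.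
Proof.
move=> cu cv; rewrite /circle_mean -mulrDr; congr (_ * _).
by apply: cintegralD; [exact: measurable_turn|exact: cc_integrable..].
Qed.

Lemma circle_meanZ a u : cc u -> circle_mean (fun z => a * u z) = a * circle_mean u.
Proof.
move=> cu; rewrite /circle_mean mulrCA; congr (_ * _).
by apply: cintegralZ; [exact: measurable_turn|exact: cc_integrable].
Qed.

Lemma circle_meanB u v : cc u -> cc v ->
  circle_mean (fun z => u z - v z) = circle_mean u - circle_mean v.
Proof.
move=> cu cv; rewrite -mulN1r -circle_meanZ// -circle_meanD//.
  by congr circle_mean; apply/funext => z; rewrite mulN1r.
by apply: ccM => //; exact: cc_cst.
Qed.

Lemma circle_mean_sum (I : Type) (s : seq I) (F : I -> R[i] -> R[i]) : (forall i, cc (F i)) ->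
  circle_mean (fun z => \sum_(i <- s) F i z) = \sum_(i <- s) circle_mean (F i).
Proof.
move=> cF; rewrite /circle_mean -mulr_sumr; congr (_ * _).
by apply: cintegral_sum; [exact: measurable_turn|move=> i; exact: cc_integrable].
Qed.

Lemma eq_circle_mean u v : (forall z, circle z -> u z = v z) -> circle_mean u = circle_mean v.
Proof.
move=> uv; rewrite /circle_mean; congr (_ * _); apply: eq_cintegral => t _.
exact: (uv _ (circle_expi t)).
Qed.

Lemma circle_meanJ u : cc u -> circle_mean (fun z => conjc (u z)) = conjc (circle_mean u).
Proof.
move=> cu; rewrite /circle_mean conjcM conjc_real; congr (_ * _).
by apply: cintegralJ; [exact: measurable_turn|exact: cc_integrable].
Qed.

Lemma circle_mean_cst a : circle_mean (fun=> a) = a :> R[i].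
Proof.
have E (c : R) : \int[leb]_(t in `[0%R, 2 * pi]) c = c * (2 * pi).
  by rewrite (@Rintegral_cst_itv R c 0 (2 * pi) true false (ltW twopi_gt0)) subr0.
rewrite /circle_mean /cintegral !E.
have P0 := gt_eqF twopi_gt0; move: (2 * pi) P0 => P P0.
by apply: complex_eq; rewrite !reimE /= !mul0r ?subr0 ?addr0 mulrCA mulVf ?P0// mulr1.
Qed.

Lemma circle_mean_le u (f : R -> R) : cc u ->
  leb.-integrable turn (EFin \o f) ->
  (forall t, turn t -> modulus (u (expi t)) <= f t) ->
  modulus (circle_mean u) <= (2 * pi)^-1 * \int[leb]_(t in turn) f t.
Proof.
move=> cu fi uf; have iu := cc_integrable cu.
rewrite modulusM modulus_real ger0_norm ?invr_ge0 ?(ltW twopi_gt0)//.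
rewrite ler_wpM2l ?invr_ge0 ?(ltW twopi_gt0)//.
apply: (@le_trans _ _ (\int[leb]_(t in turn) modulus (u (expi t)))).
  exact: (modulus_cintegral_le measurable_turn iu).
apply: le_Rintegral => //; first exact: measurable_turn.
exact: (integrable_modulus measurable_turn iu).
Qed.

Lemma circle_mean_ccvg (F : nat -> R[i] -> R[i]) u (B : R) : (forall n, cc (F n)) -> cc u ->
  (forall n z, circle z -> modulus (F n z) <= B) ->
  (forall z, circle z -> ccvg (F ^~ z) (u z)) ->
  ccvg (fun n => circle_mean (F n)) (circle_mean u).
Proof.
move=> cF cu FB Fu; apply: ccvgZ.
have := @cintegral_dct _ _ _ leb turn measurable_turn (fun n t => F n (expi t)) (fun t => u (expi t)) (cst B).
case=> //.
- by move=> n; exact: (cintegrable_measurable (cc_integrable (cF n))).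
- exact: (cintegrable_measurable (cc_integrable cu)).
- by apply: ae_all => t _; apply: Fu; exact: circle_expi.
- by apply: Rintegrable_cst; [exact: measurable_turn|exact: turn_finite].
- by apply: ae_all => t _ n; apply: FB; exact: circle_expi.
Qed.

Lemma circle_mean_expz (k : int) : circle_mean (fun z => z ^ k) = (k == 0)%:R :> R[i].
Proof.
have [->|k0] := eqVneq k 0.
  by under [X in circle_mean X]eq_fun do rewrite expr0z; rewrite circle_mean_cst.
have kR : k%:~R != 0 :> R by rewrite intr_eq0.
have e2 : expi (k%:~R * (2 * pi)) = 1 :> R[i] by rewrite -expiz expi_2pi exp1rz.
have [ec es] : cos (k%:~R * (2 * pi)) = 1 :> R /\ sin (k%:~R * (2 * pi)) = 0 :> R.
  by move: e2 => [-> ->].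
rewrite /circle_mean /=.
under eq_cintegral do rewrite expiz.
have dk (x : R) : is_derive x 1 (fun t => k%:~R * t) k%:~R.
  apply: (is_derive_eq (is_deriveZ k%:~R (is_derive_id x 1))); exact: mulr1.
have ck : continuous (fun t : R => k%:~R * t).
  by move=> x; apply: cvgM; [exact: cvg_cst|exact: cvg_id].
have ftc (f F : R -> R) : continuous f -> (forall x : R, is_derive x 1 F (f x)) ->
    F (2 * pi) = F 0 -> \int[leb]_(x in turn) f x = 0.
  move=> cf dF F0; rewrite /Rintegral (@continuous_FTC2 R f F 0 (2 * pi) twopi_gt0).
  - by rewrite F0 subee.
  - exact: continuous_subspaceT.
  - split.
    + by move=> x _; exact: (derivable_is_derive (dF x)).
    + apply: cvg_at_right_filter; apply: differentiable_continuous; apply/derivable1_diffP.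
      exact: (derivable_is_derive (dF 0)).
    + apply: cvg_at_left_filter; apply: differentiable_continuous; apply/derivable1_diffP.
      exact: (derivable_is_derive (dF (2 * pi))).
  - by move=> x _; exact: (derive1_is_derive (dF x)).
have Ec : \int[leb]_(t in turn) cos (k%:~R * t) = 0.
  apply: (ftc _ (fun t => k%:~R^-1 * sin (k%:~R * t))).
  - by move=> x; apply: continuous_comp; [exact: ck|exact: continuous_cos].
  - move=> x; have H := is_derive1_comp (is_derive_sin (k%:~R * x)) (dk x).
    have := is_deriveM (is_derive_cst (k%:~R^-1 : R) x 1) H.
    move/is_derive_eq; apply; rewrite scaler0 addr0.
    by rewrite -[LHS]/(k%:~R^-1 * (cos (k%:~R * x) * k%:~R)) mulrCA mulVf// mulr1.
  - by rewrite es mulr0 mulr0 sin0 mulr0.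
have Es : \int[leb]_(t in turn) sin (k%:~R * t) = 0.
  apply: (ftc _ (fun t => - k%:~R^-1 * cos (k%:~R * t))).
  - by move=> x; apply: continuous_comp; [exact: ck|exact: continuous_sin].
  - move=> x; have H := is_derive1_comp (is_derive_cos (k%:~R * x)) (dk x).
    have := is_deriveM (is_derive_cst (- k%:~R^-1 : R) x 1) H.
    move/is_derive_eq; apply; rewrite scaler0 addr0.
    by rewrite -[LHS]/((- k%:~R^-1) * (- sin (k%:~R * x) * k%:~R)) !mulNr mulrN opprK mulrCA mulVf// mulr1.
  - by rewrite ec mulr0 cos0.
rewrite /cintegral /expi /=.
rewrite -/turn Ec Es -[0 +i* 0]/(0 : R[i]) mulr0.
by [].
Qed.

Lemma circle_mul z w : circle z -> circle w -> circle (z * w).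
Proof. by move=> cz cw; rewrite /circle /= modulusM (cz : modulus z = 1) (cw : modulus w = 1) mul1r. Qed.

Lemma circleV z : circle z -> circle z^-1.
Proof. by move=> cz; rewrite /circle /= modulusV (cz : modulus z = 1) invr1. Qed.

Lemma circle_meanZr a u : cc u -> circle_mean (fun z => u z * a) = circle_mean u * a.
Proof.
by move=> cu; rewrite mulrC -circle_meanZ//; congr circle_mean; apply/funext => z; rewrite mulrC.
Qed.

Definition geom n w : R[i] := \sum_(0 <= j < n) w ^+ j.

Definition dirichlet n w : R[i] := 1 + psum (fun i => w ^ idx_int i) n.

(** Fejer's identity: summing Dirichlet kernels yields a squared modulus, hence a nonnegative
    kernel. In the induction the new products are [w ^+ n] times conjugates of lower powers, which
    [wg] evaluates. *)
Lemma geom_dirichlet n w : circle w ->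
  \sum_(0 <= k < n) dirichlet k w = geom n w * conjc (geom n w).
Proof.
move=> cw.
have ww k : w ^+ k * conjc (w ^+ k) = 1.
  by rewrite mulcJ modulusX (cw : modulus w = 1) expr1n expr1n.
have wg m : w ^+ m * conjc (geom m w) = \sum_(0 <= k < m) w ^+ k.+1.
  elim: m => [|m IH]; first by rewrite /geom !big_geq// conjc0 mulr0.
  rewrite /geom big_nat_recr//= conjcD mulrDr exprS -mulrA IH -mulrA ww mulr1.
  rewrite [in RHS]big_nat_recl//= expr1 addrC; congr (_ + _); rewrite mulr_sumr.
  by apply: eq_bigr => k _; rewrite [in RHS]exprS.
elim: n => [|n IH]; first by rewrite /geom !big_geq// mul0r.
rewrite big_nat_recr//= IH /geom [in RHS]big_nat_recr//= -/(geom n w) conjcD mulrDl !mulrDr ww.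
rewrite wg /dirichlet psumE big_split /=.
have -> : geom n w * conjc (w ^+ n) = conjc (w ^+ n * conjc (geom n w)).
  by rewrite conjcM conjcK mulrC.
rewrite wg [X in _ + (_ + (_ + X)) = _](_ : _ = conjc (\sum_(0 <= k < n) w ^+ k.+1)); last first.
  by rewrite conjc_sum; apply: eq_bigr => k _; exact: circle_Nexp.
rewrite [X in _ + (_ + (X + _)) = _](_ : _ = \sum_(0 <= k < n) w ^+ k.+1)//.
have R3 (A S T : R[i]) : A + (1 + (S + T)) = A + T + (S + 1) by ring.
exact: R3.
Qed.

Lemma geom_bound n w : circle w -> modulus (geom n w) * modulus (1 - w) <= 2.
Proof.
move=> cw; rewrite -modulusM.
have -> : geom n w * (1 - w) = 1 - w ^+ n.
  rewrite /geom; elim: n => [|n IH]; first by rewrite big_geq// mul0r expr0 subrr.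
  by rewrite big_nat_recr//= mulrDl IH exprS; ring.
apply: (le_trans (modulusB _ _)).
by rewrite modulusX (cw : modulus w = 1) expr1n -[1 in X in X + _]/(1%:C) modulus_real normr1.
Qed.

(** The Fejer kernel. *)
Definition fkernel n w : R := n.+1%:R^-1 * modulus (geom n.+1 w) ^+ 2.

Lemma fkernel_ge0 n w : 0 <= fkernel n w.
Proof. by rewrite mulr_ge0 ?sqr_ge0// invr_ge0. Qed.

Lemma fkernelE n w : circle w -> (fkernel n w)%:C = n.+1%:R^-1 * \sum_(0 <= k < n.+1) dirichlet k w.
Proof.
by move=> cw; rewrite geom_dirichlet// mulcJ real_complexM real_complexV real_complex_nat.
Qed.

Definition fsum u z n : R[i] :=
  fourier u 0 + psum (fun i => fourier u (idx_int i) * z ^ idx_int i) n.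

Definition fejer u n z : R[i] := n.+1%:R^-1 * \sum_(0 <= k < n.+1) fsum u z k.

Lemma cc_fejer u n : cc (fejer u n).
Proof.
apply: ccM; first exact: cc_cst.
apply: cc_sum => k; apply: ccD; first exact: cc_cst.
by apply: cc_sum => i; apply: ccM; [exact: cc_cst|exact: cc_expz].
Qed.

Lemma cc_rot z (k : int) : cc (fun w => (z * w^-1) ^ k).
Proof.
apply: (cc_eq (u := fun w => z ^ k * w ^ (- k))) => [w cw|].
  by rewrite expfzMl exprz_inv.
by apply: ccM; [exact: cc_cst|exact: cc_expz].
Qed.

Lemma cc_dirichlet z n : cc (fun w => dirichlet n (z * w^-1)).
Proof. by apply: ccD; [exact: cc_cst|apply: cc_sum => i; exact: cc_rot]. Qed.

Lemma cc_fkernel z n : circle z -> cc (fun w => (fkernel n (z * w^-1))%:C).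
Proof.
move=> cz; apply: (cc_eq (u := fun w => n.+1%:R^-1 * \sum_(0 <= k < n.+1) dirichlet k (z * w^-1))).
  by move=> w cw; rewrite fkernelE//; apply: circle_mul => //; exact: circleV.
by apply: ccM; [exact: cc_cst|apply: cc_sum => k; exact: cc_dirichlet].
Qed.

Lemma fsum_mean u z n : cc u -> circle z ->
  fsum u z n = circle_mean (fun w => u w * dirichlet n (z * w^-1)).
Proof.
move=> cu cz; rewrite /dirichlet.
have c1 i : cc (fun w => u w * (z * w^-1) ^ idx_int i) by apply: ccM => //; exact: cc_rot.
under [in RHS]eq_fun do rewrite mulrDr mulr1 /psum mulr_sumr.
rewrite circle_meanD//; last by apply: cc_sum.
rewrite circle_mean_sum//; congr (_ + _).
  by rewrite /fourier; congr circle_mean; apply/funext => w; rewrite oppr0 expr0z mulr1.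
apply: eq_bigr => i _; rewrite /fourier -circle_meanZr; last by apply: ccM => //; exact: cc_expz.
apply: eq_circle_mean => w cw; rewrite -mulrA; congr (_ * _).
by rewrite expfzMl exprz_inv mulrC.
Qed.

Lemma fejer_mean u n z : cc u -> circle z ->
  fejer u n z = circle_mean (fun w => u w * (fkernel n (z * w^-1))%:C).
Proof.
move=> cu cz; rewrite /fejer; under eq_bigr do rewrite fsum_mean//.
rewrite -circle_mean_sum => [|k]; last by apply: ccM => //; exact: cc_dirichlet.
rewrite -circle_meanZ; last by apply: cc_sum => k; apply: ccM => //; exact: cc_dirichlet.
apply: eq_circle_mean => w cw; rewrite fkernelE; last by apply: circle_mul => //; exact: circleV.
by rewrite -mulr_sumr mulrCA.
Qed.

Lemma fourier1 (k : int) : fourier (fun=> 1 : R[i]) k = (k == 0)%:R.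
Proof.
rewrite /fourier; under eq_fun do rewrite mul1r.
by rewrite circle_mean_expz oppr_eq0.
Qed.

Lemma idx_int_neq0 i : idx_int i != 0.
Proof. by case: i. Qed.

Lemma fkernel_mean n z : circle z -> circle_mean (fun w => (fkernel n (z * w^-1))%:C) = 1.
Proof.
move=> cz; have := fejer_mean n (cc_cst 1) cz.
under [in RHS]eq_fun do rewrite mul1r; move=> <-.
have E k : fsum (fun=> 1) z k = 1.
  rewrite /fsum fourier1 eqxx /psum big1 ?addr0// => i _.
  by rewrite fourier1 (negbTE (idx_int_neq0 i)) mul0r.
rewrite /fejer; under eq_bigr do rewrite E.
by rewrite big_const_nat iter_addr_0 subn0 -[_ *+ _]/(n.+1%:R) mulVf// pnatr_eq0.
Qed.

Lemma Re_circle_mean u : Re (circle_mean u) = (2 * pi)^-1 * \int[leb]_(t in turn) Re (u (expi t)).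
Proof. by rewrite /circle_mean !reimE mul0r subr0. Qed.

(** The Fejer kernel is nonnegative and has mean 1. *)
Lemma fejer_bound u n z (B : R) : cc u -> (forall w, circle w -> modulus (u w) <= B) ->
  circle z -> modulus (fejer u n z) <= B.
Proof.
move=> cu uB cz; rewrite fejer_mean//; have ck := cc_fkernel n cz.
apply: (le_trans (@circle_mean_le _ (fun t => B * fkernel n (z * (expi t)^-1)) _ _ _)).
- by apply: ccM.
- by apply: RintegrableZ; [exact: measurable_turn|have [] := cc_integrable ck].
- move=> t _; rewrite modulusM modulus_real ger0_norm ?fkernel_ge0// ler_wpM2r ?fkernel_ge0//.
  by apply: uB; exact: circle_expi.
rewrite RintegralZl//; [|exact: measurable_turn|by have [] := cc_integrable ck].
have := fkernel_mean n cz => /(congr1 (@complex.Re R)); rewrite Re_circle_mean.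
rewrite -[Re 1]/(1 : R) => E.
by rewrite mulrCA E mulr1.
Qed.

(** Near [z] continuity applies; at distance [d] or more, [geom_bound] bounds the kernel by
    [4 / d^2] times [1 / (n + 1)]. *)
Lemma fejer_cvg u z : cc u -> circle z -> ccvg (fun n => fejer u n z) (u z).
Proof.
move=> cu cz; have [B B0 uB] := cc_bounded cu.
apply/ccvgP => e e0; have e2 : 0 < e / 2 by lra.
have /ccP/(_ z cz _ e2)[d d0 Hd] := cu.
pose K : R := 2 * B * (4 / d ^+ 2).
have K0 : 0 <= K by rewrite !mulr_ge0// invr_ge0 sqr_ge0.
have uzB : modulus (u z) <= B + modulus (u z) by rewrite lerDr.
pose K' : R := 2 * (B + modulus (u z)) * (4 / d ^+ 2).
have K'0 : 0 <= K' by rewrite !mulr_ge0 ?addr_ge0 ?modulus_ge0// invr_ge0 sqr_ge0.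
have lim : K' * n.+1%:R^-1 @[n --> \oo] --> (0 : R).
  rewrite -(mulr0 K'); apply: cvgM; [exact: cvg_cst|exact: cvg_harmonic].
near=> n.
have Kn : K' * n.+1%:R^-1 < e / 2 by near: n; exact: (cvgr_lt _ lim).
have ck := cc_fkernel n cz.
have -> : fejer u n z - u z = circle_mean (fun w => (u w - u z) * (fkernel n (z * w^-1))%:C).
  rewrite -[u z in LHS]mulr1 -(fkernel_mean n cz) -circle_meanZ// fejer_mean//.
  rewrite -circle_meanB; [|by apply: ccM|by apply: ccM => //; exact: cc_cst].
  by congr circle_mean; apply/funext => w; rewrite mulrBl.
have iK : leb.-integrable turn (EFin \o (fun t => fkernel n (z * (expi t)^-1))).
  by have [] := cc_integrable ck.
apply: (le_lt_trans (@circle_mean_le _ (fun t => e / 2 * fkernel n (z * (expi t)^-1) + K' * n.+1%:R^-1) _ _ _)).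
- apply: ccM => //; apply: ccD => //; exact: cc_cst.
- apply: RintegrableD; first exact: measurable_turn.
    by apply: RintegrableZ; [exact: measurable_turn|].
  by apply: Rintegrable_cst; [exact: measurable_turn|exact: turn_finite].
- move=> t tt; rewrite modulusM modulus_real ger0_norm ?fkernel_ge0//.
  have ct := circle_expi t.
  have [near|far] := ltP (modulus (expi t - z)) d.
    have := ltW (Hd _ ct near) => H.
    apply: (@le_trans _ _ (e / 2 * fkernel n (z * (expi t)^-1))).
      by rewrite ler_wpM2r ?fkernel_ge0.
    by rewrite lerDl mulr_ge0// invr_ge0.
  apply: (@le_trans _ _ (K' * n.+1%:R^-1)); last first.
    by rewrite lerDr mulr_ge0 ?fkernel_ge0// ltW.
  have H1 : modulus (u (expi t) - u z) <= 2 * (B + modulus (u z)).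
    apply: (le_trans (modulusB _ _)); have := uB t tt; have := modulus_ge0 (u z); lra.
  have H2 : fkernel n (z * (expi t)^-1) <= 4 / d ^+ 2 * n.+1%:R^-1.
    rewrite /fkernel mulrC ler_wpM2r ?invr_ge0// ler_pdivlMr ?exprn_gt0//.
    have cw := circle_mul cz (circleV ct).
    have := geom_bound n.+1 cw.
    have -> : modulus (1 - z * (expi t)^-1) = modulus (expi t - z).
      have -> : 1 - z * (expi t)^-1 = (expi t - z) * (expi t)^-1.
        by rewrite mulrBl mulfV// expi_neq0.
      by rewrite modulusM modulusV modulus_expi invr1 mulr1.
    have g0 := modulus_ge0 (geom n.+1 (z * (expi t)^-1)).
    move: (modulus (geom _ _)) g0 => g g0 H.
    have gd : g * d <= 2 by apply: (le_trans _ H); rewrite ler_wpM2l.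
    have gd0 : 0 <= g * d by rewrite mulr_ge0// ltW.
    by rewrite -exprMn; nra.
  rewrite /K' -mulrA; apply: ler_pM => //; [exact: modulus_ge0|exact: fkernel_ge0].
have mT := measurable_turn.
rewrite RintegralD//; last 2 first.
- by apply: RintegrableZ.
- by apply: Rintegrable_cst; [|exact: turn_finite].
rewrite RintegralZl// (@Rintegral_cst_itv R _ 0 (2 * pi) true false (ltW twopi_gt0)) subr0.
have E : (2 * pi)^-1 * \int[leb]_(t in turn) fkernel n (z * (expi t)^-1) = 1.
  by have := fkernel_mean n cz => /(congr1 (@complex.Re R)); rewrite Re_circle_mean.
rewrite mulrDr mulrCA E mulr1 [(2 * pi)^-1 * _]mulrC mulfK ?gt_eqF ?twopi_gt0//.
by rewrite [X in _ < X](splitr e) ltrD2l.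
Unshelve. all: by end_near.
Qed.

(** Substitutes [phi] into the Fourier expansion of [u] at the level of Cesaro means, where
    boundedness and pointwise convergence hold for every continuous [u]. *)
Lemma circle_mean_fejer u (f phi : R[i] -> R[i]) n : cc f -> cc phi ->
  (forall z, circle z -> circle (phi z)) ->
  circle_mean (fun z => f z * fejer u n (phi z)) =
  n.+1%:R^-1 * \sum_(0 <= k < n.+1) (fourier u 0 * circle_mean f +
     psum (fun i => fourier u (idx_int i) * circle_mean (fun z => f z * phi z ^ idx_int i)) k).
Proof.
move=> cf cp pc; rewrite /fejer.
have c1 k : cc (fun z => f z * phi z ^ k) by apply: ccM => //; exact: ccXz.
have c2 a k : cc (fun z => a * (f z * phi z ^ k)) by apply: ccM => //; exact: cc_cst.
have c3 k : cc (fun z => \sum_(i <- ixs k) fourier u (idx_int i) * (f z * phi z ^ idx_int i)).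
  by apply: cc_sum => i; exact: c2.
have c0 : cc (fun z => fourier u 0 * f z) by apply: ccM => //; exact: cc_cst.
have c4 k : cc (fun z => fourier u 0 * f z +
    \sum_(i <- ixs k) fourier u (idx_int i) * (f z * phi z ^ idx_int i)) by apply: ccD.
rewrite (_ : (fun z => _) = (fun z => n.+1%:R^-1 * \sum_(0 <= k < n.+1) (fourier u 0 * f z +
    \sum_(i <- ixs k) fourier u (idx_int i) * (f z * phi z ^ idx_int i)))); last first.
  apply/funext => z; rewrite mulrCA; congr (_ * _); rewrite mulr_sumr; apply: eq_bigr => k _.
  rewrite /fsum /psum mulrDr mulrC mulr_sumr; congr (_ + _).
  by apply: eq_bigr => i _; rewrite mulrCA.
rewrite circle_meanZ; last by apply: cc_sum.
rewrite circle_mean_sum//; congr (_ * _); apply: eq_bigr => k _.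
rewrite circle_meanD// circle_mean_sum => [|i]; last exact: c2.
rewrite circle_meanZ//; congr (_ + _).
by apply: eq_bigr => i _; rewrite circle_meanZ.
Qed.

Lemma fourierJ u (k : int) : cc u -> conjc (fourier u k) = fourier (fun z => conjc (u z)) (- k).
Proof.
move=> cu; rewrite /fourier -circle_meanJ; last by apply: ccM => //; exact: cc_expz.
by apply: eq_circle_mean => z cz; rewrite conjcM circle_conj_expz.
Qed.

(** The mean of [conj u] times the Fejer means of [u] is an average of partial sums of squared
    coefficients, and it tends to the mean square of [u]. *)
Lemma parseval_le u (K : R) : cc u ->
  (forall n, modulus (fourier u 0) ^+ 2 + nsq (fun i => fourier u (idx_int i)) n <= K) ->
  Re (circle_mean (fun z => (modulus (u z) ^+ 2)%:C)) <= K.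
Proof.
move=> cu uK; have cJ := ccJ cu.
have E z : (modulus (u z) ^+ 2)%:C = conjc (u z) * u z by rewrite mulrC mulcJ.
under eq_fun do rewrite E.
have [B B0 uB] := cc_bounded cu.
have L : ccvg (fun n => circle_mean (fun z => conjc (u z) * fejer u n z)) (circle_mean (fun z => conjc (u z) * u z)).
  have [B' HB'] : exists B', forall z, circle z -> modulus (u z) <= B'.
    exists B => z cz; have [t tt ->] := circle_arg cz; exact: uB.
  apply: (circle_mean_ccvg (B := B' * B')).
  - by move=> n; apply: ccM => //; apply: cc_fejer.
  - exact: ccM.
  - move=> n z cz; rewrite modulusM modulusJ; apply: ler_pM; rewrite ?modulus_ge0 ?HB'//.
    exact: fejer_bound.
  - by move=> z cz; apply: ccvgZ; exact: fejer_cvg.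
have [L1 _] := L; rewrite -(cvg_lim _ L1)//; apply: limr_le; first exact: (cvgP _ L1).
apply: nearW => n; rewrite (circle_mean_fejer _ _ cJ cc_id)//.
have Ek k : fourier u 0 * circle_mean (fun z => conjc (u z)) +
    psum (fun i => fourier u (idx_int i) * circle_mean (fun z => conjc (u z) * z ^ idx_int i)) k =
    (modulus (fourier u 0) ^+ 2 + nsq (fun i => fourier u (idx_int i)) k)%:C.
  rewrite real_complexD -mulcJ [conjc (fourier u 0)]fourierJ// oppr0; congr (_ * _ + _).
    by congr circle_mean; apply/funext => z; rewrite oppr0 expr0z mulr1.
  by rewrite /nsq real_complex_sum; apply: eq_bigr => i _; rewrite -mulcJ fourierJ// /fourier opprK.
under eq_bigr do rewrite Ek.
rewrite -real_complex_sum -real_complex_nat -real_complexV -real_complexM Re_real.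
rewrite ler_pdivrMl ?ltr0n//.
apply: (@le_trans _ _ (\sum_(0 <= k < n.+1) K)); first by apply: ler_sum => k _; exact: uK.
by rewrite big_const_nat iter_addr_0 subn0 mulr_natl.
Qed.

End circle_functions.

(** * The logarithmic kernel and the composition matrix *)

Section log_series.
Context (R : realType).
Implicit Types (w : R[i]) (r t : R).

Lemma is_derive_power_sum (a : nat -> R) N t :
  is_derive t 1 (fun t : R => \sum_(0 <= n < N) n.+1%:R^-1 * t ^+ n.+1 * a n)
    (\sum_(0 <= n < N) t ^+ n * a n).
Proof.
elim: N => [|N IH].
  rewrite big_geq// (_ : (fun t => _) = cst 0); first exact: is_derive_cst.
  by apply/funext => s; rewrite big_geq.
rewrite big_nat_recr//= (_ : (fun t => _) = (fun t => \sum_(0 <= n < N) n.+1%:R^-1 * t ^+ n.+1 * a n)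
  \+ (fun t => N.+1%:R^-1 * a N * t ^+ N.+1)); last first.
  by apply/funext => s; rewrite big_nat_recr//= [_ * a N]mulrAC.
apply: is_deriveD.
have H := is_deriveZ (N.+1%:R^-1 * a N) (is_deriveX N.+1 (is_derive_id t 1)).
have -> : (fun t0 => N.+1%:R^-1 * a N * t0 ^+ N.+1) = (N.+1%:R^-1 * a N) \*: (id ^+ N.+1 : R -> R).
  by apply/funext => s; rewrite /= exprfctE.
apply: (is_derive_eq H).
rewrite -[LHS]/(N.+1%:R^-1 * a N * (N.+1%:R * t ^+ N * 1)) mulr1.
by rewrite mulrACA mulVf ?pnatr_eq0// mul1r mulrC.
Qed.

Definition poisson_log r w : R := - ln (modulus (1 - r%:C * w)).

Lemma modulus2_1B r w : modulus w = 1 ->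
  modulus (1 - r%:C * w) ^+ 2 = 1 - 2 * r * Re w + r ^+ 2.
Proof.
move=> w1; have : Re w ^+ 2 + Im w ^+ 2 = 1 by rewrite -modulus2 w1 expr1n.
by rewrite modulus2 !reimE /=; nra.
Qed.

Lemma modulus_1B_ge r w : 0 <= r -> modulus w = 1 -> 1 - r <= modulus (1 - r%:C * w).
Proof.
move=> r0 w1; have := modulusD (1 - r%:C * w) (r%:C * w).
by rewrite subrK modulusM modulus_real w1 mulr1 ger0_norm// -[1 in X in X <= _]/(1%:C) modulus_real normr1 -lerBlDr.
Qed.

Lemma modulus_1B_le r w : 0 <= r <= 1 -> modulus w = 1 -> modulus (1 - r%:C * w) <= 2.
Proof.
move=> /andP[r0 r1] w1; apply: (le_trans (modulusB _ _)).
rewrite modulusM modulus_real w1 mulr1 ger0_norm// -[1 in X in X + _]/(1%:C) modulus_real normr1; lra.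
Qed.

(** The derivative of the remainder in [t] is the real part of [w (t w)^N / (1 - t w)], a geometric
    tail of modulus at most [r^N / (1 - r)]; the mean value theorem concludes, uniformly in [w]. *)
Lemma poisson_log_series r w N : 0 <= r < 1 -> modulus w = 1 ->
  `|poisson_log r w - \sum_(0 <= n < N) n.+1%:R^-1 * r ^+ n.+1 * Re (w ^+ n.+1)| <= r ^+ N / (1 - r).
Proof.
move=> /andP[r0 r1] w1.
pose q t : R := 1 - 2 * t * Re w + t ^+ 2.
have q2 t : modulus (1 - t%:C * w) ^+ 2 = q t by exact: modulus2_1B.
have q0 t : 0 <= t -> t < 1 -> 0 < q t.
  move=> t0 t1; rewrite -q2 exprn_gt0//; apply: lt_le_trans (modulus_1B_ge t0 w1); lra.
(* The squared modulus [q] is a polynomial in [t], so the logarithm is differentiated through it;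
   this accounts for the factor 1/2. *)
pose g t : R := - (2^-1) * ln (q t) - \sum_(0 <= n < N) n.+1%:R^-1 * t ^+ n.+1 * Re (w ^+ n.+1).
have gE t : 0 <= t -> t < 1 -> g t = poisson_log t w - \sum_(0 <= n < N) n.+1%:R^-1 * t ^+ n.+1 * Re (w ^+ n.+1).
  move=> t0 t1; rewrite /g -q2 lnXn; last first.
    by apply: lt_le_trans (modulus_1B_ge t0 w1); lra.
  by rewrite /poisson_log mulr2n; congr (_ - _); field.
pose dg t : R := (Re w - t) / q t - \sum_(0 <= n < N) t ^+ n * Re (w ^+ n.+1).
have dq t : is_derive t 1 q (- 2 * Re w + 2 * t).
  have H := is_deriveD (is_deriveB (is_derive_cst (1 : R) t 1) (is_deriveZ (2 * Re w) (is_derive_id t 1))) (is_deriveX 2 (is_derive_id t (1 : R))).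
  have -> : q = ((cst 1 - 2 * Re w \*: id) + id ^+ 2)%R :> (R -> R).
    by apply/funext => s; rewrite /q -[RHS]/(1 - 2 * Re w * s + s ^+ 2); ring.
  apply: (is_derive_eq H).
  rewrite -[LHS]/(0 - 2 * Re w * 1 + 2%:R * t ^+ 1 * 1) expr1; ring.
have dgP t : 0 <= t -> t < 1 -> is_derive t 1 g (dg t).
  move=> t0 t1.
  have H1 := is_derive1_comp (is_derive1_ln (q0 t t0 t1)) (dq t).
  have H := is_deriveB (is_deriveZ (- (2^-1) : R) H1) (is_derive_power_sum (fun n => Re (w ^+ n.+1)) N t).
  apply: (is_derive_eq H).
  rewrite /dg; congr (_ - _).
  rewrite -[LHS]/(- 2^-1 * ((q t)^-1 * (- 2 * Re w + 2 * t))).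
  by field; rewrite gt_eqF// q0.
have dgb t : 0 <= t -> t <= r -> `|dg t| <= r ^+ N / (1 - r).
  move=> t0 tr; have t1 : t < 1 by exact: le_lt_trans r1.
  have n0 : 1 - t%:C * w != 0.
    by rewrite -modulus_gt0; apply: lt_le_trans (modulus_1B_ge t0 w1); lra.
  have E : dg t = Re (w * (t%:C * w) ^+ N / (1 - t%:C * w)).
    have E1 : (Re w - t) / q t = Re (w / (1 - t%:C * w)).
      have -> : w / (1 - t%:C * w) = (w - t%:C) * ((q t)^-1)%:C.
        apply: (mulIf n0); rewrite -mulrA mulVf// mulr1 -mulrA [((q t)^-1)%:C * _]mulrC mulrA.
        have wJ : w * conjc w = 1 by rewrite mulcJ w1 expr1n.
        have -> : w - t%:C = w * conjc (1 - t%:C * w).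
          have -> : conjc (1 - t%:C * w) = 1 - t%:C * conjc w.
            by apply: complex_eq; rewrite !reimE /=; ring.
          rewrite mulrBr mulr1; congr (_ - _).
          by rewrite mulrCA wJ mulr1.
        rewrite -[w * _ * _]mulrA [conjc _ * _]mulrC mulcJ q2 -mulrA -real_complexM.
        by rewrite mulfV ?mulr1// gt_eqF// q0.
      by rewrite !reimE /=; ring.
    have E2 : \sum_(0 <= n < N) t ^+ n * Re (w ^+ n.+1) = Re (w * (1 - (t%:C * w) ^+ N) / (1 - t%:C * w)).
      have -> : w * (1 - (t%:C * w) ^+ N) / (1 - t%:C * w) = \sum_(0 <= n < N) (t ^+ n)%:C * w ^+ n.+1.
        apply: (mulIf n0); rewrite divfK//.
        elim: (N) => [|n IH]; first by rewrite big_geq// mul0r expr0 subrr mulr0.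
        rewrite big_nat_recr//= mulrDl -IH real_complexX !exprS exprMn; ring.
      by rewrite Re_sum; apply: eq_bigr => n _; rewrite !reimE mul0r subr0.
    rewrite /dg E1 E2.
    have -> : w * (t%:C * w) ^+ N / (1 - t%:C * w) =
        w / (1 - t%:C * w) - w * (1 - (t%:C * w) ^+ N) / (1 - t%:C * w) by ring.
    by move: (w / _) (w * _ / _) => A B; rewrite !reimE.
  rewrite E; apply: (le_trans (Re_le_modulus _)).
  rewrite !modulusM modulusX modulusM modulus_real w1 mulr1 mul1r modulusV ger0_norm//.
  apply: ler_pM; rewrite ?exprn_ge0 ?invr_ge0 ?modulus_ge0//.
    by apply: lerXn2r.
  rewrite lef_pV2 ?posrE; last 2 first.
  - by rewrite modulus_gt0.
  - lra.
  by apply: le_trans (modulus_1B_ge t0 w1); lra.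
rewrite -gE//.
have [r00|rn0] := eqVneq r 0.
  have -> : g r = 0.
    rewrite gE// /poisson_log r00 mul0r subr0 -[1]/(1%:C) modulus_real normr1 ln1 oppr0 sub0r.
    by rewrite big1 ?oppr0// => n _; rewrite expr0n mulr0 mul0r.
  by rewrite normr0 divr_ge0 ?exprn_ge0// subr_ge0 ltW.
have rp : 0 < r by rewrite lt_neqAle eq_sym rn0.
have cg : {within `[0, r], continuous g}.
  apply: continuous_in_subspaceT => t; rewrite inE /= in_itv/= => /andP[t0 tr].
  apply: differentiable_continuous; apply/derivable1_diffP.
  by apply: (derivable_is_derive (dgP t t0 _)); exact: le_lt_trans r1.
have [|c] := MVT rp _ cg (df := dg).
  move=> t; rewrite in_itv/= => /andP[/ltW t0 tr]; apply: dgP => //; exact: lt_trans r1.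
rewrite in_itv/= => /andP[/ltW c0 /ltW cr].
have -> : g 0 = 0.
  rewrite gE// /poisson_log mul0r subr0 -[1]/(1%:C) modulus_real normr1 ln1 oppr0 sub0r.
  by rewrite big1 ?oppr0// => n _; rewrite expr0n mulr0 mul0r.
rewrite !subr0 => ->; rewrite normrM [`|r|]ger0_norm//.
apply: (@le_trans _ _ (`|dg c| * 1)); first by rewrite ler_wpM2l// ltW.
by rewrite mulr1 dgb.
Qed.

End log_series.

(** * Means over the torus *)

Section double_means.
Context (R : realType).
Local Notation leb := (@lebesgue_measure R).
Local Notation mu2 := (@plane_measure R).
Local Notation P2 := (measurableTypeR R * measurableTypeR R)%type.
Local Notation T := (@turn R).
Implicit Types (u v : R[i] -> R[i]).

Definition torus : set P2 := T `*` T.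

Lemma measurable_torus : @measurable _ P2 torus.
Proof. by apply: measurableX; exact: measurable_turn. Qed.

Lemma leb_turn : leb T = (2 * pi)%:E.
Proof. by rewrite [LHS]lebesgue_measure_itv/= lte_fin twopi_gt0 oppr0 adde0. Qed.

Lemma torus_measure : mu2 torus = ((2 * pi) ^+ 2)%:E.
Proof.
have := @product_measure1E _ _ (measurableTypeR R) (measurableTypeR R) R leb leb T T (@measurable_turn R) (@measurable_turn R).
by move=> E; rewrite [LHS]E [X in (X * _)%E]leb_turn [X in (_ * X)%E]leb_turn -EFinM.
Qed.

Lemma torus_finite : (mu2 torus < +oo)%E.
Proof. by rewrite torus_measure ltry. Qed.

Definition dmean (f : R -> R -> R[i]) : R[i] :=
  ((2 * pi) ^- 2)%:C * cintegral mu2 torus (fun p => f p.1 p.2).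

Lemma Rintegral_prod (a b : R -> R) : continuous a -> continuous b ->
  mu2.-integrable torus (EFin \o (fun p : P2 => a p.1 * b p.2)) /\
  \int[mu2]_(p in torus) (a p.1 * b p.2) = (\int[leb]_(t in T) a t) * (\int[leb]_(t in T) b t).
Proof.
move=> ca cb.
have [Ka Ka0 ba] := continuous_itv_bounded (@continuous_subspaceT _ _ `[0, 2 * pi] _ ca).
have [Kb Kb0 bb] := continuous_itv_bounded (@continuous_subspaceT _ _ `[0, 2 * pi] _ cb).
have ma : measurable_fun setT (fun p : P2 => a p.1).
  exact: (measurableT_comp (measurable_leb ca) measurable_fst).
have mb : measurable_fun setT (fun p : P2 => b p.2).
  exact: (measurableT_comp (measurable_leb cb) measurable_snd).
have iab : mu2.-integrable torus (EFin \o (fun p : P2 => a p.1 * b p.2)).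
  apply: (@Rintegrable_le _ P2 _ mu2 torus measurable_torus _ (cst (Ka * Kb))).
  - by apply: measurable_funTS; exact: measurable_funM.
  - by apply: Rintegrable_cst; [exact: measurable_torus|exact: torus_finite].
  - move=> p [/= p1 p2]; rewrite normrM; apply: ler_pM => //; [apply: ba|apply: bb].
      by move: p1; rewrite /turn /= in_itv.
    by move: p2; rewrite /turn /= in_itv.
split => //.
have i2 : mu2.-integrable setT (EFin \o ((fun p : P2 => a p.1 * b p.2) \_ torus)).
  by apply: Rintegrable_restrict; [exact: measurable_torus|exact: iab].
rewrite Rintegral_mkcond; apply: EFin_inj; rewrite (plane_Rintegral_y i2).
have ia : leb.-integrable T (EFin \o a).
  by apply: continuous_compact_integrable; [exact: segment_compact|exact: continuous_subspaceT].
have ib : leb.-integrable T (EFin \o b).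
  by apply: continuous_compact_integrable; [exact: segment_compact|exact: continuous_subspaceT].
have mT : @measurable _ (measurableTypeR R) T := @measurable_turn R.
rewrite [RHS](_ : _ = (\int[leb]_(y in T) (\int[leb]_(x in T) a x * b y)%:E)%E); last first.
  rewrite (@integral_EFin _ (measurableTypeR R) R leb T mT (fun y => (\int[leb]_(x in T) a x) * b y)).
    by rewrite RintegralZl.
  exact: RintegrableZ.
rewrite [RHS]integral_mkcond; apply: eq_integral => y _.
rewrite patchE; case: ifPn => yT; last first.
  rewrite (eq_integral (cst 0%E)) ?integral0// => x _; rewrite patchE ifF//.
  by apply/negbTE; apply: contra yT => /set_mem[_ /=]; exact: mem_set.
transitivity (\int[leb]_x ((fun x => a x * b y) \_ T x)%:E)%E.
  apply: eq_integral => x _; congr EFin; rewrite !patchE; congr (if _ then _ else _).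
  apply/idP/idP => /set_mem xT; apply/mem_set; first by case: xT.
  by split => //=; exact: set_mem.
have iay : leb.-integrable T (EFin \o (fun x => a x * b y)).
  by under eq_fun do rewrite mulrC; exact: RintegrableZ.
transitivity (\int[leb]_(x in T) (a x * b y)%:E)%E.
  by rewrite [RHS]integral_mkcond; apply: eq_integral => x _; rewrite !patchE; case: ifP.
rewrite integral_EFin//; congr EFin.
by under eq_Rintegral do rewrite mulrC; rewrite RintegralZl// mulrC.
Qed.

Lemma dmean_prod u v : cc u -> cc v ->
  cintegrable mu2 torus (fun p => u (expi p.1) * v (expi p.2)) /\
  dmean (fun s t => u (expi s) * v (expi t)) = circle_mean u * circle_mean v.
Proof.
move=> cu cv; have [u1 u2] := cc_slice cu; have [v1 v2] := cc_slice cv.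
have [i1 e1] := Rintegral_prod u1 v1; have [i2 e2] := Rintegral_prod u2 v2.
have [i3 e3] := Rintegral_prod u1 v2; have [i4 e4] := Rintegral_prod u2 v1.
split.
  split; under eq_fun do rewrite !reimE.
    by apply: RintegrableB => //; exact: measurable_torus.
  by apply: RintegrableD => //; exact: measurable_torus.
rewrite /dmean /circle_mean mulrACA -real_complexM -expr2 -exprVn; congr (_ * _).
have -> : cintegral mu2 torus (fun p => u (expi p.1) * v (expi p.2)) =
    (\int[mu2]_(p in torus) (Re (u (expi p.1)) * Re (v (expi p.2)) - Im (u (expi p.1)) * Im (v (expi p.2)))) +i*
    (\int[mu2]_(p in torus) (Re (u (expi p.1)) * Im (v (expi p.2)) + Im (u (expi p.1)) * Re (v (expi p.2)))).
  by rewrite /cintegral; congr (_ +i* _); apply: eq_Rintegral => p _; rewrite !reimE.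
have mT := measurable_torus.
rewrite RintegralB ?RintegralD// e1 e2 e3 e4.
by apply: complex_eq; rewrite !reimE.
Qed.

Lemma dmeanD f g : cintegrable mu2 torus (fun p => f p.1 p.2) ->
  cintegrable mu2 torus (fun p => g p.1 p.2) ->
  dmean (fun s t => f s t + g s t) = dmean f + dmean g.
Proof.
move=> cf cg; rewrite /dmean -mulrDr; congr (_ * _).
by apply: cintegralD => //; exact: measurable_torus.
Qed.

Lemma dmeanZ a f : cintegrable mu2 torus (fun p => f p.1 p.2) ->
  dmean (fun s t => a * f s t) = a * dmean f.
Proof.
move=> cf; rewrite /dmean mulrCA; congr (_ * _).
by apply: cintegralZ => //; exact: measurable_torus.
Qed.

Lemma dmean_sum (I : Type) (s : seq I) (F : I -> R -> R -> R[i]) :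
  (forall i, cintegrable mu2 torus (fun p => F i p.1 p.2)) ->
  dmean (fun x y => \sum_(i <- s) F i x y) = \sum_(i <- s) dmean (F i).
Proof.
move=> cF; rewrite /dmean -mulr_sumr; congr (_ * _).
by apply: cintegral_sum => //; exact: measurable_torus.
Qed.

(** For fixed [s], coincidence is possible only at [t = s] and at the ends 0 and [2 * pi] of the
    turn, a null set on each slice. *)
Lemma ae_expi_neq : {ae mu2, forall p : P2, torus p -> (expi p.1 : R[i]) != expi p.2}.
Proof.
have mD : measurable [set p : P2 | (expi p.1 : R[i]) != expi p.2].
  rewrite (_ : [set p : P2 | _] = [set p : P2 | 0 < (cos p.1 - cos p.2) ^+ 2 + (sin p.1 - sin p.2) ^+ 2]).
    have mf : measurable_fun [set: P2] (fun p : P2 => (cos p.1 - cos p.2) ^+ 2 + (sin p.1 - sin p.2) ^+ 2).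
      have mc := measurable_leb (@continuous_cos R); have ms := measurable_leb (@continuous_sin R).
      by apply: measurable_funD; apply: measurable_funX; apply: measurable_funB;
        apply: (measurableT_comp _ measurable_fst) || apply: (measurableT_comp _ measurable_snd).
    rewrite -[X in measurable X]setTI (_ : [set p : P2 | _] = (fun p : P2 => (cos p.1 - cos p.2) ^+ 2 + (sin p.1 - sin p.2) ^+ 2) @^-1` `]0, +oo[%classic).
      by apply: mf => //; exact: measurable_itv.
    by apply/seteqP; split => p /=; rewrite in_itv/= andbT.
  apply/seteqP; split => p /=.
    rewrite -subr_eq0 -modulus_gt0 => H; have := exprn_gt0 2 H.
    by rewrite modulus2 !reimE.
  by move=> H; apply/eqP => -[c12 s12]; move: H; rewrite c12 s12 !subrr expr0n /= addr0 ltxx.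
have inj (s t : R) : T s -> T t -> t != s -> t != 0 -> t != 2 * pi -> (expi s : R[i]) != expi t.
  rewrite /turn /= !in_itv/= => /andP[s0 s2] /andP[t0 t2] ts tn0 tn2; apply/eqP => E.
  have c1 : cos (t - s) = 1.
    have : (expi (t - s) : R[i]) = 1 by rewrite expiD -E -expiD subrr expi0.
    by case.
  have t0' : 0 < t by rewrite lt_neqAle eq_sym tn0.
  have t2' : t < 2 * pi by rewrite lt_neqAle tn2.
  (* Half angles: [cos (2 d) = 1 - 2 sin(d)^2] is less than 1, as [0 < d < pi]. *)
  pose d := `|t - s| / 2.
  have d0 : 0 < d by rewrite divr_gt0// normr_gt0 subr_eq0.
  have dpi : d < pi by rewrite /d ltr_pdivrMr// mulrC ltr_norml; apply/andP; split; lra.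
  have sd := sin_gt0_pi (introT andP (conj d0 dpi)).
  have : cos (d + d) = 1.
    by rewrite -splitr; have [_|_] := ger0P (t - s); rewrite ?cosN.
  rewrite cosD -!expr2 => H; have := cos2Dsin2 d; nra.
suff : {ae mu2, forall p : P2, (~` torus `|` [set p : P2 | (expi p.1 : R[i]) != expi p.2]) p}.
  by apply: ae_imply => p [|]//.
apply: ae_plane_x; first by apply: measurableU => //; apply: measurableC; exact: measurable_torus.
apply: ae_all => s.
have pt (c : R) : {ae leb, forall t : measurableTypeR R, t != c}.
  exists [set c]; split; [exact: measurable_set1|exact: lebesgue_measure_set1|].
  by move=> t /= /negP; rewrite negbK => /eqP.
have := ae_imply2 (fun (t : measurableTypeR R) (a : t != s) (b : t != 0) => conj a b) (pt s) (pt 0).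
move=> /(ae_imply2 (fun (t : measurableTypeR R) (a : t != 2 * pi) (b : t != s /\ t != 0) => conj a b) (pt (2 * pi))).
apply: ae_imply => t [t2 [ts t0]].
have [st|nst] := pselect (torus (s, t)); last by left.
by right; case: st => /= sT tT; exact: inj.
Qed.

End double_means.

(** Covers alike quasisymmetric maps, Moebius maps, their inverses and the identity. *)
Record circle_emb (R : realType) (phi : R[i] -> R[i]) : Prop := CircleEmb {
  ce_cc : cc phi;
  ce_circle : forall z, circle z -> circle (phi z);
  ce_inj : forall z w, circle z -> circle w -> phi z = phi w -> z = w }.

(** * Fourier coefficients of the logarithmic kernel *)

Section log_kernels.
Context (R : realType).
Local Notation leb := (@lebesgue_measure R).
Local Notation mu2 := (@plane_measure R).
Local Notation P2 := (measurableTypeR R * measurableTypeR R)%type.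
Local Notation T := (@turn R).
Implicit Types (phi : R[i] -> R[i]) (k l : int) (r : R).
Local Notation mT := (@measurable_torus R).
Local Notation torus := (@torus R).

Definition fc phi k (n : int) : R[i] := fourier (fun z => phi z ^ n) k.

(** The exponential occurring in [lambda phi k (- l)]. The sign of [l] makes the coefficients of a
    product kernel take the form [fc k * conj (fc l)]. *)
Definition mode k l (s t : R) : R[i] := expi s ^ (- k) * expi t ^ l.

(** The factor 1/2 comes from [Re W = (W + conj W) / 2], which spreads each power over an index and
    its opposite. *)
Definition wt r (i : idx) : R := r ^+ (irank i).+1 / (2 * (irank i).+1%:R).

(** The quotient of two values of [phi], since conjugation inverts on the circle. *)
Definition rel_arg phi (s t : R) : R[i] := phi (expi s) * conjc (phi (expi t)).

Lemma rel_arg1 phi s t : circle_emb phi -> modulus (rel_arg phi s t) = 1.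
Proof.
move=> [_ pc _]; rewrite modulusM modulusJ.
by rewrite (pc _ (circle_expi s) : modulus _ = 1) (pc _ (circle_expi t) : modulus _ = 1) mulr1.
Qed.

Lemma mode1 k l s t : modulus (mode k l s t) = 1.
Proof.
rewrite modulusM (circle_expz _ (circle_expi s) : modulus _ = 1).
by rewrite (circle_expz _ (circle_expi t) : modulus _ = 1) mulr1.
Qed.

Lemma series_psum phi r s t N : circle_emb phi ->
  (\sum_(0 <= n < N) n.+1%:R^-1 * r ^+ n.+1 * Re (rel_arg phi s t ^+ n.+1))%:C =
  psum (fun i => (wt r i)%:C * (phi (expi s) ^ idx_int i * conjc (phi (expi t) ^ idx_int i))) N.
Proof.
move=> [_ pc _]; rewrite psumE real_complex_sum; apply: eq_bigr => n _; rewrite /wt /=.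
rewrite -mulrDr.
have -> : phi (expi s) ^ (- n.+1%:Z) * conjc (phi (expi t) ^ (- n.+1%:Z)) =
    conjc (rel_arg phi s t ^+ n.+1).
  rewrite !circle_Nexp; try exact: (pc _ (circle_expi _)).
  by rewrite conjcK /rel_arg exprMn conjcM conjcX conjcX conjcK.
have -> : phi (expi s) ^ n.+1%:Z * conjc (phi (expi t) ^ n.+1%:Z) = rel_arg phi s t ^+ n.+1.
  by rewrite /rel_arg exprMn -conjcX.
have n0 : n.+1%:R != 0 :> R by rewrite pnatr_eq0.
move: (rel_arg phi s t ^+ n.+1) (n.+1%:R) n0 (r ^+ n.+1) => W c c0 rn.
by apply: complex_eq; rewrite !reimE /=; field.
Qed.

Lemma cmeasurable_prod (f g : P2 -> R[i]) : cmeasurable torus f -> cmeasurable torus g ->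
  cmeasurable torus (fun p => f p * g p).
Proof.
move=> [f1 f2] [g1 g2]; split.
  by under eq_fun do rewrite !reimE; apply: measurable_funB; exact: measurable_funM.
by under eq_fun do rewrite !reimE; apply: measurable_funD; exact: measurable_funM.
Qed.

Lemma cmeasurable_fst (u : R[i] -> R[i]) : cc u -> cmeasurable torus (fun p : P2 => u (expi p.1)).
Proof.
move=> /cc_slice[u1 u2]; split; apply: measurable_funTS.
  exact: (measurableT_comp (measurable_leb u1) measurable_fst).
exact: (measurableT_comp (measurable_leb u2) measurable_fst).
Qed.

Lemma cmeasurable_snd (u : R[i] -> R[i]) : cc u -> cmeasurable torus (fun p : P2 => u (expi p.2)).
Proof.
move=> /cc_slice[u1 u2]; split; apply: measurable_funTS.
  exact: (measurableT_comp (measurable_leb u1) measurable_snd).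
exact: (measurableT_comp (measurable_leb u2) measurable_snd).
Qed.

Lemma cmeasurable_mode k l : cmeasurable torus (fun p : P2 => mode k l p.1 p.2).
Proof.
apply: cmeasurable_prod.
  by apply: (@cmeasurable_fst (fun z => z ^ (- k))); exact: cc_expz.
by apply: (@cmeasurable_snd (fun z => z ^ l)); exact: cc_expz.
Qed.

Lemma cmeasurable_rel_arg phi : circle_emb phi -> cmeasurable torus (fun p : P2 => rel_arg phi p.1 p.2).
Proof.
move=> [cp _ _]; apply: cmeasurable_prod; first exact: cmeasurable_fst.
by apply: (@cmeasurable_snd (fun z => conjc (phi z))); exact: ccJ.
Qed.

Lemma cmeasurable_real (f : P2 -> R) : measurable_fun torus f -> cmeasurable torus (fun p => (f p)%:C).
Proof. by move=> mf; split => //; exact: measurable_cst. Qed.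

Lemma measurable_poisson_log_comp (W : P2 -> R[i]) r : cmeasurable torus W ->
  measurable_fun torus (fun p => poisson_log r (W p)).
Proof.
move=> [m1 m2]; apply: measurableT_comp => //; apply: (measurableT_comp (@measurable_ln R)).
apply: measurable_modulus; split.
  by under eq_fun do rewrite !reimE mul0r subr0; apply: measurable_funB => //; exact: measurable_funM.
by under eq_fun do rewrite !reimE mul0r addr0; apply: measurable_funB => //; exact: measurable_funM.
Qed.

Lemma measurable_poisson_log phi r : circle_emb phi ->
  measurable_fun torus (fun p : P2 => poisson_log r (rel_arg phi p.1 p.2)).
Proof. by move=> ep; apply: measurable_poisson_log_comp; exact: cmeasurable_rel_arg. Qed.

Lemma poisson_log_bound r w : 0 <= r < 1 -> modulus w = 1 -> `|poisson_log r w| <= (1 - r)^-1.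
Proof.
move=> r01 w1; have := poisson_log_series 0 r01 w1.
by rewrite big_geq// subr0 expr0 mul1r.
Qed.

Definition pker phi r k l s t : R[i] := (poisson_log r (rel_arg phi s t))%:C * mode k l s t.

(** For [r < 1] the partial sums of the kernel converge boundedly, which allows integration term by
    term; each term separates into a function of [s] and one of [t]. *)
Lemma pker_sum phi r k l : circle_emb phi -> 0 <= r < 1 ->
  isummable (fun i => (wt r i)%:C * (fc phi k (idx_int i) * conjc (fc phi l (idx_int i))))
    (dmean (pker phi r k l)).
Proof.
move=> ep r01; have [cp pc _] := ep; have /andP[r0 r1] := r01.
have cpz n : cc (fun z => phi z ^ n) by exact: ccXz.
have cx n : cc (fun z => phi z ^ n * z ^ (- k)) by apply: ccM => //; exact: cc_expz.
have cy n : cc (fun z => conjc (phi z ^ n) * z ^ l).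
  by apply: ccM; [exact: ccJ|exact: cc_expz].
pose F i (s t : R) : R[i] := (wt r i)%:C * ((phi (expi s) ^ idx_int i * expi s ^ (- k)) *
  (conjc (phi (expi t) ^ idx_int i) * expi t ^ l)).
have iF i : cintegrable mu2 torus (fun p => F i p.1 p.2).
  by apply: cintegrableZ; [exact: mT|exact: (dmean_prod (cx _) (cy _)).1].
have EF i : dmean (F i) = (wt r i)%:C * (fc phi k (idx_int i) * conjc (fc phi l (idx_int i))).
  rewrite dmeanZ; last exact: (dmean_prod (cx _) (cy _)).1.
  rewrite (dmean_prod (cx _) (cy _)).2; congr (_ * (_ * _)).
  rewrite /fc /fourier -circle_meanJ; last by apply: ccM => //; exact: cc_expz.
  by apply: eq_circle_mean => z cz; rewrite conjcM [conjc (z ^ _)]circle_conj_expz// opprK.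
rewrite /isummable (_ : psum _ = fun n => dmean (fun s t => \sum_(i <- ixs n) F i s t)); last first.
  by apply/funext => n; rewrite dmean_sum//; apply: eq_bigr => i _; rewrite EF.
have E n s t : \sum_(i <- ixs n) F i s t =
    (\sum_(0 <= m < n) m.+1%:R^-1 * r ^+ m.+1 * Re (rel_arg phi s t ^+ m.+1))%:C * mode k l s t.
  rewrite series_psum// /psum mulr_suml; apply: eq_bigr => i _; rewrite /F /mode -[RHS]mulrA.
  by congr (_ * _); rewrite mulrACA.
apply: ccvgZ.
have [] := @cintegral_dct _ P2 _ mu2 torus mT (fun n p => \sum_(i <- ixs n) F i p.1 p.2)
  (fun p => pker phi r k l p.1 p.2) (cst (2 * (1 - r)^-1)) => //.
- by move=> n; apply: cintegrable_measurable; apply: cintegrable_sum => //; exact: mT.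
- apply: cmeasurable_prod; last exact: cmeasurable_mode.
  by apply: cmeasurable_real; exact: measurable_poisson_log.
- apply: ae_all => p _; under eq_fun do rewrite E; rewrite /pker.
  apply: ccvgM; last exact: ccvg_cst.
  apply/ccvgP => e e0.
  have lim : r ^+ n / (1 - r) @[n --> \oo] --> (0 : R).
    rewrite -(mul0r (1 - r)^-1); apply: cvgM; last exact: cvg_cst.
    by apply: cvg_expr; rewrite ger0_norm.
  near=> n; rewrite -real_complexB modulus_real distrC.
  apply: (le_lt_trans (poisson_log_series n r01 (rel_arg1 _ _ ep))).
  by near: n; exact: (cvgr_lt _ lim).
- by apply: Rintegrable_cst; [exact: mT|exact: torus_finite].
- apply: ae_all => p _ n; rewrite E modulusM mode1 mulr1 modulus_real.
  have w1 := rel_arg1 p.1 p.2 ep.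
  have b0 := poisson_log_bound r01 w1; have bn := poisson_log_series n r01 w1.
  have : r ^+ n / (1 - r) <= (1 - r)^-1.
    by rewrite ler_piMl ?invr_ge0 ?exprn_ile1 ?(ltW r1)// subr_ge0 ltW.
  move: b0 bn; rewrite !ler_norml => /andP[h1 h2] /andP[h3 h4] h5; apply/andP; split; rewrite /=; lra.
Unshelve. all: by end_near.
Qed.

Definition logk phi (s t : R) : R := ln (modulus (phi (expi s) - phi (expi t))).

Lemma modulus_1B_rel_arg phi s t : circle_emb phi ->
  modulus (1 - rel_arg phi s t) = modulus (phi (expi s) - phi (expi t)).
Proof.
move=> [_ pc _]; have ct := pc _ (circle_expi t).
have -> : 1 - rel_arg phi s t = (phi (expi t) - phi (expi s)) * conjc (phi (expi t)).
  by rewrite mulrBl mulcJ (ct : modulus _ = 1) expr1n.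
by rewrite modulusM modulusJ (ct : modulus _ = 1) mulr1 modulusBC.
Qed.

Lemma measurable_logk phi : circle_emb phi -> measurable_fun torus (fun p : P2 => logk phi p.1 p.2).
Proof.
move=> ep; apply: (measurableT_comp (@measurable_ln R)); apply: measurable_modulus.
have [p1 p2] := cmeasurable_fst (ce_cc ep); have [q1 q2] := cmeasurable_snd (ce_cc ep).
by split; under eq_fun do rewrite !reimE; exact: measurable_funB.
Qed.

Definition rad (n : nat) : R := 1 - n.+1%:R^-1.

Lemma rad01 n : 0 <= rad n < 1.
Proof.
rewrite /rad; have : 0 < n.+1%:R^-1 :> R by rewrite invr_gt0.
have : n.+1%:R^-1 <= 1 :> R by rewrite invf_le1// ler1n.
by move: (n.+1%:R^-1 : R) => x *; apply/andP; split; lra.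
Qed.

Lemma rad_cvg : rad n @[n --> \oo] --> (1 : R).
Proof.
by rewrite -[X in _ --> X]subr0; apply: cvgB; [exact: cvg_cst|exact: cvg_harmonic].
Qed.

Lemma poisson_log_cvg phi s t : circle_emb phi -> phi (expi s) != phi (expi t) ->
  poisson_log (rad n) (rel_arg phi s t) @[n --> \oo] --> - logk phi s t.
Proof.
move=> ep st; apply: cvgN; rewrite /logk -modulus_1B_rel_arg//.
have m0 : 0 < modulus (1 - rel_arg phi s t).
  by rewrite modulus_1B_rel_arg// modulus_gt0 subr_eq0.
have H : ccvg (fun n => 1 - (rad n)%:C * rel_arg phi s t) (1 - 1 * rel_arg phi s t).
  apply: ccvgB; first exact: ccvg_cst.
  apply: ccvgM; last exact: ccvg_cst.
  by split; [exact: rad_cvg|exact: cvg_cst].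
move: H; rewrite mul1r => /ccvg_modulus H.
exact: (cvg_comp _ _ H (continuous_ln m0)).
Qed.

Lemma ln2_ge0 : 0 <= ln 2 :> R.
Proof. by rewrite ln_ge0// ler1n. Qed.

Lemma logk_le phi s t : circle_emb phi -> logk phi s t <= ln 2.
Proof.
move=> [_ pc _]; rewrite /logk; set m := modulus _.
(* When the two points coincide, [ln] takes its default value 0. *)
have [m0|m0] := ltP 0 m; last by rewrite ln0// ln2_ge0.
rewrite ler_ln ?posrE//; apply: (le_trans (modulusB _ _)).
by rewrite (pc _ (circle_expi s) : modulus _ = 1) (pc _ (circle_expi t) : modulus _ = 1).
Qed.

Lemma poisson_log_ge phi r s t : circle_emb phi -> 0 <= r < 1 -> - ln 2 <= poisson_log r (rel_arg phi s t).
Proof.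
move=> ep /andP[r0 r1]; have w1 := rel_arg1 s t ep.
have := modulus_1B_ge r0 w1; have := @modulus_1B_le R r _ (introT andP (conj r0 (ltW r1))) w1.
rewrite /poisson_log => m2 m0; rewrite lerN2 ler_ln ?posrE//; lra.
Qed.

(** A domination uniform in [r]: from [|1 - w| <= |1 - r w| + (1 - r)] and [1 - r <= |1 - r w|]
    follows [|1 - w| <= 2 |1 - r w|]. *)
Lemma poisson_log_le phi r s t : circle_emb phi -> 0 <= r < 1 -> phi (expi s) != phi (expi t) ->
  `|poisson_log r (rel_arg phi s t)| <= `|logk phi s t| + ln 2.
Proof.
move=> ep r01 st; have /andP[r0 r1] := r01; have w1 := rel_arg1 s t ep.
have lo := poisson_log_ge s t ep r01.
have m0 : 0 < modulus (1 - rel_arg phi s t).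
  by rewrite modulus_1B_rel_arg// modulus_gt0 subr_eq0.
have mr : 0 < modulus (1 - r%:C * rel_arg phi s t).
  by apply: lt_le_trans (modulus_1B_ge r0 w1); lra.
have half : modulus (1 - rel_arg phi s t) <= 2 * modulus (1 - r%:C * rel_arg phi s t).
  have -> : 1 - rel_arg phi s t = (1 - r%:C * rel_arg phi s t) - (1 - r)%:C * rel_arg phi s t.
    by rewrite real_complexB; ring.
  apply: (le_trans (modulusB _ _)); rewrite modulusM w1 mulr1 modulus_real ger0_norm; last by lra.
  by have := modulus_1B_ge r0 w1; lra.
have hi : poisson_log r (rel_arg phi s t) <= - logk phi s t + ln 2.
  have E : ln (2 * modulus (1 - r%:C * rel_arg phi s t)) = ln 2 + ln (modulus (1 - r%:C * rel_arg phi s t)).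
    by rewrite lnM ?posrE.
  move: half; rewrite -ler_ln ?posrE ?mulr_gt0// E /poisson_log /logk -modulus_1B_rel_arg//; lra.
have := ler_norm (logk phi s t); have := ler_norm (- logk phi s t); rewrite normrN => h1 h2.
by rewrite ler_norml; apply/andP; split; have := normr_ge0 (logk phi s t); lra.
Qed.

Lemma ae_phi_neq phi : circle_emb phi ->
  {ae mu2, forall p : P2, torus p -> phi (expi p.1) != phi (expi p.2)}.
Proof.
move=> [_ _ pi]; apply: ae_imply (@ae_expi_neq R) => p H Tp.
by apply: contra (H Tp) => /eqP E; apply/eqP; apply: pi E; exact: circle_expi.
Qed.

Definition log_int phi : Prop := mu2.-integrable torus (EFin \o (fun p : P2 => logk phi p.1 p.2)).

Lemma wt_ge0 r i : 0 <= r -> 0 <= wt r i.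
Proof. by move=> r0; rewrite divr_ge0 ?exprn_ge0// mulr_ge0. Qed.

Lemma wt_le1 r i : 0 <= r <= 1 -> wt r i <= wt 1 i.
Proof.
by move=> /andP[r0 r1]; rewrite ler_wpM2r ?invr_ge0 ?mulr_ge0// expr1n exprn_ile1.
Qed.

Lemma fc_sq phi k i : fc phi k i * conjc (fc phi k i) = (modulus (fc phi k i) ^+ 2)%:C.
Proof. exact: mulcJ. Qed.

(* Fatou's lemma along [r -> 1], for the constant Fourier mode. *)
Lemma log_integrable phi (K : R) : circle_emb phi ->
  (forall n, \sum_(i <- ixs n) wt 1 i * modulus (fc phi 0 (idx_int i)) ^+ 2 <= K) -> log_int phi.
Proof.
move=> ep sK.
have mlog := measurable_logk ep.
have ipl n : mu2.-integrable torus (EFin \o (fun p : P2 => poisson_log (rad n) (rel_arg phi p.1 p.2))).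
  apply: (@Rintegrable_le _ P2 _ mu2 torus mT _ (cst (1 - rad n)^-1)).
  - exact: measurable_poisson_log.
  - by apply: Rintegrable_cst; [exact: mT|exact: torus_finite].
  - by move=> p _; apply: poisson_log_bound; [exact: rad01|exact: rel_arg1].
have Kn n : (2 * pi) ^- 2 * \int[mu2]_(p in torus) poisson_log (rad n) (rel_arg phi p.1 p.2) <= K.
  have [L _] := pker_sum 0 0 ep (rad01 n).
  have -> : (2 * pi) ^- 2 * \int[mu2]_(p in torus) poisson_log (rad n) (rel_arg phi p.1 p.2) =
      Re (dmean (pker phi (rad n) 0 0)).
    rewrite /dmean /pker; under [X in cintegral _ _ X]eq_fun do rewrite /mode oppr0 !expr0z !mulr1.
    by rewrite (@cintegral_real _ P2 R mu2 torus mT) !reimE mul0r subr0.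
  rewrite -(cvg_lim _ L)//; apply: limr_le; first exact: (cvgP _ L).
  apply: nearW => m; apply: le_trans (sK m).
  rewrite Re_sum; apply: ler_sum => i _; rewrite fc_sq -real_complexM Re_real.
  by rewrite ler_wpM2r ?sqr_ge0// wt_le1//; have /andP[-> /ltW] := rad01 n.
(* Adding [ln 2] makes the kernels nonnegative, as Fatou's lemma requires. *)
have ig : mu2.-integrable torus (EFin \o (fun p : P2 => ln 2 - logk phi p.1 p.2)).
  apply: (@Rintegrable_ge0 _ P2 _ mu2 torus) => //.
  - by apply: measurable_funB.
  - by move=> p _; rewrite subr_ge0 logk_le.
  apply: (@le_lt_trans _ _ (((K + ln 2) * (2 * pi) ^+ 2)%:E)); last exact: ltry.
  apply: (@fatou_le _ P2 _ mu2 torus mT (fun n p => poisson_log (rad n) (rel_arg phi p.1 p.2) + ln 2)).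
  - by move=> n; apply: measurable_funD => //; exact: measurable_poisson_log.
  - exact: measurable_funB.
  - by move=> n p _; rewrite -lerBlDr sub0r poisson_log_ge// rad01.
  - apply: ae_imply (ae_phi_neq ep) => p H Tp; rewrite addrC.
    by apply: cvgD; [apply: poisson_log_cvg => //; exact: H|exact: cvg_cst].
  apply: nearW => n.
  have ic : mu2.-integrable torus (EFin \o (fun _ : P2 => ln 2 : R)).
    by apply: Rintegrable_cst; [exact: mT|exact: torus_finite].
  rewrite (@integral_EFin _ P2 R mu2 torus mT); last by apply: RintegrableD => //; exact: mT.
  rewrite lee_fin RintegralD//; last exact: mT.
  have -> : \int[mu2]_(p in torus) ln 2 = ln 2 * (2 * pi) ^+ 2 :> R.
    by rewrite Rintegral_cst; [rewrite [X in fine X]torus_measure|exact: mT].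
  rewrite [leRHS]mulrDl lerD2r -ler_pdivrMr ?exprn_gt0 ?twopi_gt0// mulrC.
  exact: Kn.
rewrite /log_int (_ : (fun p : P2 => logk phi p.1 p.2) = fun p => ln 2 - (ln 2 - logk phi p.1 p.2)); last first.
  by apply/funext => p; ring.
apply: RintegrableB => //; first exact: mT.
by apply: Rintegrable_cst; [exact: mT|exact: torus_finite].
Qed.

Definition lker phi k l s t : R[i] := (- logk phi s t)%:C * mode k l s t.

Lemma lker_lim phi k l : circle_emb phi -> log_int phi ->
  cintegrable mu2 torus (fun p => lker phi k l p.1 p.2) /\
  ccvg (fun n => dmean (pker phi (rad n) k l)) (dmean (lker phi k l)).
Proof.
move=> ep il.
have [] := @cintegral_dct _ P2 _ mu2 torus mT (fun n p => pker phi (rad n) k l p.1 p.2)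
  (fun p => lker phi k l p.1 p.2) (fun p => `|logk phi p.1 p.2| + ln 2).
- move=> n; apply: cmeasurable_prod; last exact: cmeasurable_mode.
  by apply: cmeasurable_real; exact: measurable_poisson_log.
- apply: cmeasurable_prod; last exact: cmeasurable_mode.
  by apply: cmeasurable_real; apply: measurableT_comp => //; exact: measurable_logk.
- apply: ae_imply (ae_phi_neq ep) => p H Tp; apply: ccvgM; last exact: ccvg_cst.
  by split; [apply: poisson_log_cvg => //; exact: H|exact: cvg_cst].
- apply: RintegrableD; [exact: mT|exact: (integrable_norm il)|].
  by apply: Rintegrable_cst; [exact: mT|exact: torus_finite].
- apply: ae_imply (ae_phi_neq ep) => p H Tp n; rewrite modulusM mode1 mulr1 modulus_real.
  by apply: poisson_log_le => //; [exact: rad01|exact: H].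
by move=> i1 c1; split => //; exact: ccvgZ.
Qed.

Lemma wt_cvg i : wt (rad n) i @[n --> \oo] --> wt 1 i.
Proof.
rewrite /wt; apply: cvgM; last exact: cvg_cst.
elim: (irank i).+1 => [|m IH]; first by under eq_fun do rewrite expr0; rewrite expr0; exact: cvg_cst.
under eq_fun do rewrite exprS; rewrite exprS; apply: cvgM => //; exact: rad_cvg.
Qed.

(** For [l = k] all terms are nonnegative, so a partial sum is at most the mean of the kernel for
    each [r < 1], and the inequality survives the limit. *)
Lemma fc_sq_bound phi k : circle_emb phi -> log_int phi ->
  exists K : R, forall n, \sum_(i <- ixs n) wt 1 i * modulus (fc phi k (idx_int i)) ^+ 2 <= K.
Proof.
move=> ep il; have [_ [L _]] := lker_lim k k ep il.
exists (Re (dmean (lker phi k k))) => N.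
have c1 : \sum_(i <- ixs N) wt (rad n) i * modulus (fc phi k (idx_int i)) ^+ 2 @[n --> \oo] -->
    \sum_(i <- ixs N) wt 1 i * modulus (fc phi k (idx_int i)) ^+ 2.
  elim: (ixs N) => [|i s IH].
    by under eq_fun do rewrite big_nil; rewrite big_nil; exact: cvg_cst.
  under eq_fun do rewrite big_cons; rewrite big_cons; apply: cvgD => //.
  by apply: cvgM; [exact: wt_cvg|exact: cvg_cst].
apply: (ler_cvg_to c1 L); apply: nearW => n.
have [M _] := pker_sum k k ep (rad01 n).
rewrite -(cvg_lim _ M)//; apply: limr_ge; first exact: (cvgP _ M).
exists N => // m /= Nm; rewrite Re_sum.
have r0 : 0 <= rad n by have /andP[] := rad01 n.
apply: (le_trans (ler_sum_ixs (f := fun i => wt (rad n) i * modulus (fc phi k (idx_int i)) ^+ 2) _ Nm)).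
  by move=> i; rewrite mulr_ge0 ?wt_ge0 ?sqr_ge0.
by apply: ler_sum => i _; rewrite fc_sq -real_complexM Re_real.
Qed.

(** At [r = 1] the series converges absolutely by the diagonal bounds [fc_sq_bound]. Its tails
    dominate those for all [r < 1], so the limit in [r] and the sum may be exchanged. *)
Lemma lker_sum phi k l : circle_emb phi -> log_int phi ->
  isummable (fun i => (wt 1 i)%:C * (fc phi k (idx_int i) * conjc (fc phi l (idx_int i))))
    (dmean (lker phi k l)).
Proof.
move=> ep il; have [_ L] := lker_lim k l ep il.
have [Kk Hk] := fc_sq_bound k ep il; have [Kl Hl] := fc_sq_bound l ep il.
set a := fun i => _.
have aK n : \sum_(i <- ixs n) modulus (a i) <= Kk + Kl.
  apply: (le_trans _ (lerD (Hk n) (Hl n))); rewrite -big_split; apply: ler_sum => i _.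
  change (modulus (a i) <= wt 1 i * modulus (fc phi k (idx_int i)) ^+ 2 + wt 1 i * modulus (fc phi l (idx_int i)) ^+ 2).
  rewrite /a modulusM [modulus (_ * conjc _)]modulusM modulusJ modulus_real ger0_norm ?wt_ge0// -mulrDr ler_wpM2l ?wt_ge0//.
  have := amgm (modulus (fc phi k (idx_int i))) (modulus (fc phi l (idx_int i))) (@ltr01 R).
  by rewrite invr1 !mul1r.
have [S HS] := abs_isummable aK.
suff -> : dmean (lker phi k l) = S by [].
apply/eqP; rewrite -subr_eq0 -modulus_eq0; apply/eqP/le_anti; rewrite modulus_ge0 andbT.
apply/ler_addgt0Pr => e e0; rewrite add0r.
pose A n := \sum_(i <- ixs n) modulus (a i).
have Amono n m : (n <= m)%N -> A n <= A m by apply: ler_sum_ixs => i; exact: modulus_ge0.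
have cA : cvgn A.
  by apply: nondecreasing_is_cvgn; [exact: Amono|exists (Kk + Kl) => _ [n _ <-]; exact: aK].
have e2 : 0 < e / 2 by lra.
have /cvgrPdist_lt /(_ _ e2) [N _ HN] := cA.
have tailA m : (N <= m)%N -> A m - A N <= e / 2.
  move=> Nm; have := HN N (leqnn N); rewrite /= ger0_norm ?subr_ge0; last first.
    exact: (nondecreasing_cvgn_le Amono cA).
  by have := nondecreasing_cvgn_le Amono cA m; lra.
(* One [N] serves all series dominated by [a], in particular those for every [r < 1]. *)
have tail (b : idx -> R[i]) s : (forall i, modulus (b i) <= modulus (a i)) -> isummable b s ->
    modulus (s - psum b N) <= e / 2.
  move=> ba bs; apply: (ccvg_modulus_le (ccvgB bs (ccvg_cst _))).
  exists N => // m /= Nm; apply: le_trans (tailA m Nm).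
  have E (V : zmodType) (f : idx -> V) : \sum_(i <- ixs m) f i - \sum_(i <- ixs N) f i =
      \sum_(i <- ixs m) (if (irank i < N)%N then 0 else f i).
    rewrite -(big_cut f Nm) -sumrB; apply: eq_bigr => i _.
    by case: ifP => _; rewrite ?subrr ?subr0.
  rewrite /A /psum !E; apply: (le_trans (modulus_sum _ _)); apply: ler_sum => i _.
  by case: ifP => _; rewrite ?modulus0.
have t1 := tail a S (fun i => lexx _) HS.
have t2 : modulus (dmean (lker phi k l) - psum a N) <= e / 2.
  pose b n i := (wt (rad n) i)%:C * (fc phi k (idx_int i) * conjc (fc phi l (idx_int i))).
  have cb : ccvg (fun n => psum (b n) N) (psum a N).
    apply: ccvg_sum => i; apply: ccvgM; last exact: ccvg_cst.
    by split; [exact: wt_cvg|exact: cvg_cst].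
  apply: (ccvg_modulus_le (ccvgB L cb)); apply: nearW => n.
  apply: tail; last exact: (pker_sum k l ep (rad01 n)).
  move=> i; rewrite /b /a modulusM [modulus (_%:C * _) in leRHS]modulusM !modulus_real; have /andP[r0 /ltW r1] := rad01 n.
  by rewrite !ger0_norm ?wt_ge0// ler_wpM2r ?mulr_ge0 ?modulus_ge0// wt_le1// r0.
have -> : dmean (lker phi k l) - S = (dmean (lker phi k l) - psum a N) - (S - psum a N) by ring.
by apply: (le_trans (modulusB _ _)); rewrite (splitr e) lerD.
Qed.

End log_kernels.

(** * Products of bounded matrices *)

Section matrix_algebra.
Context (R : realType).
Implicit Types (A B C D L : imx R) (x y h : idx -> R[i]).

Lemma bform_tr A M : bform A M -> bform (fun i j => A j i) M.
Proof.
move=> bA m u v; have := bA m v u; rewrite exchange_big /= addrC; congr (modulus _ <= _).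
by apply: eq_bigr => p _; apply: eq_bigr => q _; ring.
Qed.

Lemma ell2_col A M j : bform A M -> ell2 (A ^~ j).
Proof. by move=> /bform_tr/(bform_row_ell2 j). Qed.

Lemma half_op C L M h : bform C M ->
  (forall i j, L i j = 2^-1 * ((i == j)%:R - ip (C i) (imx_adj C ^~ j))) -> ell2 h ->
  imx_op L h = fun i => 2^-1 * (h i - imx_op C (imx_op (imx_adj C) h) i).
Proof.
move=> bC LE hh; apply/funext => i.
have bA := bform_adj bC; have rC := bform_row_ell2 i bC.
have E := ip_swap bA rC hh.
pose s j := ip (C i) (imx_adj C ^~ j).
have Sj : isummable (fun j => s j * h j) (imx_op C (imx_op (imx_adj C) h) i).
  have -> : imx_op C (imx_op (imx_adj C) h) i = ip (C i) (imx_op (imx_adj C) h) by [].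
  rewrite -E.
  have es : ell2 s.
    have -> : s = imx_op (fun j n => imx_adj C n j) (C i).
      by apply/funext => j; congr idx_sum; apply/funext => n; exact: mulrC.
    exact: imx_op_ell2 (bform_tr bA) rC.
  exact: (ip_summable es hh).
have Sd : isummable (fun j => (i == j)%:R * h j) (h i).
  have Z j : j != i -> (i == j)%:R * h j = 0 by rewrite eq_sym => /negbTE ->; rewrite mul0r.
  by have := isummable_single Z; rewrite eqxx mul1r.
apply: idx_sumE; have := isummableZ (2^-1) (isummableB Sd Sj).
by congr isummable; apply/funext => j; rewrite LE -mulrBl mulrA.
Qed.

Lemma cut_ell2 n x : ell2 (cut n x) /\ (forall m, nsq (cut n x) m <= nsq x n).
Proof.
have H m : nsq (cut n x) m <= nsq x n.
  rewrite -(nsq_cut x (leq_maxl n m)); apply: ler_sum_ixs (leq_maxr n m) => p; exact: sqr_ge0.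
by split => //; apply/ell2P; exists (nsq x n).
Qed.

Lemma imx_op_cut A n x p : imx_op A (cut n x) p = \sum_(q <- ixs n) A p q * x q.
Proof.
apply: idx_sumE.
have H : forall q, (n <= irank q)%N -> A p q * cut n x q = 0.
  by move=> q nq; rewrite /cut ltnNge nq mulr0.
have := isummable_finite H; congr isummable.
rewrite /psum big_seq [RHS]big_seq; apply: eq_bigr => q.
by rewrite mem_ixs /cut => ->.
Qed.

(** The form of the product at [x], [y] is the pairing of the transpose of [B] applied to [x] with
    [A y], and [imx_op_nsq] controls both vectors. *)
Lemma bform_mul A B D (M1 M2 : R) : bform A M1 -> bform B M2 ->
  (forall i j, D i j = ip (B i) (A ^~ j)) -> exists M, bform D M.
Proof.
move=> b1 b2 DE; have [N1 N10 B1] := bform_pos b1; have [N2 N20 B2] := bform_pos b2.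
exists (4 * N1 ^+ 2 + 4 * N2 ^+ 2) => n x y.
have BT := bform_tr B2.
have [ex nx] := cut_ell2 n x; have [ey ny] := cut_ell2 n y.
have e2x := imx_op_ell2 BT ex; have e1y := imx_op_ell2 B1 ey.
have F p : ell2 (B p) by exact: bform_row_ell2 B2.
have E : \sum_(p <- ixs n) \sum_(q <- ixs n) x p * D p q * y q =
    ip (imx_op (fun p q => B q p) (cut n x)) (imx_op A (cut n y)).
  have -> : ip (imx_op (fun p q => B q p) (cut n x)) (imx_op A (cut n y)) =
      \sum_(p <- ixs n) x p * ip (B p) (imx_op A (cut n y)).
    apply: idx_sumE.
    have -> : (fun m => imx_op (fun p q => B q p) (cut n x) m * imx_op A (cut n y) m) =
        (fun m => \sum_(p <- ixs n) x p * (B p m * imx_op A (cut n y) m)).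
      by apply/funext => m; rewrite imx_op_cut mulr_suml; apply: eq_bigr => p _; ring.
    rewrite /isummable (_ : psum _ = fun k => \sum_(p <- ixs n) x p * psum (fun m => B p m * imx_op A (cut n y) m) k); last first.
      by apply/funext => m; rewrite /psum exchange_big; apply: eq_bigr => p _; rewrite mulr_sumr.
    by apply: ccvg_sum => p; apply: ccvgZ; exact: (ip_summable (F p) e1y).
  apply: eq_bigr => p _; rewrite -(ip_swap B1 (F p) ey).
  have H q : (n <= irank q)%N -> ip (B p) (A ^~ q) * cut n y q = 0.
    by move=> nq; rewrite /cut ltnNge nq mulr0.
  rewrite (idx_sumE (isummable_finite H)) /psum mulr_sumr big_seq [RHS]big_seq; apply: eq_bigr => q.
  by rewrite mem_ixs /cut => ->; rewrite DE mulrA.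
rewrite E.
have n1 m := imx_op_nsq m N20 BT ex nx; have n2 m := imx_op_nsq m N10 B1 ey ny.
apply: (le_trans (ip_le ltr01 n1 n2)); rewrite invr1 !mul1r.
have := nsq_ge0 x n; have := nsq_ge0 y n; have := sqr_ge0 N1; have := sqr_ge0 N2; nra.
Qed.

End matrix_algebra.

(** * Entries of the composition matrix and of the welding matrix *)

Section matrix_entries.
Context (R : realType).
Implicit Types (phi : R[i] -> R[i]) (i j : idx) (k l : int).

(** The square root of [|idx_int i|], the norm of the corresponding power of [z] in the Sobolev
    space. *)
Definition sq i : R := Num.sqrt (irank i).+1%:R.

Lemma sq_gt0 i : 0 < sq i.
Proof. by rewrite sqrtr_gt0 ltr0n. Qed.

Lemma sq2 i : sq i ^+ 2 = (irank i).+1%:R.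
Proof. by rewrite sqr_sqrtr// ler0n. Qed.

Lemma normz_idx i : `|idx_int i| = (irank i).+1%:Z.
Proof. by case: i => n; rewrite /idx_int ?normrN. Qed.

Lemma idx_int_inj : injective idx_int.
Proof.
move=> [n|n] [m|m] //= => [[->]//|/oppr_inj[->]//].
Qed.

Lemma cc_pow phi k : circle_emb phi -> cc (fun z => phi z ^ k).
Proof. by move=> [cp pc _]; exact: ccXz. Qed.

Lemma fourierE (u v : R[i] -> R[i]) k : (forall z, circle z -> u z = v z) -> fourier u k = fourier v k.
Proof. by move=> uv; apply: eq_circle_mean => z cz; rewrite uv. Qed.

Lemma fourier_expz k l : fourier (fun z : R[i] => z ^ l) k = (l == k)%:R.
Proof.
rewrite -subr_eq0 -circle_mean_expz; apply: eq_circle_mean => z cz.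
by rewrite -expfzDr// circle_neq0.
Qed.

Lemma fourierZ (u : R[i] -> R[i]) a k : cc u -> fourier (fun z => a * u z) k = a * fourier u k.
Proof.
move=> cu; rewrite /fourier -circle_meanZ; last by apply: ccM => //; exact: cc_expz.
by congr circle_mean; apply/funext => z; rewrite mulrA.
Qed.

Lemma fourierB (u v : R[i] -> R[i]) k : cc u -> cc v ->
  fourier (fun z => u z - v z) k = fourier u k - fourier v k.
Proof.
move=> cu cv; have ce := @cc_expz R (- k).
rewrite /fourier -circle_meanB; [|exact: ccM..].
by congr circle_mean; apply/funext => z; rewrite mulrBl.
Qed.

Lemma fourier_sum (I : Type) (s : seq I) (F : I -> R[i] -> R[i]) k : (forall m, cc (F m)) ->
  fourier (fun z => \sum_(m <- s) F m z) k = \sum_(m <- s) fourier (F m) k.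
Proof.
move=> cF; rewrite /fourier -circle_mean_sum => [|m]; last by apply: ccM => //; exact: cc_expz.
by congr circle_mean; apply/funext => z; rewrite mulr_suml.
Qed.

Lemma fourier_cst a k : k != 0 -> fourier (fun=> a : R[i]) k = 0.
Proof.
move=> k0; have := fourierZ a k (cc_cst 1); rewrite fourier1 (negbTE k0) mulr0 => <-.
by apply: fourierE => z _; rewrite mulr1.
Qed.

Lemma fourier0 (u : R[i] -> R[i]) : fourier u 0 = circle_mean u.
Proof. by congr circle_mean; apply/funext => z; rewrite oppr0 expr0z mulr1. Qed.

Lemma Hdot_basisE j (z : R[i]) : Hdot_basis j z = ((sq j)^-1)%:C * z ^ idx_int j.
Proof. by rewrite /Hdot_basis normz_idx mulrC real_complexV. Qed.

(** Subtracting the mean changes only the Fourier coefficient at 0, and the inner product with a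
    basis vector keeps a single coefficient. *)
Lemma Cmx_entry phi i j : circle_emb phi ->
  Cmx phi i j = (sq i / sq j)%:C * fc phi (idx_int i) (idx_int j).
Proof.
move=> ep; have cp := cc_pow (idx_int j) ep.
have fb n : fourier (Hdot_basis (R := R) i) (idx_int n) = ((sq i)^-1)%:C * (i == n)%:R.
  rewrite (@fourierE _ (fun z => ((sq i)^-1)%:C * z ^ idx_int i)) => [|z _]; last exact: Hdot_basisE.
  by rewrite fourierZ; [rewrite fourier_expz (inj_eq idx_int_inj)|exact: cc_expz].
have fco : fourier (comp_op phi (Hdot_basis j)) (idx_int i) = ((sq j)^-1)%:C * fc phi (idx_int i) (idx_int j).
  rewrite /comp_op /=; set m := circle_mean _.
  rewrite (@fourierE _ (fun z => ((sq j)^-1)%:C * phi z ^ idx_int j - m)) => [|z _]; last by rewrite Hdot_basisE.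
  rewrite fourierB; [|by apply: ccM => //; exact: cc_cst|exact: cc_cst].
  by rewrite (fourier_cst m (idx_int_neq0 i)) subr0 fourierZ.
rewrite /Cmx /Hdot_inner.
set F := fun i0 => _.
have FE n : F n = `|idx_int n|%:~R * fourier (comp_op phi (Hdot_basis j)) (idx_int n) *
    conjc (fourier (Hdot_basis i) (idx_int n)) by [].
have F0 n : n != i -> F n = 0.
  by move=> ni; rewrite FE fb eq_sym (negbTE ni) mulr0 conjc0 mulr0.
rewrite (idx_sumE (isummable_single F0)) FE fco fb eqxx mulr1 conjc_real normz_idx.
rewrite -[_%:~R]/((irank i).+1%:R : R[i]) -real_complex_nat -sq2.
rewrite mulrAC -!real_complexM mulrA -real_complexM; congr (_%:C * _).
by field; rewrite !gt_eqF// sq_gt0.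
Qed.

Lemma circle_emb_id : circle_emb (id : R[i] -> R[i]).
Proof. by split => //; exact: cc_id. Qed.

Lemma fc_id k l : fc (id : R[i] -> R[i]) k l = (l == k)%:R.
Proof. exact: fourier_expz. Qed.

(** The denominator of the welding kernel is the kernel of the identity, for which all the means in
    [log_integrable] vanish. *)
Lemma log_int_id : log_int (id : R[i] -> R[i]).
Proof.
apply: (@log_integrable R _ 0 circle_emb_id) => n; rewrite big1// => i _.
by rewrite fc_id (negbTE (idx_int_neq0 i)) modulus0 expr0n mulr0.
Qed.

Lemma modeJ k l (s t : R) : conjc (mode k l s t) = mode (- k) (- l) s t.
Proof. by rewrite /mode conjcM !circle_conj_expz//; exact: circle_expi. Qed.

Lemma dmeanB f g : cintegrable (@plane_measure R) (@torus R) (fun p => f p.1 p.2) ->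
  cintegrable (@plane_measure R) (@torus R) (fun p => g p.1 p.2) ->
  dmean (fun s t => f s t - g s t) = dmean f - dmean g.
Proof.
move=> cf cg; rewrite -mulN1r -dmeanZ// -dmeanD//.
  by congr dmean; apply/funext => s; apply/funext => t; rewrite mulN1r.
by apply: cintegrableZ => //; exact: measurable_torus.
Qed.

Lemma lambda_lker phi k l : circle_emb phi -> log_int phi ->
  lambda phi k (- l) = (Num.sqrt `|k * - l|%:~R)%:C * (dmean (lker id k l) - dmean (lker phi k l)).
Proof.
move=> ep il; congr (_ * _).
have [i1 _] := lker_lim k l ep il; have [i0 _] := lker_lim k l circle_emb_id log_int_id.
rewrite -dmeanB//; congr (_ * _).
apply: eq_cintegral => p _.
have -> : expi (- (k%:~R * p.1 + (- l)%:~R * p.2)) = mode k l p.1 p.2.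
  by rewrite /mode !expiz -expiD; congr expi; rewrite !mulrNz; ring.
rewrite /lker -mulrBl -real_complexB; congr (_%:C * _).
(* On the diagonal the quotient is [0 / 0 = 0], and every logarithm takes the default value at 0. *)
rewrite /logk /log_kernel opprK; have [E|ne] := eqVneq (expi p.1 : R[i]) (expi p.2).
  by rewrite E !subrr mul0r addNr modulus0 ln0.
have ne' : phi (expi p.1) != phi (expi p.2).
  by apply: contra ne => /eqP H; apply/eqP; apply: (ce_inj ep) H; exact: circle_expi.
by rewrite modulusM modulusV ln_div ?posrE ?modulus_gt0 ?subr_eq0// addrC.
Qed.

(** The kernel is real, so conjugation changes the signs of both indices; this brings the four
    blocks of [Lambda] under one formula. *)
Lemma lambdaJ phi k l : circle_emb phi -> log_int phi ->
  conjc (lambda phi k l) = lambda phi (- k) (- l).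
Proof.
move=> ep il; have E1 := lambda_lker k (- l) ep il; rewrite opprK in E1.
rewrite E1 (lambda_lker (- k) l ep il).
have conj_lker (psi : R[i] -> R[i]) : circle_emb psi -> log_int psi ->
    conjc (dmean (lker psi k (- l))) = dmean (lker psi (- k) l).
  move=> ep' il'; have [i1 _] := lker_lim k (- l) ep' il'.
  rewrite /dmean conjcM conjc_real; congr (_ * _).
  rewrite -cintegralJ//; last exact: measurable_torus.
  by apply: eq_cintegral => p _; rewrite /lker conjcM conjc_real modeJ opprK.
rewrite conjcM conjc_real conjcB !conj_lker//; last 2 first.
- exact: circle_emb_id.
- exact: log_int_id.
by rewrite mulrNN.
Qed.

Lemma Lambda_lambda phi i j : circle_emb phi -> log_int phi ->
  Lambda phi i j = lambda phi (idx_int i) (- idx_int j).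
Proof.
move=> ep il; case: i j => n [m|m].
- by [].
- by rewrite /idx_int opprK.
- exact: (lambdaJ n.+1%:Z m.+1%:Z ep il).
- exact: (lambdaJ n.+1%:Z (- m.+1%:Z) ep il).
Qed.

Lemma Cmx_CmxJ phi i j n : circle_emb phi ->
  Cmx phi i n * conjc (Cmx phi j n) = (2 * (sq i * sq j))%:C *
    ((wt 1 n)%:C * (fc phi (idx_int i) (idx_int n) * conjc (fc phi (idx_int j) (idx_int n)))).
Proof.
move=> ep; rewrite !Cmx_entry// conjcM conjc_real mulrACA -real_complexM [RHS]mulrA -real_complexM; congr (_%:C * _).
by rewrite /wt expr1n -sq2; field; rewrite gt_eqF// sq_gt0.
Qed.

(** The kernel of [phi] contributes the product of the matrix with its adjoint, and the kernel of
    the identity contributes the Kronecker symbol. *)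
Lemma Lambda_sum phi i j : circle_emb phi -> log_int phi ->
  isummable (fun n => Cmx phi i n * conjc (Cmx phi j n)) ((i == j)%:R - 2 * Lambda phi i j).
Proof.
move=> ep il; rewrite (Lambda_lambda _ _ ep il) (lambda_lker _ _ ep il).
have H := isummableZ (2 * (sq i * sq j))%:C (lker_sum (idx_int i) (idx_int j) ep il).
rewrite (_ : (fun n => _) = (fun n => (2 * (sq i * sq j))%:C *
    ((wt 1 n)%:C * (fc phi (idx_int i) (idx_int n) * conjc (fc phi (idx_int j) (idx_int n)))))); last first.
  by apply/funext => n; rewrite Cmx_CmxJ.
suff -> : (i == j)%:R - 2 * ((Num.sqrt `|idx_int i * - idx_int j|%:~R)%:C *
    (dmean (lker id (idx_int i) (idx_int j)) - dmean (lker phi (idx_int i) (idx_int j)))) =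
    (2 * (sq i * sq j))%:C * dmean (lker phi (idx_int i) (idx_int j)) by [].
have -> : Num.sqrt `|idx_int i * - idx_int j|%:~R = sq i * sq j :> R.
  rewrite mulrN normrN normrM !normz_idx -sqrtrM// -natrM.
  by congr Num.sqrt; rewrite -PoszM.
have S := lker_sum (idx_int i) (idx_int j) circle_emb_id log_int_id.
have Z n : n != i -> (wt 1 n)%:C * (fc id (idx_int i) (idx_int n) * conjc (fc id (idx_int j) (idx_int n))) = 0 :> R[i].
  by move=> ni; rewrite fc_id (inj_eq idx_int_inj) (negbTE ni) mul0r mulr0.
rewrite -(idx_sumE S) (idx_sumE (isummable_single Z)) !fc_id eqxx (inj_eq idx_int_inj) mul1r.
have -> : conjc ((i == j)%:R : R[i]) = (i == j)%:R.
  by rewrite -[(i == j)%:R in LHS]real_complex_nat conjc_real real_complex_nat.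
have [->|ij] := eqVneq i j; last by rewrite !mulr0 sub0r [in LHS]real_complexM; ring.
rewrite mulr1 mulrBr mulrBr [2 * _ in X in 1 - (X - _)]mulrA.
have two : 2 * (sq j * sq j)%:C = (2 * (sq j * sq j))%:C :> R[i].
  by rewrite [in RHS]real_complexM; congr (_ * _); rewrite real_complex_nat.
rewrite two [2 * (_ * dmean _)]mulrA.
rewrite two.
rewrite -real_complexM /wt expr1n -sq2.
have -> : 2 * (sq j * sq j) * (1 / (2 * sq j ^+ 2)) = 1 by field; rewrite gt_eqF// sq_gt0.
by ring.
Qed.

Lemma Lambda_ip phi i j : circle_emb phi -> log_int phi ->
  Lambda phi i j = 2^-1 * ((i == j)%:R - ip (Cmx phi i) (imx_adj (Cmx phi) ^~ j)).
Proof.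
move=> ep il; have -> : ip (Cmx phi i) (imx_adj (Cmx phi) ^~ j) = (i == j)%:R - 2 * Lambda phi i j.
  exact: (idx_sumE (Lambda_sum i j ep il)).
by rewrite opprB addrC subrK mulrA mulVf ?mul1r// pnatr_eq0.
Qed.

Lemma circle_emb_comp phi1 phi2 : circle_emb phi1 -> circle_emb phi2 -> circle_emb (phi1 \o phi2).
Proof.
move=> [c1 p1 i1] [c2 p2 i2]; split.
- exact: cc_comp.
- by move=> z cz; apply: p1; exact: p2.
- by move=> z w cz cw /i1 H; apply: i2 => //; apply: H; exact: p2.
Qed.

(** The Fejer means of [phi1 ^ j] are composed with [phi2]. The sum over the intermediate index
    converges by boundedness, so its value is its Cesaro limit. *)
Lemma Cmx_comp phi1 phi2 (M1 M2 : R) i j : circle_emb phi1 -> circle_emb phi2 ->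
  bform (Cmx phi1) M1 -> bform (Cmx phi2) M2 ->
  Cmx (phi1 \o phi2) i j = ip (Cmx phi2 i) (Cmx phi1 ^~ j).
Proof.
move=> e1 e2 b1 b2; have [c1 p1 _] := e1; have [c2 p2 _] := e2.
have e12 := circle_emb_comp e1 e2.
have r2 := bform_row_ell2 i b2.
have r1 := ell2_col j b1.
have S := ip_summable r2 r1.
apply/esym; apply: (ccvg_unique (ccvg_cesaro S)).
pose u z := phi1 z ^ idx_int j; have cu : cc u by exact: cc_pow.
pose f z : R[i] := z ^ (- idx_int i); have cf : cc f by exact: cc_expz.
have [B B0 uB0] := cc_bounded cu.
have uB z : circle z -> modulus (u z) <= B.
  by move=> /circle_arg[t tt ->]; exact: uB0.
have L : ccvg (fun n => circle_mean (fun z => f z * fejer u n (phi2 z))) (circle_mean (fun z => f z * u (phi2 z))).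
  apply: (circle_mean_ccvg (B := B)).
  - move=> n; apply: ccM => //; exact: (cc_comp (cc_fejer u n) c2 p2).
  - by apply: ccM => //; exact: (cc_comp cu c2 p2).
  - move=> n z cz; rewrite modulusM (circle_expz _ cz : modulus _ = 1) mul1r.
    by apply: fejer_bound => //; exact: p2.
  - by move=> z cz; apply: ccvgZ; apply: fejer_cvg => //; exact: p2.
have E : circle_mean (fun z => f z * u (phi2 z)) = fc (phi1 \o phi2) (idx_int i) (idx_int j).
  by apply: eq_circle_mean => z _; rewrite mulrC.
(* The constant term of the expansion drops out, because the row index is nonzero. *)
have f0 : circle_mean f = 0.
  by rewrite /f circle_mean_expz oppr_eq0 (negbTE (idx_int_neq0 i)).
rewrite (Cmx_entry _ _ e12) -E.
have := ccvgZ (sq i / sq j)%:C L; congr (ccvg _ _); apply/funext => n.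
rewrite (circle_mean_fejer u n cf c2 p2) mulrCA; congr (_ * _).
rewrite mulr_sumr; apply: eq_bigr => k _; rewrite f0 mulr0 add0r /psum mulr_sumr.
apply: eq_bigr => m _; rewrite (Cmx_entry _ _ e1) (Cmx_entry _ _ e2) [RHS]mulrACA -real_complexM.
have -> : sq i / sq m * (sq m / sq j) = sq i / sq j by field; rewrite !gt_eqF// sq_gt0.
congr (_ * _); rewrite mulrC; congr (_ * _).
by apply: eq_circle_mean => z _; rewrite mulrC.
Qed.

Lemma bform_comp phi1 phi2 (M1 M2 : R) : circle_emb phi1 -> circle_emb phi2 ->
  bform (Cmx phi1) M1 -> bform (Cmx phi2) M2 -> exists M, bform (Cmx (phi1 \o phi2)) M.
Proof.
by move=> e1 e2 b1 b2; apply: (bform_mul b1 b2) => i j; exact: (Cmx_comp _ _ e1 e2 b1 b2).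
Qed.

End matrix_entries.

(** * Integrability of the kernel and the cocycle identity *)

Section mean_bound.
Context (R : realType).
Implicit Types (phi : R[i] -> R[i]) (i j : idx).

(** [G] is [g] shifted by one along the integers; the shift takes -1 to 0, which is no index, whence
    the value 0. The added terms are those at 1, [-(n + 1)] and [-(n + 2)]. *)
Lemma sum_shift (g G : idx -> R) n : (forall k, G (inl k) = g (inl k.+1)) -> G (inr 0%N) = 0 ->
  (forall k, G (inr k.+1) = g (inr k)) ->
  \sum_(i <- ixs n.+1) G i + (g (inl 0%N) + g (inr n) + g (inr n.+1)) = \sum_(i <- ixs n.+2) g i.
Proof.
move=> G1 G2 G3; elim: n => [|n IH].
  by rewrite /= !big_cons !big_nil G1 G2; ring.
have S (f : idx -> R) m : \sum_(i <- ixs m.+1) f i = \sum_(i <- ixs m) f i + (f (inl m) + f (inr m)).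
  have C : \sum_(i <- [:: inl m; inr m]) f i = f (inl m) + f (inr m).
    by rewrite 2!big_cons big_nil addr0.
  rewrite -[ixs m.+1]/(ixs m ++ [:: inl m; inr m]) -C; exact: big_cat.
by rewrite (S g n.+2) -IH (S G n.+1) G1 G3; ring.
Qed.

(** Otherwise all Fejer means are constant, hence [phi] is, against injectivity at 1 and -1. *)
Lemma nonconstant_coefficient phi : circle_emb phi ->
  exists i, fourier phi (idx_int i) != 0.
Proof.
move=> [cp pc pi]; apply: contrapT => H.
have F0 i : fourier phi (idx_int i) = 0.
  by apply/eqP/negPn/negP => ne; apply: H; exists i.
have cst z : circle z -> phi z = fourier phi 0.
  move=> cz; apply: (ccvg_unique (fejer_cvg cp cz)).
  rewrite (_ : (fun n => _) = fun=> fourier phi 0); first exact: ccvg_cst.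
  have E k : fsum phi z k = fourier phi 0.
    by rewrite /fsum /psum big1 ?addr0// => i _; rewrite F0 mul0r.
  apply/funext => n; rewrite /fejer; under eq_bigr do rewrite E.
  by rewrite big_const_nat iter_addr_0 subn0 -[fourier phi 0 *+ _]mulr_natl mulrA mulVf ?mul1r// pnatr_eq0.
have c1 : circle (1 : R[i]) by rewrite -expi0; exact: circle_expi.
have c2 : circle (- 1 : R[i]) by rewrite -[circle _]/(modulus (- 1) = 1) modulusN.
have := pi _ _ c1 c2; rewrite !cst// => /(_ erefl) /eqP.
by rewrite -subr_eq0 opprK -[1 + 1]/(2%:R) pnatr_eq0.
Qed.

(* [C] ignores the means of the powers of [phi]. They are recovered as follows:
   if [u] is a combination of these powers with mean [m], then [phi u] is again
   such a combination, and its coefficient at an index [k0] where [phi] has a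
   nonzero coefficient is that of [m phi] plus that of [phi (u - m)]. *)
Lemma mean_bound phi (M : R) : circle_emb phi -> bform (Cmx phi) M ->
  exists K : R, forall n, \sum_(i <- ixs n) wt 1 i * modulus (fc phi 0 (idx_int i)) ^+ 2 <= K.
Proof.
move=> ep /bform_pos[N N0 bC]; have [cp pc _] := ep.
have [i0 f0] := nonconstant_coefficient ep.
pose c0 i := fc phi 0 (idx_int i); pose w i : R := (irank i).+1%:R^-1.
have w0 i : 0 < w i by rewrite invr_gt0 ltr0n.
pose gam := modulus (fourier phi (idx_int i0)).
have gam0 : 0 < gam by rewrite modulus_gt0.
(* The sums of the coefficients and of the constant terms in the bounds [b2] and [bW] below. *)
pose al : R := 1 + 4 * N ^+ 2; pose be : R := 8 * N ^+ 2 + 1.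
have N2 := sqr_ge0 N.
have al0 : 0 < al by rewrite /al; lra.
have be0 : 0 < be by rewrite /be; lra.
have row n := bform_row i0 n N0 bC.
have cpw k := cc_pow k ep.
(* The left-hand side is linear in [t] and the first term on the right quadratic, so for small [t]
   the sum on the left absorbs the one on the right. *)
have key n (t : R) : 0 < t ->
    t * (\sum_(i <- ixs n) w i * modulus (c0 i) ^+ 2) * gam <=
    al * (t ^+ 2 * \sum_(i <- ixs n) w i * modulus (c0 i) ^+ 2) + be.
  move=> t0; set S := \sum_(i <- ixs n) _.
  (* The dual coefficients, for which the mean of [U] is [t * S]. *)
  pose a i : R[i] := (t * w i)%:C * conjc (c0 i).
  pose U z := \sum_(i <- ixs n) a i * phi z ^ idx_int i.
  have cai i : cc (fun z => a i * phi z ^ idx_int i) by apply: ccM => //; exact: cc_cst.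
  have cU : cc U by exact: cc_sum.
  have mU : circle_mean U = (t * S)%:C.
    rewrite circle_mean_sum// /S mulr_sumr real_complex_sum; apply: eq_bigr => i _.
    rewrite circle_meanZ// -fourier0 -/(fc phi 0 (idx_int i)) -/(c0 i) /a -mulrA.
    by rewrite [conjc _ * _]mulrC mulcJ -real_complexM mulrA.
  pose W z := U z - (t * S)%:C.
  have cW : cc W.
    by rewrite /W -[(t * S)%:C]opprK; under eq_fun do rewrite opprK; apply: ccD => //; exact: cc_cst.
  have W0 : fourier W 0 = 0.
    rewrite fourier0 circle_meanB//; last exact: cc_cst.
    by rewrite mU circle_mean_cst subrr.
  have WE k : fourier W (idx_int k) = \sum_(i <- ixs n) a i * fc phi (idx_int k) (idx_int i).
    rewrite fourierB//; last exact: cc_cst.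
    rewrite (fourier_cst _ (idx_int_neq0 k)) subr0 fourier_sum//; apply: eq_bigr => i _.
    by rewrite fourierZ.
  pose y i := a i * (sq R i)%:C.
  have yS : nsq y n = t ^+ 2 * S.
    rewrite /nsq /S mulr_sumr; apply: eq_bigr => i _.
    have wr : w i * (irank i).+1%:R = 1 by rewrite mulVf// pnatr_eq0.
    rewrite /y /a modulusM [modulus ((t * w i)%:C * _)]modulusM modulusJ !modulus_real.
    rewrite !exprMn !real_normK ?num_real// sq2 exprMn.
    by move: (modulus (c0 i)) ((irank i).+1%:R : R) wr => c rk wr; rewrite -[RHS]mulr1 -wr; ring.
  (* The weighted coefficients of [W] are the image of [y] under the matrix; boundedness and
     [parseval_le] then control the mean square of [W]. *)
  have WC k : imx_op (Cmx phi) (cut n y) k = (sq R k)%:C * fourier W (idx_int k).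
    rewrite imx_op_cut WE mulr_sumr; apply: eq_bigr => i _.
    rewrite (Cmx_entry _ _ ep) /y real_complexM real_complexV.
    have : (sq R i)%:C != 0 :> R[i] by rewrite -modulus_gt0 modulus_real gtr0_norm sq_gt0.
    by move=> s0; field.
  have [ey ny] := cut_ell2 n y.
  have Wsq m : modulus (fourier W 0) ^+ 2 + nsq (fun i => fourier W (idx_int i)) m <= 4 * N ^+ 2 * (t ^+ 2 * S).
    rewrite W0 modulus0 expr0n add0r -yS.
    apply: (le_trans _ (imx_op_nsq m N0 bC ey ny)); apply: ler_sum => k _.
    rewrite WC modulusM modulus_real exprMn real_normK ?num_real// sq2.
    by rewrite ler_peMl ?sqr_ge0// ler1n.
  have P := parseval_le cW Wsq.
  have cphW : cc (fun z => phi z * W z * z ^ (- idx_int i0)).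
    by apply: ccM; [exact: ccM|exact: cc_expz].
  have bW : modulus (fourier (fun z => phi z * W z) (idx_int i0)) <= 1 + 4 * N ^+ 2 * (t ^+ 2 * S).
    have cW2 : cc (fun z => (modulus (W z) ^+ 2)%:C).
      apply: (cc_eq (u := fun z => W z * conjc (W z))) => [z _|]; first exact: mulcJ.
      by apply: ccM => //; exact: ccJ.
    have [iW _] := cc_integrable cW2.
    have mT := @measurable_turn R.
    have i1 : (@lebesgue_measure R).-integrable (@turn R) (EFin \o (fun _ : R => 1 : R)).
      by apply: Rintegrable_cst; [exact: mT|exact: turn_finite].
    apply: (le_trans (circle_mean_le (f := fun t => 1 + modulus (W (expi t)) ^+ 2) cphW _ _)).
    - exact: (RintegrableD mT i1 iW).
    - move=> s _; rewrite !modulusM (circle_expz _ (circle_expi s) : modulus _ = 1) mulr1.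
      rewrite (pc _ (circle_expi s) : modulus _ = 1) mul1r.
      by have := sqr_ge0 (modulus (W (expi s)) - 1); have := modulus_ge0 (W (expi s)); nra.
    rewrite (RintegralD mT i1 iW) (@Rintegral_cst_itv R 1 0 (2 * pi) true false (ltW (twopi_gt0 R))) subr0 mul1r.
    rewrite mulrDr mulVf ?gt_eqF ?twopi_gt0// lerD2l.
    by move: P; rewrite Re_circle_mean.
  have id1 : fourier (fun z => phi z * U z) (idx_int i0) =
      (t * S)%:C * fourier phi (idx_int i0) + fourier (fun z => phi z * W z) (idx_int i0).
    rewrite /fourier -circle_meanZ; last by apply: ccM => //; exact: cc_expz.
    rewrite -circle_meanD//; last by apply: ccM; [exact: cc_cst|apply: ccM => //; exact: cc_expz].
    by congr circle_mean; apply/funext => z; rewrite /W; ring.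
  have id2 : fourier (fun z => phi z * U z) (idx_int i0) =
      \sum_(i <- ixs n) a i * fc phi (idx_int i0) (idx_int i + 1).
    rewrite (fourierE _ (v := fun z => \sum_(i <- ixs n) a i * phi z ^ (idx_int i + 1))) => [|z cz].
      rewrite fourier_sum => [|i]; last by apply: ccM; [exact: cc_cst|exact: cpw].
      by apply: eq_bigr => i _; rewrite fourierZ.
    rewrite /U mulr_sumr; apply: eq_bigr => i _.
    rewrite expfzDr; last by apply: circle_neq0; exact: pc.
    by rewrite expr1z; ring.
  pose g i : R := modulus (Cmx phi i0 i) ^+ 2.
  (* Multiplication by [phi] raises exponents by one, so the coefficients are read off row [i0]
     shifted by one place; exponent 0 contributes nothing at [i0]. *)
  pose G i : R := match i with inl k => g (inl k.+1) | inr 0%N => 0 | inr k.+1 => g (inr k) end.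
  have g_ge0 i : 0 <= g i by exact: sqr_ge0.
  have G_ge0 i : 0 <= G i by rewrite /G; case: i => [k|[|k]].
  (* The factor 2 comes from [k + 2 <= 2 (k + 1)]. *)
  have fG i : w i * modulus (fc phi (idx_int i0) (idx_int i + 1)) ^+ 2 <= 2 * G i.
    have fE m : modulus (fc phi (idx_int i0) (idx_int m)) ^+ 2 <= (irank m).+1%:R * g m.
      rewrite /g (Cmx_entry _ _ ep) modulusM exprMn modulus_real real_normK ?num_real//.
      rewrite exprMn exprVn !sq2; set f := modulus _ ^+ 2; have f_ge0 : 0 <= f by exact: sqr_ge0.
      have E : (irank m).+1%:R * ((irank i0).+1%:R / (irank m).+1%:R) = (irank i0).+1%:R :> R.
        by rewrite mulrCA mulfV ?mulr1// pnatr_eq0.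
      by rewrite mulrA E ler_peMl// ler1n.
    case: i => [k|[|k]].
    - rewrite -[idx_int (inl k)]/(k.+1%:Z) -[w _]/(k.+1%:R^-1 : R) -[G _]/(g (inl k.+1)).
      have -> : (k.+1%:Z + 1 = idx_int (inl k.+1))%R by rewrite /idx_int -PoszD addn1.
      have := fE (inl k.+1); rewrite -[irank (inl _)]/(k.+1).
      move: (modulus _ ^+ 2) (g (inl k.+1)) (g_ge0 (inl k.+1)) => f gk gk0 fk.
      rewrite mulrC ler_pdivrMr ?ltr0n//; apply: (le_trans fk).
      rewrite [leRHS](_ : _ = (2 * k.+1%:R) * gk); last by ring.
      by rewrite ler_wpM2r// -natrM ler_nat mul2n -addnn addSn ltnS addnS ltnS leq_addl.
    - rewrite -[idx_int (inr 0%N)]/(- 1%:Z) -[G _]/(0 : R) addNr mulr0 /fc (fourierE _ (v := fun=> 1)) => [|z _]; last exact: expr0z.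
      by rewrite fourier1 (negbTE (idx_int_neq0 i0)) modulus0 expr0n mulr0.
    - rewrite -[idx_int (inr k.+1)]/(- k.+2%:Z) -[w _]/(k.+2%:R^-1 : R) -[G _]/(g (inr k)).
      have -> : (- k.+2%:Z + 1 = idx_int (inr k))%R by rewrite /idx_int -[k.+2]addn1 PoszD opprD addrNK.
      have := fE (inr k); rewrite -[irank (inr _)]/k.
      move: (modulus _ ^+ 2) (g (inr k)) (g_ge0 (inr k)) => f gk gk0 fk.
      rewrite mulrC ler_pdivrMr ?ltr0n//; apply: (le_trans fk).
      rewrite [leRHS](_ : _ = (2 * k.+2%:R) * gk); last by ring.
      rewrite ler_wpM2r// -natrM ler_nat.
      by rewrite (leq_trans (leqnSn _))// leq_pmull.
  have sG : \sum_(i <- ixs n) G i <= 4 * N ^+ 2.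
    apply: (le_trans (ler_sum_ixs G_ge0 (leqnSn n))).
    apply: (le_trans _ (row n.+2)).
    rewrite /nsq -/g -(@sum_shift g G n)// lerDl.
    by rewrite !addr_ge0.
  have b2 : modulus (fourier (fun z => phi z * U z) (idx_int i0)) <= t ^+ 2 * S + 8 * N ^+ 2.
    rewrite id2; apply: (le_trans (modulus_sum _ _)).
    apply: (@le_trans _ _ (\sum_(i <- ixs n) (modulus (y i) ^+ 2 + 2 * G i))).
      apply: ler_sum => i _; apply: (@le_trans _ _ (modulus (y i) ^+ 2 + w i * modulus (fc phi (idx_int i0) (idx_int i + 1)) ^+ 2)); last by rewrite lerD2l.
      rewrite modulusM; set f := modulus (fc _ _ _).
      have yE : modulus (y i) ^+ 2 = (w i)^-1 * modulus (a i) ^+ 2.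
        by rewrite /y modulusM modulus_real exprMn real_normK ?num_real// sq2 /w invrK mulrC.
      have := @amgm R (w i)^-1 (modulus (a i)) f; rewrite invr_gt0 w0 => /(_ isT).
      by rewrite yE invrK.
    rewrite big_split /= -/(nsq y n) yS -mulr_sumr lerD2l.
    have := sG; lra.
  have E2 : modulus ((t * S)%:C * fourier phi (idx_int i0)) = t * S * gam.
    rewrite modulusM modulus_real ger0_norm// mulr_ge0 ?(ltW t0)//.
    by apply: sumr_ge0 => i _; rewrite mulr_ge0 ?sqr_ge0// ltW.
  rewrite -E2 (_ : _ * fourier phi _ = fourier (fun z => phi z * U z) (idx_int i0) -
    fourier (fun z => phi z * W z) (idx_int i0)); last by rewrite id1 addrK.
  by apply: (le_trans (modulusB _ _)); move: b2 bW; rewrite /al /be; lra.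
exists (4 * al * be / gam ^+ 2) => n.
(* This [t] makes the quadratic term half of the left-hand side. *)
have t0 : 0 < gam / (2 * al) by rewrite divr_gt0// mulr_gt0.
have := key n _ t0; set S := \sum_(i <- ixs n) _ => H.
have S0 : 0 <= S by apply: sumr_ge0 => i _; rewrite mulr_ge0 ?sqr_ge0// ltW.
have S1 : S <= 4 * al * be / gam ^+ 2.
  rewrite ler_pdivlMr ?exprn_gt0//.
  have E1 : gam / (2 * al) * S * gam = (S * gam ^+ 2) / (2 * al) by field; rewrite gt_eqF.
  have E2 : al * ((gam / (2 * al)) ^+ 2 * S) = (S * gam ^+ 2) / (4 * al) by field; rewrite gt_eqF.
  move: H; rewrite E1 E2 => H.
  have E3 : S * gam ^+ 2 / (2 * al) = S * gam ^+ 2 / (4 * al) + S * gam ^+ 2 / (4 * al) by field; rewrite gt_eqF.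
  move: H; rewrite E3 lerD2l ler_pdivrMr ?mulr_gt0// => H; apply: (le_trans H).
  by rewrite mulrC.
apply: (le_trans _ S1); apply: ler_sum => i _; rewrite ler_wpM2r ?sqr_ge0//.
by rewrite /wt expr1n mul1r /w lef_pV2 ?posrE ?mulr_gt0 ?ltr0n// ler_peMl ?ler1n.
Qed.

(** The property through which both quasisymmetric and Moebius maps enter the matrix algebra; it is
    stable under composition. *)
Definition good phi : Prop := circle_emb phi /\ exists M : R, bform (Cmx phi) M.

Lemma good_log_int phi : good phi -> log_int phi.
Proof. by move=> [ep [M /(mean_bound ep)[K HK]]]; exact: (log_integrable ep HK). Qed.

Lemma good_comp phi1 phi2 : good phi1 -> good phi2 -> good (phi1 \o phi2).
Proof.
move=> [e1 [M1 b1]] [e2 [M2 b2]]; split; first exact: circle_emb_comp.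
exact: (bform_comp e1 e2 b1 b2).
Qed.

Lemma op_mul (A B D : imx R) (M1 M2 : R) h : bform A M1 -> bform B M2 ->
  (forall i j, D i j = ip (B i) (A ^~ j)) -> ell2 h -> imx_op D h = imx_op B (imx_op A h).
Proof.
move=> bA bB DE hh; apply/funext => i; have := ip_swap bA (bform_row_ell2 i bB) hh.
by rewrite -[RHS]/(imx_op B (imx_op A h) i) => <-; congr idx_sum; apply/funext => j; rewrite DE.
Qed.

Lemma adj_ip (A B D : imx R) (M1 M2 : R) i j : bform A M1 -> bform B M2 ->
  (forall i j, D i j = ip (B i) (A ^~ j)) ->
  imx_adj D i j = ip (imx_adj A i) (imx_adj B ^~ j).
Proof.
move=> bA bB DE; rewrite -[LHS]/(conjc (D j i)) DE; apply/esym/idx_sumE.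
have := isummableJ (ip_summable (bform_row_ell2 j bB) (ell2_col i bA)).
by congr isummable; apply/funext => n; rewrite conjcM mulrC.
Qed.

(** With [P = C1 C1^adj] the identity reads [I - C2 P C2^adj = C2 (I - P) C2^adj + (I - C2 C2^adj)],
    halved. *)
Lemma Lambda_comp_op phi1 phi2 h : good phi1 -> good phi2 -> ell2 h ->
  imx_op (Lambda (phi1 \o phi2)) h =
  imx_op (Cmx phi2) (imx_op (Lambda phi1) (imx_op (imx_adj (Cmx phi2)) h)) + imx_op (Lambda phi2) h.
Proof.
move=> g1 g2 hh; have g12 := good_comp g1 g2.
have L1 := good_log_int g1; have L2 := good_log_int g2; have L12 := good_log_int g12.
have [e1 [M1 b1]] := g1; have [e2 [M2 b2]] := g2; have [e12 [M12 b12]] := g12.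
have half phi (M : R) k : circle_emb phi -> log_int phi -> bform (Cmx phi) M -> ell2 k ->
    imx_op (Lambda phi) k = fun i => 2^-1 * (k i - imx_op (Cmx phi) (imx_op (imx_adj (Cmx phi)) k) i).
  by move=> e L b; apply: (half_op b) => i j; exact: Lambda_ip.
have DE i j := Cmx_comp i j e1 e2 b1 b2.
have H1 k := half phi1 M1 k e1 L1 b1; have H2 k := half phi2 M2 k e2 L2 b2.
have H12 k := half _ M12 k e12 L12 b12.
move: (Lambda phi1) (Lambda phi2) (Lambda _) (Cmx phi1) (Cmx phi2) (Cmx (phi1 \o phi2)) b1 b2 b12 DE H1 H2 H12.
move=> L1' L2' L C1 C2 C b1 b2 b12 DE H1 H2 H12.
have a1 := bform_adj b1; have a2 := bform_adj b2.
have eg : ell2 (imx_op (imx_adj C2) h) by exact: imx_op_ell2 a2 hh.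
rewrite (H12 h hh) (H2 h hh) (H1 _ eg).
have eg1 : ell2 (imx_op (imx_adj C1) (imx_op (imx_adj C2) h)) by exact: imx_op_ell2 a1 eg.
have eg2 := imx_op_ell2 b1 eg1.
have adjE : imx_op (imx_adj C) h = imx_op (imx_adj C1) (imx_op (imx_adj C2) h).
  by apply: (op_mul a2 a1 _ hh) => i j; exact: (adj_ip i j b1 b2 DE).
rewrite adjE (op_mul b1 b2 DE eg1).
rewrite (imx_opB (2^-1) b2 eg eg2); apply/funext => i.
rewrite -[RHS]/(_ + _); ring.
Qed.

End mean_bound.

(** * Moebius maps *)

Section moebius.
Context (R : realType).
Implicit Types (phi : R[i] -> R[i]) (i j : idx).
Local Notation mT := (@measurable_torus R).
Local Notation mu2 := (@plane_measure R).
Local Notation P2 := (measurableTypeR R * measurableTypeR R)%type.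

(** A form of [Mob] that the inverse map is readily seen to satisfy. *)
Definition moebius (mu : R[i] -> R[i]) : Prop := circle_emb mu /\
  exists a b c d : R[i], a * d - b * c != 0 /\
    forall z, circle z -> mu z = (a * z + b) / (c * z + d).

Lemma homeo_emb phi : homeo circle circle phi -> circle_emb phi /\
  exists g : R[i] -> R[i], circle_emb g /\ (forall z, circle z -> g (phi z) = z /\ phi (g z) = z).
Proof.
move=> [cp [g [cg gp pg]]]; split.
  split; first exact: CC.
  - by move=> z /gp[].
  - by move=> z w /gp[_ zE] /gp[_ wE] E; rewrite -zE E wE.
exists g; split; last by move=> z cz; split; [exact: (gp z cz).2|exact: (pg z cz).2].
split; first exact: CC.
- by move=> z /pg[].
- by move=> z w /pg[_ zE] /pg[_ wE] E; rewrite -zE E wE.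
Qed.

Lemma Mob_moebius mu : Mob mu -> moebius mu /\
  exists g, moebius g /\ (forall z, circle z -> g (mu z) = z /\ mu (g z) = z).
Proof.
move=> [[hmu _] [a [b [c [d [D0 muE]]]]]]; have [emu [g [eg gmu]]] := homeo_emb hmu.
split; first by split => //; exists a, b, c, d.
exists g; split => //; split => //; exists d, (- b), (- c), a; split.
  by rewrite mulrNN mulrC.
move=> w cw; have [_ mgw] := gmu w cw; have cz := ce_circle eg cw.
move: mgw; rewrite muE// => E.
have den : c * g w + d != 0.
  apply/eqP => d0; have := circle_neq0 cw; rewrite -E d0 invr0 mulr0 eqxx//.
have E2 : a * g w + b = w * (c * g w + d) by rewrite -[X in _ = X * _]E divfK.
have E3 : g w * (- c * w + a) = d * w + - b.
  rewrite (_ : _ * _ = a * g w + b - w * (c * g w + d) + (d * w - b)); last by ring.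
  by rewrite E2 subrr add0r.
(* Otherwise [E3] gives [a = c w] and [b = d w], and the determinant vanishes. *)
have n0 : - c * w + a != 0.
  apply: contra_neq D0 => z0; move: E3; rewrite z0 mulr0 => /esym/eqP.
  rewrite addr_eq0 opprK => /eqP bE; move: z0; rewrite mulNr addrC => /eqP; rewrite subr_eq0 => /eqP aE.
  by rewrite aE -bE; ring.
by rewrite -E3 mulfK.
Qed.

Lemma cc_ln (c d : R[i]) : (forall z, circle z -> c * z + d != 0) ->
  cc (fun z => (ln (modulus (c * z + d)))%:C).
Proof.
move=> nz; apply/ccP => z cz e e0; have m0 : 0 < modulus (c * z + d) by rewrite modulus_gt0 nz.
have /cvgrPdist_lt /(_ _ e0) [r r0 Hr] := continuous_ln m0.
exists (r / (modulus c + 1)); first by rewrite divr_gt0// ltr_wpDl ?modulus_ge0.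
move=> w cw; rewrite ltr_pdivlMr ?ltr_wpDl ?modulus_ge0// => wz.
set p := ln _; set q := ln _; rewrite (_ : p%:C - q%:C = (p - q)%:C); last by rewrite real_complexB.
  rewrite modulus_real distrC; apply: Hr => /=.
have cwz : modulus (c * w - c * z) < r.
  rewrite -mulrBr modulusM; apply: le_lt_trans wz; rewrite mulrC ler_wpM2l ?modulus_ge0//.
  by rewrite lerDl.
apply: le_lt_trans cwz; rewrite distrC ler_norml; apply/andP; split.
  have := modulusD (c * w + d) (c * z - c * w).
  rewrite (_ : c * w + d + (c * z - c * w) = c * z + d); last by ring.
  by rewrite [modulus (c * z - c * w)]modulusBC; lra.
have := modulusD (c * z + d) (c * w - c * z).
rewrite (_ : c * z + d + (c * w - c * z) = c * w + d); last by ring.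
by lra.
Qed.

(* [mu z - mu w = (a d - b c) (z - w) / ((c z + d) (c w + d))]. *)
Lemma moebius_kernel mu : moebius mu -> exists (L : R) (q : R[i] -> R),
  cc (fun z => (q z)%:C) /\ {ae mu2, forall p : P2, torus p ->
    logk mu p.1 p.2 = L + logk id p.1 p.2 - q (expi p.1) - q (expi p.2)}.
Proof.
move=> [emu [a [b [c [d [D0 muE]]]]]].
have den z : circle z -> c * z + d != 0.
  move=> cz; apply/eqP => d0; have := circle_neq0 (ce_circle emu cz).
  by rewrite muE// d0 invr0 mulr0 eqxx.
exists (ln (modulus (a * d - b * c))), (fun z => ln (modulus (c * z + d))); split; first exact: cc_ln.
apply: ae_imply (ae_phi_neq (circle_emb_id R)) => p H Tp.
have ne : expi p.1 - expi p.2 != 0 :> R[i] by rewrite subr_eq0; exact: (H Tp).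
have n1 := den _ (circle_expi p.1); have n2 := den _ (circle_expi p.2).
have -> : logk mu p.1 p.2 = ln (modulus ((a * d - b * c) * (expi p.1 - expi p.2) /
    ((c * expi p.1 + d) * (c * expi p.2 + d)))).
  rewrite /logk !muE ?circle_expi//; try exact: circle_expi.
  by congr (ln (modulus _)); field; rewrite n1 n2.
rewrite !modulusM modulusV modulusM ln_div ?posrE ?mulr_gt0 ?modulus_gt0//.
by rewrite !lnM ?posrE ?modulus_gt0// /logk; ring.
Qed.

(** Integration in the variable absent from [u] leaves the mean of a nonconstant power. *)
Lemma dmean0_mode (u : R[i] -> R[i]) k l : k != 0 -> l != 0 -> cc u ->
  [/\ cintegrable mu2 (@torus R) (fun p => u (expi p.1) * mode k l p.1 p.2),
      cintegrable mu2 (@torus R) (fun p => u (expi p.2) * mode k l p.1 p.2),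
      dmean (fun s t => u (expi s) * mode k l s t) = 0 &
      dmean (fun s t => u (expi t) * mode k l s t) = 0].
Proof.
move=> k0 l0 cu.
have c1 : cc (fun z => u z * z ^ (- k)) by apply: ccM => //; exact: cc_expz.
have c2 : cc (fun z : R[i] => z ^ l) by exact: cc_expz.
have c3 : cc (fun z : R[i] => z ^ (- k)) by exact: cc_expz.
have c4 : cc (fun z => u z * z ^ l) by apply: ccM => //; exact: cc_expz.
have [i1 e1] := dmean_prod c1 c2; have [i2 e2] := dmean_prod c3 c4.
have E1 : (fun s t => u (expi s) * mode k l s t) = (fun s t => u (expi s) * expi s ^ (- k) * expi t ^ l).
  by apply/funext => s; apply/funext => t; rewrite mulrA.
have E2 : (fun s t => u (expi t) * mode k l s t) = (fun s t => expi s ^ (- k) * (u (expi t) * expi t ^ l)).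
  by apply/funext => s; apply/funext => t; rewrite mulrCA.
split.
- by move: i1; congr cintegrable; apply/funext => p; rewrite mulrA.
- by move: i2; congr cintegrable; apply/funext => p; rewrite mulrCA.
- by rewrite E1 e1 circle_mean_expz (negbTE l0) mulr0.
- by rewrite E2 e2 circle_mean_expz oppr_eq0 (negbTE k0) mul0r.
Qed.

Lemma cc_real_integrable (q : R[i] -> R) : cc (fun z => (q z)%:C) ->
  mu2.-integrable (@torus R) (EFin \o (fun p : P2 => q (expi p.1))) /\
  mu2.-integrable (@torus R) (EFin \o (fun p : P2 => q (expi p.2))).
Proof.
move=> cq; have [i1 _] := dmean_prod cq (cc_cst 1); have [i2 _] := dmean_prod (cc_cst 1) cq.
split.
  have [+ _] := i1; congr (mu2.-integrable _ _); apply/funext => p.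
  by rewrite -[LHS]/(Re ((q (expi p.1))%:C * 1))%:E mulr1.
have [+ _] := i2; congr (mu2.-integrable _ _); apply/funext => p.
by rewrite -[LHS]/(Re (1 * (q (expi p.2))%:C))%:E mul1r.
Qed.

Lemma moebius_Lambda0 mu i j : moebius mu -> log_int mu /\ Lambda mu i j = 0.
Proof.
move=> mmu; have [L [q [cq ae]]] := moebius_kernel mmu; have [emu _] := mmu.
have [q1 q2] := cc_real_integrable cq.
have iL : mu2.-integrable (@torus R) (EFin \o (fun _ : P2 => L)).
  by apply: Rintegrable_cst; [exact: mT|exact: torus_finite].
have li : log_int mu.
  have i3 := RintegrableB mT (RintegrableB mT (RintegrableD mT iL (@log_int_id R)) q1) q2.
  by move: (ae_Rintegrable mT (measurable_logk emu) ae i3).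
split => //; rewrite Lambda_lambda// lambda_lker//.
set k := idx_int i; set l := idx_int j.
suff -> : dmean (lker mu k l) = dmean (lker id k l) by rewrite subrr mulr0.
have [il _] := lker_lim k l emu li.
have [i0 _] := lker_lim k l (circle_emb_id R) (@log_int_id R).
have k0 : k != 0 by exact: idx_int_neq0.
have l0 : l != 0 by exact: idx_int_neq0.
have [j1 j2 z1 z2] := dmean0_mode k0 l0 cq.
have [j3 _ z3 _] := dmean0_mode k0 l0 (cc_cst L%:C).
pose G s t : R[i] := (lker id k l s t + (q (expi s))%:C * mode k l s t) +
  ((q (expi t))%:C * mode k l s t + (- L%:C) * mode k l s t).
have j4 : cintegrable mu2 (@torus R) (fun p => (- L%:C) * mode k l p.1 p.2).
  have := cintegrableN mT j3; congr cintegrable; apply/funext => p; by rewrite mulNr.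
have z4 : dmean (fun s t => (- L%:C) * mode k l s t) = 0.
  have := @dmeanZ R (-1) (fun s t => L%:C * mode k l s t) j3; rewrite z3 mulr0 => <-; congr dmean; apply/funext => s; apply/funext => t.
  by rewrite mulN1r mulNr.
have <- : dmean G = dmean (lker id k l).
  rewrite dmeanD; [|exact: (cintegrableD mT i0 j1)|exact: (cintegrableD mT j2 j4)].
  by rewrite dmeanD// dmeanD// z1 z2 z4 !addr0.
have iG := cintegrableD mT (cintegrableD mT i0 j1) (cintegrableD mT j2 j4).
congr (_ * _); have [m1 m2] := cintegrable_measurable il; have [g1 g2] := cintegrable_measurable iG.
have E : {ae mu2, forall p : P2, torus p -> lker mu k l p.1 p.2 = G p.1 p.2}.
  apply: ae_imply ae => p H Tp; rewrite /G /lker H// !real_complexN !real_complexB real_complexD; ring.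
apply: complex_eq; rewrite /cintegral /=; apply: ae_Rintegral => //; first exact: mT.
- by apply: ae_imply E => p H Tp; rewrite H.
- exact: mT.
- by apply: ae_imply E => p H Tp; rewrite H.
Qed.

Lemma delta_op (D : imx R) h : (forall i j, D i j = (i == j)%:R) -> imx_op D h = h.
Proof.
move=> DE; apply/funext => i; apply: idx_sumE.
have Z j : j != i -> D i j * h j = 0 by rewrite DE eq_sym => /negbTE ->; rewrite mul0r.
by have := isummable_single Z; rewrite DE eqxx mul1r.
Qed.

(** Orthonormal rows give the combination [v] of rows the squared norm [nsq x n]. This bounds the
    matrix of a Moebius map directly, without an extension to the disc. *)
Lemma coisometry_bform (C : imx R) :
  (forall i j, isummable (fun n => C i n * conjc (C j n)) ((i == j)%:R)) -> bform C 1.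
Proof.
move=> CC n x y; pose v q := \sum_(p <- ixs n) x p * C p q.
have S : isummable (fun q => v q * conjc (v q)) (nsq x n)%:C.
  have -> : (nsq x n)%:C = \sum_(p <- ixs n) \sum_(r <- ixs n) x p * conjc (x r) * (p == r)%:R.
    rewrite /nsq real_complex_sum; rewrite big_seq [RHS]big_seq; apply: eq_bigr => p pn.
    rewrite (bigD1_seq p) ?uniq_ixs//= eqxx mulr1 mulcJ big1_seq ?addr0// => r /andP[/negbTE rp _].
    by rewrite eq_sym rp mulr0.
  rewrite /isummable (_ : psum _ = fun m => \sum_(p <- ixs n) \sum_(r <- ixs n)
      x p * conjc (x r) * psum (fun q => C p q * conjc (C r q)) m); last first.
    apply/funext => m; rewrite /psum.
    under eq_bigr do rewrite /v conjc_sum mulr_suml.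
    rewrite exchange_big; apply: eq_bigr => p _.
    under eq_bigr do rewrite mulr_sumr.
    rewrite exchange_big; apply: eq_bigr => r _; rewrite mulr_sumr; apply: eq_bigr => q _.
    by rewrite conjcM; ring.
  apply: ccvg_sum => p; apply: ccvg_sum => r; apply: ccvgZ; exact: CC.
have vS : nsq v n <= nsq x n.
  have [S1 _] := S; rewrite -[nsq x n]/(Re (nsq x n)%:C) -(cvg_lim _ S1)//.
  apply: limr_ge; first exact: (cvgP _ S1).
  exists n => // m /= nm; rewrite Re_sum /nsq.
  apply: (le_trans (ler_sum_ixs (f := fun i => modulus (v i) ^+ 2) (fun i => sqr_ge0 _) nm)).
  by apply: ler_sum => q _; rewrite mulcJ Re_real.
have -> : \sum_(p <- ixs n) \sum_(q <- ixs n) x p * C p q * y q = \sum_(q <- ixs n) v q * y q.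
  by rewrite exchange_big; apply: eq_bigr => q _; rewrite /v mulr_suml.
rewrite mul1r; apply: (le_trans (modulus_sum _ _)).
apply: (@le_trans _ _ (nsq v n + nsq y n)); last by rewrite lerD2r.
rewrite /nsq -big_split; apply: ler_sum => q _; rewrite modulusM.
have := amgm (modulus (v q)) (modulus (y q)) (@ltr01 R).
by rewrite invr1 2!mul1r.
Qed.

Lemma moebius_good mu : moebius mu -> good mu /\
  (forall i j, (i == j)%:R = ip (Cmx mu i) (imx_adj (Cmx mu) ^~ j)).
Proof.
move=> mmu; have [emu _] := mmu.
have S i j : isummable (fun n => Cmx mu i n * conjc (Cmx mu j n)) ((i == j)%:R).
  have [li L0] := moebius_Lambda0 i j mmu.
  by have := Lambda_sum i j emu li; rewrite L0 mulr0 subr0.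
split; first by split => //; exists 1; exact: coisometry_bform.
by move=> i j; apply/esym/idx_sumE; exact: S.
Qed.

Lemma Cmx_inverse (mu nu : R[i] -> R[i]) i j : circle_emb mu -> circle_emb nu ->
  (forall z, circle z -> mu (nu z) = z) -> Cmx (mu \o nu) i j = (i == j)%:R.
Proof.
move=> emu enu E; rewrite (Cmx_entry _ _ (circle_emb_comp emu enu)).
rewrite /fc (fourierE _ (v := fun z => z ^ idx_int j)) => [|z cz]; last by rewrite /= E.
rewrite fourier_expz (inj_eq idx_int_inj) eq_sym; have [->|_] := eqVneq i j; last by rewrite mulr0.
by rewrite mulfV ?gt_eqF ?sq_gt0// mulr1.
Qed.

Lemma moebius_unitary (mu : R[i] -> R[i]) : Mob mu -> imx_unitary (Cmx mu).
Proof.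
move=> /Mob_moebius[mmu [g [mg gE]]].
have [[emu [M bM]] I1] := moebius_good mmu; have [[eg [N bN]] _] := moebius_good mg.
have bA := bform_adj bM.
have CA h : ell2 h -> imx_op (Cmx mu) (imx_op (imx_adj (Cmx mu)) h) = h.
  move=> hh; rewrite -(op_mul bA bM (D := fun i j => (i == j)%:R) I1 hh); exact: delta_op.
have GC h : ell2 h -> imx_op (Cmx g) (imx_op (Cmx mu) h) = h.
  move=> hh; rewrite -(op_mul bM bN (D := Cmx (mu \o g)) _ hh) => [|i j].
    by apply: delta_op => i j; apply: Cmx_inverse => // z cz; have [] := gE z cz.
  exact: (Cmx_comp i j emu eg bM bN).
clear I1; move: (Cmx mu) (Cmx g) bM bN bA CA GC => A B bM bN bA CA GC.
split; first exact: bform_bounded bM; last exact: CA.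
move=> h hh; have eC := imx_op_ell2 bM hh; have eA := imx_op_ell2 bA eC.
(* With [B] a left inverse of [A]: [A^adj A h = B A A^adj A h = B A h = h]. *)
by rewrite -[LHS](GC _ eA) (CA _ eC) GC.
Qed.

Lemma Lambda_comp_moebius phi mu h : good phi -> Mob mu -> ell2 h ->
  imx_op (Lambda (phi \o mu)) h =
  imx_op (Cmx mu) (imx_op (Lambda phi) (imx_op (imx_adj (Cmx mu)) h)).
Proof.
move=> gp /Mob_moebius[mmu _] hh; have [gmu _] := moebius_good mmu.
have Z : imx_op (Lambda mu) h = fun=> 0.
  apply/funext => i; apply: idx_sumE.
  rewrite (_ : (fun j => _) = fun=> 0); last first.
    by apply/funext => j; have [_ ->] := moebius_Lambda0 i j mmu; rewrite mul0r.
  have := @isummable_finite R (fun=> 0) 0 (fun _ _ => erefl); by rewrite /psum big_nil.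
rewrite (Lambda_comp_op gp gmu hh) Z; apply/funext => i; exact: addr0.
Qed.

End moebius.

(** * Dirichlet energy of polynomials in a quasiconformal map *)

Section jets.
Context (R : realType).
Local Notation leb := (@lebesgue_measure R).
Local Notation mu2 := (@plane_measure R).
Local Notation P2 := (measurableTypeR R * measurableTypeR R)%type.
Implicit Types (W V : R * R -> R[i]) (p : R * R) (F G : R * R -> R).

Definition pcont W := continuous (fun p => Re (W p)) /\ continuous (fun p => Im (W p)).

Lemma pcont_cst c : pcont (fun=> c).
Proof. by split=> p; exact: cvg_cst. Qed.

Lemma pcontD W V : pcont W -> pcont V -> pcont (fun p => W p + V p).
Proof.
move=> [w1 w2] [v1 v2]; split=> p.
  by under eq_fun do rewrite ReD; apply: cvgD; [exact: w1|exact: v1].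
by under eq_fun do rewrite ImD; apply: cvgD; [exact: w2|exact: v2].
Qed.

Lemma pcontM W V : pcont W -> pcont V -> pcont (fun p => W p * V p).
Proof.
move=> [w1 w2] [v1 v2]; split=> p.
  under eq_fun do rewrite reimE; apply: cvgB; apply: cvgM;
    by [exact: w1|exact: v1|exact: w2|exact: v2].
under eq_fun do rewrite reimE; apply: cvgD; apply: cvgM;
  by [exact: w1|exact: v1|exact: w2|exact: v2].
Qed.

Lemma pcontJ W : pcont W -> pcont (fun p => conjc (W p)).
Proof.
move=> [w1 w2]; split=> p; first by under eq_fun do rewrite reimE; exact: w1.
by under eq_fun do rewrite reimE; apply: cvgN; exact: w2.
Qed.

Lemma pcont_real F : continuous F -> pcont (fun p => (F p)%:C).
Proof. by move=> cF; split=> p; [exact: cF|exact: cvg_cst]. Qed.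

(** The cut-offs are squares of positive parts, which are continuously differentiable. *)
Definition pos (x : R) : R := Num.max x 0.

Lemma pos_ge0 x : 0 <= pos x. Proof. by rewrite /pos le_max lexx orbT. Qed.

Lemma posP x : pos x = x /\ 0 <= x \/ pos x = 0 /\ x <= 0.
Proof.
by rewrite /pos; have [x0|x0] := lerP 0 x; [left|right]; rewrite // ltW.
Qed.

Lemma pos_lip x y : `|pos x - pos y| <= `|x - y|.
Proof.
have := ler_norm (x - y); have := ler_norm (y - x); rewrite (distrC y x) => h1 h2.
rewrite ler_norml; apply/andP.
by have [[-> x0]|[-> x0]] := posP x; have [[-> y0]|[-> y0]] := posP y; split; lra.
Qed.

Lemma continuous_pos : continuous pos.
Proof.
move=> x; apply/cvgrPdist_lt => e e0; near=> y; apply: le_lt_trans (pos_lip _ _) _.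
by near: y; apply: (@cvgr_dist_lt _ _ _ _ _ id _ cvg_id).
Unshelve. all: by end_near. Qed.

Lemma quadratic_is_derive (f : R -> R) (x l : R) :
  (forall y, `|f y - f x - l * (y - x)| <= (y - x) ^+ 2) -> is_derive x 1 f l.
Proof.
move=> H; have C : h^-1 *: (f (h *: 1 + x) - f x) @[h --> (0 : R)^'] --> l.
  apply/cvgrPdist_le => e e0; near=> h.
  have h0 : h != 0 by near: h; exact: nbhs_dnbhs_neq.
  have he : `|h| <= e by apply: ltW; near: h; exact: dnbhs0_lt.
  have := H (h + x); rewrite addrK -[h *: 1]/(h * 1) mulr1 -[_ *: _]/(h^-1 * _) => H1.
  apply: le_trans he; rewrite (_ : l - _ = - (h^-1 * (f (h + x) - f x - l * h))); last by field.
  rewrite normrN normrM normfV ler_pdivrMl ?normr_gt0//.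
  by apply: le_trans H1 _; rewrite -expr2 real_normK ?num_real.
split; [exact: cvgP C|exact: cvg_lim C].
Unshelve. all: by end_near. Qed.

Lemma is_derive_pos2 (x : R) : is_derive x 1 (fun t => pos t ^+ 2) (2 * pos x).
Proof.
apply: quadratic_is_derive => y; rewrite ler_norml; apply/andP.
have x2 := sqr_ge0 x; have y2 := sqr_ge0 y; have xy2 := sqr_ge0 (y - x).
have [[-> x0]|[-> x0]] := posP x; have [[-> y0]|[-> y0]] := posP y; first by split; nra.
- have xy := mulr_ge0_le0 x0 y0; split; nra.
- have xy := mulr_le0_ge0 x0 y0; split; nra.
- split; nra.
Qed.

Definition cder (f : R -> R[i]) (t : R) (l : R[i]) : Prop :=
  is_derive t 1 (fun s => Re (f s)) (Re l) /\ is_derive t 1 (fun s => Im (f s)) (Im l).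

Lemma cder_cst c t : cder (fun=> c) t 0.
Proof. by split; exact: is_derive_cst. Qed.

Lemma cderD f g t l m : cder f t l -> cder g t m -> cder (fun s => f s + g s) t (l + m).
Proof.
move=> [f1 f2] [g1 g2]; split; rewrite !reimE; under eq_fun do rewrite !reimE;
  by apply: is_deriveD.
Qed.

Lemma cderM f g t l m : cder f t l -> cder g t m ->
  cder (fun s => f s * g s) t (l * g t + f t * m).
Proof.
move=> [f1 f2] [g1 g2]; split; rewrite !reimE; under eq_fun do rewrite !reimE.
  have h1 := is_deriveM f1 g1; have h2 := is_deriveM f2 g2.
  apply: is_derive_eq (is_deriveB h1 h2) _; rewrite -!/(_ * _) /GRing.scale /=; ring.
have h1 := is_deriveM f1 g2; have h2 := is_deriveM f2 g1.
apply: is_derive_eq (is_deriveD h1 h2) _; rewrite /GRing.scale /=; ring.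
Qed.

Lemma cderJ f t l : cder f t l -> cder (fun s => conjc (f s)) t (conjc l).
Proof.
move=> [f1 f2]; split; rewrite !reimE; under eq_fun do rewrite !reimE; [exact: f1|exact: is_deriveN].
Qed.

Lemma cder_real (f : R -> R) (t l : R) : is_derive t 1 f l -> cder (fun s => (f s)%:C) t l%:C.
Proof. by move=> H; split; [exact: H|exact: is_derive_cst]. Qed.

Lemma cder_derive f t l : cder f t l ->
  derive1 (fun s => Re (f s)) t +i* derive1 (fun s => Im (f s)) t = l.
Proof.
by move=> [f1 f2]; rewrite (derive1_is_derive f1) (derive1_is_derive f2); exact: complex_eq.
Qed.

Definition caclx W := acl_x (fun p => Re (W p)) /\ acl_x (fun p => Im (W p)).
Definition cacly W := acl_y (fun p => Re (W p)) /\ acl_y (fun p => Im (W p)).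
(** Square integrability of the derivatives is kept apart, because it holds only locally for a
    quasiconformal map. *)
Record csob W : Prop := CSob { cs_cont : pcont W; cs_acx : caclx W; cs_acy : cacly W }.

Lemma aclx_map2 (F G H : R * R -> R) :
  (forall y a b, real_ac a b (fun x => F (x, y)) -> real_ac a b (fun x => G (x, y)) ->
     real_ac a b (fun x => H (x, y))) -> acl_x F -> acl_x G -> acl_x H.
Proof.
by move=> K; apply: ae_imply2 => y F1 G1 a b ab d; apply: K; [exact: F1|exact: G1].
Qed.

Lemma acly_map2 (F G H : R * R -> R) :
  (forall x a b, real_ac a b (fun y => F (x, y)) -> real_ac a b (fun y => G (x, y)) ->
     real_ac a b (fun y => H (x, y))) -> acl_y F -> acl_y G -> acl_y H.
Proof.
by move=> K; apply: ae_imply2 => y F1 G1 a b ab d; apply: K; [exact: F1|exact: G1].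
Qed.

Lemma csob_cst c : csob (fun=> c).
Proof.
split; first exact: pcont_cst.
  by split; apply: ae_all => y a b _ _; exact: real_ac_cst.
by split; apply: ae_all => y a b _ _; exact: real_ac_cst.
Qed.

Lemma csobD W V : csob W -> csob V -> csob (fun p => W p + V p).
Proof.
move=> [cw [w1 w2] [w3 w4]] [cv [v1 v2] [v3 v4]]; split; first exact: pcontD.
  by split; under eq_fun do rewrite !reimE;
    [apply: aclx_map2 w1 v1|apply: aclx_map2 w2 v2] => y a b; exact: real_acD.
by split; under eq_fun do rewrite !reimE;
  [apply: acly_map2 w3 v3|apply: acly_map2 w4 v4] => y a b; exact: real_acD.
Qed.

Lemma real_acN a b (f : R -> R) : real_ac a b f -> real_ac a b (fun x => - f x).
Proof.
move=> af; apply: (real_ac_dominated ler01 _ af (real_ac_cst a b 0)) => x y _ _.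
by rewrite /cst subrr normr0 addr0 mul1r opprK addrC distrC.
Qed.

Lemma csobJ W : csob W -> csob (fun p => conjc (W p)).
Proof.
move=> [cw [w1 w2] [w3 w4]]; split; first exact: pcontJ.
  by split; under eq_fun do rewrite !reimE; [exact: w1|apply: (aclx_map2 _ w2 w2) => y a b /real_acN].
by split; under eq_fun do rewrite !reimE; [exact: w3|apply: (acly_map2 _ w4 w4) => y a b /real_acN].
Qed.

Lemma within_slice_x F y a b : continuous F -> {within `[a, b], continuous (fun x => F (x, y))}.
Proof. by move=> cF; apply: continuous_subspaceT; exact: continuous_slice_x. Qed.

Lemma within_slice_y F x a b : continuous F -> {within `[a, b], continuous (fun y => F (x, y))}.
Proof. by move=> cF; apply: continuous_subspaceT; exact: continuous_slice_y. Qed.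

Lemma acl_xM F G : continuous F -> continuous G -> acl_x F -> acl_x G ->
  acl_x (fun p => F p * G p).
Proof.
by move=> cF cG; apply: aclx_map2 => y a b; apply: real_acM; exact: within_slice_x.
Qed.

Lemma acl_yM F G : continuous F -> continuous G -> acl_y F -> acl_y G ->
  acl_y (fun p => F p * G p).
Proof.
by move=> cF cG; apply: acly_map2 => y a b; apply: real_acM; exact: within_slice_y.
Qed.

Lemma acl_xD F G : acl_x F -> acl_x G -> acl_x (fun p => F p + G p).
Proof. by apply: aclx_map2 => y a b; exact: real_acD. Qed.
Lemma acl_yD F G : acl_y F -> acl_y G -> acl_y (fun p => F p + G p).
Proof. by apply: acly_map2 => y a b; exact: real_acD. Qed.
Lemma acl_xN F : acl_x F -> acl_x (fun p => - F p).
Proof. by move=> aF; apply: (aclx_map2 _ aF aF) => y a b /real_acN. Qed.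
Lemma acl_yN F : acl_y F -> acl_y (fun p => - F p).
Proof. by move=> aF; apply: (acly_map2 _ aF aF) => y a b /real_acN. Qed.

Lemma csobM W V : csob W -> csob V -> csob (fun p => W p * V p).
Proof.
move=> [cw [w1 w2] [w3 w4]] [cv [v1 v2] [v3 v4]]; have [c1 c2] := cw; have [d1 d2] := cv.
split; first exact: pcontM.
  by split; under eq_fun do rewrite !reimE; apply: acl_xD; do ?apply: acl_xN; exact: acl_xM.
by split; under eq_fun do rewrite !reimE; apply: acl_yD; do ?apply: acl_yN; exact: acl_yM.
Qed.

Lemma real_ac_pos a b (f : R -> R) : real_ac a b f -> real_ac a b (fun x => pos (f x)).
Proof.
move=> af; apply: (real_ac_dominated ler01 _ af (real_ac_cst a b 0)) => x y _ _.
by rewrite /cst subrr normr0 addr0 mul1r pos_lip.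
Qed.

Lemma csob_pos2 W : csob W -> csob (fun p => (pos (Re (W p)) ^+ 2)%:C).
Proof.
move=> [[cw _] [w1 _] [w3 _]].
have c1 : continuous (fun p => pos (Re (W p))).
  by move=> p; apply: continuous_comp; [exact: cw|exact: continuous_pos].
have c2 : continuous (fun p => pos (Re (W p)) ^+ 2).
  by move=> p; under eq_fun do rewrite expr2; apply: cvgM; exact: c1.
split; first exact: pcont_real.
  split; last by apply: ae_all => y a b _ _; exact: real_ac_cst.
  rewrite /=; under eq_fun do rewrite expr2.
  by apply: acl_xM => //; apply: (aclx_map2 _ w1 w1) => y a b /real_ac_pos.
split; last by apply: ae_all => y a b _ _; exact: real_ac_cst.
rewrite /=; under eq_fun do rewrite expr2.
by apply: acl_yM => //; apply: (acly_map2 _ w3 w3) => y a b /real_ac_pos.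
Qed.

Section over.
Variable Phi : R * R -> R[i].

(* [W] is a function of [Phi]; [W1] and [W2] are its partial derivatives with
   respect to the real and imaginary parts of [Phi]. *)
Record jet (W W1 W2 : R * R -> R[i]) : Prop := Jet {
  j_sob : csob W;
  j_c1 : pcont W1;
  j_c2 : pcont W2;
  j_der : forall (g : R -> R * R) t l, cder (fun s => Phi (g s)) t l ->
    cder (fun s => W (g s)) t ((Re l)%:C * W1 (g t) + (Im l)%:C * W2 (g t)) }.

Lemma jet_cst c : jet (fun=> c) (fun=> 0) (fun=> 0).
Proof.
split; [exact: csob_cst|exact: pcont_cst|exact: pcont_cst|].
by move=> g t l _; rewrite !mulr0 addr0; exact: cder_cst.
Qed.

Lemma jet_id : csob Phi -> jet Phi (fun=> 1) (fun=> 0 +i* 1).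
Proof.
move=> sP; split => //; [exact: pcont_cst|exact: pcont_cst|].
move=> g t l; rewrite mulr1 (_ : _ + _ = l)//; case: l => x y.
by apply: complex_eq => /=; ring.
Qed.

Lemma jetD W W1 W2 V V1 V2 : jet W W1 W2 -> jet V V1 V2 ->
  jet (fun p => W p + V p) (fun p => W1 p + V1 p) (fun p => W2 p + V2 p).
Proof.
move=> [sW w1 w2 dW] [sV v1 v2 dV]; split; [exact: csobD|exact: pcontD|exact: pcontD|].
move=> g t l d; have := cderD (dW _ _ _ d) (dV _ _ _ d); congr cder; ring.
Qed.

Lemma jetM W W1 W2 V V1 V2 : jet W W1 W2 -> jet V V1 V2 ->
  jet (fun p => W p * V p) (fun p => W1 p * V p + W p * V1 p) (fun p => W2 p * V p + W p * V2 p).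
Proof.
move=> [sW w1 w2 dW] [sV v1 v2 dV]; have [cW _ _] := sW; have [cV _ _] := sV.
split; [exact: csobM|by apply: pcontD; exact: pcontM|by apply: pcontD; exact: pcontM|].
move=> g t l d; have := cderM (dW _ _ _ d) (dV _ _ _ d); congr cder; ring.
Qed.

Lemma jetJ W W1 W2 : jet W W1 W2 ->
  jet (fun p => conjc (W p)) (fun p => conjc (W1 p)) (fun p => conjc (W2 p)).
Proof.
move=> [sW w1 w2 dW]; split; [exact: csobJ|exact: pcontJ|exact: pcontJ|].
move=> g t l d; have := cderJ (dW _ _ _ d); congr cder.
by rewrite conjcD !conjcM !conjc_real.
Qed.

Lemma jet_pos2 W W1 W2 : jet W W1 W2 ->
  jet (fun p => (pos (Re (W p)) ^+ 2)%:C)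
    (fun p => (2 * pos (Re (W p)) * Re (W1 p))%:C) (fun p => (2 * pos (Re (W p)) * Re (W2 p))%:C).
Proof.
move=> [sW [w1 _] [w2 _] dW]; have [[cW _] _ _] := sW.
have c1 : continuous (fun p => 2 * pos (Re (W p))).
  move=> p; apply: cvgM; first exact: cvg_cst.
  by apply: (continuous_comp (f := fun p => Re (W p))); [exact: cW|exact: continuous_pos].
split; [exact: csob_pos2|apply: pcont_real => p; apply: cvgM; [exact: c1|exact: w1]|
  apply: pcont_real => p; apply: cvgM; [exact: c1|exact: w2]|].
move=> g t l d; have [d1 _] := dW _ _ _ d.
have := cder_real (is_derive1_comp (is_derive_pos2 (Re (W (g t)))) d1); congr cder.
by apply: complex_eq; rewrite !reimE /= /GRing.scale /=; ring.
Qed.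

End over.
End jets.

(** * Null Lagrangians of functions of a quasiconformal map *)

Section local_sobolev.
Context (R : realType).
Local Notation leb := (@lebesgue_measure R).
Local Notation mu2 := (@plane_measure R).
Local Notation P2 := (measurableTypeR R * measurableTypeR R)%type.
Implicit Types (W V A B : R * R -> R[i]) (p : R * R) (F G : R * R -> R).

(** The parameter is the square of the radius. *)
Definition dsc (s : R) : set (R * R) := [set p | p.1 ^+ 2 + p.2 ^+ 2 <= s].

Lemma measurable_dsc s : @measurable _ P2 (dsc s).
Proof.
rewrite -[dsc s]setTI (_ : dsc s = (fun p => p.1 ^+ 2 + p.2 ^+ 2) @^-1` `]-oo, s]%classic).
  apply: (_ : measurable_fun (setT : set P2) _) => //.
  by apply: measurable_funD; apply: measurable_funX; [exact: measurable_fst|exact: measurable_snd].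
by apply/seteqP; split=> p; rewrite /dsc /= in_itv.
Qed.

Lemma dsc_udisc s : s < 1 -> dsc s `<=` @udisc R.
Proof. by move=> s1 p ps; exact: le_lt_trans ps s1. Qed.

Lemma udisc_box : @udisc R `<=` @box R.
Proof.
move=> p; rewrite /udisc /= => p1; have h1 := sqr_ge0 p.1; have h2 := sqr_ge0 p.2.
by split; rewrite /= in_itv /=; apply/andP; split; nra.
Qed.

Lemma udisc_finite : (mu2 (@udisc R) < +oo)%E.
Proof.
apply: le_lt_trans (@box_finite R); apply: le_measure; rewrite ?inE.
- exact: measurable_udisc.
- exact: measurable_box.
- exact: udisc_box.
Qed.

Lemma compact_box : compact (@box R).
Proof. by apply: compact_setX; exact: segment_compact. Qed.

Lemma box_bounded F : continuous F -> exists2 K, 0 <= K & forall p, box p -> `|F p| <= K.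
Proof.
move=> cF; have cn : continuous (fun p => `|F p|).
  by move=> p; apply: continuous_comp; [exact: cF|exact: norm_continuous].
have b0 : box (0 : R, 0 : R) by split; rewrite /= in_itv /=; apply/andP; split; lra.
have [c _ H] := compact_EVT_max (ex_intro _ _ b0) compact_box (continuous_subspaceT cn).
by exists `|F c| => // p bp; apply: H; rewrite inE.
Qed.

Lemma box_modulus_bounded W : pcont W -> exists2 K, 0 <= K & forall p, box p -> modulus (W p) <= K.
Proof.
move=> [/box_bounded[K K0 HK] /box_bounded[L L0 HL]]; exists (K + L); first exact: addr_ge0.
by move=> p bp; apply: le_trans (modulus_le_ReIm _) _; rewrite lerD ?HK ?HL.
Qed.

Definition cpx W p : R[i] := px (fun q => Re (W q)) p +i* px (fun q => Im (W q)) p.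
Definition cpy W p : R[i] := py (fun q => Re (W q)) p +i* py (fun q => Im (W q)) p.
Definition gradsq W p : R := modulus (cpx W p) ^+ 2 + modulus (cpy W p) ^+ 2.
Definition jac W p : R := Re (cpx W p) * Im (cpy W p) - Re (cpy W p) * Im (cpx W p).

Lemma gradsq_ge0 W p : 0 <= gradsq W p. Proof. by rewrite addr_ge0 ?sqr_ge0. Qed.

Lemma jac_le W p : `|jac W p| <= gradsq W p.
Proof.
rewrite /jac /gradsq !modulus2.
move: (cpx W p) (cpy W p) => X Y; move: (Re X) (Im X) (Re Y) (Im Y) => a b c d.
have h1 := sqr_ge0 (a - d); have h2 := sqr_ge0 (a + d); have h3 := sqr_ge0 (b - c); have h4 := sqr_ge0 (b + c).
by rewrite ler_norml; apply/andP; split; nra.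
Qed.

Lemma measurable_cp W : pcont W -> cmeasurable (setT : set P2) (cpx W) /\ cmeasurable (setT : set P2) (cpy W).
Proof.
by move=> [c1 c2]; split; split; [exact: measurable_px|exact: measurable_px|exact: measurable_py|exact: measurable_py].
Qed.

Lemma measurable_gradsq W : pcont W -> measurable_fun (setT : set P2) (gradsq W).
Proof.
move=> cW; have [m1 m2] := measurable_cp cW.
by apply: measurable_funD; apply: measurable_funX; exact: measurable_modulus.
Qed.

Lemma measurable_jac W : pcont W -> measurable_fun (setT : set P2) (jac W).
Proof.
move=> cW; have [[m1 m2] [m3 m4]] := measurable_cp cW.
exact: (measurable_funB (measurable_funM m1 m4) (measurable_funM m3 m2)).
Qed.

Lemma csob_cder W : csob W -> {ae mu2, forall p, udisc p ->
  cder (fun x => W (x, p.2)) p.1 (cpx W p) /\ cder (fun y => W (p.1, y)) p.2 (cpy W p)}.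
Proof.
move=> [[c1 c2] [x1 x2] [y1 y2]].
have X := ae_imply2 _ (ae_derivable_x c1 x1) (ae_derivable_x c2 x2).
have Y := ae_imply2 _ (ae_derivable_y c1 y1) (ae_derivable_y c2 y2).
apply: (ae_imply2 _ (X _ (fun p a b => conj a b)) (Y _ (fun p a b => conj a b))) => p [a b] [c d] up.
by split; split; [exact: (is_derive_derive1 (a up))|exact: (is_derive_derive1 (b up))|
  exact: (is_derive_derive1 (c up))|exact: (is_derive_derive1 (d up))].
Qed.

Lemma jet_cp Phi W W1 W2 : csob Phi -> jet Phi W W1 W2 -> {ae mu2, forall p, udisc p ->
  cpx W p = (Re (cpx Phi p))%:C * W1 p + (Im (cpx Phi p))%:C * W2 p /\
  cpy W p = (Re (cpy Phi p))%:C * W1 p + (Im (cpy Phi p))%:C * W2 p}.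
Proof.
move=> sP [_ _ _ jd]; apply: ae_imply (csob_cder sP) => p H up; have [h1 h2] := H up.
have d1 := jd (fun x => (x, p.2)) _ _ h1; have d2 := jd (fun y => (p.1, y)) _ _ h2.
by move: d1 d2; rewrite -surjective_pairing => /cder_derive d1 /cder_derive d2.
Qed.

Lemma integrable_support s (D : set (R * R)) G : @measurable _ P2 D ->
  mu2.-integrable (dsc s) (EFin \o G) -> (forall p, ~ dsc s p -> G p = 0) ->
  mu2.-integrable D (EFin \o G).
Proof.
move=> mD iG G0; have := Rintegrable_restrict (measurable_dsc s) iG.
rewrite (_ : G \_ (dsc s) = G); first by apply: integrableS.
apply/funext => p; rewrite /patch; case: ifPn => //; rewrite notin_setE => /G0 ->//.
Qed.

Lemma px_py_out s A p : ~ dsc s p -> (forall q, ~ dsc s q -> A q = 0) -> cpx A p = 0 /\ cpy A p = 0.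
Proof.
move=> np A0.
have nz (f : R -> R) (c x : R) : s < x ^+ 2 + c -> (forall t, s < t ^+ 2 + c -> f t = 0) -> derive1 f x = 0.
  move=> x1 f0; rewrite derive1E (@near_eq_derive _ _ _ _ (cst 0)) ?derive_cst//.
  have : \forall y \near x, s < y ^+ 2 + c.
    apply: (@cvgr_gt R _ _ (nbhs_filter x) (fun y => y ^+ 2 + c) (x ^+ 2 + c)) => //.
    by apply: cvgD; [exact: exprn_continuous|exact: cvg_cst].
  by apply: filterS => y; exact: f0.
have np' : s < p.1 ^+ 2 + p.2 ^+ 2 by rewrite ltNge; apply/negP.
have np2 : s < p.2 ^+ 2 + p.1 ^+ 2 by rewrite addrC.
have Ax t : s < t ^+ 2 + p.2 ^+ 2 -> A (t, p.2) = 0.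
  by move=> h; apply: A0; rewrite /dsc /=; apply/negP; rewrite -ltNge.
have Ay t : s < t ^+ 2 + p.1 ^+ 2 -> A (p.1, t) = 0.
  by move=> h; apply: A0; rewrite /dsc /=; apply/negP; rewrite -ltNge addrC.
by split; apply: complex_eq;
  [apply: (nz _ _ _ np')|apply: (nz _ _ _ np')|apply: (nz _ _ _ np2)|apply: (nz _ _ _ np2)] => t h;
  rewrite ?(Ax t h) ?(Ay t h).
Qed.

(** On this line the function vanishes outside the disc of squared radius [(1 + s) / 2], which lies
    between its support and the unit circle; the chord of that disc is a segment to which [ac]
    applies. *)
Lemma acl_support (s : R) (f : R -> R -> R) y c d : 0 <= s -> s < 1 ->
  (forall x, s < x ^+ 2 + y ^+ 2 -> f y x = 0) ->
  (forall a b, a < b -> (forall x, a <= x <= b -> x ^+ 2 + y ^+ 2 < 1) -> real_ac a b (f y)) ->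
  real_ac c d (f y).
Proof.
move=> s0 s1 f0 ac; pose t := (1 + s) / 2 - y ^+ 2.
have [t0|t0] := lerP t 0.
  apply: (@real_ac_eq _ _ _ (cst 0)) (real_ac_cst _ _ 0) => x _; apply/esym/f0.
  by have := sqr_ge0 x; move: t0; rewrite /t; lra.
have w0 : 0 < Num.sqrt t by rewrite sqrtr_gt0.
have w2 : Num.sqrt t ^+ 2 = t by rewrite sqr_sqrtr// ltW.
have far x : Num.sqrt t ^+ 2 <= x ^+ 2 -> f y x = 0.
  by rewrite w2 => h; apply: f0; move: h; rewrite /t; lra.
apply: (@real_ac_zero_ext _ (- Num.sqrt t) (Num.sqrt t)).
- by lra.
- by move=> x h; apply: far; nra.
- by move=> x h; apply: far; nra.
apply: ac; first by lra.
move=> x /andP[h1 h2]; have : x ^+ 2 <= Num.sqrt t ^+ 2 by nra.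
by rewrite w2 /t; lra.
Qed.

(* [Phi] is defined on the whole plane, and everything outside the unit disc is
   sent outside it, so that cut-offs in [|Phi|^2] have compact support in the
   disc. *)
Record qc_ext Phi (K : R) : Prop := QcExt {
  qe_sob : csob Phi;
  qe_in : forall p, udisc p -> modulus (Phi p) ^+ 2 < 1;
  qe_out : forall p, ~ udisc p -> 1 <= modulus (Phi p) ^+ 2;
  qe_l2 : forall s, s < 1 -> mu2.-integrable (dsc s) (EFin \o gradsq Phi);
  qe_K : 0 < K;
  qe_dil : {ae mu2, forall p, udisc p -> gradsq Phi p <= K * jac Phi p} }.

Section extension.
Variables (Phi : R * R -> R[i]) (K : R).
Hypothesis qc : qc_ext Phi K.
Let sP := qe_sob qc.

(** The set where [|Phi|^2 <= c] is closed in the box and, by [qe_out], contained in the open disc;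
    by compactness [p.1^2 + p.2^2] attains its maximum there, which is below 1. *)
Lemma qc_support (c : R) : c < 1 -> exists s, [/\ 0 <= s, s < 1 &
  forall p, ~ dsc s p -> c < modulus (Phi p) ^+ 2].
Proof.
move=> c1; have [[cR cI] _ _] := sP.
have cm : continuous (fun p => modulus (Phi p) ^+ 2).
  move=> p; under eq_fun do rewrite modulus2.
  by apply: cvgD; under eq_fun do rewrite expr2; apply: cvgM; by [exact: cR|exact: cI].
pose E := @box R `&` [set p | modulus (Phi p) ^+ 2 <= c].
have nE p : ~ E p -> ~ udisc p \/ c < modulus (Phi p) ^+ 2.
  move=> nEp; have [up|?] := pselect (udisc p); last by left.
  by right; rewrite ltNge; apply/negP => h; apply: nEp; split => //; exact: udisc_box.
have EU p : E p -> udisc p.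
  move=> [_ /= h]; apply: contrapT => /(qe_out qc) h2; lra.
have cE : compact E.
  apply: (@subclosed_compact _ _ (@box R)); [|exact: compact_box|by move=> p []].
  apply: closedI; first by apply: compact_closed; [exact: norm_hausdorff|exact: compact_box].
  rewrite (_ : mkset _ = (fun p => modulus (Phi p) ^+ 2) @^-1` [set x | x <= c]) //.
  by apply: (closed_comp (fun p _ => cm p)); exact: closed_le.
have [[q Eq]|E0] := pselect (E !=set0); last first.
  exists 0; split => // p; rewrite /dsc /= => np; have [/(qe_out qc) h|//] := nE p (fun h => E0 (ex_intro _ p h)).
  exact: lt_le_trans h.
have cq : continuous (fun p : R * R => p.1 ^+ 2 + p.2 ^+ 2).
  move=> p; apply: cvgD; under eq_fun do rewrite expr2; apply: cvgM;
    by [exact: cvg_fst|exact: cvg_snd].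
have [m mE H] := compact_EVT_max (ex_intro _ _ Eq) cE (continuous_subspaceT cq).
exists (m.1 ^+ 2 + m.2 ^+ 2); split.
- by rewrite addr_ge0 ?sqr_ge0.
- by move: mE; rewrite inE => /EU.
move=> p np; have [Ep|/nE[/(qe_out qc) h|//]] := pselect (E p); last exact: lt_le_trans h.
by exfalso; apply: np; apply: H; rewrite inE.
Qed.

Lemma jet_gradsq W W1 W2 : jet Phi W W1 W2 -> exists2 C, 0 <= C &
  {ae mu2, forall p, udisc p -> gradsq W p <= C * gradsq Phi p}.
Proof.
move=> jW; have [_ c1 c2 _] := jW.
have [M M0 HM] := box_modulus_bounded c1; have [L L0 HL] := box_modulus_bounded c2.
exists (2 * (M ^+ 2 + L ^+ 2)); first by have := sqr_ge0 M; have := sqr_ge0 L; lra.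
apply: ae_imply (jet_cp sP jW) => p H up; rewrite {1}/gradsq; have [-> ->] := H up.
have bp := udisc_box up; have := HM p bp; have := HL p bp; rewrite /gradsq.
have key (z : R[i]) : modulus (W1 p) <= M -> modulus (W2 p) <= L ->
    modulus ((Re z)%:C * W1 p + (Im z)%:C * W2 p) ^+ 2 <= 2 * (M ^+ 2 + L ^+ 2) * modulus z ^+ 2.
  move=> h1 h2; have := modulusD ((Re z)%:C * W1 p) ((Im z)%:C * W2 p).
  rewrite [modulus (_ * W1 p)]modulusM [modulus (_ * W2 p)]modulusM !modulus_real.
  rewrite [modulus z ^+ 2]modulus2 -[Re z ^+ 2]real_normK ?num_real// -[Im z ^+ 2]real_normK ?num_real//.
  have := modulus_ge0 ((Re z)%:C * W1 p + (Im z)%:C * W2 p).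
  have := modulus_ge0 (W1 p); have := modulus_ge0 (W2 p).
  have := normr_ge0 (Re z); have := normr_ge0 (Im z).
  move: h1 h2; move: (modulus (_ + _)) (modulus (W1 p)) (modulus (W2 p)) `|Re z| `|Im z| => T a b x y.
  move=> h1 h2 y0 x0 b0 a0 T0 T1.
  have T2 : T <= x * M + y * L.
    by apply: le_trans T1 _; rewrite lerD// ler_wpM2l.
  have T3 : T ^+ 2 <= (x * M + y * L) ^+ 2 by rewrite ler_sqr ?nnegrE// addr_ge0// mulr_ge0.
  apply: (le_trans T3); rewrite -subr_ge0.
  rewrite (_ : _ - _ = (x * M - y * L) ^+ 2 + 2 * ((x * L) ^+ 2 + (y * M) ^+ 2)); last by ring.
  by rewrite addr_ge0 ?sqr_ge0// mulr_ge0// addr_ge0 ?sqr_ge0.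
by move=> h2 h1; rewrite mulrDr lerD ?key.
Qed.

Lemma gradsq_support s W W1 W2 : s < 1 -> jet Phi W W1 W2 ->
  mu2.-integrable (dsc s) (EFin \o gradsq W).
Proof.
move=> s1 jW; have [[cW _ _] _ _ _] := jW; have [C C0 H] := jet_gradsq jW.
(* The bound of [jet_gradsq] holds almost everywhere; the minimum satisfies it everywhere. *)
apply: (@ae_Rintegrable _ P2 R mu2 _ _ (fun p => Num.min (gradsq W p) (C * gradsq Phi p)) (measurable_dsc s)).
- exact: measurable_funTS (measurable_gradsq cW).
- by apply: ae_imply H => p H ps; rewrite (min_idPl _)//; exact: H (dsc_udisc s1 ps).
have [cP _ _] := sP.
apply: (@Rintegrable_le _ P2 _ mu2 _ (measurable_dsc s) _ (fun p => C * gradsq Phi p)).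
- apply: measurable_funTS; apply: measurable_minr; first exact: measurable_gradsq.
  by apply: measurable_funM => //; exact: measurable_gradsq.
- exact: (RintegrableZ (measurable_dsc s) C (qe_l2 qc s1)).
- move=> p _; rewrite ger0_norm ?ge_min ?lexx ?orbT// le_min gradsq_ge0 mulr_ge0//; exact: gradsq_ge0.
Qed.

Lemma jet_test_fun W W1 W2 s : 0 <= s -> s < 1 -> (forall p, ~ dsc s p -> W p = 0) ->
  jet Phi W W1 W2 -> test_fun (fun p => Re (W p)) /\ test_fun (fun p => Im (W p)).
Proof.
move=> s0 s1 W0 jW; have [[cW [x1 x2] [y1 y2]] _ _ _] := jW; have [cR cI] := cW.
have iW := gradsq_support s1 jW; have [mx my] := measurable_cp cW.
have [M M0 HM] := box_modulus_bounded cW.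
have out p : (1 <= `|p.1|) || (1 <= `|p.2|) -> ~ dsc s p.
  move=> /orP H ps; have : p.1 ^+ 2 + p.2 ^+ 2 < 1 by exact: le_lt_trans ps s1.
  rewrite -[p.1 ^+ 2]real_normK ?num_real// -[p.2 ^+ 2]real_normK ?num_real//.
  by have := normr_ge0 p.1; have := normr_ge0 p.2; case: H => h; nra.
have bnd p : modulus (W p) <= M.
  have [bp|nb] := pselect (box p); first exact: HM.
  by rewrite W0 ?modulus0// => /(dsc_udisc s1) /udisc_box.
have sq (f : R * R -> R) : measurable_fun (setT : set P2) f -> (forall p, ~ dsc s p -> f p = 0) ->
    (forall p, f p ^+ 2 <= gradsq W p) -> mu2.-integrable setT (EFin \o (fun p => f p ^+ 2)).
  move=> mf f0 fW; apply: (@integrable_support s) => //; last by move=> p /f0 ->; rewrite expr0n.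
  apply: (@Rintegrable_le _ P2 _ mu2 _ (measurable_dsc s) _ (gradsq W)) => //.
    by apply: measurable_funTS; exact: measurable_funX.
  by move=> p _; rewrite ger0_norm ?sqr_ge0.
have gE p : gradsq W p = px (fun q => Re (W q)) p ^+ 2 + px (fun q => Im (W q)) p ^+ 2 +
    (py (fun q => Re (W q)) p ^+ 2 + py (fun q => Im (W q)) p ^+ 2) by rewrite /gradsq !modulus2.
have dout p : ~ dsc s p -> [/\ px (fun q => Re (W q)) p = 0, px (fun q => Im (W q)) p = 0,
    py (fun q => Re (W q)) p = 0 & py (fun q => Im (W q)) p = 0].
  by move=> /px_py_out /(_ W0)[[-> ->] [-> ->]].
have W0x x y : s < x ^+ 2 + y ^+ 2 -> W (x, y) = 0.
  by move=> h; apply: W0; rewrite /dsc /=; apply/negP; rewrite -ltNge.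
have W0y x y : s < y ^+ 2 + x ^+ 2 -> W (x, y) = 0 by rewrite addrC; exact: W0x.
split; split => //.
- by move=> p /out /W0 ->.
- by exists M => p; exact: le_trans (Re_le_modulus _) (bnd p).
- apply: ae_imply x1 => y H a b; apply: (@acl_support s (fun y x => Re (W (x, y)))) => // x /W0x ->//.
- apply: ae_imply y1 => y H a b; apply: (@acl_support s (fun x y => Re (W (x, y)))) => // [x /W0y ->//|c d cd h].
  by apply: H => // t /h; rewrite addrC.
- apply: sq; [exact: mx.1|by move=> p /dout[]|move=> p; rewrite gE].
  by rewrite -addrA lerDl !addr_ge0 ?sqr_ge0.
- apply: sq; [exact: my.1|by move=> p /dout[]|move=> p; rewrite gE].
  by rewrite addrA addrAC lerDr !addr_ge0 ?sqr_ge0.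
- by move=> p /out /W0 ->.
- by exists M => p; exact: le_trans (Im_le_modulus _) (bnd p).
- apply: ae_imply x2 => y H a b; apply: (@acl_support s (fun y x => Im (W (x, y)))) => // x /W0x ->//.
- apply: ae_imply y2 => y H a b; apply: (@acl_support s (fun x y => Im (W (x, y)))) => // [x /W0y ->//|c d cd h].
  by apply: H => // t /h; rewrite addrC.
- apply: sq; [exact: mx.2|by move=> p /dout[]|move=> p; rewrite gE].
  by rewrite addrAC lerDr !addr_ge0 ?sqr_ge0.
- apply: sq; [exact: my.2|by move=> p /dout[]|move=> p; rewrite gE].
  by rewrite addrA lerDr !addr_ge0 ?sqr_ge0.
Qed.

(** By the chain rule the null Lagrangian of two functions of [Phi] is their Jacobian in the target
    variable times [jac Phi]. This is what replaces the substitution [w = Phi(z)]. *)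
Lemma null_real s (a b a1 a2 b1 b2 : R * R -> R) : s < 1 -> test_fun a -> test_fun b ->
  (forall p, ~ dsc s p -> [/\ px a p = 0, py a p = 0, px b p = 0 & py b p = 0]) ->
  continuous (fun p => a1 p * b2 p - a2 p * b1 p) ->
  {ae mu2, forall p, udisc p ->
    px a p = Re (cpx Phi p) * a1 p + Im (cpx Phi p) * a2 p /\
    py a p = Re (cpy Phi p) * a1 p + Im (cpy Phi p) * a2 p} ->
  {ae mu2, forall p, udisc p ->
    px b p = Re (cpx Phi p) * b1 p + Im (cpx Phi p) * b2 p /\
    py b p = Re (cpy Phi p) * b1 p + Im (cpy Phi p) * b2 p} ->
  mu2.-integrable (@udisc R) (EFin \o (fun p => (a1 p * b2 p - a2 p * b1 p) * jac Phi p)) /\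
  \int[mu2]_(p in @udisc R) ((a1 p * b2 p - a2 p * b1 p) * jac Phi p) = 0.
Proof.
move=> s1 ta tb out cw aea aeb; have mU := @measurable_udisc R : @measurable _ P2 _.
have mxa := measurable_px (tf_cont ta); have mya := measurable_py (tf_cont ta).
have mxb := measurable_px (tf_cont tb); have myb := measurable_py (tf_cont tb).
have i1 := @mul_integrable _ P2 R mu2 setT measurableT _ _ mxa myb (tf_px2 ta) (tf_py2 tb).
have i2 := @mul_integrable _ P2 R mu2 setT measurableT _ _ mxb mya (tf_px2 tb) (tf_py2 ta).
have i12 := RintegrableB measurableT i1 i2.
have I0 : \int[mu2]_p (px a p * py b p - px b p * py a p) = 0.
  by rewrite (RintegralB measurableT i1 i2) null_lagrangian// subrr.
have E : {ae mu2, forall p, udisc p ->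
    (a1 p * b2 p - a2 p * b1 p) * jac Phi p = px a p * py b p - px b p * py a p}.
  apply: (ae_imply2 _ aea aeb) => p H1 H2 up; have [-> ->] := H1 up; have [-> ->] := H2 up.
  rewrite /jac; move: (cpx Phi p) (cpy Phi p) (a1 p) (a2 p) (b1 p) (b2 p) => X Y x1 x2 y1 y2.
  by move: (Re X) (Im X) (Re Y) (Im Y) => ? ? ? ?; ring.
have mw : measurable_fun (@udisc R : set P2) (fun p => (a1 p * b2 p - a2 p * b1 p) * jac Phi p).
  apply: measurable_funTS; apply: measurable_funM; first exact: continuous_plane_measurable.
  by apply: measurable_jac; have [] := sP.
have iU : mu2.-integrable (@udisc R) (EFin \o (fun p => px a p * py b p - px b p * py a p)).
  exact: (@integrableS _ P2 _ mu2 setT).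
split; first exact: (@ae_Rintegrable _ P2 R mu2 _ _ _ mU mw E iU).
rewrite -[RHS]I0 (@ae_Rintegral _ P2 R mu2 _ _ _ mU mw _ E); last first.
  by have /integrableP[/measurable_EFinP] := iU.
rewrite Rintegral_mkcond; apply: eq_Rintegral => p _; rewrite /patch; case: ifPn => //.
rewrite notin_setE => np; have [|-> -> -> ->] := out p; last by rewrite !mul0r subrr.
by move=> /(dsc_udisc s1).
Qed.

Lemma null_complex c A A1 A2 B B1 B2 : c < 1 -> jet Phi A A1 A2 -> jet Phi B B1 B2 ->
  (forall p, c < modulus (Phi p) ^+ 2 -> A p = 0) -> (forall p, c < modulus (Phi p) ^+ 2 -> B p = 0) ->
  cintegral mu2 (@udisc R) (fun p => (A1 p * B2 p - A2 p * B1 p) * (jac Phi p)%:C) = 0.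
Proof.
move=> c1 jA jB A0' B0'; have [s [s0 s1 Hs]] := qc_support c1.
have A0 p : ~ dsc s p -> A p = 0 by move=> /Hs /A0'.
have B0 p : ~ dsc s p -> B p = 0 by move=> /Hs /B0'.
have [ra ia] := jet_test_fun s0 s1 A0 jA; have [rb ib] := jet_test_fun s0 s1 B0 jB.
have [_ [a1 a1'] [a2 a2'] _] := jA; have [_ [b1 b1'] [b2 b2'] _] := jB.
have C (f g h k : R * R -> R) : continuous f -> continuous g -> continuous h -> continuous k ->
    continuous (fun p => f p * g p - h p * k p).
  by move=> cf cg ch ck p; apply: cvgB; apply: cvgM; by [exact: cf|exact: cg|exact: ch|exact: ck].
have o (W V : R * R -> R[i]) p : (forall p, ~ dsc s p -> W p = 0) -> (forall p, ~ dsc s p -> V p = 0) -> ~ dsc s p ->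
    (cpx W p = 0 /\ cpy W p = 0) /\ (cpx V p = 0 /\ cpy V p = 0).
  by move=> W0 V0 np; split; exact: px_py_out np _.
have D W W1 W2 : jet Phi W W1 W2 ->
   {ae mu2, forall p, udisc p ->
    px (fun q => Re (W q)) p = Re (cpx Phi p) * Re (W1 p) + Im (cpx Phi p) * Re (W2 p) /\
    py (fun q => Re (W q)) p = Re (cpy Phi p) * Re (W1 p) + Im (cpy Phi p) * Re (W2 p)} /\
   {ae mu2, forall p, udisc p ->
    px (fun q => Im (W q)) p = Re (cpx Phi p) * Im (W1 p) + Im (cpx Phi p) * Im (W2 p) /\
    py (fun q => Im (W q)) p = Re (cpy Phi p) * Im (W1 p) + Im (cpy Phi p) * Im (W2 p)}.
  move=> /(jet_cp sP) H; split; apply: ae_imply H => p H /H [hx hy]; split.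
  - by move: (congr1 (fun z : R[i] => Re z) hx); rewrite !reimE /= !mul0r !subr0.
  - by move: (congr1 (fun z : R[i] => Re z) hy); rewrite !reimE /= !mul0r !subr0.
  - by move: (congr1 (fun z : R[i] => Im z) hx); rewrite !reimE /= !mul0r !addr0.
  - by move: (congr1 (fun z : R[i] => Im z) hy); rewrite !reimE /= !mul0r !addr0.
have [dra dia] := D _ _ _ jA; have [drb dib] := D _ _ _ jB.
have [irr Irr] := null_real s1 ra rb (fun p np => let: conj (conj x y) (conj z t) := o A B p A0 B0 np in
  And4 (congr1 (fun z : R[i] => Re z) x) (congr1 (fun z : R[i] => Re z) y) (congr1 (fun z : R[i] => Re z) z) (congr1 (fun z : R[i] => Re z) t)) (C _ _ _ _ a1 b2 a2 b1) dra drb.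
have [iri Iri] := null_real s1 ra ib (fun p np => let: conj (conj x y) (conj z t) := o A B p A0 B0 np in
  And4 (congr1 (fun z : R[i] => Re z) x) (congr1 (fun z : R[i] => Re z) y) (congr1 (fun z : R[i] => Im z) z) (congr1 (fun z : R[i] => Im z) t)) (C _ _ _ _ a1 b2' a2 b1') dra dib.
have [iir Iir] := null_real s1 ia rb (fun p np => let: conj (conj x y) (conj z t) := o A B p A0 B0 np in
  And4 (congr1 (fun z : R[i] => Im z) x) (congr1 (fun z : R[i] => Im z) y) (congr1 (fun z : R[i] => Re z) z) (congr1 (fun z : R[i] => Re z) t)) (C _ _ _ _ a1' b2 a2' b1) dia drb.
have [iii Iii] := null_real s1 ia ib (fun p np => let: conj (conj x y) (conj z t) := o A B p A0 B0 np in
  And4 (congr1 (fun z : R[i] => Im z) x) (congr1 (fun z : R[i] => Im z) y) (congr1 (fun z : R[i] => Im z) z) (congr1 (fun z : R[i] => Im z) t)) (C _ _ _ _ a1' b2' a2' b1') dia dib.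
have mU := @measurable_udisc R : @measurable _ P2 _.
apply: complex_eq.
  rewrite -[LHS]/(\int[mu2]_(p in @udisc R) Re ((A1 p * B2 p - A2 p * B1 p) * (jac Phi p)%:C)).
  rewrite -[RHS]/(0 : R) -[RHS](subrr 0) -{1}Irr -Iii -(RintegralB mU irr iii).
  by apply: eq_Rintegral => p _; rewrite !reimE; ring.
rewrite -[LHS]/(\int[mu2]_(p in @udisc R) Im ((A1 p * B2 p - A2 p * B1 p) * (jac Phi p)%:C)).
rewrite -[RHS]/(0 : R) -[RHS](addr0 0) -{1}Iri -Iir -(RintegralD mU iri iir).
by apply: eq_Rintegral => p _; rewrite !reimE; ring.
Qed.

Lemma weight_integrable c W : c < 1 -> pcont W -> (forall p, c < modulus (Phi p) ^+ 2 -> W p = 0) ->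
  cintegrable mu2 (@udisc R) (fun p => W p * (jac Phi p)%:C).
Proof.
move=> c1 [cR cI] W0'; have [s [s0 s1 Hs]] := qc_support c1.
have W0 p : ~ dsc s p -> W p = 0 by move=> /Hs /W0'.
have [cP _ _] := sP; have mU := @measurable_udisc R : @measurable _ P2 _; have md := measurable_dsc s.
have iJ : mu2.-integrable (dsc s) (EFin \o jac Phi).
  apply: (@Rintegrable_le _ P2 _ mu2 _ md _ (gradsq Phi)); last by move=> p _; exact: jac_le.
    exact: measurable_funTS (measurable_jac cP).
  exact: (qe_l2 qc s1).
have key F : continuous F -> (forall p, ~ dsc s p -> F p = 0) ->
    mu2.-integrable (@udisc R) (EFin \o (fun p => F p * jac Phi p)).
  move=> cF F0; have [M M0 HM] := box_bounded cF.
  apply: (@integrable_support s) => //; last by move=> p /F0 ->; rewrite mul0r.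
  rewrite (_ : (fun p => _) = (fun p => jac Phi p * F p)); last by apply/funext => p; rewrite mulrC.
  apply: (@Rintegrable_bounded _ _ P2 mu2 _ _ _ M) => //.
    exact: measurable_funTS (continuous_plane_measurable cF).
  by move=> p /(dsc_udisc s1) /udisc_box /HM.
split.
  have := key _ cR (fun p np => congr1 (fun z : R[i] => Re z) (W0 p np)); congr (mu2.-integrable _ _).
  by apply/funext => p; congr EFin; rewrite !reimE mulr0 subr0.
have := key _ cI (fun p np => congr1 (fun z : R[i] => Im z) (W0 p np)); congr (mu2.-integrable _ _).
by apply/funext => p; congr EFin; rewrite !reimE mulr0 add0r.
Qed.

End extension.
End local_sobolev.

(** * Area integrals of powers of a quasiconformal map *)

Section area.
Context (R : realType).
Local Notation mu2 := (@plane_measure R).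
Local Notation P2 := (measurableTypeR R * measurableTypeR R)%type.
Local Notation D := (@udisc R).
Variables (Phi : R * R -> R[i]) (K : R).
Hypothesis qc : qc_ext Phi K.
Let sP := qe_sob qc.
Let cP : pcont Phi. Proof. by case: sP. Qed.
Let mD : @measurable _ P2 D. Proof. exact: measurable_udisc. Qed.
Implicit Types (W : R * R -> R[i]) (p : R * R) (N j k : nat).

Lemma jet_eq W W1 W2 V V1 V2 : (forall p, W p = V p) -> (forall p, W1 p = V1 p) ->
  (forall p, W2 p = V2 p) -> jet Phi W W1 W2 -> jet Phi V V1 V2.
Proof. by move=> /funext-> /funext-> /funext->. Qed.

Lemma jetX W W1 W2 n : jet Phi W W1 W2 -> jet Phi (fun p => W p ^+ n.+1)
  (fun p => n.+1%:R * W p ^+ n * W1 p) (fun p => n.+1%:R * W p ^+ n * W2 p).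
Proof.
move=> jW; elim: n => [|n IH].
  by apply: jet_eq jW => p; rewrite ?expr1// expr0 !mul1r.
apply: (jet_eq _ _ _ (jetM jW IH)) => p; first by rewrite [RHS]exprS.
  by rewrite exprS -[n.+2]addn1 natrD; ring.
by rewrite exprS -[n.+2]addn1 natrD; ring.
Qed.

Lemma jet_sum (I : Type) (s : seq I) (F F1 F2 : I -> R * R -> R[i]) :
  (forall i, jet Phi (F i) (F1 i) (F2 i)) ->
  jet Phi (fun p => \sum_(i <- s) F i p) (fun p => \sum_(i <- s) F1 i p) (fun p => \sum_(i <- s) F2 i p).
Proof.
move=> H; elim: s => [|i s IH].
  by apply: jet_eq (jet_cst _ 0) => p; rewrite big_nil.
by apply: jet_eq (jetD (H i) IH) => p; rewrite big_cons.
Qed.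

Lemma jetZ c W W1 W2 : jet Phi W W1 W2 ->
  jet Phi (fun p => c * W p) (fun p => c * W1 p) (fun p => c * W2 p).
Proof. by move=> jW; apply: jet_eq (jetM (jet_cst Phi c) jW) => p //; ring. Qed.

Definition rho p : R := modulus (Phi p) ^+ 2.

Lemma rho_ge0 p : 0 <= rho p. Proof. exact: sqr_ge0. Qed.
Lemma rho_le1 p : D p -> rho p <= 1. Proof. by move=> /(qe_in qc) /ltW. Qed.

Lemma PhiE p : Phi p = (Re (Phi p))%:C + (0 +i* 1) * (Im (Phi p))%:C.
Proof. by apply: complex_eq => /=; ring. Qed.

Lemma PhiJE p : conjc (Phi p) = (Re (Phi p))%:C - (0 +i* 1) * (Im (Phi p))%:C.
Proof. by case: (Phi p) => x y; apply: complex_eq => /=; ring. Qed.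

Lemma conjc_i : conjc (0 +i* 1) = - (0 +i* 1) :> R[i].
Proof. by apply: complex_eq => /=; ring. Qed.

Let i2 : (0 +i* 1) * (0 +i* 1) = - 1 :> R[i].
Proof. by apply: complex_eq => /=; ring. Qed.

Lemma jet_rho : jet Phi (fun p => (rho p)%:C)
  (fun p => (2 * Re (Phi p))%:C) (fun p => (2 * Im (Phi p))%:C).
Proof.
have j1 := jet_id sP; apply: jet_eq (jetM j1 (jetJ j1)) => p; first exact: mulcJ.
  rewrite conjc1 real_complexM real_complex_nat PhiJE; have PE := PhiE p.
  by move: (Phi p) (Re (Phi p))%:C (Im (Phi p))%:C PE => z x y ->; ring.
rewrite conjc_i real_complexM real_complex_nat PhiJE; have PE := PhiE p.
move: (Phi p) (Re (Phi p))%:C (Im (Phi p))%:C PE => z x y ->.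
by move: (0 +i* 1) i2 => i ii; ring: ii.
Qed.

(* A radial cut-off, supported in [rho^(N+1) <= 1/2], that increases to 1 on the
   disc; [dkap] is its derivative in [rho]. *)
Definition kap N p : R := pos (1 - 2 * rho p ^+ N.+1) ^+ 2.
Definition dkap N p : R := - 4 * N.+1%:R * rho p ^+ N * pos (1 - 2 * rho p ^+ N.+1).

Lemma jet_kap N : jet Phi (fun p => (kap N p)%:C)
  (fun p => (dkap N p * (2 * Re (Phi p)))%:C) (fun p => (dkap N p * (2 * Im (Phi p)))%:C).
Proof.
have j := jet_pos2 (jetD (jet_cst Phi 1) (jetZ (- 2) (jetX N jet_rho))).
have E p : Re (1 + - 2 * (rho p)%:C ^+ N.+1) = 1 - 2 * rho p ^+ N.+1.
  by rewrite mulNr -real_complexX -real_complex_nat -real_complexM !reimE.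
have E2 p y : Re (0 + - 2 * (N.+1%:R * (rho p)%:C ^+ N * y%:C)) = - 2 * (N.+1%:R * rho p ^+ N * y).
  by rewrite -real_complexX -!real_complex_nat -real_complexN -!real_complexM !reimE add0r.
apply: (jet_eq _ _ _ j) => p; first by rewrite E.
  by rewrite E E2 /dkap; congr (_%:C); ring.
by rewrite E E2 /dkap; congr (_%:C); ring.
Qed.

Lemma bernoulli_le (x : R) n : 0 <= x <= 1 -> 1 - n%:R * x <= (1 - x) ^+ n.
Proof.
move=> /andP[x0 x1]; elim: n => [|n IH]; first by rewrite mul0r subr0 expr0.
rewrite exprS; apply: (@le_trans _ _ ((1 - x) * (1 - n%:R * x))).
  rewrite -[n.+1]addn1 natrD -subr_ge0 (_ : _ - _ = n%:R * x ^+ 2); last by ring.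
  by rewrite mulr_ge0// sqr_ge0.
by rewrite ler_wpM2l// subr_ge0.
Qed.

(** A threshold below 1 beyond which [kap N] vanishes: Bernoulli's inequality gives
    [kcut N ^+ N.+1 >= 1 / 2]. *)
Definition kcut N : R := 1 - (2 * N.+1%:R)^-1.

Lemma kcut_lt1 N : kcut N < 1.
Proof. by rewrite ltrBlDr ltrDl invr_gt0 mulr_gt0. Qed.

Lemma pos0 x : x <= 0 -> pos x = 0 :> R.
Proof. by move=> x0; rewrite /pos (max_idPr x0). Qed.

Lemma pos_id x : 0 <= x -> pos x = x :> R.
Proof. by move=> x0; rewrite /pos (max_idPl x0). Qed.

Lemma kap_out N p : kcut N < rho p -> pos (1 - 2 * rho p ^+ N.+1) = 0.
Proof.
move=> h; apply: pos0.
pose y : R := (2 * N.+1%:R)^-1.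
have y0 : 0 <= y by rewrite invr_ge0 mulr_ge0.
have y1 : y <= 1.
  by rewrite /y -natrM invf_le1 ?ltr0n ?muln_gt0// ler1n muln_gt0.
have := @bernoulli_le y N.+1; rewrite y0 y1 => /(_ isT).
have -> : N.+1%:R * y = 2^-1.
  by rewrite /y invfM mulrCA mulfV ?mulr1// pnatr_eq0.
have : (1 - y) ^+ N.+1 <= rho p ^+ N.+1.
  by rewrite lerXn2r ?nnegrE ?rho_ge0 ?subr_ge0// ltW.
lra.
Qed.

Lemma continuous_rho : continuous rho.
Proof. by have [_ [c _] _ _] := jet_rho; have [[[c1 _] _ _] _ _ _] := jet_rho. Qed.

Lemma pcontX W n : pcont W -> pcont (fun p => W p ^+ n).
Proof.
move=> cW; elim: n => [|n IH]; first by under eq_fun do rewrite expr0; exact: pcont_cst.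
by under eq_fun do rewrite exprS; exact: pcontM.
Qed.

(** The two weights of [jac Phi] in the null Lagrangians: in [Eu] both derivatives fall on the
    monomials, in [Ev] one of them falls on the cut-off. *)
Definition Eu j k N p : R[i] := Phi p ^+ j * conjc (Phi p) ^+ k * (kap N p ^+ 2)%:C.
Definition Ev j k N p : R[i] := Phi p ^+ j * conjc (Phi p) ^+ k * (rho p * kap N p * dkap N p)%:C.

Lemma jac_ge0 : {ae mu2, forall p, D p -> 0 <= jac Phi p}.
Proof.
apply: ae_imply (qe_dil qc) => p H Dp; have := le_trans (gradsq_ge0 _ _) (H Dp).
by rewrite pmulr_rge0 ?(qe_K qc).
Qed.

Lemma continuous_kap N : continuous (kap N).
Proof. by have [[[c _] _ _] _ _ _] := jet_kap N. Qed.

Lemma Eu_integrable j k N : cintegrable mu2 D (fun p => Eu j k N p * (jac Phi p)%:C).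
Proof.
apply: (weight_integrable qc (kcut_lt1 N)) => [|p h]; last first.
  by rewrite /Eu /kap (kap_out h) !expr0n mulr0.
apply: pcontM; first by apply: pcontM; apply: pcontX => //; exact: pcontJ.
have [[c _ _] _ _ _] := jet_kap N.
by under eq_fun do rewrite expr2 real_complexM; exact: pcontM.
Qed.

Lemma Ev_integrable j k N : cintegrable mu2 D (fun p => Ev j k N p * (jac Phi p)%:C).
Proof.
apply: (weight_integrable qc (kcut_lt1 N)) => [|p h]; last first.
  by rewrite /Ev /kap (kap_out h) expr0n mulr0 mul0r mulr0.
apply: pcontM; first by apply: pcontM; apply: pcontX => //; exact: pcontJ.
have [[c _ _] c1 c2 _] := jet_kap N; have [cr ci] := cP.
(* Continuity of [rho * dkap N] is read off the jet of [kap N], contracted with the components of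
   [Phi]. *)
rewrite (_ : (fun p => _) = (fun p => (2^-1)%:C * ((kap N p)%:C * ((Re (Phi p))%:C * (dkap N p * (2 * Re (Phi p)))%:C +
    (Im (Phi p))%:C * (dkap N p * (2 * Im (Phi p)))%:C)))).
  by apply: pcontM; [exact: pcont_cst|apply: pcontM => //; apply: pcontD; apply: pcontM => //; exact: pcont_real].
apply/funext => p; rewrite -!real_complexM -real_complexD -!real_complexM /rho modulus2; congr (_%:C); by field.
Qed.

Definition cu j k N := cintegral mu2 D (fun p => Eu j k N p * (jac Phi p)%:C).
Definition cv j k N := cintegral mu2 D (fun p => Ev j k N p * (jac Phi p)%:C).

Let i0 : (0 +i* 1) != 0 :> R[i].
Proof. by apply/eqP => /(congr1 (fun z : R[i] => Im z)) /= /eqP; rewrite oner_eq0. Qed.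

(* The null Lagrangian of [Phi^(j+1) kap] and [conj Phi^(k+1) kap]. *)
Lemma null_power j k N : j.+1%:R * k.+1%:R * cu j k N + (j + k + 2)%:R * cv j k N = 0.
Proof.
have j1 := jet_id sP; have jk := jet_kap N.
have o (W V : R * R -> R[i]) p : kcut N < modulus (Phi p) ^+ 2 -> W p * (kap N p)%:C = 0.
  by move=> h; rewrite /kap (kap_out h) expr0n mulr0.
have := null_complex qc (kcut_lt1 N) (jetM (jetX j j1) jk) (jetM (jetX k (jetJ j1)) jk)
  (o _ (fun=> 0)) (o _ (fun=> 0)).
rewrite (_ : (fun p => _) = (fun p => (- 2 * (0 +i* 1)) *
  ((j.+1%:R * k.+1%:R) * (Eu j k N p * (jac Phi p)%:C) + (j + k + 2)%:R * (Ev j k N p * (jac Phi p)%:C)))).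
  have h1 := cintegrableZ mD (j.+1%:R * k.+1%:R) (Eu_integrable j k N).
  have h2 := cintegrableZ mD (j + k + 2)%:R (Ev_integrable j k N).
  rewrite (cintegralZ mD _ (cintegrableD mD h1 h2)) (cintegralD mD h1 h2).
  rewrite (cintegralZ mD _ (Eu_integrable j k N)) (cintegralZ mD _ (Ev_integrable j k N)).
  by move/eqP; rewrite mulf_eq0 mulf_eq0 oppr_eq0 (negbTE i0) pnatr_eq0 /= => /eqP.
apply/funext => p; rewrite /Eu /Ev conjc1 conjc_i.
have rE : (rho p)%:C = Phi p * conjc (Phi p) by rewrite mulcJ.
move: (rho p) (kap N p) (dkap N p) (jac Phi p) rE => r a b c rE.
rewrite expr2 !real_complexM rE !real_complex_nat !exprS PhiJE.
have PE := PhiE p; move: (Phi p) (Re (Phi p))%:C (Im (Phi p))%:C PE => z x y ->.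
move: (0 +i* 1) i2 => i ii; set P := _ ^+ j; set Q := _ ^+ k.
move: P Q a%:C b%:C c%:C => P Q {}a {}b {}c.
rewrite !natrD -[j.+1]addn1 -[k.+1]addn1 !natrD; ring: ii.
Qed.

(* The null Lagrangian of [Phi^j conj Phi^k kap] and [kap]. *)
Lemma null_angular j k N : (j%:R - k%:R) * cv j k N = 0.
Proof.
have j1 := jet_id sP; have jk := jet_kap N.
have o W p : kcut N < modulus (Phi p) ^+ 2 -> W p * (kap N p)%:C = 0.
  by move=> h; rewrite /kap (kap_out h) expr0n mulr0.
have o1 p : kcut N < modulus (Phi p) ^+ 2 -> (kap N p)%:C = 0.
  by move=> h; rewrite /kap (kap_out h) expr0n.
have := null_complex qc (kcut_lt1 N) (jetM (jetM (jetX j j1) (jetX k (jetJ j1))) jk) jk (o _) o1.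
rewrite (_ : (fun p => _) = (fun p => (- 2 * (0 +i* 1)) *
  ((j%:R - k%:R) * (Ev j k N p * (jac Phi p)%:C)))).
  have h2 := cintegrableZ mD (j%:R - k%:R) (Ev_integrable j k N).
  rewrite (cintegralZ mD _ h2) (cintegralZ mD _ (Ev_integrable j k N)).
  by move/eqP; rewrite mulf_eq0 mulf_eq0 oppr_eq0 (negbTE i0) pnatr_eq0 /= => /eqP.
apply/funext => p; rewrite /Eu /Ev conjc1 conjc_i.
have rE : (rho p)%:C = Phi p * conjc (Phi p) by rewrite mulcJ.
move: (rho p) (kap N p) (dkap N p) (jac Phi p) rE => r a b c rE.
rewrite !real_complexM rE !real_complex_nat !exprS PhiJE.
have PE := PhiE p; move: (Phi p) (Re (Phi p))%:C (Im (Phi p))%:C PE => z x y ->.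
move: (0 +i* 1) i2 => i ii; set P := _ ^+ j; set Q := _ ^+ k.
move: P Q a%:C b%:C c%:C => P Q {}a {}b {}c.
rewrite -[j.+1]addn1 -[k.+1]addn1 !natrD; ring: ii.
Qed.

(** Analogue of the orthogonality of the powers of [z] on the disc: [null_angular] removes [cv], and
    [null_power] then removes [cu]. *)
Lemma cu_orthogonal j k N : j != k -> cu j k N = 0.
Proof.
move=> jk; have v0 : cv j k N = 0.
  by have /eqP := null_angular j k N; rewrite mulf_eq0 subr_eq0 eqr_nat (negbTE jk) => /eqP.
by have /eqP := null_power j k N; rewrite v0 mulr0 addr0 !mulf_eq0 !pnatr_eq0 => /eqP.
Qed.

Lemma int_jac_ge0 (f : R * R -> R) : measurable_fun (D : set P2) f -> (forall p, D p -> 0 <= f p) ->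
  0 <= \int[mu2]_(p in D) (f p * jac Phi p).
Proof.
move=> mf f0; have mJ : measurable_fun (D : set P2) (jac Phi) by apply: measurable_funTS; exact: measurable_jac.
rewrite (@ae_Rintegral _ P2 R mu2 D _ (fun p => f p * Num.max (jac Phi p) 0) mD).
- by apply: Rintegral_ge0 => // p Dp; rewrite mulr_ge0 ?f0// le_max lexx orbT.
- exact: measurable_funM.
- by apply: measurable_funM => //; exact: measurable_maxr.
- by apply: ae_imply jac_ge0 => p H Dp; rewrite (max_idPl (H Dp)).
Qed.

Definition Au k N : R := \int[mu2]_(p in D) (rho p ^+ k * kap N p ^+ 2 * jac Phi p).
Definition Av k N : R := \int[mu2]_(p in D) (rho p ^+ k.+1 * kap N p * dkap N p * jac Phi p).

Lemma rhoE p : Phi p * conjc (Phi p) = (rho p)%:C. Proof. exact: mulcJ. Qed.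

Let EuE k N p : Eu k k N p = (rho p ^+ k * kap N p ^+ 2)%:C.
Proof. by rewrite /Eu -exprMn mulcJ -real_complexX -real_complexM. Qed.
Let EvE k N p : Ev k k N p = (rho p ^+ k.+1 * kap N p * dkap N p)%:C.
Proof. by rewrite /Ev -exprMn rhoE -real_complexX -real_complexM exprSr !mulrA. Qed.

Lemma Au_integrable k N :
  mu2.-integrable D (EFin \o (fun p => rho p ^+ k * kap N p ^+ 2 * jac Phi p)).
Proof.
have [+ _] := Eu_integrable k k N; congr (mu2.-integrable _ _); apply/funext => p.
by rewrite -[LHS]/(Re (Eu k k N p * (jac Phi p)%:C))%:E EuE -real_complexM.
Qed.

Lemma Av_integrable k N :
  mu2.-integrable D (EFin \o (fun p => rho p ^+ k.+1 * kap N p * dkap N p * jac Phi p)).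
Proof.
have [+ _] := Ev_integrable k k N; congr (mu2.-integrable _ _); apply/funext => p.
by rewrite -[LHS]/(Re (Ev k k N p * (jac Phi p)%:C))%:E EvE -real_complexM.
Qed.

Lemma cu_diag k N : cu k k N = (Au k N)%:C.
Proof.
rewrite /cu (_ : (fun p => _) = (fun p => (rho p ^+ k * kap N p ^+ 2 * jac Phi p)%:C)) ?cintegral_real//.
by apply/funext => p; rewrite EuE -real_complexM.
Qed.

Lemma cv_diag k N : cv k k N = (Av k N)%:C.
Proof.
rewrite /cv (_ : (fun p => _) = (fun p => (rho p ^+ k.+1 * kap N p * dkap N p * jac Phi p)%:C)) ?cintegral_real//.
by apply/funext => p; rewrite EvE -real_complexM.
Qed.

Lemma Au_Av k N : k.+1%:R * Au k N = - 2 * Av k N.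
Proof.
have := null_power k k N; rewrite cu_diag cv_diag -!real_complex_nat -!real_complexM -real_complexD.
move=> /(congr1 (fun z : R[i] => Re z)); rewrite -[Re 0]/(0 : R) -[Re _]/(_ + _ : R).
rewrite (_ : (k + k + 2)%:R = 2 * k.+1%:R :> R); last by rewrite -[k.+1]addn1 !natrD; ring.
have k0 : k.+1%:R != 0 :> R by rewrite pnatr_eq0.
move=> H; apply: (mulfI k0); move/eqP: H; rewrite addr_eq0 => /eqP H.
by rewrite mulrA H; ring.
Qed.

Lemma dkap_le0 N p : dkap N p <= 0.
Proof.
by rewrite /dkap mulNr mulNr mulNr oppr_le0 !mulr_ge0 ?pos_ge0// exprn_ge0 ?rho_ge0.
Qed.

Lemma kap_ge0 N p : 0 <= kap N p. Proof. exact: sqr_ge0. Qed.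

Lemma kap_le1 N p : kap N p <= 1.
Proof.
have h : 0 <= rho p ^+ N.+1 by rewrite exprn_ge0 ?rho_ge0.
by rewrite /kap expr_le1 ?pos_ge0//; have [[-> _]|[-> _]] := posP (1 - 2 * rho p ^+ N.+1); lra.
Qed.

Let meas_int (f : R * R -> R) : mu2.-integrable D (EFin \o f) -> measurable_fun (D : set P2) f.
Proof. by move=> /integrableP[/measurable_EFinP]. Qed.

Let mrho : measurable_fun (D : set P2) rho.
Proof. by apply: measurable_funTS; apply: continuous_plane_measurable; exact: continuous_rho. Qed.
Let mkap N : measurable_fun (D : set P2) (kap N).
Proof. by apply: measurable_funTS; apply: continuous_plane_measurable; exact: continuous_kap. Qed.
Let mpos (f : R * R -> R) : measurable_fun (D : set P2) f -> measurable_fun (D : set P2) (fun p => pos (f p)).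
Proof. by move=> mf; apply: measurable_maxr => //; exact: measurable_cst. Qed.
Let mdkap N : measurable_fun (D : set P2) (dkap N).
Proof.
apply: measurable_funM; first by apply: measurable_funM; [exact: measurable_cst|exact: measurable_funX].
apply: mpos.
apply: measurable_funB; first exact: measurable_cst.
by apply: measurable_funM; [exact: measurable_cst|exact: measurable_funX].
Qed.

(** Since [dkap <= 0] and [rho <= 1], [- Av k N] is at most [- Av 0 N], and [Au_Av] translates this.
    For the identity without cut-off the integrals are [pi / (k + 1)]. *)
Lemma Au_le k N : k.+1%:R * Au k N <= Au 0 N.
Proof.
have := Au_Av 0 N; rewrite mul1r => ->; rewrite Au_Av.
suff : 0 <= Av k N - Av 0 N by lra.
rewrite /Av -(RintegralB mD (Av_integrable k N) (Av_integrable 0 N)).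
rewrite (_ : (fun p => _ - _) = (fun p => (rho p * (rho p ^+ k - 1) * kap N p * dkap N p) * jac Phi p)); last first.
  by apply/funext => p; rewrite exprS expr1; ring.
apply: int_jac_ge0 => [|p Dp].
  apply: measurable_funM => //; apply: measurable_funM => //; apply: measurable_funM => //.
  by apply: measurable_funB; [exact: measurable_funX|exact: measurable_cst].
rewrite mulr_le0 ?dkap_le0// mulr_le0_ge0 ?kap_ge0// mulr_ge0_le0 ?rho_ge0// subr_le0.
by rewrite exprn_ile1 ?rho_ge0 ?rho_le1.
Qed.

(** At least 1 where [rho <= 3 / 4], and supported in [rho <= 7 / 8], a compact part of the disc. *)
Definition bump p : R := 8 * pos (7 / 8 - rho p).

Lemma bump_integrable : mu2.-integrable D (EFin \o (fun p => bump p * jac Phi p)).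
Proof.
have c1 : (7 / 8 : R) < 1 by lra.
have cb : continuous bump.
  move=> p; apply: cvgM; first exact: cvg_cst.
  apply: (continuous_comp (f := fun p => 7 / 8 - rho p)); last exact: continuous_pos.
  by apply: cvgB; [exact: cvg_cst|exact: continuous_rho].
have [|+ _] := weight_integrable qc c1 (pcont_real cb).
  by move=> p h; rewrite /bump pos0 ?mulr0// subr_le0 ltW.
congr (mu2.-integrable _ _); apply/funext => p.
by rewrite -[LHS]/(Re ((bump p)%:C * (jac Phi p)%:C))%:E -real_complexM.
Qed.

(** Independent of [N], as the removal of the cut-off requires. *)
Definition C0 : R := 3 * \int[mu2]_(p in D) (bump p * jac Phi p).

Lemma C0_ge0 : 0 <= C0.
Proof.
rewrite mulr_ge0// int_jac_ge0// => [|p _]; last by rewrite mulr_ge0 ?pos_ge0.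
apply: measurable_funM; first exact: measurable_cst.
apply: mpos.
by apply: measurable_funB; [exact: measurable_cst|].
Qed.

(* [2 Au 1 <= Au 0], whereas the part of [Au 0] where [rho] is close to 1 is
   nearly equal to that of [Au 1]; hence the remaining part dominates. *)
Lemma Au0_le N : Au 0 N <= C0.
Proof.
have A1 := Au_le 1 N.
(* Where [rho >= 3 / 4] the term [4 * rho] outweighs 3; elsewhere [3 * bump] does. Together with
   [2 * Au 1 N <= Au 0 N] this gives [Au 0 N <= C0]. *)
suff : 0 <= \int[mu2]_(p in D) ((3 * bump p + 4 * (rho p ^+ 1 * kap N p ^+ 2) - 3 * (rho p ^+ 0 * kap N p ^+ 2)) * jac Phi p).
  have q1 := RintegrableZ mD 3 bump_integrable.
  have q2 := RintegrableZ mD 4 (Au_integrable 1 N).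
  have q3 := RintegrableZ mD 3 (Au_integrable 0 N).
  rewrite (_ : (fun p => _ * jac Phi p) = (fun p => (3 * (bump p * jac Phi p) + 4 * (rho p ^+ 1 * kap N p ^+ 2 * jac Phi p)) -
     3 * (rho p ^+ 0 * kap N p ^+ 2 * jac Phi p))); last by apply/funext => p; ring.
  rewrite (RintegralB mD (RintegrableD mD q1 q2) q3) (RintegralD mD q1 q2).
  rewrite (RintegralZl _ mD bump_integrable) (RintegralZl _ mD (Au_integrable 1 N)) (RintegralZl _ mD (Au_integrable 0 N)).
  by rewrite -/(Au 1 N) -/(Au 0 N) -/C0; move: A1; lra.
apply: int_jac_ge0 => [|p Dp].
  have mb : measurable_fun (D : set P2) bump.
    apply: measurable_funM; first exact: measurable_cst.
    apply: mpos.
    by apply: measurable_funB; [exact: measurable_cst|].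
  apply: measurable_funB; last first.
    by apply: measurable_funM; [exact: measurable_cst|apply: measurable_funM; exact: measurable_funX].
  apply: measurable_funD; first by apply: measurable_funM; [exact: measurable_cst|].
  by apply: measurable_funM; [exact: measurable_cst|apply: measurable_funM; exact: measurable_funX].
rewrite expr0 expr1 mul1r.
have k0 : 0 <= kap N p ^+ 2 by exact: sqr_ge0.
have k1 : kap N p ^+ 2 <= 1 by rewrite expr_le1 ?kap_ge0 ?kap_le1.
rewrite /bump; move: k0 k1 (rho_ge0 p); move: (kap N p ^+ 2) (rho p) => k r k0 k1 r0.
by have [[-> h]|[-> h]] := posP (7 / 8 - r); nra.
Qed.

Definition pol n (b : nat -> R[i]) p : R[i] := \sum_(0 <= k < n) b k * Phi p ^+ k.

Lemma pol_pcont n b : pcont (pol n b).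
Proof.
rewrite /pol; elim: (index_iota 0 n) => [|i s IH].
  by under eq_fun do rewrite big_nil; exact: pcont_cst.
under eq_fun do rewrite big_cons; apply: pcontD => //.
by apply: pcontM; [exact: pcont_cst|exact: pcontX].
Qed.

(** The square is expanded: [cu_orthogonal] removes the mixed terms, and [Au_le] with [Au0_le]
    bounds the remaining ones. *)
Lemma pol_area n b N :
  mu2.-integrable D (EFin \o (fun p => modulus (pol n b p) ^+ 2 * kap N p ^+ 2 * jac Phi p)) /\
  \int[mu2]_(p in D) (modulus (pol n b p) ^+ 2 * kap N p ^+ 2 * jac Phi p) <=
  C0 * \sum_(0 <= k < n) modulus (b k) ^+ 2 / k.+1%:R.
Proof.
have iE j k : cintegrable mu2 D (fun p => (b j * conjc (b k)) * (Eu j k N p * (jac Phi p)%:C)).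
  by apply: (cintegrableZ mD); exact: Eu_integrable.
have iS : cintegrable mu2 D (fun p => \sum_(0 <= j < n) \sum_(0 <= k < n)
    (b j * conjc (b k)) * (Eu j k N p * (jac Phi p)%:C)).
  by apply: (cintegrable_sum mD) => j; apply: (cintegrable_sum mD) => k; exact: iE.
have E p : \sum_(0 <= j < n) \sum_(0 <= k < n) (b j * conjc (b k)) * (Eu j k N p * (jac Phi p)%:C) =
    (modulus (pol n b p) ^+ 2 * kap N p ^+ 2 * jac Phi p)%:C.
  rewrite real_complexM [X in X * _]real_complexM -[X in X * _ * _]mulcJ {1}/pol conjc_sum mulr_suml !mulr_suml; apply: eq_bigr => j _.
  rewrite mulr_sumr !mulr_suml; apply: eq_bigr => k _.
  by rewrite /Eu conjcM conjcX; ring.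
have S : cintegral mu2 D (fun p => \sum_(0 <= j < n) \sum_(0 <= k < n)
    (b j * conjc (b k)) * (Eu j k N p * (jac Phi p)%:C)) =
    (\sum_(0 <= k < n) modulus (b k) ^+ 2 * Au k N)%:C.
  rewrite (cintegral_sum mD) => [|j]; last by apply: (cintegrable_sum mD) => k; exact: iE.
  rewrite real_complex_sum big_nat [RHS]big_nat; apply: eq_bigr => j /andP[_ jn].
  rewrite (cintegral_sum mD) => [|k]; last exact: iE.
  rewrite (bigD1_seq j) ?mem_index_iota ?iota_uniq//= big1 => [|k kj].
    by rewrite addr0 (cintegralZ mD) ?mulcJ -?/(cu j j N) ?cu_diag -?real_complexM//; exact: Eu_integrable.
  by rewrite (cintegralZ mD) -?/(cu j k N) ?cu_orthogonal ?mulr0 1?eq_sym//; exact: Eu_integrable.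
have EQ : (fun p => \sum_(0 <= j < n) \sum_(0 <= k < n) (b j * conjc (b k)) * (Eu j k N p * (jac Phi p)%:C)) =
    (fun p => (modulus (pol n b p) ^+ 2 * kap N p ^+ 2 * jac Phi p)%:C) by apply/funext.
rewrite EQ in iS S.
have {}S : \int[mu2]_(p in D) (modulus (pol n b p) ^+ 2 * kap N p ^+ 2 * jac Phi p) =
    \sum_(0 <= k < n) modulus (b k) ^+ 2 * Au k N := congr1 (fun z : R[i] => Re z) S.
have [iS1 _] := iS; split; first exact: iS1.
rewrite S mulr_sumr; apply: ler_sum => k _.
rewrite mulrCA ler_wpM2l ?sqr_ge0// ler_pdivlMr ?ltr0n// mulrC.
exact: le_trans (Au_le k N) (Au0_le N).
Qed.

Lemma kap_cvg p : D p -> kap N p ^+ 2 @[N --> \oo] --> (1 : R).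
Proof.
move=> Dp; have r1 : `|rho p| < 1 by rewrite ger0_norm ?rho_ge0//; exact: (qe_in qc Dp).
have c1 : rho p ^+ N.+1 @[N --> \oo] --> (0 : R).
  by have := cvg_expr r1; rewrite -cvg_shiftS; apply.
have c2 : 1 - 2 * rho p ^+ N.+1 @[N --> \oo] --> (1 : R).
  rewrite -[X in _ --> X]subr0 -[X in _ - X](mulr0 2).
  by apply: cvgB; [exact: cvg_cst|apply: cvgM => //; exact: cvg_cst].
have c3 : pos (1 - 2 * rho p ^+ N.+1) @[N --> \oo] --> (1 : R).
  by have := cvg_comp _ _ c2 (@continuous_pos R 1); rewrite pos_id.
have c4 : kap N p @[N --> \oo] --> (1 : R).
  by rewrite -[X in _ --> X]mulr1 /kap; under eq_fun do rewrite expr2; exact: cvgM.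
by rewrite -[X in _ --> X]mulr1; under eq_fun do rewrite expr2; exact: cvgM.
Qed.

Lemma cvg_sandwich (u : nat -> R) (a l b : R) : u n @[n --> \oo] --> l ->
  a * u n * b @[n --> \oo] --> a * l * b.
Proof. by move=> ul; apply: cvgM; [apply: cvgM => //; exact: cvg_cst|exact: cvg_cst]. Qed.

(** The dilatation bound replaces the energy density by [K * jac Phi], and Fatou's lemma removes the
    cut-off. *)
Lemma pol_grad n b : (\int[mu2]_(p in D) (modulus (pol n b p) ^+ 2 * gradsq Phi p)%:E <=
  (K * C0 * \sum_(0 <= k < n) modulus (b k) ^+ 2 / k.+1%:R)%:E)%E.
Proof.
have mp : measurable_fun (D : set P2) (fun p => modulus (pol n b p) ^+ 2).
  apply: measurable_funX; apply: measurable_modulus; have [c1 c2] := pol_pcont n b.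
  by split; apply: measurable_funTS; exact: continuous_plane_measurable.
have mG : measurable_fun (D : set P2) (gradsq Phi) by apply: measurable_funTS; exact: measurable_gradsq.
have mJ : measurable_fun (D : set P2) (jac Phi) by apply: measurable_funTS; exact: measurable_jac.
have mk N : measurable_fun (D : set P2) (fun p => modulus (pol n b p) ^+ 2 * kap N p ^+ 2).
  by apply: measurable_funM => //; exact: measurable_funX.
apply: (fatou_le mD (u := fun N p => modulus (pol n b p) ^+ 2 * kap N p ^+ 2 * gradsq Phi p)).
- by move=> N; exact: measurable_funM.
- exact: measurable_funM.
- by move=> N p _; apply: mulr_ge0 (gradsq_ge0 _ _); apply: mulr_ge0; exact: sqr_ge0.
- apply: ae_all => p /kap_cvg kc; rewrite (_ : modulus (pol n b p) ^+ 2 * gradsq Phi p =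
    modulus (pol n b p) ^+ 2 * 1 * gradsq Phi p); last by rewrite mulr1.
  exact: cvg_sandwich.
near=> N; have [iA lA] := pol_area n b N.
(* The Jacobian is nonnegative almost everywhere; the maximum with 0 is nonnegative everywhere. *)
pose v p := modulus (pol n b p) ^+ 2 * kap N p ^+ 2 * (K * Num.max (jac Phi p) 0).
have mM : measurable_fun (D : set P2) (fun p => Num.max (jac Phi p) 0) by exact: measurable_maxr.
have mv : measurable_fun (D : set P2) v by apply: measurable_funM => //; exact: measurable_funM.
have vE : {ae mu2, forall p, D p -> v p = K * (modulus (pol n b p) ^+ 2 * kap N p ^+ 2 * jac Phi p)}.
  by apply: ae_imply jac_ge0 => p H Dp; rewrite /v (max_idPl (H Dp)); ring.
have iK := RintegrableZ mD K iA.
have iv := @ae_Rintegrable _ P2 R mu2 D _ _ mD mv vE iK.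
apply: (@le_trans _ _ (\int[mu2]_(p in D) (v p)%:E)%E).
  apply: (@ae_ge0_le_integral _ P2) => //.
  - by move=> p _; rewrite lee_fin; apply: mulr_ge0 (gradsq_ge0 _ _); apply: mulr_ge0; exact: sqr_ge0.
  - by apply/measurable_EFinP; exact: measurable_funM.
  - move=> p _; rewrite lee_fin; apply: mulr_ge0; first by apply: mulr_ge0; exact: sqr_ge0.
    by apply: mulr_ge0; [exact: ltW (qe_K qc)|rewrite le_max lexx orbT].
  - exact/measurable_EFinP.
  apply: (ae_imply2 _ (qe_dil qc) jac_ge0) => p H1 H2 Dp; rewrite lee_fin; apply: ler_wpM2l; first by apply: mulr_ge0; exact: sqr_ge0.
  by rewrite (max_idPl (H2 Dp)) H1.
rewrite (integral_EFin mD iv) lee_fin (@ae_Rintegral _ P2 R mu2 D v _ mD mv _ vE); last first.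
  by apply: measurable_funM; [exact: measurable_cst|exact: measurable_funM].
by rewrite (RintegralZl _ mD iA) -mulrA ler_wpM2l// ltW// (qe_K qc).
Unshelve. all: by end_near. Qed.

(** On the circle these are the powers of [phi]; a negative power is represented by a power of the
    conjugate, which has no pole in the disc. *)
Definition eps (i : idx) p : R[i] :=
  match i with inl k => Phi p ^+ k.+1 | inr k => conjc (Phi p) ^+ k.+1 end.

Definition extF n (a : idx -> R[i]) p : R[i] := \sum_(i <- ixs n) a i * eps i p.

Lemma big_ixs (V : nmodType) (f : idx -> V) n :
  \sum_(i <- ixs n) f i = \sum_(0 <= k < n) f (inl k) + \sum_(0 <= k < n) f (inr k).
Proof.
elim: n => [|n IH]; first by rewrite !big_nil addr0.
rewrite !big_nat_recr//= big_cat IH !big_cons big_nil /=.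
by rewrite addr0 addrACA.
Qed.

Lemma jet_extF n a : jet Phi (extF n a)
  (fun p => pol n (fun k => a (inl k) * k.+1%:R) p + conjc (pol n (fun k => conjc (a (inr k)) * k.+1%:R) p))
  (fun p => (0 +i* 1) * (pol n (fun k => a (inl k) * k.+1%:R) p -
     conjc (pol n (fun k => conjc (a (inr k)) * k.+1%:R) p))).
Proof.
have j1 := jet_id sP.
have h1 := jet_sum (index_iota 0 n) (fun k => jetZ (a (inl k)) (jetX k j1)).
have h2 := jet_sum (index_iota 0 n) (fun k => jetZ (a (inr k)) (jetX k (jetJ j1))).
apply: (jet_eq _ _ _ (jetD h1 h2)) => p; first by rewrite /extF big_ixs.
  rewrite conjc1 /pol conjc_sum; congr (_ + _); apply: eq_bigr => k _; first by ring.
  by rewrite !conjcM conjcX conjcK conjc_nat; ring.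
rewrite conjc_i /pol conjc_sum mulrBr !mulr_sumr; congr (_ + _).
  by apply: eq_bigr => k _; ring.
rewrite -sumrN; apply: eq_bigr => k _; rewrite !conjcM conjcX conjcK conjc_nat; ring.
Qed.

Lemma extF_csob n a : csob (extF n a). Proof. by case: (jet_extF n a). Qed.

Lemma extF_grad n a : (\int[mu2]_(p in D) (gradsq (extF n a) p)%:E <=
  (2 * (K * C0) * \sum_(i <- ixs n) (irank i).+1%:R * modulus (a i) ^+ 2)%:E)%E.
Proof.
set b := fun k => a (inl k) * k.+1%:R; set c := fun k => conjc (a (inr k)) * k.+1%:R.
have mp e : measurable_fun (D : set P2) (fun p => modulus (pol n e p) ^+ 2 * gradsq Phi p).
  apply: measurable_funM; last by apply: measurable_funTS; exact: measurable_gradsq.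
  apply: measurable_funX; apply: measurable_modulus; have [c1 c2] := pol_pcont n e.
  by split; apply: measurable_funTS; exact: continuous_plane_measurable.
have p0 e p : 0 <= modulus (pol n e p) ^+ 2 * gradsq Phi p by exact: mulr_ge0 (sqr_ge0 _) (gradsq_ge0 _ _).
have mF : measurable_fun (D : set P2) (gradsq (extF n a)).
  by apply: measurable_funTS; apply: measurable_gradsq; case: (extF_csob n a).
pose v p := 2 * (modulus (pol n b p) ^+ 2 * gradsq Phi p + modulus (pol n c p) ^+ 2 * gradsq Phi p).
apply: (@le_trans _ _ (\int[mu2]_(p in D) (v p)%:E)%E).
  apply: (@ae_ge0_le_integral _ P2) => //.
  - by move=> p _; rewrite lee_fin gradsq_ge0.
  - exact/measurable_EFinP.
  - by move=> p _; rewrite lee_fin mulr_ge0// addr_ge0.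
  - by apply/measurable_EFinP; apply: measurable_funM; [exact: measurable_cst|exact: measurable_funD].
  apply: ae_imply (jet_cp sP (jet_extF n a)) => p H /H[hx hy]; rewrite lee_fin /gradsq hx hy -/b -/c.
  (* The derivative in the direction [z] is [z P + conj (z Q)], the sum of a holomorphic and an
     antiholomorphic part. *)
  have key (z P Q : R[i]) : modulus ((Re z)%:C * (P + conjc Q) + (Im z)%:C * ((0 +i* 1) * (P - conjc Q))) ^+ 2 <=
      2 * (modulus P ^+ 2 * modulus z ^+ 2 + modulus Q ^+ 2 * modulus z ^+ 2).
    rewrite (_ : _ + _ = z * P + conjc (z * Q)); last first.
      by case: z P Q => z1 z2 [q1 q2] [r1 r2]; apply: complex_eq => /=; ring.
    have := modulusD (z * P) (conjc (z * Q)); rewrite modulusJ [modulus (z * P)]modulusM [modulus (z * Q)]modulusM.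
    have := modulus_ge0 (z * P + conjc (z * Q)).
    move: (modulus (_ + _)) (modulus z) (modulus P) (modulus Q) => m x y w m0 ml.
    have h := sqr_ge0 (x * y - x * w).
    have : m ^+ 2 <= (x * y + x * w) ^+ 2 by rewrite ler_sqr ?nnegrE//; exact: le_trans m0 ml.
    nra.
  have E (x y z w : R) : 2 * (x * z + y * z) + 2 * (x * w + y * w) = 2 * (x * (z + w) + y * (z + w)) by ring.
  by apply: (le_trans (lerD (key _ _ _) (key _ _ _))); rewrite E lexx.
have iq e : mu2.-integrable D (EFin \o (fun p => modulus (pol n e p) ^+ 2 * gradsq Phi p)).
  apply: (@Rintegrable_ge0 _ P2 _ mu2 D) => //.
  exact: le_lt_trans (pol_grad n e) (ltry _).
have lq e : \int[mu2]_(p in D) (modulus (pol n e p) ^+ 2 * gradsq Phi p) <=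
    K * C0 * \sum_(0 <= k < n) modulus (e k) ^+ 2 / k.+1%:R.
  by rewrite -lee_fin -(integral_EFin mD (iq e)) pol_grad.
have ibc := RintegrableD mD (iq b) (iq c).
rewrite (integral_EFin mD (RintegrableZ mD 2 ibc)) lee_fin /v (RintegralZl _ mD ibc) (RintegralD mD (iq b) (iq c)).
apply: (@le_trans _ _ (2 * (K * C0 * \sum_(0 <= k < n) modulus (b k) ^+ 2 / k.+1%:R +
    K * C0 * \sum_(0 <= k < n) modulus (c k) ^+ 2 / k.+1%:R))).
  by rewrite ler_wpM2l// lerD.
rewrite big_ixs -mulrDr !mulrA.
have e (x : R[i]) k : modulus (x * k.+1%:R) ^+ 2 / k.+1%:R = k.+1%:R * modulus x ^+ 2.
  have k0 : k.+1%:R != 0 :> R by rewrite pnatr_eq0.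
  by rewrite modulusM -real_complex_nat modulus_real normr_nat exprMn expr2 mulrA mulfK// mulrC.
rewrite /b /c; under eq_bigr do rewrite e; under [in X in _ + X]eq_bigr do rewrite e modulusJ.
by rewrite lexx.
Qed.

End area.

(** * Green's formula on the disc *)

Section green.
Context (R : realType).
Local Notation leb := (@lebesgue_measure R).
Local Notation mu2 := (@plane_measure R).
Local Notation P2 := (measurableTypeR R * measurableTypeR R)%type.
Local Notation D := (@udisc R).
Implicit Types (g : R * R -> R) (W : R * R -> R[i]).

Lemma continuous_pair_comp g (u v : R -> R) : continuous g -> continuous u -> continuous v ->
  continuous (fun t => g (u t, v t)).
Proof.
move=> /plane_continuousP cg cu cv t; apply/cvgrPdist_lt => e e0.
have [d d0 H] := cg (u t, v t) e e0; near=> s; rewrite distrC; apply: H => /=; rewrite distrC; near: s.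
  by move/cvgrPdist_lt : (cu t); apply.
by move/cvgrPdist_lt : (cv t); apply.
Unshelve. all: by end_near. Qed.

Lemma continuous_root : continuous (fun x : R => Num.sqrt (1 - x ^+ 2)).
Proof.
move=> x; apply: (continuous_comp (f := fun x : R => 1 - x ^+ 2) (g := @Num.sqrt R)); last exact: sqrt_continuous.
by apply: cvgB; [exact: cvg_cst|exact: exprn_continuous].
Qed.

Lemma derive1_cos : derive1 (@cos R) = fun t => - sin t.
Proof. by apply/funext => t; apply: derive1_is_derive; exact: is_derive_cos. Qed.

Lemma cos_LR (a b : R) : derivable_oo_LRcontinuous (@cos R) a b.
Proof.
split; first by move=> x _; apply: derivable_is_derive (is_derive_cos x).
  by apply: cvg_at_right_filter; exact: continuous_cos.
by apply: cvg_at_left_filter; exact: continuous_cos.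
Qed.

Lemma continuous_Nsin : continuous (fun t : R => - sin t).
Proof. by move=> t; apply: cvgN; exact: continuous_sin. Qed.

Lemma upper_arc (G : R -> R) : continuous G ->
  \int[leb]_(x in `[(-1), 1]) G x = \int[leb]_(t in `[0, pi]) (G (cos t) * sin t).
Proof.
move=> cG; have := @integration_by_substitution_decreasing R cos G 0 pi (pi_ge0 R).
rewrite derive1_cos cos0 cospi => H; rewrite /Rintegral H.
- by congr fine; apply: eq_integral => t _; rewrite -[LHS]/((G (cos t) * - - sin t)%:E) opprK.
- by move=> x y x0 y0 xy; rewrite ltr_cos.
- by move=> x _; exact: continuous_Nsin.
- by apply/cvg_ex; exists (- sin 0); apply: cvg_at_right_filter; exact: continuous_Nsin.
- by apply/cvg_ex; exists (- sin pi); apply: cvg_at_left_filter; exact: continuous_Nsin.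
- exact: cos_LR.
- exact: continuous_subspaceT.
Qed.

Lemma cosBpi (x : R) : cos x = - cos (x - pi).
Proof. by rewrite -{1}[x](subrK pi) cosDpi. Qed.

Lemma sinBpi (x : R) : sin x = - sin (x - pi).
Proof. by rewrite -{1}[x](subrK pi) sinDpi. Qed.

Lemma lower_arc (G : R -> R) : continuous G ->
  \int[leb]_(x in `[(-1), 1]) G x = \int[leb]_(t in `[pi, 2 * pi]) (G (cos t) * - sin t).
Proof.
move=> cG; have p0 := pi_ge0 R; have p2 : pi <= 2 * pi :> R by lra.
have := @integration_by_substitution_increasing R cos G pi (2 * pi) p2.
rewrite derive1_cos cospi (_ : cos (2 * pi) = 1); last by rewrite mulr_natl cos2pi.
move=> H; rewrite /Rintegral H //.
- move=> x y; rewrite !in_itv /= => /andP[x1 x2] /andP[y1 y2] xy.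
  rewrite (cosBpi x) (cosBpi y) ltrN2 ltr_cos ?ltrD2r// in_itv /=; apply/andP; split; lra.
- by move=> x _; exact: continuous_Nsin.
- by apply/cvg_ex; exists (- sin pi); apply: cvg_at_right_filter; exact: continuous_Nsin.
- by apply/cvg_ex; exists (- sin (2 * pi)); apply: cvg_at_left_filter; exact: continuous_Nsin.
- exact: cos_LR.
- exact: continuous_subspaceT.
Qed.

Lemma continuous_Rintegrable (f : R -> R) a b : continuous f ->
  leb.-integrable `[a, b] (EFin \o f).
Proof.
by move=> cf; apply: continuous_compact_integrable; [exact: segment_compact|exact: continuous_subspaceT].
Qed.

(** The substitution [x = cos t] is used on each half circle; [sin t] is the square root on the
    upper one and its opposite on the lower one. *)
Lemma arc g : continuous g ->
  \int[leb]_(x in `[(-1), 1]) (g (x, Num.sqrt (1 - x ^+ 2)) - g (x, - Num.sqrt (1 - x ^+ 2))) =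
  \int[leb]_(t in @turn R) (g (cos t, sin t) * sin t).
Proof.
move=> cg; have p0 := pi_ge0 R; have cr := continuous_root.
have cN : continuous (fun x : R => - Num.sqrt (1 - x ^+ 2)) by move=> x; apply: cvgN; exact: cr.
have c1 : continuous (fun x : R => g (x, Num.sqrt (1 - x ^+ 2))) by apply: continuous_pair_comp => // ?; exact: cvg_id.
have c2 : continuous (fun x : R => g (x, - Num.sqrt (1 - x ^+ 2))) by apply: continuous_pair_comp => // ?; exact: cvg_id.
have cF : continuous (fun t : R => g (cos t, sin t) * sin t).
  move=> t; apply: cvgM; last exact: continuous_sin.
  by apply: continuous_pair_comp => //; [exact: continuous_cos|exact: continuous_sin].
have m11 : @measurable _ (measurableTypeR R) `[(-1 : R), 1]%classic by exact: measurable_itv.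
rewrite (RintegralB m11 (continuous_Rintegrable (-1) 1 c1) (continuous_Rintegrable (-1) 1 c2)).
rewrite (upper_arc c1) (lower_arc c2).
rewrite (_ : @turn R = `[0, 2 * pi]%classic)//.
have iF := continuous_Rintegrable 0 (2 * pi) cF.
have := @Rintegral_itvB R _ _ _ pi iF; rewrite !bnd_simp => /(_ p0).
have -> : pi <= 2 * pi :> R by lra.
move=> /(_ isT) E; rewrite -[RHS](subrK (\int[leb]_(t in `[0, pi]) (g (cos t, sin t) * sin t))) E [RHS]addrC.
congr (_ + _).
  apply: eq_Rintegral => t; rewrite inE /= in_itv /= => t0.
  by rewrite -sin2cos2 sqrtr_sqr ger0_norm// sin_ge0_pi.
rewrite (@Rintegral_itv_obnd_cbnd R pi (BRight (2 * pi)) (fun t => g (cos t, sin t) * sin t)); last first.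
  apply: (leb_integrableS _ _ _ iF); [exact: measurable_itv|exact: measurable_itv|].
  by move=> t /=; rewrite !in_itv /= => /andP[h1 ->]; rewrite andbT; lra.
have cG : continuous (fun t : R => g (cos t, - Num.sqrt (1 - cos t ^+ 2)) * - sin t).
  move=> t; apply: cvgM; last exact: continuous_Nsin.
  exact: (cvg_comp _ _ (@continuous_cos R t) (c2 (cos t))).
have m2 : @measurable _ (measurableTypeR R) `[pi, 2 * pi]%classic by exact: measurable_itv.
rewrite -[LHS]mulN1r -(RintegralZl _ m2 (continuous_Rintegrable pi (2 * pi) cG)).
apply: eq_Rintegral => t; rewrite inE /= in_itv /= => /andP[t1 t2].
rewrite -sin2cos2 sqrtr_sqr ler0_norm; first by rewrite opprK mulN1r mulrN opprK.
by rewrite sinBpi oppr_le0 sin_ge0_pi//; apply/andP; split; lra.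
Qed.

(** Absolute continuity is available on compact parts of the chord only. Integrability of the
    derivative and continuity at the ends allow the limit along the segments [[- v n, v n]]. *)
Lemma slice_ftc (f : R -> R) (w : R) : 0 < w -> continuous f ->
  (forall a b, a < b -> (forall x, a <= x <= b -> `|x| < w) -> real_ac a b f) ->
  leb.-integrable `]- w, w[ (EFin \o derive1 f) ->
  \int[leb]_(x in `]- w, w[) (derive1 f) x = f w - f (- w).
Proof.
move=> w0 cf ac iD; pose v n : R := w * (1 - n.+2%:R^-1).
have v0 n : 0 < v n < w.
  have h0 : 0 < n.+2%:R^-1 :> R by rewrite invr_gt0 ltr0n.
  have h1 : n.+2%:R^-1 < 1 :> R by rewrite invf_lt1 ?ltr0n// ltr1n.
  by rewrite /v; move: h0 h1; move: (n.+2%:R^-1) => y h0 h1; apply/andP; split; nra.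
have vw : v n @[n --> \oo] --> w.
  rewrite -[X in _ --> X]mulr1 -[X in _ * X]subr0; apply: cvgM; first exact: cvg_cst.
  apply: cvgB; first exact: cvg_cst.
  by have := @cvg_harmonic R; rewrite -cvg_shiftS.
have E n : \int[leb]_(x in `]- w, w[) (derive1 f x * \1_(`]- v n, v n[%classic : set R) x) = f (v n) - f (- v n).
  have /andP[v1 v2] := v0 n; have vv : - v n < v n by lra.
  have acv : real_ac (- v n) (v n) f.
    by apply: ac => // x /andP[h1 h2]; rewrite ltr_norml; apply/andP; split; lra.
  have [_ _ ->] := real_ac_ftc vv acv; rewrite ?lexx ?(ltW vv)//.
  rewrite Rintegral_mkcond [RHS]Rintegral_mkcond; apply: eq_Rintegral => x _.
  rewrite /patch indicE !mem_setE !in_itv /=.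
  have [/andP[h1 h2]|h] := boolP (- v n < x < v n); last by rewrite mulr0; case: ifP.
  by rewrite mulr1 ifT//; apply/andP; split; lra.
have mI : @measurable _ (measurableTypeR R) `]- w, w[%classic by exact: measurable_itv.
have mD : measurable_fun (`]- w, w[%classic : set (measurableTypeR R)) (derive1 f) by have /integrableP[/measurable_EFinP] := iD.
have [_ [L _]] : cintegrable leb `]- w, w[%classic (fun x => (derive1 f x)%:C) /\
    ccvg (fun n => cintegral leb `]- w, w[%classic (fun x => (derive1 f x * \1_(`]- v n, v n[%classic : set R) x)%:C))
      (cintegral leb `]- w, w[%classic (fun x => (derive1 f x)%:C)).
  apply: (cintegral_dct mI (g := fun x => `|derive1 f x|)).
  - move=> n; split; last exact: measurable_cst.
    by apply: measurable_funM => //; apply: measurable_indic; exact: measurable_itv.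
  - by split; [|exact: measurable_cst].
  - apply: ae_all => x; rewrite /= in_itv /= => /andP[x1 x2]; apply: ccvg_near; last exact: ccvg_cst.
    near=> n; rewrite indicE mem_set ?mulr1//= in_itv /=; apply/andP; split.
      by rewrite ltrNl; near: n; apply: (cvgr_gt w) => //; lra.
    by near: n; apply: (cvgr_gt w).
  - by have := integrable_norm iD.
  - apply: ae_all => x _ n; rewrite modulus_real normrM ler_piMr// indicE; case: (_ \in _); rewrite ?normr1// normr0//.
have L1 : f (v n) - f (- v n) @[n --> \oo] --> \int[leb]_(x in `]- w, w[) (derive1 f) x.
  by under eq_fun do rewrite -E; exact: L.
have L2 : f (v n) - f (- v n) @[n --> \oo] --> f w - f (- w).
  apply: cvgB; first exact: (cvg_comp _ _ vw (cf w)).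
  by apply: (cvg_comp _ _ (cvgN vw) (cf (- w))).
exact: (cvg_unique _ L1 L2).
Unshelve. all: by end_near. Qed.

(** Common part of Green's formulas in both variables: almost every chord contributes the difference
    of the values at its ends, and [arc] parametrizes the ends by the angle. *)
Lemma slices (f : R * R -> R) (F : R -> \bar R) : measurable_fun setT F -> continuous f ->
  {ae leb, forall x, forall a b, a < b -> (forall y, a <= y <= b -> x ^+ 2 + y ^+ 2 < 1) ->
     real_ac a b (fun y => f (x, y))} ->
  {ae leb, forall x, leb.-integrable setT (EFin \o (derive1 (fun y => f (x, y)) \_ [set y | x ^+ 2 + y ^+ 2 < 1])) /\
     F x = (\int[leb]_y (derive1 (fun y => f (x, y)) \_ [set y | x ^+ 2 + y ^+ 2 < 1]) y)%:E} ->
  (\int[leb]_x F x = (\int[leb]_(t in @turn R) (f (cos t, sin t) * sin t))%:E)%E.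
Proof.
move=> mF cf ac H; pose k (x : R) := f (x, Num.sqrt (1 - x ^+ 2)) - f (x, - Num.sqrt (1 - x ^+ 2)).
have cr := continuous_root.
have ck : continuous k.
  have cN : continuous (fun x : R => - Num.sqrt (1 - x ^+ 2)) by move=> x; apply: cvgN; exact: cr.
  by move=> x; apply: cvgB; apply: continuous_pair_comp => // ?; exact: cvg_id.
have mk : measurable_fun (setT : set (measurableTypeR R)) (fun x => (k x)%:E).
  by apply/measurable_EFinP; exact: measurable_leb.
have k0 x : 1 <= x ^+ 2 -> k x = 0.
  by move=> x1; rewrite /k ler0_sqrtr ?oppr0 ?subrr// subr_le0.
rewrite (_ : (\int[leb]_x F x = \int[leb]_x (k x)%:E)%E); last first.
  apply: ae_eq_integral => //.
  apply: (ae_imply2 _ ac H) => x acx [ix Fx] _; rewrite Fx; congr EFin.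
  have [x1|x1] := lerP 1 (x ^+ 2).
    rewrite k0// (_ : _ \_ _ = cst 0) ?Rintegral0//; last first.
      apply/funext => y; rewrite /patch ifF//; apply/negbTE; rewrite notin_setE /=.
      by apply/negP; rewrite -leNgt; have := sqr_ge0 y; lra.
    by rewrite (@eq_Rintegral _ _ _ _ _ (fun=> 0))// Rintegral_cst ?mul0r.
  have w0 : 0 < Num.sqrt (1 - x ^+ 2) by rewrite sqrtr_gt0 subr_gt0.
  have w2 : Num.sqrt (1 - x ^+ 2) ^+ 2 = 1 - x ^+ 2 by rewrite sqr_sqrtr// subr_ge0 ltW.
  move: w0 w2; rewrite /k; move: (Num.sqrt _) => w w0 w2.
  have E : [set y | x ^+ 2 + y ^+ 2 < 1] = `]- w, w[%classic.
    apply/seteqP; split=> y /=; rewrite in_itv /=.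
      move=> h; have : y ^+ 2 < w ^+ 2 by rewrite w2; lra.
      by move=> h2; apply/andP; split; nra.
    move=> /andP[h1 h2]; have : y ^+ 2 < w ^+ 2 by nra.
    by rewrite w2; lra.
  move: ix; rewrite E => ix; rewrite -(Rintegral_mkcond leb).
  have cs : continuous (fun y => f (x, y)) by exact: continuous_slice_y.
  rewrite (slice_ftc w0 cs)//; last first.
    apply: Rintegrable_restrictP => //; exact: measurable_itv.
  move=> a b ab h; apply: acx => // y /h; rewrite ltr_norml => /andP[h1 h2].
  have : y ^+ 2 < w ^+ 2 by nra.
  by rewrite w2; lra.
pose I : set (measurableTypeR R) := `[(-1), 1]%classic.
rewrite -(arc cf) -/k (_ : (\int[leb]_x (k x)%:E = \int[leb]_(x in I) (k x)%:E)%E).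
  by rewrite (integral_EFin _ (continuous_Rintegrable (-1) 1 ck))//; exact: measurable_itv.
rewrite [RHS]integral_mkcond; apply: eq_integral => x _; rewrite /patch; case: ifPn => //.
rewrite notin_setE /I /= in_itv /= => h; rewrite k0//.
rewrite leNgt; apply/negP => h2; apply: h; apply/andP; split; nra.
Qed.

Lemma green_y g : continuous g -> acl_y g -> mu2.-integrable D (EFin \o py g) ->
  \int[mu2]_(p in D) py g p = \int[leb]_(t in @turn R) (g (cos t, sin t) * sin t).
Proof.
move=> cg ag iD; have mU := @measurable_udisc R : @measurable _ P2 _.
have ih := Rintegrable_restrict mU iD.
have E x y : (py g \_ D) (x, y) = (derive1 (fun y => g (x, y)) \_ [set y | x ^+ 2 + y ^+ 2 < 1]) y.
  by rewrite /patch !mem_setE.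
apply: EFin_inj; rewrite Rintegral_mkcond -(integral_EFin measurableT ih).
rewrite -(integral12_prod_meas1 ih); apply: slices => //.
  exact: (measurable_int _ (integrable_fubini_F ih)).
apply: ae_imply (ae_integrable1 ih) => x ix.
have ix' : leb.-integrable setT (EFin \o (derive1 (fun y => g (x, y)) \_ [set y | x ^+ 2 + y ^+ 2 < 1])).
  by move: ix; congr (leb.-integrable _ _); apply/funext => y; rewrite -E.
split=> //; rewrite /fubini_F -(integral_EFin measurableT ix'); apply: eq_integral => y _.
by rewrite -E.
Qed.

(** The coordinates are exchanged, in the boundary parametrization too; [circle_mean_flip] restores
    the usual one. *)
Lemma green_x g : continuous g -> acl_x g -> mu2.-integrable D (EFin \o px g) ->
  \int[mu2]_(p in D) px g p = \int[leb]_(t in @turn R) (g (sin t, cos t) * sin t).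
Proof.
move=> cg ag iD; have mU := @measurable_udisc R : @measurable _ P2 _.
have ih := Rintegrable_restrict mU iD.
have E x y : (px g \_ D) (x, y) = (derive1 (fun x => g (x, y)) \_ [set x | y ^+ 2 + x ^+ 2 < 1]) x.
  rewrite /patch; congr (if _ then _ else _).
  by apply/idP/idP; rewrite !inE /udisc /= addrC.
have cs : continuous (fun p : R * R => g (p.2, p.1)).
  move/plane_continuousP : cg => cg; apply/plane_continuousP => p e e0.
  by have [d d0 H] := cg (p.2, p.1) e e0; exists d => // q q1 q2; exact: H.
apply: EFin_inj; rewrite Rintegral_mkcond -(integral_EFin measurableT ih).
rewrite -(integral21_prod_meas1 ih); apply: (slices (f := fun p : R * R => g (p.2, p.1))) => //.
- exact: (measurable_fubini_G ih).
- apply: ae_imply ag => y H a b ab h; apply: H => // x /h; by rewrite addrC.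
apply: ae_imply (ae_integrable2 ih) => y iy.
have iy' : leb.-integrable setT (EFin \o (derive1 (fun x => g (x, y)) \_ [set x | y ^+ 2 + x ^+ 2 < 1])).
  by move: iy; congr (leb.-integrable _ _); apply/funext => x; exact: (congr1 EFin (E x y)).
split=> //; rewrite /fubini_G -(integral_EFin measurableT iy'); apply: eq_integral => x _.
exact: (congr1 EFin (E x y)).
Qed.

(* The reflection [z -> i conj z] exchanges the coordinates; it deduces Green's
   formula in [x] from the one in [y]. *)
Lemma circle_mean_flip (u : R[i] -> R[i]) : cc u ->
  circle_mean (fun z => u ((0 +i* 1) * conjc z)) = circle_mean u.
Proof.
move=> cu; pose phi (z : R[i]) := (0 +i* 1) * conjc z.
have ci : circle (0 +i* 1 : R[i]) by rewrite /circle /= expr0n /= add0r expr1n sqrtr1.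
have cp : cc phi by apply: ccM; [exact: cc_cst|exact: ccJ (cc_id R)].
have pc z : circle z -> circle (phi z).
  by move=> cz; apply: circle_mul => //; rewrite /circle /= -[LHS]/(modulus (conjc z)) modulusJ.
have c1 : cc (fun=> 1 : R[i]) by exact: cc_cst.
(* The reflection takes powers to multiples of powers, so nonconstant terms keep mean 0; Fejer means
   extend the invariance to [u] in place of a change of variables. *)
have m0 i : circle_mean (fun z => 1 * phi z ^ idx_int i) = 0.
  rewrite (eq_circle_mean (v := fun z => (0 +i* 1) ^ idx_int i * z ^ (- idx_int i))) => [|z cz].
    rewrite circle_meanZ; last exact: cc_expz.
    by rewrite circle_mean_expz oppr_eq0 (negbTE (idx_int_neq0 i)) mulr0.
  by rewrite mul1r /phi expfzMl -circle_conj_expz// -(circle_conjV cz) exprz_inv circle_conj_expz.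
have E n : circle_mean (fun z => 1 * fejer u n (phi z)) = circle_mean u.
  rewrite circle_mean_fejer//.
  have E0 k : fourier u 0 * circle_mean (fun=> 1) +
      psum (fun i => fourier u (idx_int i) * circle_mean (fun z => 1 * phi z ^ idx_int i)) k = circle_mean u.
    rewrite circle_mean_cst mulr1 /psum big1 ?addr0 => [|i _]; last by rewrite m0 mulr0.
    by rewrite /fourier oppr0; apply: eq_circle_mean => z _; rewrite expr0z mulr1.
  under eq_bigr do rewrite E0.
  by rewrite big_const_nat iter_addr_0 subn0 -[circle_mean u *+ _]mulr_natl mulrA mulVf ?mul1r// pnatr_eq0.
have [B B0 uB] := cc_bounded cu.
have uB' z : circle z -> modulus (u z) <= B.
  by move=> cz; have [t tt ->] := circle_arg cz; exact: uB.
have L : ccvg (fun n => circle_mean (fun z => 1 * fejer u n (phi z))) (circle_mean (fun z => u (phi z))).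
  apply: (circle_mean_ccvg (B := B)).
  - by move=> n; apply: ccM => //; apply: cc_comp => //; exact: cc_fejer.
  - exact: cc_comp.
  - by move=> n z cz; rewrite mul1r; apply: fejer_bound => //; exact: pc.
  - by move=> z cz; under eq_fun do rewrite mul1r; apply: fejer_cvg => //; exact: pc.
by apply: (ccvg_unique L); under eq_fun do rewrite E; exact: ccvg_cst.
Qed.

Definition onz W (z : R[i]) : R[i] := W (Re z, Im z).

Lemma cc_onz W : pcont W -> cc (onz W).
Proof.
move=> [/plane_continuousP c1 /plane_continuousP c2]; apply/ccP => z cz e e0.
have e2 : 0 < e / 2 by rewrite divr_gt0.
have [d1 d10 H1] := c1 (Re z, Im z) _ e2; have [d2 d20 H2] := c2 (Re z, Im z) _ e2.
exists (Num.min d1 d2) => [|w cw]; first by rewrite lt_min d10 d20.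
rewrite lt_min => /andP[w1 w2]; apply: le_lt_trans (modulus_le_ReIm _) _.
rewrite [X in _ < X](splitr e); apply: ltrD; rewrite !reimE.
  by apply: H1 => /=; [apply: le_lt_trans w1; have := Re_le_modulus (w - z)|apply: le_lt_trans w1; have := Im_le_modulus (w - z)]; rewrite !reimE.
by apply: H2 => /=; [apply: le_lt_trans w2; have := Re_le_modulus (w - z)|apply: le_lt_trans w2; have := Im_le_modulus (w - z)]; rewrite !reimE.
Qed.

Lemma turn_mean (u : R[i] -> R[i]) : \int[leb]_(t in @turn R) Re (u (expi t)) = 2 * pi * Re (circle_mean u).
Proof. by rewrite Re_circle_mean mulrA mulfV ?mul1r// gt_eqF// twopi_gt0. Qed.

Lemma turn_mean_im (u : R[i] -> R[i]) : \int[leb]_(t in @turn R) Im (u (expi t)) = 2 * pi * Im (circle_mean u).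
Proof.
have -> : Im (circle_mean u) = (2 * pi)^-1 * \int[leb]_(t in @turn R) Im (u (expi t)).
  by rewrite /circle_mean !reimE /= mul0r addr0.
by rewrite mulrA mulfV ?mul1r// gt_eqF// twopi_gt0.
Qed.

Lemma realMz (a : R) (z : R[i]) : a%:C * z = (a * Re z) +i* (a * Im z).
Proof. by apply: complex_eq; rewrite !reimE /= mul0r ?subr0 ?addr0. Qed.

Lemma green_cy W : csob W -> cintegrable mu2 D (cpy W) ->
  cintegral mu2 D (cpy W) = (2 * pi)%:C * circle_mean (fun z => onz W z * (Im z)%:C).
Proof.
move=> [[c1 c2] _ [a1 a2]] [i1 i2].
rewrite -[LHS]/((\int[mu2]_(p in D) py (fun q => Re (W q)) p) +i* (\int[mu2]_(p in D) py (fun q => Im (W q)) p)).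
rewrite (green_y c1 a1 i1) (green_y c2 a2 i2); rewrite realMz; congr (_ +i* _).
  rewrite -turn_mean; apply: eq_Rintegral => t _.
  by rewrite !reimE mulr0 subr0.
rewrite -turn_mean_im; apply: eq_Rintegral => t _.
by rewrite !reimE mulr0 add0r.
Qed.

Lemma flipE (t : R) : (0 +i* 1) * conjc (expi t) = sin t +i* cos t.
Proof. by apply: complex_eq => /=; ring. Qed.

Lemma green_cx W : csob W -> cintegrable mu2 D (cpx W) ->
  cintegral mu2 D (cpx W) = (2 * pi)%:C * circle_mean (fun z => onz W z * (Re z)%:C).
Proof.
move=> [[c1 c2] [a1 a2] _] [i1 i2].
rewrite -[LHS]/((\int[mu2]_(p in D) px (fun q => Re (W q)) p) +i* (\int[mu2]_(p in D) px (fun q => Im (W q)) p)).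
have cu : cc (fun z => onz W z * (Re z)%:C).
  apply: ccM; first exact: cc_onz.
  have := ccM (cc_cst (2^-1)%:C) (ccD (cc_id R) (ccJ (cc_id R))); apply: cc_eq => z _.
  by case: z => x y; apply: complex_eq => /=; field.
rewrite -(circle_mean_flip cu).
rewrite (green_x c1 a1 i1) (green_x c2 a2 i2); rewrite realMz; congr (_ +i* _).
  rewrite -turn_mean; apply: eq_Rintegral => t _.
  by rewrite flipE -[onz W _]/(W (sin t, cos t)) !reimE mulr0 subr0.
rewrite -turn_mean_im; apply: eq_Rintegral => t _.
by rewrite flipE -[onz W _]/(W (sin t, cos t)) !reimE mulr0 add0r.
Qed.

End green.

Section ae_complex.
Context d (T : measurableType d) (R : realType).
Context (mu : {measure set T -> \bar R}) (D : set T) (mD : measurable D).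

Lemma ae_cintegrable (f g : T -> R[i]) : cmeasurable D f ->
  {ae mu, forall x, D x -> f x = g x} -> cintegrable mu D g -> cintegrable mu D f.
Proof.
move=> [m1 m2] E [i1 i2]; split.
  by apply: (ae_Rintegrable mD m1 _ i1); apply: ae_imply E => x H Dx; rewrite H.
by apply: (ae_Rintegrable mD m2 _ i2); apply: ae_imply E => x H Dx; rewrite H.
Qed.

Lemma ae_cintegral (f g : T -> R[i]) : cmeasurable D f -> cmeasurable D g ->
  {ae mu, forall x, D x -> f x = g x} -> cintegral mu D f = cintegral mu D g.
Proof.
move=> [m1 m2] [n1 n2] E; congr (_ +i* _).
  by apply: ae_Rintegral => //; apply: ae_imply E => x H Dx; rewrite H.
by apply: ae_Rintegral => //; apply: ae_imply E => x H Dx; rewrite H.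
Qed.
End ae_complex.

(** * The Dirichlet pairing and boundedness of the composition matrix *)

Section dirichlet_pairing.
Context (R : realType).
Local Notation mu2 := (@plane_measure R).
Local Notation P2 := (measurableTypeR R * measurableTypeR R)%type.
Local Notation D := (@udisc R).
Implicit Types (W F : R * R -> R[i]) (i j : idx).

Definition Zp (p : R * R) : R[i] := p.1 +i* p.2.
Let I : R[i] := 0 +i* 1.

Lemma csob_Zp : csob Zp.
Proof.
split.
- by split=> p; [exact: cvg_fst|exact: cvg_snd].
- by split; apply: ae_all => y a b _ _; [exact: real_ac_id|exact: real_ac_cst].
- by split; apply: ae_all => y a b _ _; [exact: real_ac_cst|exact: real_ac_id].
Qed.

Lemma Zp_cderx p : cder (fun x => Zp (x, p.2)) p.1 1.
Proof. by split; [exact: is_derive_id|exact: is_derive_cst]. Qed.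

Lemma Zp_cdery p : cder (fun y => Zp (p.1, y)) p.2 I.
Proof. by split; [exact: is_derive_cst|exact: is_derive_id]. Qed.

Lemma jet_Zp W W1 W2 p : jet Zp W W1 W2 -> cder (fun x => W (x, p.2)) p.1 (W1 p) /\
  cder (fun y => W (p.1, y)) p.2 (W2 p).
Proof.
move=> [_ _ _ jd]; split.
  have := jd (fun x => (x, p.2)) _ _ (Zp_cderx p); rewrite -surjective_pairing; congr cder.
  by rewrite Re1 Im1 mul1r mul0r addr0.
have := jd (fun y => (p.1, y)) _ _ (Zp_cdery p); rewrite -surjective_pairing; congr cder.
by rewrite -[Re I]/(0 : R) -[Im I]/(1 : R) mul0r mul1r add0r.
Qed.

Lemma jet_Zp_cp W W1 W2 p : jet Zp W W1 W2 -> cpx W p = W1 p /\ cpy W p = W2 p.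
Proof. by move=> /(jet_Zp p)[/cder_derive h1 /cder_derive h2]. Qed.

(** With the identity as an instance, [extF_grad] also bounds the energy of the second factor of the
    pairing. The constant is [gradsq Zp = 2] over [jac Zp = 1]. *)
Lemma Zp_qc : qc_ext Zp 2.
Proof.
have cp p := jet_Zp_cp p (jet_id csob_Zp).
have gE p : gradsq Zp p = 2.
  by rewrite /gradsq; have [-> ->] := cp p; rewrite !modulus2 /=; ring.
have jE p : jac Zp p = 1.
  by rewrite /jac; have [-> ->] := cp p; rewrite /=; ring.
split.
- exact: csob_Zp.
- by move=> p; rewrite modulus2.
- by move=> p; rewrite modulus2 /udisc /= leNgt => /negP.
- move=> s s1; apply: (@Rintegrable_le _ P2 _ mu2 _ (measurable_dsc s) _ (fun=> 2)).
  + by apply: measurable_funTS; apply: measurable_gradsq; case: csob_Zp.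
  + apply: Rintegrable_cst; first exact: measurable_dsc.
    apply: le_lt_trans (@udisc_finite R); apply: le_measure; rewrite ?inE.
    * exact: measurable_dsc.
    * exact: measurable_udisc.
    * exact: dsc_udisc.
  + by move=> p _; rewrite gE ger0_norm.
- by [].
- by apply: ae_all => p _; rewrite gE jE mulr1.
Qed.

(** Cauchy-Riemann equations: the factor from the x-derivative to the y-derivative, for holomorphic
    and antiholomorphic powers. *)
Definition ceps i : R[i] := match i with inl _ => I | inr _ => - I end.
Definition deps Phi i (p : R * R) : R[i] := (irank i).+1%:R *
  match i with inl k => Phi p ^+ k | inr k => conjc (Phi p) ^+ k end.

Lemma jet_eps (Phi : R * R -> R[i]) i : csob Phi -> jet Phi (eps Phi i) (deps Phi i) (fun p => ceps i * deps Phi i p).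
Proof.
move=> sP; have j1 := jet_id sP; case: i => k.
  by apply: (jet_eq _ _ _ (jetX k j1)) => p //; [exact: mulr1|exact: mulrC].
apply: (jet_eq _ _ _ (jetX k (jetJ j1))) => p //; first by rewrite conjc1; exact: mulr1.
by rewrite conjc_i; exact: mulrC.
Qed.

Lemma jet_deps i : exists E, jet Zp (deps Zp i) E (fun p => ceps i * E p).
Proof.
have j1 := jet_id csob_Zp; case: i => [[|k]|[|k]].
- by exists (fun=> 0); apply: (jet_eq _ _ _ (jet_cst Zp 1)) => p; rewrite /deps ?mulr0// expr0 mulr1.
- exists (fun p => k.+2%:R * (k.+1%:R * Zp p ^+ k)).
  by apply: (jet_eq _ _ _ (jetZ k.+2%:R (jetX k j1))) => p //; [rewrite mulr1|rewrite mulrA mulrC].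
- by exists (fun=> 0); apply: (jet_eq _ _ _ (jet_cst Zp 1)) => p; rewrite /deps ?mulr0// expr0 mulr1.
exists (fun p => k.+2%:R * (k.+1%:R * conjc (Zp p) ^+ k)).
by apply: (jet_eq _ _ _ (jetZ k.+2%:R (jetX k (jetJ j1)))) => p //; [rewrite conjc1 mulr1|rewrite conjc_i mulrA mulrC].
Qed.

Lemma onz_Zp (z : R[i]) : onz Zp z = z.
Proof. by rewrite /onz /Zp; case: z. Qed.

Let mD : @measurable _ P2 D. Proof. exact: measurable_udisc. Qed.

Lemma ceps2 i : ceps i * ceps i = - 1.
Proof. by case: i => k; apply: complex_eq => /=; ring. Qed.

(** The normal derivative of a homogeneous harmonic polynomial on the circle, by Euler's
    identity. *)
Lemma circle_eps i z : circle z ->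
  deps Zp i (Re z, Im z) * ((Re z)%:C + ceps i * (Im z)%:C) = (irank i).+1%:R * z ^ idx_int i.
Proof.
move=> cz; have ZE : Zp (Re z, Im z) = z by exact: onz_Zp.
rewrite /deps -mulrA ZE; congr (_ * _); case: i => k; rewrite /ceps /idx_int.
  rewrite (_ : _ + _ = z) -?exprSr//.
  by case: z {cz ZE} => x y; apply: complex_eq => /=; ring.
rewrite (_ : _ + _ = conjc z) -?exprSr//; last first.
  by case: z {cz ZE} => x y; apply: complex_eq => /=; ring.
by rewrite circle_Nexp// conjcX.
Qed.

Lemma pcont_cmeasurable W : pcont W -> cmeasurable (D : set P2) W.
Proof.
by move=> [c1 c2]; split; apply: measurable_funTS; exact: continuous_plane_measurable.
Qed.

Lemma modulus_le_sq (z : R[i]) : modulus z <= 1 + modulus z ^+ 2.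
Proof. by have := sqr_ge0 (modulus z - 1); have := modulus_ge0 z; nra. Qed.

Lemma grad_pair_integrable F W V : csob F -> mu2.-integrable D (EFin \o gradsq F) -> pcont W -> pcont V ->
  cintegrable mu2 D (fun p => cpx F p * W p + F p * V p) /\
  cintegrable mu2 D (fun p => cpy F p * W p + F p * V p).
Proof.
move=> [cF _ _] iG cW cV; have [mx my] := measurable_cp cF.
have [A A0 HA] := box_modulus_bounded cF; have [B B0 HB] := box_modulus_bounded cW.
have [C C0 HC] := box_modulus_bounded cV.
have i1 : mu2.-integrable D (EFin \o (fun p => B * (1 + gradsq F p) + A * C)).
  have k1 : mu2.-integrable D (EFin \o (fun=> 1 : R)) by apply: Rintegrable_cst => //; exact: udisc_finite.
  have k2 : mu2.-integrable D (EFin \o (fun=> A * C : R)) by apply: Rintegrable_cst => //; exact: udisc_finite.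
  exact: (RintegrableD mD (RintegrableZ mD B (RintegrableD mD k1 iG)) k2).
have key (G : R * R -> R[i]) : cmeasurable (setT : set P2) G -> (forall p, modulus (G p) ^+ 2 <= gradsq F p) ->
    cintegrable mu2 D (fun p => G p * W p + F p * V p).
  move=> [m1 m2] GF; apply: (cintegrable_le mD _ i1).
    have [w1 w2] := pcont_cmeasurable cW.
    have [v1 v2] := pcont_cmeasurable (pcontM cF cV).
    have {m1} m1 : measurable_fun (D : set P2) (fun p => Re (G p)) by exact: measurable_funTS.
    have {m2} m2 : measurable_fun (D : set P2) (fun p => Im (G p)) by exact: measurable_funTS.
    split.
      rewrite (_ : (fun p => _) = (fun p => (Re (G p) * Re (W p) - Im (G p) * Im (W p)) + Re (F p * V p))).
        by apply: measurable_funD v1; apply: measurable_funB; exact: measurable_funM.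
      by apply/funext => p; rewrite !reimE.
    rewrite (_ : (fun p => _) = (fun p => (Re (G p) * Im (W p) + Im (G p) * Re (W p)) + Im (F p * V p))).
      by apply: measurable_funD v2; apply: measurable_funD; exact: measurable_funM.
    by apply/funext => p; rewrite !reimE.
  move=> p /udisc_box bp; apply: le_trans (modulusD _ _) _.
  rewrite [modulus (G p * _)]modulusM [modulus (F p * _)]modulusM lerD//.
    rewrite mulrC; apply: ler_pM; rewrite ?modulus_ge0 ?HB//.
    by apply: le_trans (modulus_le_sq _) _; rewrite lerD2l.
  by apply: ler_pM; rewrite ?modulus_ge0 ?HA ?HC.
have h1 (a b : R) : 0 <= b -> a <= a + b by rewrite lerDl.
have h2 (a b : R) : 0 <= b -> a <= b + a by rewrite lerDr.
by split; apply: key => // p; [apply: h1|apply: h2]; exact: sqr_ge0.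
Qed.

(** Green's formula for [F] times the gradient of the harmonic function [eps Zp i]: the second
    derivatives [E] and [- E] cancel, and the boundary term is the normal derivative of
    [circle_eps]. *)
Lemma green_eps F i : csob F -> mu2.-integrable D (EFin \o gradsq F) ->
  cintegrable mu2 D (fun p => cpx F p * deps Zp i p + cpy F p * (ceps i * deps Zp i p)) /\
  cintegral mu2 D (fun p => cpx F p * deps Zp i p + cpy F p * (ceps i * deps Zp i p)) =
  (2 * pi)%:C * ((irank i).+1%:R * circle_mean (fun z => onz F z * z ^ idx_int i)).
Proof.
move=> sF iG; have [E jE] := jet_deps i; have [sd cE ccE _] := jE.
have [cF _ _] := sF; have [cd _ _] := sd.
have sc : csob (fun p => ceps i * deps Zp i p) by apply: csobM => //; exact: csob_cst.
have [ccd _ _] := sc.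
have s1 := csobM sF sd; have s2 := csobM sF sc.
have [i1 _] := grad_pair_integrable sF iG cd cE.
have cNE : pcont (fun p => - E p).
  by have := pcontM (pcont_cst (- 1)) cE; congr pcont; apply/funext => p; rewrite mulN1r.
have [_ i2] := grad_pair_integrable sF iG ccd cNE.
have ae1 : {ae mu2, forall p, D p -> cpx (fun p => F p * deps Zp i p) p = cpx F p * deps Zp i p + F p * E p}.
  apply: ae_imply (csob_cder sF) => p H /H[d1 _]; have [e1 _] := jet_Zp p jE.
  by have /cder_derive := cderM d1 e1; rewrite -surjective_pairing.
have ae2 : {ae mu2, forall p, D p -> cpy (fun p => F p * (ceps i * deps Zp i p)) p =
    cpy F p * (ceps i * deps Zp i p) + F p * - E p}.
  apply: ae_imply (csob_cder sF) => p H /H[_ d1]; have [_ e1] := jet_Zp p (jetZ (ceps i) jE).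
  have /cder_derive := cderM d1 e1; rewrite -surjective_pairing [ceps i * (ceps i * E p)]mulrA ceps2 mulN1r; exact.
have mm1 : cmeasurable (D : set P2) (cpx (fun p => F p * deps Zp i p)).
  by have [c _ _] := s1; have [[m1 m2] _] := measurable_cp c; split; exact: measurable_funTS.
have mm2 : cmeasurable (D : set P2) (cpy (fun p => F p * (ceps i * deps Zp i p))).
  by have [c _ _] := s2; have [_ [m1 m2]] := measurable_cp c; split; exact: measurable_funTS.
have j1 := ae_cintegrable mD mm1 ae1 i1; have j2 := ae_cintegrable mD mm2 ae2 i2.
have g1 := green_cx s1 j1; have g2 := green_cy s2 j2.
have E12 : (fun p => cpx F p * deps Zp i p + cpy F p * (ceps i * deps Zp i p)) =
    (fun p => (cpx F p * deps Zp i p + F p * E p) + (cpy F p * (ceps i * deps Zp i p) + F p * - E p)).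
  by apply/funext => p; ring.
rewrite E12; split; first exact: (cintegrableD mD i1 i2).
rewrite (cintegralD mD i1 i2) -(ae_cintegral mD mm1 (cintegrable_measurable i1) ae1).
rewrite -(ae_cintegral mD mm2 (cintegrable_measurable i2) ae2) g1 g2 -mulrDr; congr (_ * _).
have cRe : cc (fun z : R[i] => (Re z)%:C).
  have := ccM (cc_cst (2^-1)%:C) (ccD (cc_id R) (ccJ (cc_id R))); apply: cc_eq => z _.
  by case: z => x y; apply: complex_eq => /=; field.
have cIm : cc (fun z : R[i] => (Im z)%:C).
  have := ccM (cc_cst (0 -i* 2^-1)) (ccD (cc_id R) (ccM (cc_cst (- 1)) (ccJ (cc_id R)))); apply: cc_eq => z _.
  by case: z => x y; apply: complex_eq => /=; field.
have cn1 := ccM (cc_onz (cs_cont s1)) cRe; have cn2 := ccM (cc_onz (cs_cont s2)) cIm.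
rewrite -circle_meanD// -circle_meanZ; last by apply: ccM; [exact: cc_onz|exact: cc_expz].
apply: eq_circle_mean => z cz; rewrite [RHS]mulrCA -(circle_eps i cz) /onz.
by move: (F _) (deps _ _ _) (Re z)%:C (Im z)%:C => f e x y; ring.
Qed.

(** The opposite index: a pairing without conjugation couples each power with its inverse. *)
Definition flip i : idx := match i with inl k => inr k | inr k => inl k end.

Lemma sum_flip (V : nmodType) (f : idx -> V) n : \sum_(i <- ixs n) f (flip i) = \sum_(i <- ixs n) f i.
Proof. by rewrite !big_ixs addrC. Qed.

Lemma idx_int_flip i : idx_int (flip i) = - idx_int i.
Proof. by case: i => k; rewrite /idx_int ?opprK. Qed.

Lemma extF_Zp_cp n b p : cpx (extF Zp n b) p = \sum_(i <- ixs n) b i * deps Zp i p /\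
  cpy (extF Zp n b) p = \sum_(i <- ixs n) b i * (ceps i * deps Zp i p).
Proof.
exact: (jet_Zp_cp p (jet_sum (ixs n) (fun i => jetZ (b i) (jet_eps i csob_Zp)))).
Qed.

Lemma sum_pair (A B : R[i]) (s : seq idx) (u v : idx -> R[i]) :
  A * (\sum_(i <- s) u i) + B * (\sum_(i <- s) v i) = \sum_(i <- s) (A * u i + B * v i).
Proof. by rewrite !mulr_sumr -big_split. Qed.

Lemma mul_le_sq (u v : R) : u * v <= u ^+ 2 + v ^+ 2.
Proof. by have := sqr_ge0 (u - v); have := sqr_ge0 u; have := sqr_ge0 v; nra. Qed.

Lemma sum_bound (u v x y c1 c2 : R) : 0 <= c1 -> 0 <= c2 -> 0 <= x -> 0 <= y ->
  u <= c1 * y -> v <= c2 * x -> u + v <= (c1 + c2) * (x + y).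
Proof.
move=> h1 h2 h3 h4 h5 h6; have h7 := mulr_ge0 h1 h3; have h8 := mulr_ge0 h2 h4.
by rewrite mulrDl !mulrDr; lra.
Qed.

Section bilinear.
Variables (phi : R[i] -> R[i]) (Phi : R * R -> R[i]) (K : R).
Hypotheses (ep : circle_emb phi) (qc : qc_ext Phi K).
Hypothesis Phi_phi : forall z, circle z -> onz Phi z = phi z.

Lemma eps_phi i z : circle z -> onz (eps Phi i) z = phi z ^ idx_int i.
Proof.
move=> cz; have pE : Phi (Re z, Im z) = phi z by exact: Phi_phi.
rewrite /onz /eps pE; case: i => k //; rewrite /idx_int circle_Nexp ?conjcX//.
exact: (ce_circle ep).
Qed.

(** The factors [(sq j)^-1] normalize the basis; with the factor [|idx_int i|] of the normal
    derivative they give the ratio [sq i / sq j] of [Cmx_entry]. *)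
Lemma pairing n (x y : idx -> R[i]) (a := fun j => y j * ((sq R j)^-1)%:C)
  (b := fun i => x (flip i) * ((sq R i)^-1)%:C) :
  mu2.-integrable D (EFin \o gradsq (extF Phi n a)) ->
  let f := fun p => cpx (extF Phi n a) p * cpx (extF Zp n b) p + cpy (extF Phi n a) p * cpy (extF Zp n b) p in
  cintegrable mu2 D f /\
  (2 * pi)%:C * (\sum_(i <- ixs n) \sum_(j <- ixs n) x i * Cmx phi i j * y j) = cintegral mu2 D f.
Proof.
move=> iG f; set F := extF Phi n a; have sF : csob F by exact: (extF_csob qc).
have G i := green_eps i sF iG.
pose t i p := b i * (cpx F p * deps Zp i p + cpy F p * (ceps i * deps Zp i p)).
have it i : cintegrable mu2 D (t i) by apply: (cintegrableZ mD); case: (G i).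
have fE : f = fun p => \sum_(i <- ixs n) t i p.
  apply/funext => p; rewrite /f -/F; have [-> ->] := extF_Zp_cp n b p.
  have R3 (A B c e g : R[i]) : A * (c * e) + B * (c * (g * e)) = c * (A * e + B * (g * e)) by ring.
  by rewrite sum_pair; apply: eq_bigr => i _; rewrite R3.
rewrite fE; split; first exact: (cintegrable_sum mD).
rewrite (cintegral_sum mD)// mulr_sumr -[RHS]sum_flip; apply: eq_bigr => i _.
have [gi gE] := G (flip i); rewrite /t (cintegralZ mD)// gE.
have FE z : circle z -> onz F z * z ^ idx_int (flip i) =
    \sum_(j <- ixs n) a j * (phi z ^ idx_int j * z ^ (- idx_int i)).
  move=> cz; rewrite idx_int_flip /onz /F /extF mulr_suml; apply: eq_bigr => j _.
  by rewrite -mulrA -(eps_phi j cz).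
have cj j : cc (fun z => phi z ^ idx_int j * z ^ (- idx_int i)).
  by apply: ccM; [exact: cc_pow|exact: cc_expz].
rewrite (eq_circle_mean FE) circle_mean_sum => [|j]; last by apply: ccM => //; exact: cc_cst.
have ir : irank (flip i) = irank i by case: (i).
have sf : sq R (flip i) = sq R i by rewrite /sq ir.
have ff : flip (flip i) = i by case: (i).
rewrite /b ff ir sf !mulr_sumr; apply: eq_bigr => j _.
rewrite circle_meanZ// -[circle_mean _]/(fc phi (idx_int i) (idx_int j)) (Cmx_entry _ _ ep) /a.
have sE : (irank i).+1%:R = (sq R i)%:C * (sq R i)%:C :> R[i].
  by rewrite -real_complexM -expr2 sq2 real_complex_nat.
rewrite sE [(sq R i / sq R j)%:C]real_complexM !real_complexV.
have s0 : (sq R i)%:C != 0 :> R[i] by rewrite -modulus_gt0 modulus_real gtr0_norm sq_gt0.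
have t0 : (sq R j)%:C != 0 :> R[i] by rewrite -modulus_gt0 modulus_real gtr0_norm sq_gt0.
move: s0 t0; move: (fc _ _ _) (sq R i)%:C (sq R j)%:C (2 * pi)%:C (x i) (y j) => c s t' w u v s0 t0.
by field; rewrite s0 t0.
Qed.

Lemma ext_bform : exists M : R, bform (Cmx phi) M.
Proof.
pose C1 := 2 * (K * C0 Phi); pose C2 := 2 * (2 * C0 Zp).
have C10 : 0 <= C1 by rewrite mulr_ge0// mulr_ge0 ?(ltW (qe_K qc))// (C0_ge0 qc).
have C20 : 0 <= C2 by rewrite mulr_ge0// mulr_ge0// (C0_ge0 Zp_qc).
exists ((2 * pi)^-1 * (C1 + C2)) => n x y.
set a := fun j => y j * ((sq R j)^-1)%:C; set b := fun i => x (flip i) * ((sq R i)^-1)%:C.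
have bnd (P : R * R -> R[i]) (L : R) (q : qc_ext P L) (c e : idx -> R[i]) :
    (forall i, e i = c i * ((sq R i)^-1)%:C) ->
    mu2.-integrable D (EFin \o gradsq (extF P n e)) /\
    \int[mu2]_(p in D) gradsq (extF P n e) p <= 2 * (L * C0 P) * nsq c n.
  move=> eE; have S : \sum_(i <- ixs n) (irank i).+1%:R * modulus (e i) ^+ 2 = nsq c n.
    apply: eq_bigr => i _; rewrite eE modulusM exprMn modulus_real real_normK ?num_real// exprVn sq2.
    by rewrite mulrCA mulfV ?mulr1// pnatr_eq0.
  have := extF_grad q n e; rewrite S => H.
  have iE : mu2.-integrable D (EFin \o gradsq (extF P n e)).
    apply: (@Rintegrable_ge0 _ P2 _ mu2 D).
    - by apply: measurable_funTS; apply: measurable_gradsq; case: (extF_csob q n e).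
    - by move=> p _; exact: gradsq_ge0.
    - exact: le_lt_trans H (ltry _).
  by split => //; rewrite -lee_fin -(integral_EFin mD iE).
have [iF lF] := bnd _ _ qc y a (fun i => erefl).
have [iH lH] := bnd _ _ Zp_qc (fun i => x (flip i)) b (fun i => erefl).
have [cf E] := @pairing n x y iF.
have twopi : 0 < 2 * pi :> R := twopi_gt0 R.
have nf : nsq (fun i => x (flip i)) n = nsq x n.
  exact: (sum_flip (fun i => modulus (x i) ^+ 2) n).
set S := \sum_(i <- ixs n) _ in E *.
have -> : modulus S = (2 * pi)^-1 * modulus ((2 * pi)%:C * S).
  by rewrite [modulus (_ * S)]modulusM modulus_real gtr0_norm// mulKf// gt_eqF.
rewrite E -mulrA; apply: ler_wpM2l; first by rewrite invr_ge0 ltW.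
apply: le_trans (modulus_cintegral_le mD cf) _.
(* The pointwise bound by the sum of both energies is enough, as [bform] is stated with a sum on the
   right. *)
apply: (@le_trans _ _ (\int[mu2]_(p in D) (gradsq (extF Phi n a) p + gradsq (extF Zp n b) p))).
  apply: le_Rintegral => //; [exact: integrable_modulus|exact: RintegrableD|].
  move=> p _; apply: le_trans (modulusD _ _) _; rewrite [modulus (cpx _ _ * _)]modulusM [modulus (cpy _ _ * _)]modulusM.
  by apply: (le_trans (lerD (mul_le_sq _ _) (mul_le_sq _ _))); rewrite addrACA; exact: lexx.
rewrite (RintegralD mD iF iH).
have Ny := nsq_ge0 y n; have Nx := nsq_ge0 x n.
by move: lF lH; rewrite nf; exact: (sum_bound C10 C20 Nx Ny).
Qed.

End bilinear.
End dirichlet_pairing.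

(** * Quasisymmetric maps *)

Section disc_extension.
Context (R : realType).
Local Notation leb := (@lebesgue_measure R).
Local Notation mu2 := (@plane_measure R).
Local Notation P2 := (measurableTypeR R * measurableTypeR R)%type.
Local Notation D := (@udisc R).
Variable Phi : R[i] -> R[i].
Hypothesis qcPhi : quasiconformal disc disc Phi.
Hypothesis cPhi : continuous_on closed_disc Phi.
Hypothesis circPhi : forall z, circle z -> circle (Phi z).

(* Precomposing with the radial retraction onto the closed disc extends [Phi] to
   the plane. *)
Definition radius (p : R * R) : R := Num.max 1 (modulus (Zp p)).
Definition retr (p : R * R) : R[i] := (p.1 / radius p) +i* (p.2 / radius p).
Definition ext (p : R * R) : R[i] := Phi (retr p).

Lemma radius_gt0 p : 0 < radius p. Proof. by rewrite lt_max ltr01. Qed.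

Lemma udiscE p : D p <-> modulus (Zp p) < 1.
Proof.
have E : modulus (Zp p) ^+ 2 = p.1 ^+ 2 + p.2 ^+ 2 by rewrite modulus2.
by rewrite -[D p]/(is_true (p.1 ^+ 2 + p.2 ^+ 2 < 1)) -E expr_lt1 ?modulus_ge0.
Qed.

Lemma retr_in p : D p -> retr p = Zp p.
Proof.
move=> /udiscE h; rewrite /retr /radius (max_idPl (ltW h)) !divr1//.
Qed.

Lemma retrE p : retr p = ((radius p)^-1)%:C * Zp p.
Proof. by apply: complex_eq; rewrite !reimE /= mul0r ?subr0 ?addr0 mulrC. Qed.

Lemma modulus_retr p : modulus (retr p) = modulus (Zp p) / radius p.
Proof. by rewrite retrE modulusM modulus_real ger0_norm ?invr_ge0 ?ltW ?radius_gt0// mulrC. Qed.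

Lemma retr_closed p : closed_disc (retr p).
Proof. by rewrite -[closed_disc _]/(is_true (modulus (retr p) <= 1)) modulus_retr ler_pdivrMr ?radius_gt0// mul1r le_max lexx orbT. Qed.

Lemma retr_out p : ~ D p -> circle (retr p).
Proof.
move=> h; have m1 : 1 <= modulus (Zp p) by rewrite leNgt; apply/negP => /udiscE.
rewrite -[circle _]/(modulus (retr p) = 1) modulus_retr /radius (max_idPr m1) mulfV// gt_eqF//; exact: lt_le_trans m1.
Qed.

Lemma continuous_modulus_Zp : continuous (fun p : R * R => modulus (Zp p)).
Proof.
apply/plane_continuousP => p e e0; exists (e / 2) => [|q q1 q2]; first by rewrite divr_gt0.
have B : modulus (Zp q - Zp p) < e.
  apply: le_lt_trans (modulus_le_ReIm _) _; rewrite [X in _ < X](splitr e) !reimE /=.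
  exact: ltrD.
apply: le_lt_trans B; rewrite ler_norml; apply/andP; split.
  have := modulusD (Zp q) (Zp p - Zp q); rewrite addrC subrK [modulus (Zp p - Zp q)]modulusBC; lra.
by have := modulusD (Zp p) (Zp q - Zp p); rewrite addrC subrK; lra.
Qed.

Lemma continuous_radius : continuous radius.
Proof.
have E : radius = fun p => 1 + pos (modulus (Zp p) - 1).
  apply/funext => p; rewrite /radius; move: (modulus (Zp p)) => m.
  have [[-> h]|[-> h]] := posP (m - 1).
    have m1 : 1 <= m by lra.
    rewrite (max_idPr m1); lra.
  have m1 : m <= 1 by lra.
  rewrite (max_idPl m1); lra.
rewrite E => p; apply: cvgD; first exact: cvg_cst.
apply: (continuous_comp (f := fun p => modulus (Zp p) - 1)); last exact: continuous_pos.
by apply: cvgB; [exact: continuous_modulus_Zp|exact: cvg_cst].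
Qed.

Lemma pcont_retr : pcont retr.
Proof.
have r0 p : radius p != 0 by rewrite gt_eqF// radius_gt0.
split=> p; apply: cvgM; [exact: cvg_fst|by apply: cvgV; [exact: r0|exact: continuous_radius]|
  exact: cvg_snd|by apply: cvgV; [exact: r0|exact: continuous_radius]].
Qed.

Lemma pcont_ext : pcont ext.
Proof.
have [/plane_continuousP c1 /plane_continuousP c2] := pcont_retr.
have K p e : 0 < e -> exists2 d, 0 < d & forall q, `|q.1 - p.1| < d -> `|q.2 - p.2| < d ->
    modulus (ext q - ext p) < e.
  move=> e0; have /continuous_onP/(_ _ (retr_closed p) e e0)[d d0 H] := cPhi.
  have d2 : 0 < d / 2 by rewrite divr_gt0.
  have [r r0 H1] := c1 p _ d2; have [t t0 H2] := c2 p _ d2.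
  exists (Num.min r t) => [|q]; first by rewrite lt_min r0 t0.
  rewrite !lt_min => /andP[q1 q1'] /andP[q2 q2']; apply: H; first exact: retr_closed.
  apply: le_lt_trans (modulus_le_ReIm _) _; rewrite [X in _ < X](splitr d) !reimE.
  by apply: ltrD; [exact: H1|exact: H2].
split; apply/plane_continuousP => p e /(K p)[d d0 H]; exists d => // q q1 q2.
  by apply: le_lt_trans (H q q1 q2); have := Re_le_modulus (ext q - ext p); rewrite !reimE.
by apply: le_lt_trans (H q q1 q2); have := Im_le_modulus (ext q - ext p); rewrite !reimE.
Qed.

Lemma ext_in p : D p -> ext p = Phi (Zp p). Proof. by move=> /retr_in; rewrite /ext => ->. Qed.

Lemma near_x_disc p : D p -> \forall x \near p.1, D (x, p.2).
Proof.
move=> Dp; have : (fun x => x ^+ 2 + p.2 ^+ 2) x @[x --> p.1] --> p.1 ^+ 2 + p.2 ^+ 2.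
  by apply: cvgD; [exact: exprn_continuous|exact: cvg_cst].
by move=> c; apply: (cvgr_lt _ c).
Qed.

Lemma near_y_disc p : D p -> \forall y \near p.2, D (p.1, y).
Proof.
move=> Dp; have : (fun y => p.1 ^+ 2 + y ^+ 2) y @[y --> p.2] --> p.1 ^+ 2 + p.2 ^+ 2.
  by apply: cvgD; [exact: cvg_cst|exact: exprn_continuous].
by move=> c; apply: (cvgr_lt _ c).
Qed.

Lemma partial_ext p : D p -> partial_x Phi (p.1 +i* p.2) = cpx ext p /\ partial_y Phi (p.1 +i* p.2) = cpy ext p.
Proof.
move=> Dp; have eqd (f g : R -> R) x : {near x, f =1 g} -> derive1 f x = derive1 g x.
  by move=> fg; rewrite !derive1E; exact: near_eq_derive.
split; congr (_ +i* _); apply: eqd => /=.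
- by apply: filterS (near_x_disc Dp) => x Dx; rewrite (ext_in Dx).
- by apply: filterS (near_x_disc Dp) => x Dx; rewrite (ext_in Dx).
- by apply: filterS (near_y_disc Dp) => y Dy; rewrite (ext_in Dy).
- by apply: filterS (near_y_disc Dp) => y Dy; rewrite (ext_in Dy).
Qed.

Lemma ext_dil : exists2 K : R, 0 < K & {ae mu2, forall p, D p -> gradsq ext p <= K * jac ext p}.
Proof.
have [_ _ _ [k [/andP[k0 k1] H]]] := qcPhi.
have kk : 0 < 1 - k ^+ 2 by nra.
(* The energy density is [2 (|f_z|^2 + |f_zbar|^2)] and the Jacobian is [|f_z|^2 - |f_zbar|^2]. *)
exists (2 * (1 + k ^+ 2) / (1 - k ^+ 2)).
  by rewrite divr_gt0// mulr_gt0// ltr_wpDr ?sqr_ge0.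
apply: ae_imply H => p H Dp; have [pxE pyE] := partial_ext Dp.
have /H : disc (p.1 +i* p.2) by move/udiscE : Dp.
rewrite /d_zbar /d_z pxE pyE /gradsq /jac !modulus2.
move: (cpx ext p) (cpy ext p) => [a b] [c d] h.
have h2 : modulus ((a +i* b + (0 +i* 1) * (c +i* d)) / 2) ^+ 2 <= k ^+ 2 * modulus ((a +i* b - (0 +i* 1) * (c +i* d)) / 2) ^+ 2.
  by rewrite -exprMn ler_sqr ?nnegrE ?modulus_ge0// mulr_ge0// modulus_ge0.
have E1 : modulus ((a +i* b + (0 +i* 1) * (c +i* d)) / 2) ^+ 2 = ((a - d) ^+ 2 + (b + c) ^+ 2) / 4.
  rewrite (_ : _ / 2 = ((a - d) / 2) +i* ((b + c) / 2)) ?modulus2 /=; first by field.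
  by rewrite -real_complex_nat -real_complexV; apply: complex_eq => /=; field.
have E2 : modulus ((a +i* b - (0 +i* 1) * (c +i* d)) / 2) ^+ 2 = ((a + d) ^+ 2 + (b - c) ^+ 2) / 4.
  rewrite (_ : _ / 2 = ((a + d) / 2) +i* ((b - c) / 2)) ?modulus2 /=; first by field.
  by rewrite -real_complex_nat -real_complexV; apply: complex_eq => /=; field.
move: h2; rewrite E1 E2 /= => h2.
rewrite mulrAC ler_pdivlMr//; nra.
Qed.

Let mesh (n k : nat) : R := k%:R / n.+1%:R.

Lemma ae_grid (P : nat -> nat -> nat -> R -> Prop) :
  (forall n k m, {ae leb, forall y, P n k m y}) -> {ae leb, forall y, forall n k m, P n k m y}.
Proof. by move=> H; do 3 (apply/ae_foralln => ?); exact: H. Qed.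

(* A slice of the disc over [[a, b]] lies in a rectangle of a fixed countable family. *)
Lemma grid_rect (y a b : R) : (forall x, a <= x <= b -> x ^+ 2 + y ^+ 2 < 1) -> a < b ->
  exists n k m, [/\ mesh n k - 1 <= y <= mesh n k.+1 - 1, - mesh n m <= a, b <= mesh n m &
   forall x t, - mesh n m <= x <= mesh n m -> mesh n k - 1 <= t <= mesh n k.+1 - 1 -> x ^+ 2 + t ^+ 2 < 1].
Proof.
move=> H ab; pose X := Num.max `|a| `|b|.
have Xy : X ^+ 2 + y ^+ 2 < 1.
  have h1 := H a; have h2 := H b; rewrite /X /Num.max; case: ifP => _; rewrite real_normK ?num_real//.
    by apply: h2; rewrite lexx ltW.
  by apply: h1; rewrite lexx ltW.
have X0 : 0 <= X by rewrite le_max normr_ge0.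
have aX : `|a| <= X by rewrite le_max lexx.
have bX : `|b| <= X by rewrite le_max lexx orbT.
pose e := 1 - (X ^+ 2 + y ^+ 2); have e0 : 0 < e by rewrite subr_gt0.
(* Moving both coordinates by at most [d = 1 / (n + 1)] raises the sum of squares by less than
   [8 * d], which is below the gap [e]. *)
pose n := Num.truncn (8 / e); pose N : R := n.+1%:R.
have N0 : 0 < N by rewrite ltr0n.
have Ne : 8 / e < N by exact: truncnS_gt.
pose d := N^-1; have d0 : 0 < d by rewrite invr_gt0.
have d1 : 8 * d < e by rewrite /d ltr_pdivrMr// mulrC -ltr_pdivrMr.
have y1 : `|y| < 1 by rewrite -(expr_lt1 (n := 2))// real_normK ?num_real//; have := sqr_ge0 X; lra.
have X1 : X < 1 by rewrite -(expr_lt1 (n := 2))//; have := sqr_ge0 y; lra.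
move: (y1); rewrite ltr_norml => /andP[y2 y3].
have yN : 0 <= (y + 1) * N by rewrite mulr_ge0 ?ltW//; lra.
have XN : 0 <= X * N by rewrite mulr_ge0// ltW.
pose k := Num.truncn ((y + 1) * N); pose m := (Num.truncn (X * N)).+1.
have /andP[k1 k2] : k%:R <= (y + 1) * N < k.+1%:R by exact: truncn_itv.
have /andP[m1 m2] : (Num.truncn (X * N))%:R <= X * N < m%:R by exact: truncn_itv.
have K1 : mesh n k <= y + 1 by rewrite ler_pdivrMr.
have K2 : y + 1 < mesh n k.+1 by rewrite ltr_pdivlMr.
have K3 : mesh n k.+1 = mesh n k + d by rewrite /mesh -natr1 mulrDl mul1r.
have M1 : X < mesh n m by rewrite ltr_pdivlMr.
have M2 : mesh n m <= X + d.
  by rewrite /mesh /m -natr1 mulrDl mul1r lerD2r ler_pdivrMr.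
move: aX bX; rewrite !ler_norml => /andP[a1 a2] /andP[b1 b2].
exists n, k, m; split; [by apply/andP; split; lra|by lra|by lra|].
move=> x t /andP[x1 x2] /andP[t1 t2]; rewrite K3 in t2 K2.
have Y0 := normr_ge0 y.
have hx : x ^+ 2 <= (X + d) ^+ 2 by nra.
have ht : t ^+ 2 <= (`|y| + d) ^+ 2.
  have : - (`|y| + d) <= t <= `|y| + d.
    by apply/andP; split; have := ler_norm y; have := lerNnormlW (lexx `|y|); lra.
  by move=> /andP[h1 h2]; nra.
have y22 : `|y| ^+ 2 = y ^+ 2 by rewrite real_normK ?num_real.
have e1 : e <= 1 by rewrite /e; have := sqr_ge0 X; have := sqr_ge0 y; lra.
have : (X + d) ^+ 2 + (`|y| + d) ^+ 2 < 1.
  have -> : (X + d) ^+ 2 + (`|y| + d) ^+ 2 = (1 - e) + 2 * d * (X + `|y|) + 2 * d * d.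
    by rewrite /e -y22; ring.
  nra.
lra.
Qed.

(** The null sets of [ACL], one for each rectangle, are united over the countable family of
    [grid_rect]. *)
Lemma csob_ext : csob ext.
Proof.
have [_ acl _ _] := qcPhi; split; first exact: pcont_ext.
  pose P n k m y := (forall x t, - mesh n m <= x <= mesh n m -> mesh n k - 1 <= t <= mesh n k.+1 - 1 -> x ^+ 2 + t ^+ 2 < 1) ->
    mesh n k - 1 <= y <= mesh n k.+1 - 1 -> abs_continuous (- mesh n m) (mesh n m) (fun x => Phi (x +i* y)).
  have aP : {ae leb, forall y, forall n k m, P n k m y}.
    apply: ae_grid => n k m; rewrite /P.
    have [Q|nQ] := pselect (forall x t, - mesh n m <= x <= mesh n m -> mesh n k - 1 <= t <= mesh n k.+1 - 1 -> x ^+ 2 + t ^+ 2 < 1).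
      have [|H _] := acl (- mesh n m) (mesh n m) (mesh n k - 1) (mesh n k.+1 - 1).
        by move=> x t hx ht; apply/(udiscE (x, t)); exact: Q.
      by apply: ae_imply H => y H _; exact: H.
    by apply: ae_all => y /nQ.
  have K y : (forall n k m, P n k m y) -> forall a b, a < b -> (forall x, a <= x <= b -> x ^+ 2 + y ^+ 2 < 1) ->
      real_ac a b (fun x => Re (ext (x, y))) /\ real_ac a b (fun x => Im (ext (x, y))).
    move=> H a b ab h; have [n [k [m [yk am bm Q]]]] := grid_rect h ab.
    have [r1 r2] := abs_continuous_real_ac (H n k m Q yk).
    have E x : a <= x <= b -> Phi (x +i* y) = ext (x, y) by move=> /h Dx; rewrite (@ext_in (x, y)).
    split; [apply: (real_ac_eq _ (real_ac_sub am bm r1))|apply: (real_ac_eq _ (real_ac_sub am bm r2))];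
      by move=> x xab; rewrite E.
  by split; apply: ae_imply aP => y H a b ab h; have [] := K y H a b ab h.
pose P n k m x := (forall y t, - mesh n m <= y <= mesh n m -> mesh n k - 1 <= t <= mesh n k.+1 - 1 -> y ^+ 2 + t ^+ 2 < 1) ->
  mesh n k - 1 <= x <= mesh n k.+1 - 1 -> abs_continuous (- mesh n m) (mesh n m) (fun y => Phi (x +i* y)).
have aP : {ae leb, forall x, forall n k m, P n k m x}.
  apply: ae_grid => n k m; rewrite /P.
  have [Q|nQ] := pselect (forall y t, - mesh n m <= y <= mesh n m -> mesh n k - 1 <= t <= mesh n k.+1 - 1 -> y ^+ 2 + t ^+ 2 < 1).
    have [|_ H] := acl (mesh n k - 1) (mesh n k.+1 - 1) (- mesh n m) (mesh n m).
      by move=> x t hx ht; apply/(udiscE (x, t)); rewrite /udisc /= addrC; exact: Q.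
    by apply: ae_imply H => y H _; exact: H.
  by apply: ae_all => y /nQ.
have K x : (forall n k m, P n k m x) -> forall a b, a < b -> (forall y, a <= y <= b -> x ^+ 2 + y ^+ 2 < 1) ->
    real_ac a b (fun y => Re (ext (x, y))) /\ real_ac a b (fun y => Im (ext (x, y))).
  move=> H a b ab h'; have h y : a <= y <= b -> y ^+ 2 + x ^+ 2 < 1 by rewrite addrC; exact: h'.
  have [n [k [m [yk am bm Q]]]] := grid_rect h ab.
  have [r1 r2] := abs_continuous_real_ac (H n k m Q yk).
  have E y : a <= y <= b -> Phi (x +i* y) = ext (x, y) by move=> /h' Dx; rewrite (@ext_in (x, y)).
  split; [apply: (real_ac_eq _ (real_ac_sub am bm r1))|apply: (real_ac_eq _ (real_ac_sub am bm r2))];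
    by move=> y yab; rewrite E.
by split; apply: ae_imply aP => y H a b ab h; have [] := K y H a b ab h.
Qed.

Let cell n k l : set (R * R) := `[mesh n k - 1, mesh n k.+1 - 1] `*` `[mesh n l - 1, mesh n l.+1 - 1].

Lemma cell_integrable n k l : cell n k l `<=` D -> mu2.-integrable (cell n k l) (EFin \o gradsq ext).
Proof.
move=> cD; have [_ _ H _] := qcPhi.
have mc : @measurable _ P2 (cell n k l) by apply: measurableX; exact: measurable_itv.
have mG : measurable_fun (cell n k l : set P2) (gradsq ext).
  by apply: measurable_funTS; apply: measurable_gradsq; exact: pcont_ext.
apply: (@Rintegrable_ge0 _ P2 _ mu2) => //; first by move=> p _; exact: gradsq_ge0.
have := H (mesh n k - 1) (mesh n k.+1 - 1) (mesh n l - 1) (mesh n l.+1 - 1).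
set I1 := integral _ _ _; have -> : I1 = (\int[mu2]_(p in cell n k l) (gradsq ext p)%:E)%E.
  by apply: eq_integral => p; rewrite inE => pc; have [-> ->] := partial_ext (cD p pc).
apply=> x y hx hy.
have hx' : x \in `[mesh n k - 1, mesh n k.+1 - 1] by rewrite in_itv.
have hy' : y \in `[mesh n l - 1, mesh n l.+1 - 1] by rewrite in_itv.
have Dxy : D (x, y) by apply: cD; split; [exact: hx'|exact: hy'].
exact: (proj1 (udiscE (x, y)) Dxy).
Qed.

(** The energy is given as finite on rectangles; finitely many grid squares inside the unit disc
    cover [dsc s]. *)
Lemma ext_l2 s : s < 1 -> mu2.-integrable (dsc s) (EFin \o gradsq ext).
Proof.
move=> s1; pose e := 1 - s; have e0 : 0 < e by rewrite subr_gt0.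
pose n := Num.truncn (8 / e); pose N : R := n.+1%:R.
have N0 : 0 < N by rewrite ltr0n.
have Ne : 8 / e < N by exact: truncnS_gt.
pose d := N^-1; have d0 : 0 < d by rewrite invr_gt0.
have d1 : 8 * d < e by rewrite /d ltr_pdivrMr// mulrC -ltr_pdivrMr.
(* Squares that leave the disc contribute 0, so the sum over the whole grid is integrable. *)
pose f k l : R * R -> R := if `[< cell n k l `<=` D >] then gradsq ext \_ (cell n k l) else cst 0.
have f_ge0 k l p : 0 <= f k l p.
  by rewrite /f; case: asboolP => // _; rewrite /patch; case: ifP => // _; exact: gradsq_ge0.
have mc k l : @measurable _ P2 (cell n k l) by apply: measurableX; exact: measurable_itv.
have fi k l : mu2.-integrable setT (EFin \o f k l).
  rewrite /f; case: asboolP => [cD|_]; first by apply: (@Rintegrable_restrict _ P2 R mu2 _ (mc k l)); exact: cell_integrable cD.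
  exact: integrable0.
pose I := index_iota 0 (2 * n.+1)%N.
have si : mu2.-integrable setT (EFin \o (fun p => \sum_(k <- I) \sum_(l <- I) f k l p)).
  by do 2 (apply: (@Rintegrable_sum _ P2 _ _ _ measurableT) => ?); exact: fi.
apply: (@Rintegrable_le _ P2 _ mu2 _ (measurable_dsc s) _ (fun p => \sum_(k <- I) \sum_(l <- I) f k l p)).
- by apply: measurable_funTS; apply: measurable_gradsq; exact: pcont_ext.
- by apply: (@integrableS _ P2 _ mu2 setT) si => //; exact: measurable_dsc.
move=> p ps; rewrite ger0_norm ?gradsq_ge0//.
have Dp : D p by exact: dsc_udisc ps.
have bd (x : R) : x ^+ 2 < 1 -> exists k, [/\ k \in I, mesh n k - 1 <= x <= mesh n k.+1 - 1 & mesh n k.+1 = mesh n k + d].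
  move=> x1; have xN : `|x| < 1 by rewrite -(expr_lt1 (n := 2))// real_normK ?num_real.
  move: xN; rewrite ltr_norml => /andP[x2 x3].
  have xN : 0 <= (x + 1) * N by rewrite mulr_ge0 ?ltW//; lra.
  have /andP[k1 k2] := truncn_itv xN.
  exists (Num.truncn ((x + 1) * N)); split; last by rewrite /mesh -natr1 mulrDl mul1r.
    rewrite mem_index_iota /= -(ltr_nat R); apply: (le_lt_trans k1).
    by rewrite natrM ltr_pM2r//; lra.
  by rewrite lerBlDr lerBrDr ler_pdivrMr// k1 ler_pdivlMr// ltW.
have [x1 x2] : p.1 ^+ 2 < 1 /\ p.2 ^+ 2 < 1.
  by move: Dp; rewrite /udisc /=; have := sqr_ge0 p.1; have := sqr_ge0 p.2; split; lra.
have [k [kI kp kd]] := bd _ x1; have [l [lI lp ld]] := bd _ x2.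
have cD : cell n k l `<=` D.
  move=> q [/=]; rewrite !in_itv /= => /andP[q1 q2] /andP[q3 q4]; rewrite /udisc /=.
  move: kp lp q2 q4; rewrite kd ld => /andP[k1 k2] /andP[l1 l2] q2 q4.
  have h1 : `|q.1 - p.1| <= d by rewrite ler_norml; apply/andP; split; lra.
  have h2 : `|q.2 - p.2| <= d by rewrite ler_norml; apply/andP; split; lra.
  have a1 : `|p.1| < 1 by rewrite -(expr_lt1 (n := 2))// real_normK ?num_real.
  have a2 : `|p.2| < 1 by rewrite -(expr_lt1 (n := 2))// real_normK ?num_real.
  have sq (u v : R) : `|u - v| <= d -> `|v| < 1 -> u ^+ 2 <= v ^+ 2 + 2 * d + d ^+ 2.
    move=> uv v1; have -> : u ^+ 2 = v ^+ 2 + 2 * v * (u - v) + (u - v) ^+ 2 by ring.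
    move: uv v1; rewrite ler_norml ltr_norml => /andP[u1 u2] /andP[v1 v2].
    have z1 : (u - v) ^+ 2 <= d ^+ 2 by nra.
    have z2 : v * (u - v) <= d by nra.
    lra.
  have := sq _ _ h1 a1; have := sq _ _ h2 a2.
  have e1 : p.1 ^+ 2 + p.2 ^+ 2 <= 1 - e by move: ps; rewrite /dsc /= /e; lra.
  have dd1 : d <= 1 by rewrite /d invf_le1// ler1n.
  have dd : d ^+ 2 <= d by rewrite expr2 ler_piMr// ltW.
  lra.
have -> : gradsq ext p = f k l p.
  by rewrite /f; case: asboolP => // _; rewrite /patch mem_set//.
rewrite (big_rem k)//= (big_rem l lI)/= -addrA lerDl addr_ge0//; first exact: sumr_ge0.
by apply: sumr_ge0 => i _; apply: sumr_ge0.
Qed.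

Lemma ext_qc : exists K, qc_ext ext K.
Proof.
have [K K0 HK] := ext_dil; exists K; split => //.
- exact: csob_ext.
- move=> p Dp; have [[_ [g [_ gP _]]] _ _ _] := qcPhi.
  have [+ _] := gP (Zp p) (proj1 (udiscE p) Dp).
  by rewrite ext_in// => h; rewrite expr_lt1 ?modulus_ge0.
- by move=> p nD; have c : modulus (ext p) = 1 := circPhi (retr_out nD); rewrite c expr1n.
- exact: ext_l2.
Qed.

Lemma ext_circle z : circle z -> onz ext z = Phi z.
Proof.
move=> cz; have zE : Zp (Re z, Im z) = z by exact: complex_eq.
have h : modulus (Zp (Re z, Im z)) = 1 by rewrite zE.
by rewrite /onz /ext /retr /radius h maxxx !divr1; congr Phi; exact: complex_eq.
Qed.

End disc_extension.

Lemma QS_good (R : realType) (phi : R[i] -> R[i]) : QS phi -> good phi.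
Proof.
move=> [[hphi _] [Phi [qc cPhi bd]]]; have [e _] := homeo_emb hphi.
have cP z : circle z -> circle (Phi z) by move=> cz; rewrite bd//; exact: ce_circle e _ cz.
have [K qK] := ext_qc qc cPhi cP.
split; first exact: e.
by apply: (ext_bform e qK) => z cz; rewrite ext_circle ?bd.
Qed.

Theorem corollary1p11 (R : realType) :
  (forall phi1 phi2 : R[i] -> R[i], QS phi1 -> QS phi2 ->
     forall h : idx -> R[i], ell2 h ->
       imx_op (Lambda (phi1 \o phi2)) h =
       imx_op (Cmx phi2) (imx_op (Lambda phi1) (imx_op (imx_adj (Cmx phi2)) h))
       + imx_op (Lambda phi2) h) /\
  (forall phi mu : R[i] -> R[i], QS phi -> Mob mu ->
     imx_unitary (Cmx mu) /\
     forall h : idx -> R[i], ell2 h ->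
       imx_op (Lambda (phi \o mu)) h =
       imx_op (Cmx mu) (imx_op (Lambda phi) (imx_op (imx_adj (Cmx mu)) h))).
Proof.
split=> [phi1 phi2 q1 q2 h h2|phi mu q m]; first by apply: Lambda_comp_op => //; exact: QS_good.
split=> [|h h2]; first exact: moebius_unitary.
by apply: Lambda_comp_moebius => //; exact: QS_good.
Qed.
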